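(* Let $r\ge2$ and let $\mathbf z\in\Omega^r$ be a CM point. If $E_r(\mathbf z)\ne0$, then $E_r(\mathbf z)$ is transcendental over $\overline K$.
   Context: Let $q$ be a power of a prime, $A=\mathbb F_q[\theta]$, $K=\mathbb F_q(\theta)$, $|\theta|_\infty=q$, $K_\infty=\mathbb F_q((1/\theta))$, $\mathbb C_\infty$ the completion of an algebraic closure of $K_\infty$, and $\overline K$ the algebraic closure of $K$ in $\mathbb C_\infty$. Let $\tau$ be the $q$-Frobenius and $\mathbb C_\infty[\tau]$ the skew polynomial ring with $\tau x=x^q\tau$. A Drinfeld module of rank $r$ is an $\mathbb F_q$-algebra homomorphism $\phi:A\to\mathbb C_\infty[\tau]$ with $\phi_\theta=\theta+\phi_{\theta,1}\tau+\dots+\phi_{\theta,r}\tau^r$, $\phi_{\theta,r}\ne0$; its exponential $\exp_\phi$ is the entire function with $\exp_\phi(x)=x+O(x^q)$ and $\exp_\phi(\theta x)=\phi_\theta(\exp_\phi(x))$, whose kernel is an $A$-lattice of rank $r$; each $A$-lattice of rank $r$ arises from a unique Drinfeld module. $\phi$ is CM if its endomorphism ring $\{v\in\mathbb C_\infty[\tau]: v\phi_\theta=\phi_\theta v\}$ is a free $A$-module of rank $r$. Fix $(-\theta)^{1/(q-1)}$ and $\tilde\pi=\theta(-\theta)^{1/(q-1)}\prod_{i\ge1}(1-\theta^{1-q^i})^{-1}$. $\Omega^r$ is the set of $\mathbf z=(z_1,\dots,z_r)^\intercal\in\mathbb C_\infty^r$ with $K_\infty$-linearly independent entries and $z_r=1$;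 $\phi^{\mathbf z}$ is the Drinfeld module whose exponential has kernel $Az_1+\dots+Az_r$, written $\phi^{\mathbf z}_\theta=\theta+g_1(\mathbf z)\tau+\dots+g_{r-1}(\mathbf z)\tau^{r-1}+\Delta_r(\mathbf z)\tau^r$. A point $\mathbf z\in\Omega^r$ is a CM point if $\phi^{\mathbf z}$ is CM. The function $E_r:\Omega^r\to\mathbb C_\infty$ is $E_r(\mathbf z)=\tilde\pi^{-1}\Delta_r(\mathbf z)^{-1}\frac{\partial}{\partial z_1}\Delta_r(\mathbf z)$, with $\Delta_r$ regarded as a function of $z_1,\dots,z_{r-1}$ (with $z_r=1$). *)

(* Defs.v *)
From HB Require Import structures.
From mathcomp Require Import all_boot all_order all_algebra.
From mathcomp Require Import reals.
From Stdlib Require Import ClassicalEpsilon.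
Set Implicit Arguments. Unset Strict Implicit. Unset Printing Implicit Defensive.
Import Order.TTheory GRing.Theory Num.Theory.
Local Open Scope ring_scope.

(* Standing data:  C plays the role of C_infinity, equipped with an absolute
   value  nrm : C -> R  (R the real numbers);  q = p^n;  theta is the variable
   of A = F_q[theta].  The characterising properties of (C, nrm, theta) are
   collected in [is_Cinfty] below. *)
Section Drinfeld.
Variables (C : fieldType) (R : realType) (nrm : C -> R) (q : nat) (theta : C).

Definition cvgC (u : nat -> C) (l : C) : Prop :=
  forall e : R, 0 < e -> exists N, forall m, (N <= m)%N -> nrm (u m - l) < e.
Definition cauchyC (u : nat -> C) : Prop :=
  forall e : R, 0 < e -> exists N, forall m k, (N <= m)%N -> (N <= k)%N ->
    nrm (u m - u k) < e.
(* the limit of a convergent sequence (limits are unique) *)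
Definition limC (u : nat -> C) : C := epsilon (inhabits 0) (cvgC u).
Definition derivC (f : C -> C) (x : C) : C :=
  epsilon (inhabits 0) (fun d => forall e : R, 0 < e -> exists del : R, 0 < del /\
    forall h, h != 0 -> nrm h < del -> nrm ((f (x + h) - f x) / h - d) < e).

Definition inFq (c : C) : Prop := c ^+ q = c.
Definition inA (x : C) : Prop :=
  exists P : {poly C}, (forall k, inFq P`_k) /\ x = P.[theta].
Definition inK (x : C) : Prop :=
  exists a b, inA a /\ inA b /\ b != 0 /\ x = a / b.
Definition inKinf (x : C) : Prop :=
  forall e : R, 0 < e -> exists k, inK k /\ nrm (x - k) < e.
Definition algebraic_over (S : C -> Prop) (x : C) : Prop :=
  exists P : {poly C}, P != 0 /\ (forall k, S P`_k) /\ root P x.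
Definition inKbar (x : C) : Prop := algebraic_over inK x.
Definition transcendental_over (S : C -> Prop) (x : C) : Prop :=
  ~ algebraic_over S x.

(* ---------- the skew polynomial ring C[tau], tau x = x^q tau ----------
   sum_i u_i tau^i is represented by the polynomial with coefficients u_i. *)
Definition skew_mul (u v : {poly C}) : {poly C} :=
  \poly_(k < size u + size v) \sum_(i < k.+1) u`_i * (v`_(k - i)) ^+ (q ^ i).
Definition skew_pow (g : {poly C}) (k : nat) : {poly C} := iter k (skew_mul g) 1.
Definition skew_eval (g : {poly C}) (y : C) : C :=
  \sum_(i < size g) g`_i * y ^+ (q ^ i).
(* phi_a for a = P(theta), P in F_q[X], where g = phi_theta *)
Definition phi_of (g P : {poly C}) : {poly C} :=
  \sum_(k < size P) skew_mul (P`_k)%:P (skew_pow g k).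
Definition is_endo (g v : {poly C}) : Prop := skew_mul v g = skew_mul g v.
Definition Fq_poly (P : {poly C}) : Prop := forall k, inFq P`_k.
(* CM: End(phi) is a free A-module of rank r (A acting by a.v = phi_a v) *)
Definition is_CM (r : nat) (g : {poly C}) : Prop :=
  exists v : 'I_r -> {poly C},
    (forall i, is_endo g (v i)) /\
    (forall w, is_endo g w -> exists P : 'I_r -> {poly C},
        (forall i, Fq_poly (P i)) /\ w = \sum_i skew_mul (phi_of g (P i)) (v i)) /\
    (forall P : 'I_r -> {poly C}, (forall i, Fq_poly (P i)) ->
        \sum_i skew_mul (phi_of g (P i)) (v i) = 0 -> forall i, P i = 0).

Definition entire (c : nat -> C) : Prop :=
  forall rad : R, 0 < rad -> forall e : R, 0 < e ->
    exists N, forall m, (N <= m)%N -> nrm (c m) * rad ^+ m < e.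
Definition psum (c : nat -> C) (x : C) : C :=
  limC (fun N => \sum_(m < N) c m * x ^+ m).
Definition is_exp (g : {poly C}) (c : nat -> C) : Prop :=
  entire c /\ c 0%N = 0 /\ c 1%N = 1 /\ (forall m, (1 < m < q)%N -> c m = 0) /\
  forall x, psum c (theta * x) = skew_eval g (psum c x).

Definition inLattice (r : nat) (z : 'I_r -> C) (x : C) : Prop :=
  exists a : 'I_r -> C, (forall i, inA (a i)) /\ x = \sum_i a i * z i.
Definition drinfeld_of_lattice (r : nat) (z : 'I_r -> C) (g : {poly C}) : Prop :=
  g`_0 = theta /\ size g = r.+1 /\
  exists c, is_exp g c /\ forall x, psum c x = 0 <-> inLattice z x.
Definition phi_z (r : nat) (z : 'I_r -> C) : {poly C} :=
  epsilon (inhabits 0) (drinfeld_of_lattice z).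
Definition Delta (r : nat) (z : 'I_r -> C) : C := (phi_z z)`_r.
Definition in_Omega (r : nat) (z : 'I_r -> C) : Prop :=
  (forall a : 'I_r -> C, (forall i, inKinf (a i)) ->
      \sum_i a i * z i = 0 -> forall i, a i = 0) /\
  (forall i : 'I_r, i.+1 = r -> z i = 1).
Definition CM_point (r : nat) (z : 'I_r -> C) : Prop :=
  in_Omega z /\ is_CM r (phi_z z).
Definition shift1 (r : nat) (z : 'I_r -> C) (h : C) : 'I_r -> C :=
  fun i => if val i == 0%N then z i + h else z i.
(* pi-tilde, given the fixed root omega = (-theta)^(1/(q-1)) *)
Definition pitilde (omega : C) : C :=
  theta * omega *
  limC (fun N => \prod_(1 <= i < N.+1) (1 - theta / theta ^+ (q ^ i))^-1).
Definition E_r (omega : C) (r : nat) (z : 'I_r -> C) : C :=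
  (pitilde omega)^-1 * (Delta z)^-1 *
  derivC (fun h => Delta (shift1 z h)) 0.
End Drinfeld.

(* (C, nrm, theta) is (isometrically isomorphic to) C_infinity for q = p^n:
   an algebraically closed complete non-archimedean valued field of
   characteristic p with |theta| = q, in which the algebraic closure of
   K_infty (= closure of F_q(theta)) is dense. *)
Definition is_Cinfty (p n : nat) (C : fieldType) (R : realType)
    (nrm : C -> R) (theta : C) : Prop :=
  [/\ prime p, (0 < n)%N, p \in [pchar C], GRing.closed_field_axiom C &
  [/\ (forall x, 0 <= nrm x), (forall x, nrm x = 0 <-> x = 0),
      (forall x y, nrm (x * y) = nrm x * nrm y),
      (forall x y, nrm (x + y) <= Num.max (nrm x) (nrm y)) &
  [/\ (forall u, cauchyC nrm u -> exists l, cvgC nrm u l),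
      nrm theta = (p ^ n)%:R &
      (forall x (e : R), 0 < e -> exists y,
          algebraic_over (inKinf nrm (p ^ n) theta) y /\ nrm (x - y) < e)]]].

(* Main.v *)
(* Let Delta = g_r be the leading coefficient of phi^z and F_ij the value at
   theta of the (j+1)-st Frobenius twist of the Anderson generating function
   sum_k exp(z_i / theta^(k+1)) x^k.  Then sum_j g_(j+1) F_ij = - z_i.  Moving
   z_1 by h changes the F_ij only by O(h^q), so Cramer's rule gives dDelta/dz_1
   as a minor of F divided by det F.  After rescaling the lattice so that
   Delta = 1, the Legendre relation says that Omega(theta) det F is algebraic,
   where Omega(theta) = - 1 / pi-tilde, and E_r(z) becomes a combination of the
   products Omega(theta)^2 F_(r,a_1) F_(2,a_2) ... F_(r,a_r) whose coefficients are
   polynomials in the g_j.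

   At a CM point the rescaled g_j are algebraic: otherwise a valuation ring
   containing Kbar but not all g_j would give a stable reduction of rank s < r
   (after scaling), and the commuting reduced endomorphisms of bounded degree
   are too few for End(phi) to have rank r.

   The products above satisfy a Frobenius difference system with algebraic
   coefficients in which Omega^2 contributes a double zero while the rest only
   grows like a pure system of slope 1, so the constant 1 is not in their
   C(t)-span.  The criterion of Anderson, Brownawell and Papanikolas (Siegel's lemma,
   extrapolation along the q^nu-th roots of theta, and the Schwarz lemma) lifts
   linear relations between values at theta to relations between functions, so no
   nonzero algebraic number is an algebraic combination of the values. *)
Require Import Defs.
From HB Require Import structures.
From mathcomp Require Import perm.
From mathcomp Require Import all_boot all_order all_algebra.
From mathcomp Require Import reals boolp classical_sets.
From Stdlib Require Import ClassicalEpsilon.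
From mathcomp Require Import zify ring lra.
Set Implicit Arguments. Unset Strict Implicit. Unset Printing Implicit Defensive.
Import Order.TTheory GRing.Theory Num.Theory.
Local Open Scope ring_scope.

(** Three obstacles shape the development. Siegel's lemma is applied to q^m-th powers of the
    unknowns, so the auxiliary coefficients leave K; independence is therefore taken over the
    perfect closure of K. The contradiction cannot come from a lower bound for a value of the
    auxiliary function. Instead the function and its twists satisfy a relation whose coefficients
    have size bounded independently of the parameter, and its lowest-order term reads sum_j a_j
    lam^(q^j) = 0, where lam is a tiny non-zero power series coefficient and the non-zero a_j are
    bounded above and below. Finally, the Drinfeld module of a lattice and the derivative are given
    by a choice operator, so nothing can be computed before uniqueness is known; the series in the
    definition of an exponential is not assumed additive, and this has to be deduced from the
    functional equation and the behaviour near 0. Algebraic numbers are handled inside finite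
    K-algebras spanned by a finite family, in place of finite field extensions with chosen bases. *)

Section Cinfty.
Variables (pch deg q : nat) (C : fieldType) (R : realType) (nrm : C -> R) (theta : C).
Hypothesis HC : is_Cinfty pch deg nrm theta.
Hypothesis qE : q = (pch ^ deg)%N.
Notation Fq := (@inFq C q).
Notation cvg := (cvgC nrm).
Notation FqP' := (Fq_poly q).
Notation inA' := (inA q theta).
Notation inK' := (inK q theta).
Notation inKbar' := (inKbar q theta).
Notation sm := (@skew_mul C q).
Notation ev := (@skew_eval C q).

(** * Absolute value and Frobenius *)
Lemma p_prime : prime pch. Proof. by case: HC. Qed.
Lemma q_gt1 : (1 < q)%N.
Proof. by case: HC => pp n0 *; rewrite qE -(exp1n deg) ltn_exp2r // prime_gt1. Qed.
Lemma q_gt0 : (0 < q)%N. Proof. exact: ltnW q_gt1. Qed.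
Lemma qk_gt0 k : (0 < q ^ k)%N. Proof. by rewrite expn_gt0 q_gt0. Qed.
Lemma pcharC : pch \in [pchar C]. Proof. by case: HC. Qed.
Lemma C_closed : GRing.closed_field_axiom C. Proof. by case: HC. Qed.

Lemma nrm_ge0 x : 0 <= nrm x. Proof. by case: HC => _ _ _ _ [h *]. Qed.
Lemma nrm_eq0 x : (nrm x == 0) = (x == 0).
Proof. by case: HC => _ _ _ _ [_ h *]; apply/eqP/eqP; rewrite h. Qed.
Lemma nrm0 : nrm 0 = 0. Proof. by apply/eqP; rewrite nrm_eq0. Qed.
Lemma nrm_gt0 x : (0 < nrm x) = (x != 0).
Proof. by rewrite lt0r nrm_ge0 nrm_eq0 andbT. Qed.
Lemma nrmM x y : nrm (x * y) = nrm x * nrm y.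
Proof. by case: HC => _ _ _ _ [_ _ h *]. Qed.
Lemma nrmD x y : nrm (x + y) <= Num.max (nrm x) (nrm y).
Proof. by case: HC => _ _ _ _ [_ _ _ h *]. Qed.
Lemma C_complete u : cauchyC nrm u -> exists l, cvgC nrm u l.
Proof. by case: HC => _ _ _ _ [_ _ _ _ [h *]]; exact: h. Qed.
Lemma nrm_theta : nrm theta = q%:R.
Proof. by rewrite qE; case: HC => _ _ _ _ [_ _ _ _ []]. Qed.

Lemma nrm1 : nrm 1 = 1.
Proof.
have h : nrm 1 * nrm 1 = nrm 1 * 1 by rewrite -nrmM !mulr1.
by apply: (mulfI _ h); rewrite nrm_eq0 oner_neq0.
Qed.
Lemma nrmX x k : nrm (x ^+ k) = nrm x ^+ k.
Proof. by elim: k => [|k IH]; rewrite ?expr0 ?nrm1 // !exprS nrmM IH. Qed.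
Lemma nrmN x : nrm (- x) = nrm x.
Proof.
rewrite -mulN1r nrmM; suff -> : nrm (-1) = 1 by rewrite mul1r.
have h : nrm (-1) ^+ 2 = 1 by rewrite -nrmX sqrrN expr1n nrm1.
by apply/eqP; rewrite -(@pexpr_eq1 _ _ 2) ?nrm_ge0 ?h.
Qed.
Lemma nrmV x : nrm (x^-1) = (nrm x)^-1.
Proof.
have [->|x0] := eqVneq x 0; first by rewrite invr0 nrm0 invr0.
have h : nrm x * nrm x^-1 = 1 by rewrite -nrmM divff ?nrm1.
by rewrite -[RHS]mulr1 -h mulrA mulVf ?mul1r ?nrm_eq0.
Qed.
Lemma nrmf x y : nrm (x / y) = nrm x / nrm y. Proof. by rewrite nrmM nrmV. Qed.
Lemma nrmB x y : nrm (x - y) <= Num.max (nrm x) (nrm y).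
Proof. by rewrite -(nrmN y) nrmD. Qed.
Lemma nrmC x y : nrm (x - y) = nrm (y - x). Proof. by rewrite -nrmN opprB. Qed.
Lemma nrmD_le x y B : nrm x <= B -> nrm y <= B -> nrm (x + y) <= B.
Proof. by move=> hx hy; apply: le_trans (nrmD x y) _; rewrite ge_max hx. Qed.
Lemma nrmD_lt x y B : nrm x < B -> nrm y < B -> nrm (x + y) < B.
Proof. by move=> hx hy; apply: le_lt_trans (nrmD x y) _; rewrite gt_max hx. Qed.
Lemma nrmB_le x y B : nrm x <= B -> nrm y <= B -> nrm (x - y) <= B.
Proof. by move=> hx hy; apply: nrmD_le; rewrite ?nrmN. Qed.
Lemma nrmB_lt x y B : nrm x < B -> nrm y < B -> nrm (x - y) < B.
Proof. by move=> hx hy; apply: nrmD_lt; rewrite ?nrmN. Qed.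
Lemma nrm_sum (I : Type) (s : seq I) (P : pred I) (F : I -> C) B :
  0 <= B -> (forall i, P i -> nrm (F i) <= B) -> nrm (\sum_(i <- s | P i) F i) <= B.
Proof.
move=> B0 h; elim/big_ind: _ => //; first by rewrite nrm0.
by move=> x y; exact: nrmD_le.
Qed.
Lemma nrm_sum_lt (I : Type) (s : seq I) (P : pred I) (F : I -> C) B :
  0 < B -> (forall i, P i -> nrm (F i) < B) -> nrm (\sum_(i <- s | P i) F i) < B.
Proof.
move=> B0 h; elim/big_ind: _ => //; first by rewrite nrm0.
by move=> x y; exact: nrmD_lt.
Qed.
Lemma nrm_prod (I : Type) (s : seq I) (P : pred I) (F : I -> C) :
  nrm (\prod_(i <- s | P i) F i) = \prod_(i <- s | P i) nrm (F i).
Proof. exact: (big_morph nrm nrmM nrm1). Qed.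
Lemma nrm_dom x y : nrm y < nrm x -> nrm (x + y) = nrm x.
Proof.
move=> h; apply/eqP; rewrite eq_le nrmD_le ?(ltW h) //=.
rewrite leNgt; apply/negP => h'.
have := nrmB_lt h' h; by rewrite addrK ltxx.
Qed.
Lemma nrm_domB x y : nrm (x - y) < nrm x -> nrm y = nrm x.
Proof. by move=> h; rewrite -(subKr x y) nrm_dom ?nrmN. Qed.

Lemma theta_neq0 : theta != 0.
Proof. by rewrite -nrm_eq0 nrm_theta pnatr_eq0 -lt0n q_gt0. Qed.
Lemma qR_gt1 : 1 < q%:R :> R. Proof. by rewrite ltr1n q_gt1. Qed.
Lemma qR_gt0 : 0 < q%:R :> R. Proof. by rewrite ltr0n q_gt0. Qed.
Lemma qR_ge1 : 1 <= q%:R :> R. Proof. exact: ltW qR_gt1. Qed.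
Lemma nrm_thetaX k : nrm (theta ^+ k) = q%:R ^+ k. Proof. by rewrite nrmX nrm_theta. Qed.
Lemma qX_gt0 k : 0 < q%:R ^+ k :> R. Proof. by rewrite exprn_gt0 ?qR_gt0. Qed.
Lemma qX_ge1 k : 1 <= q%:R ^+ k :> R. Proof. by rewrite exprn_ege1 ?qR_ge1. Qed.

Lemma expr_unbounded (x a : R) : 1 < a -> exists N, forall m, (N <= m)%N -> x < a ^+ m.
Proof.
move=> a1; have a0 : 0 < a - 1 by rewrite subr_gt0.
(* Bernoulli's inequality. *)
have key m : 1 + m%:R * (a - 1) <= a ^+ m.
  elim: m => [|m IH]; first by rewrite mul0r addr0.
  rewrite exprS -natr1; apply: (@le_trans _ _ (a * (1 + m%:R * (a - 1)))).
    have h : 0 <= m%:R * (a - 1) * (a - 1) by rewrite !mulr_ge0 // ltW.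
    rewrite -subr_ge0; move: h; congr (0 <= _); ring.
  by rewrite ler_wpM2l //; lra.
exists (Num.bound (`|x| / (a - 1))) => m hm; apply: lt_le_trans (key m).
have h : `|x| / (a - 1) < m%:R.
  by apply: lt_le_trans (archi_boundP _) _; rewrite ?ler_nat // divr_ge0 // ltW.
rewrite ltr_pdivrMr // in h; have := ler_norm x; lra.
Qed.
Lemma expr_small (x a : R) : 0 < x -> 1 < a ->
  exists N, forall m, (N <= m)%N -> a ^- m < x.
Proof.
move=> x0 a1; have [N h] := expr_unbounded x^-1 a1; exists N => m /h h'.
by rewrite -[ltRHS]invrK ltf_pV2 // posrE ?invr_gt0 // exprn_gt0 //; lra.
Qed.

Lemma pnat_qk k : [pchar C].-nat (q ^ k)%N.
Proof.
rewrite qE -expnM; have := pcharC => h.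
by rewrite (eq_pnat _ (pcharf_eq h)) pnatX pnat_id ?p_prime.
Qed.
Lemma frD k x y : (x + y) ^+ (q ^ k) = x ^+ (q ^ k) + y ^+ (q ^ k) :> C.
Proof. by rewrite (exprDn_pchar _ _ (pnat_qk k)). Qed.
Lemma fr0 k : 0 ^+ (q ^ k) = 0 :> C. Proof. by rewrite expr0n gtn_eqF ?qk_gt0. Qed.
Lemma frN k x : (- x) ^+ (q ^ k) = - x ^+ (q ^ k) :> C.
Proof. by apply/eqP; rewrite -addr_eq0 -frD addNr fr0. Qed.
Lemma frB k x y : (x - y) ^+ (q ^ k) = x ^+ (q ^ k) - y ^+ (q ^ k) :> C.
Proof. by rewrite frD frN. Qed.
Lemma fr_sum k (I : Type) (s : seq I) (P : pred I) (F : I -> C) :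
  (\sum_(i <- s | P i) F i) ^+ (q ^ k) = \sum_(i <- s | P i) F i ^+ (q ^ k).
Proof. by apply: (big_morph _ (frD k)); exact: fr0. Qed.

Lemma fr_inj k x y : x ^+ (q ^ k) = y ^+ (q ^ k) -> x = y :> C.
Proof.
move=> /eqP; rewrite -subr_eq0 -frB expf_eq0 qk_gt0 /= => /eqP h.
by apply/eqP; rewrite -subr_eq0 h.
Qed.
Lemma frqD x y : (x + y) ^+ q = x ^+ q + y ^+ q :> C. Proof. exact: (frD 1). Qed.
Lemma frqB x y : (x - y) ^+ q = x ^+ q - y ^+ q :> C. Proof. exact: (frB 1). Qed.
Lemma frqN x : (- x) ^+ q = - x ^+ q :> C. Proof. exact: (frN 1). Qed.
Lemma frq_sum (I : Type) (s : seq I) (P : pred I) (F : I -> C) :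
  (\sum_(i <- s | P i) F i) ^+ q = \sum_(i <- s | P i) F i ^+ q.
Proof. exact: (fr_sum 1). Qed.
Lemma frS k (x : C) : x ^+ (q ^ k.+1) = (x ^+ (q ^ k)) ^+ q.
Proof. by rewrite -exprM expnSr. Qed.
Lemma frSr k (x : C) : x ^+ (q ^ k.+1) = (x ^+ q) ^+ (q ^ k).
Proof. by rewrite -exprM expnS. Qed.
Lemma frA k l (x : C) : (x ^+ (q ^ k)) ^+ (q ^ l) = x ^+ (q ^ (k + l)).
Proof. by rewrite -exprM expnD. Qed.

(** * Frobenius roots, splitting of polynomials, the field of q elements *)

Lemma root_ex m (a : C) : (0 < m)%N -> exists x, x ^+ m = a.
Proof.
move=> m0; have [x h] := C_closed (fun i => if i == 0%N then a else 0) m0.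
exists x; rewrite h; case: m m0 {h} => // m _.
rewrite big_ord_recl /= expr0 mulr1 big1 ?addr0 // => i _; by rewrite mul0r.
Qed.
(** Frobenius is injective ([fr_inj]), so the root selected by [xget] is the only one. *)
Definition frt k (x : C) : C := xget 0 [set y | y ^+ (q ^ k) = x]%classic.
Lemma frtK k x : frt k x ^+ (q ^ k) = x.
Proof.
rewrite /frt; case: xgetP => // h; have [y hy] := root_ex x (qk_gt0 k).
by have := h y.
Qed.

Lemma poly_split (P : {poly C}) : exists rs, P = lead_coef P *: \prod_(x <- rs) ('X - x%:P).
Proof.
move: {2}(size P) (leqnn (size P)) => m; elim: m P => [|m IH] P.
  by rewrite leqn0 size_poly_eq0 => /eqP ->; exists [::]; rewrite lead_coef0 scale0r.
move=> sP; have [sP1|sP1] := leqP (size P) 1.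
  exists [::]; rewrite big_nil (size1_polyC sP1) lead_coefC -alg_polyC; done.
have [x rx] : exists x, root P x.
  have s0 : (0 < (size P).-1)%N by case: (size P) sP1 => // -[].
  have [x hx] := C_closed (fun i => - (P`_i / lead_coef P)) s0.
  exists x; rewrite /root horner_coef -(prednK (ltnW sP1)) big_ord_recr /= hx.
  rewrite -/(lead_coef P) mulr_sumr -big_split /= big1 // => i _.
  have lP : lead_coef P != 0 by rewrite lead_coef_eq0 -size_poly_gt0; apply: ltnW.
  by field.
have [Q PE] := factor_theorem P x rx.
have P0 : P != 0 by rewrite -size_poly_gt0; apply: ltnW.
have Q0 : Q != 0 by apply: contraNneq P0 => q0; rewrite PE q0 mul0r.
have [|rs hrs] := IH Q.
  by move: sP; rewrite PE size_Mmonic ?monicXsubC // size_XsubC addn2.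
exists (x :: rs); rewrite big_cons {1}PE {1}hrs -scalerAl mulrC.
by rewrite PE lead_coefM lead_coefXsubC mulr1 mulrC.
Qed.

(** At a repeated root the derivative would vanish. This is applied to X^q - X, whose derivative is
    -1 in characteristic p. *)
Lemma deriv_const_uniq (rs : seq C) c :
  c != 0 -> (\prod_(x <- rs) ('X - x%:P))^`() = c%:P -> uniq rs.
Proof.
move=> c0 h; apply: count_mem_uniq => x; have [xr|xr] := boolP (x \in rs); last first.
  exact/count_memPn.
have nx : x \notin rem x rs.
  rewrite -root_prod_XsubC; apply: contraNN c0 => /rootP r0.
  have := congr1 (fun P => P.[x]) h; rewrite (perm_big _ (perm_to_rem xr)) big_cons.
  by rewrite derivM !hornerE derivXsubC hornerE r0 subrr !mul0r mul1r addr0 => /esym/eqP.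
have := perm_to_rem xr; move=> /permP ->; rewrite /= eqxx.
by move/count_memPn: nx => ->.
Qed.

(** Listing F_q lets the pigeonhole counts and the products over F_q below run over a finite index
    set, without building a field structure on it. *)
Definition Fqs : seq C := xget [::] [set s | uniq s /\ (size s = q /\ forall x, (x \in s) = (x ^+ q == x))]%classic.
Lemma Fqs_prop : uniq Fqs /\ (size Fqs = q /\ forall x, (x \in Fqs) = (x ^+ q == x)).
Proof.
rewrite /Fqs; case: xgetP => // h; exfalso.
pose P : {poly C} := 'X^q - 'X.
have sP : size P = q.+1 by rewrite size_polyDl ?size_polyXn // size_polyN size_polyX ltnS q_gt1.
have lP : lead_coef P = 1.
  by rewrite /lead_coef sP /= coefB coefXn coefX eqxx gtn_eqF ?q_gt1 // subr0.
have [rs rsE] := poly_split P; rewrite lP scale1r in rsE.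
have q0 : q%:R = 0 :> C.
  have := pcharf0 pcharC; rewrite qE natrX => ->.
  by case: HC => _ n0 *; rewrite expr0n gtn_eqF.
have us : uniq rs.
  apply: (@deriv_const_uniq _ (-1)); first by rewrite oppr_eq0 oner_neq0.
  by rewrite -rsE /P !derivE -mulr_natl -polyC_natr q0 mul0r sub0r polyCN.
apply: (h rs); split => //; split.
  by have := size_prod_XsubC rs id; rewrite -rsE sP => -[].
by move=> x; rewrite -root_prod_XsubC -rsE /root !hornerE subr_eq0.
Qed.
Lemma Fqs_uniq : uniq Fqs. Proof. by case: Fqs_prop. Qed.
Lemma size_Fqs : size Fqs = q. Proof. by case: Fqs_prop => _ []. Qed.
Lemma mem_Fqs x : (x \in Fqs) = (x ^+ q == x). Proof. by case: Fqs_prop => _ []. Qed.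
Lemma FqP x : reflect (inFq q x) (x \in Fqs).
Proof. by rewrite mem_Fqs; exact: eqP. Qed.
Lemma Fq0 : Fq 0. Proof. exact: (fr0 1). Qed.
Lemma Fq1 : Fq 1. Proof. exact: expr1n. Qed.
Lemma FqD x y : Fq x -> Fq y -> Fq (x + y).
Proof. by rewrite /inFq => hx hy; rewrite frqD hx hy. Qed.
Lemma FqN x : Fq x -> Fq (- x). Proof. by rewrite /inFq => hx; rewrite frqN hx. Qed.
Lemma FqB x y : Fq x -> Fq y -> Fq (x - y). Proof. by move=> hx hy; apply/FqD/FqN. Qed.
Lemma FqM x y : Fq x -> Fq y -> Fq (x * y).
Proof. by rewrite /inFq => hx hy; rewrite exprMn hx hy. Qed.
Lemma FqV x : Fq x -> Fq x^-1. Proof. by rewrite /inFq => hx; rewrite exprVn hx. Qed.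
Lemma Fq_sum (I : Type) (s : seq I) (P : pred I) (F : I -> C) :
  (forall i, P i -> Fq (F i)) -> Fq (\sum_(i <- s | P i) F i).
Proof. by move=> h; elim/big_ind: _ => //; [exact: Fq0 | exact: FqD]. Qed.
Lemma Fq_fr x k : Fq x -> x ^+ (q ^ k) = x.
Proof. by move=> h; elim: k => // k IH; rewrite frS IH. Qed.
Lemma Fq_nrm x : Fq x -> x != 0 -> nrm x = 1.
Proof.
move=> h x0; have h' : x ^+ q.-1 = 1.
  by apply: (mulfI x0); rewrite -exprS prednK ?q_gt0 // h mulr1.
apply/eqP; rewrite -(@pexpr_eq1 _ _ q.-1) ?nrm_ge0 // -?nrmX ?h' ?nrm1 //.
by case: q q_gt1 => // -[].
Qed.
Lemma Fq_nrm_le x : Fq x -> nrm x <= 1.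
Proof. by move=> h; have [->|/(Fq_nrm h)->//] := eqVneq x 0; rewrite nrm0. Qed.

(** * Limits and power series *)
Lemma cvg_cst l : cvg (fun=> l) l.
Proof. by move=> e e0; exists 0%N => m _; rewrite subrr nrm0. Qed.
Lemma cvg_ext u v l N : (forall m, (N <= m)%N -> u m = v m) -> cvg u l -> cvg v l.
Proof.
move=> h hu e /hu [M hM]; exists (maxn N M) => m; rewrite geq_max => /andP[/h <- /hM]; exact.
Qed.
Lemma cvg_uniq u l l' : cvg u l -> cvg u l' -> l = l'.
Proof.
move=> h h'; apply/eqP; rewrite -subr_eq0 -nrm_eq0; apply: contraT => l0.
have e0 : 0 < nrm (l - l') by rewrite lt0r l0 nrm_ge0.
have [N hN] := h _ e0; have [M hM] := h' _ e0.
have := nrmB_lt (hM _ (leq_maxr N M)) (hN _ (leq_maxl N M)).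
by rewrite (_ : _ - _ - _ = l - l') ?ltxx //; ring.
Qed.
Lemma limCE u l : cvg u l -> limC nrm u = l.
Proof.
move=> h; apply: (@cvg_uniq u) => //; rewrite /limC.
by apply: ClassicalEpsilon.epsilon_spec; exists l.
Qed.
Lemma cvgD u v l l' : cvg u l -> cvg v l' -> cvg (fun m => u m + v m) (l + l').
Proof.
move=> hu hv e e0; have [N hN] := hu _ e0; have [M hM] := hv _ e0.
exists (maxn N M) => m; rewrite geq_max => /andP[/hN h1 /hM h2].
by rewrite opprD addrACA nrmD_lt.
Qed.
Lemma cvg_bound u l : cvg u l -> exists B, 0 < B /\ exists N, forall m, (N <= m)%N -> nrm (u m) <= B.
Proof.
move=> h; have [N hN] := h 1 ltr01; exists (Num.max 1 (nrm l)); split; first by rewrite lt_max ltr01.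
exists N => m /hN h1; rewrite -(subrK l (u m)); apply: le_trans (nrmD _ _) _.
by rewrite ge_max !le_max (ltW h1) lexx orbT.
Qed.
Lemma cvgM u v l l' : cvg u l -> cvg v l' -> cvg (fun m => u m * v m) (l * l').
Proof.
move=> hu hv e e0; have [B [B0 [K hK]]] := cvg_bound hu.
pose B' := nrm l' + 1; have B'0 : 0 < B' by rewrite ltr_wpDl ?nrm_ge0.
have [N hN] := hu (e / B') (divr_gt0 e0 B'0); have [M hM] := hv (e / B) (divr_gt0 e0 B0).
exists (maxn K (maxn N M)) => m; rewrite !geq_max => /and3P[/hK h0 /hN h1 /hM h2].
rewrite (_ : _ - _ = u m * (v m - l') + (u m - l) * l'); last by ring.
apply: nrmD_lt; rewrite nrmM.
  apply: le_lt_trans (ler_wpM2r (nrm_ge0 _) h0) _.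
  by rewrite mulrC -ltr_pdivlMr.
apply: (@le_lt_trans _ _ (nrm (u m - l) * B')); last by rewrite -ltr_pdivlMr.
by rewrite ler_wpM2l ?nrm_ge0 // /B' lerDl.
Qed.
Lemma cvgZ a u l : cvg u l -> cvg (fun m => a * u m) (a * l).
Proof. exact: cvgM (cvg_cst a). Qed.
Lemma cvgN u l : cvg u l -> cvg (fun m => - u m) (- l).
Proof.
move=> h e /h [N hN]; exists N => m /hN; by rewrite -opprD nrmN.
Qed.
Lemma cvgB u v l l' : cvg u l -> cvg v l' -> cvg (fun m => u m - v m) (l - l').
Proof. by move=> hu hv; apply: cvgD => //; apply: cvgN. Qed.
Lemma cvgX k u l : cvg u l -> cvg (fun m => u m ^+ k) (l ^+ k).
Proof.
move=> h; elim: k => [|k IH]; first exact: cvg_cst.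
rewrite exprS; apply: (@cvg_ext (fun m => u m * u m ^+ k) _ _ 0).
  by move=> m _; rewrite exprS.
exact: cvgM.
Qed.
Lemma cvg_sum (I : Type) (s : seq I) (P : pred I) (u : I -> nat -> C) l :
  (forall i, P i -> cvg (u i) (l i)) ->
  cvg (fun m => \sum_(i <- s | P i) u i m) (\sum_(i <- s | P i) l i).
Proof.
move=> h; elim: s => [|x s IH].
  by rewrite big_nil; apply: (@cvg_ext (fun=> 0) _ _ 0 _ (cvg_cst 0)) => m _; rewrite big_nil.
rewrite big_cons; case: ifP => Px; last first.
  by apply: (@cvg_ext _ _ _ 0 _ IH) => m _; rewrite big_cons Px.
apply: (@cvg_ext _ _ _ 0 _ (cvgD (h _ Px) IH)) => m _; by rewrite big_cons Px.
Qed.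
Lemma cvg_shift u l k : cvg u l -> cvg (fun m => u (m + k)%N) l.
Proof. by move=> h e /h [N hN]; exists N => m hm; apply: hN; apply: leq_trans hm (leq_addr _ _). Qed.
Lemma cvg_nrm_le u l B N : cvg u l -> (forall m, (N <= m)%N -> nrm (u m) <= B) -> nrm l <= B.
Proof.
move=> h hB; have B0 : 0 <= B by apply: le_trans (nrm_ge0 _) (hB _ (leqnn N)).
rewrite leNgt; apply/negP => Bl.
have [M hM] := h _ (le_lt_trans B0 Bl).
have h1 := hM _ (leq_maxr N M); have h2 := hB _ (leq_maxl N M).
have h3 : nrm (u (maxn N M)) < nrm l by apply: le_lt_trans h2 Bl.
by have := nrmB_lt h3 h1; rewrite subKr ltxx.
Qed.
Lemma cvg_nrm_eq u l : cvg u l -> l != 0 -> exists N, forall m, (N <= m)%N -> nrm (u m) = nrm l.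
Proof.
rewrite -nrm_gt0 => h /h [N hN]; exists N => m /hN; rewrite nrmC => /nrm_domB ->; done.
Qed.
Lemma cvgV u l : cvg u l -> l != 0 -> cvg (fun m => (u m)^-1) l^-1.
Proof.
move=> h l0 e e0; have [K hK] := cvg_nrm_eq h l0.
have nl : 0 < nrm l by rewrite nrm_gt0.
have [N hN] := h (e * (nrm l * nrm l)) (mulr_gt0 e0 (mulr_gt0 nl nl)).
exists (maxn K N) => m; rewrite geq_max => /andP[/hK h1 /hN h2].
have um0 : u m != 0 by rewrite -nrm_gt0 h1.
rewrite (_ : _ - _ = (l - u m) / (u m * l)); last by field; rewrite um0 l0.
by rewrite nrmf nrmM h1 ltr_pdivrMr ?mulr_gt0 // nrmC.
Qed.
(** In an ultrametric field a sequence is Cauchy as soon as its consecutive differences tend to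
    0. *)
Lemma cauchy_cvg u : (forall e, 0 < e -> exists N, forall m, (N <= m)%N -> nrm (u m.+1 - u m) < e) ->
  exists l, cvg u l.
Proof.
move=> h; apply: C_complete => e e0; have [N hN] := h e e0; exists N.
have key k : nrm (u (N + k)%N - u N) < e.
  elim: k => [|k IH]; first by rewrite addn0 subrr nrm0.
  rewrite addnS -(subrK (u (N + k)%N) (u _.+1)) -addrA; apply: nrmD_lt => //.
  by apply: hN; exact: leq_addr.
move=> m k hm hk; rewrite -(subnKC hm) -(subnKC hk).
rewrite (_ : _ - _ = (u (N + (m - N))%N - u N) - (u (N + (k - N))%N - u N)); last by ring.
exact: nrmB_lt.
Qed.
Lemma cvg0_le u (b : nat -> R) : (forall m, nrm (u m) <= b m) ->
  (forall e, 0 < e -> exists N, forall m, (N <= m)%N -> b m < e) -> cvg u 0.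
Proof.
move=> h hb e /hb [N hN]; exists N => m /hN hm; rewrite subr0; exact: le_lt_trans (h m) hm.
Qed.
Lemma geo_small (B a : R) : 0 <= a -> a < 1 -> forall e, 0 < e ->
  exists N, forall m, (N <= m)%N -> B * a ^+ m < e.
Proof.
move=> a0 a1 e e0; have [->|a0'] := eqVneq a 0.
  by exists 1%N => -[] // m _; rewrite expr0n mulr0.
have ap : 0 < a by rewrite lt0r a0'.
have B0 : 0 < `|B| + 1 by rewrite ltr_wpDl.
have [|N hN] := expr_small (divr_gt0 e0 B0) (_ : 1 < a^-1); first by rewrite invf_gt1.
exists N => m /hN; rewrite exprVn invrK ltr_pdivlMr // => h.
apply: le_lt_trans h; rewrite mulrC ler_wpM2l ?exprn_ge0 //.
by apply: le_trans (ler_norm _) _; rewrite lerDl.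
Qed.
Lemma small_elt (e : R) : 0 < e -> exists2 x : C, x != 0 & nrm x < e.
Proof.
move=> e0; have [N hN] := expr_small e0 qR_gt1.
exists (theta ^- N); first by rewrite invr_eq0 expf_neq0 ?theta_neq0.
by rewrite nrmV nrmX nrm_theta hN.
Qed.

(** * Power series and their Gauss norms *)

Definition sums (c : nat -> C) (x l : C) := cvg (fun N => \sum_(m < N) c m * x ^+ m) l.
(** A bound for the Gauss norm on the disc of radius rho. This norm is submultiplicative and carries
    all later estimates on functions. *)
Definition gle (rho B : R) (c : nat -> C) := forall i, nrm (c i) * rho ^+ i <= B.

Lemma psumE c x l : sums c x l -> psum nrm c x = l. Proof. exact: limCE. Qed.
Lemma gle_ge0 rho B c : gle rho B c -> 0 <= B.
Proof. by move=> h; apply: le_trans (h 0%N); rewrite expr0 mulr1 nrm_ge0. Qed.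
Lemma gle_term rho B c x m : 0 < rho -> gle rho B c -> nrm (c m * x ^+ m) <= B * (nrm x / rho) ^+ m.
Proof.
move=> r0 h; rewrite nrmM nrmX expr_div_n mulrA ler_pdivlMr ?exprn_gt0 //.
by rewrite mulrAC ler_wpM2r ?exprn_ge0 ?nrm_ge0.
Qed.
Lemma gle_sums rho B c x : 0 < rho -> gle rho B c -> nrm x < rho -> exists l, sums c x l.
Proof.
move=> r0 h xr; apply: cauchy_cvg => e e0.
have [||N hN] := @geo_small B (nrm x / rho) _ _ e e0.
- by rewrite divr_ge0 ?nrm_ge0 // ltW.
- by rewrite ltr_pdivrMr // mul1r.
exists N => m /hN hm; rewrite big_ord_recr /= addrAC subrr add0r.
exact: le_lt_trans (gle_term _ _ r0 h) hm.
Qed.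
Lemma sums_tail rho B c x l N : 0 < rho -> gle rho B c -> nrm x < rho -> sums c x l ->
  nrm (l - \sum_(m < N) c m * x ^+ m) <= B * (nrm x / rho) ^+ N.
Proof.
move=> r0 h xr hl; have hx1 : nrm x / rho < 1 by rewrite ltr_pdivrMr // mul1r.
have hx0 : 0 <= nrm x / rho by rewrite divr_ge0 ?nrm_ge0 // ltW.
have B0 := gle_ge0 h.
apply: (@cvg_nrm_le _ _ _ N (cvgB hl (cvg_cst _))) => k hk.
rewrite -!(big_mkord xpredT (fun m => c m * x ^+ m)) (big_cat_nat _ hk) //= [X in nrm X]addrAC subrr add0r big_seq.
apply: nrm_sum => [|i]; first by rewrite mulr_ge0 ?exprn_ge0.
rewrite mem_index_iota => /andP[Ni _]; apply: le_trans (gle_term _ _ r0 h) _.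
by rewrite ler_wpM2l // ler_wiXn2l // ltW.
Qed.
Lemma sums_le rho B c x l : 0 < rho -> gle rho B c -> nrm x < rho -> sums c x l -> nrm l <= B.
Proof. by move=> r0 h xr /(sums_tail 0 r0 h xr); rewrite big_ord0 subr0 expr0 mulr1. Qed.
Lemma gle_w rho B B' c : B <= B' -> gle rho B c -> gle rho B' c.
Proof. by move=> h hc i; apply: le_trans (hc i) h. Qed.
Lemma gleD rho B c d : gle rho B c -> gle rho B d -> gle rho B (fun i => c i + d i).
Proof.
move=> hc hd i; have [r0|r0] := leP (rho ^+ i) 0.
  apply: le_trans (gle_ge0 hc); by rewrite mulr_ge0_le0 ?nrm_ge0.
by rewrite -ler_pdivlMr // nrmD_le // ler_pdivlMr.
Qed.
Lemma gleB rho B c d : gle rho B c -> gle rho B d -> gle rho B (fun i => c i - d i).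
Proof. by move=> hc hd; apply: gleD => // i; rewrite nrmN. Qed.
Lemma gleM rho B B' (a b : nat -> C) : 0 < rho -> gle rho B a -> gle rho B' b ->
  gle rho (B * B') (fun k => \sum_(i < k.+1) a i * b (k - i)%N).
Proof.
move=> r0 ha hb k; rewrite -ler_pdivlMr ?exprn_gt0 //.
have B0 := gle_ge0 ha; have B0' := gle_ge0 hb.
apply: nrm_sum => [|i _]; first by rewrite divr_ge0 ?mulr_ge0 // exprn_ge0 // ltW.
have ik : (i <= k)%N by rewrite -ltnS.
have -> : rho ^+ k = rho ^+ i * rho ^+ (k - i) by rewrite -exprD subnKC.
rewrite ler_pdivlMr ?mulr_gt0 ?exprn_gt0 // nrmM mulrACA.
by apply: ler_pM => //; rewrite mulr_ge0 ?nrm_ge0 ?exprn_ge0 // ltW.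
Qed.
Lemma gleMp rho B B' (P Q : {poly C}) : 0 < rho -> gle rho B (fun i => P`_i) ->
  gle rho B' (fun i => Q`_i) -> gle rho (B * B') (fun i => (P * Q)`_i).
Proof. by move=> r0 hP hQ k; rewrite coefM; apply: (gleM r0 hP hQ). Qed.
Lemma horner_le rho B (P : {poly C}) N x : 0 < rho -> gle rho B (fun i => P`_i) ->
  (forall i, (i < N)%N -> P`_i = 0) -> nrm x <= rho -> nrm P.[x] <= B * (nrm x / rho) ^+ N.
Proof.
move=> r0 hP P0 xr; have hx1 : nrm x / rho <= 1 by rewrite ler_pdivrMr // mul1r.
have hx0 : 0 <= nrm x / rho by rewrite divr_ge0 ?nrm_ge0 // ltW.
have B0 := gle_ge0 hP.
rewrite horner_coef; apply: nrm_sum => [|i _]; first by rewrite mulr_ge0 ?exprn_ge0.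
have [iN|iN] := ltnP i N; first by rewrite P0 // mul0r nrm0 mulr_ge0 ?exprn_ge0.
apply: le_trans (gle_term _ _ r0 hP) _.
by rewrite ler_wpM2l // ler_wiXn2l.
Qed.
Lemma gle_poly rho (P : {poly C}) : 0 < rho -> exists2 B, 0 < B & gle rho B (fun i => P`_i).
Proof.
move=> r0; exists (1 + \sum_(i < size P) nrm P`_i * rho ^+ i).
  by rewrite ltr_wpDr // sumr_ge0 // => i _; rewrite mulr_ge0 ?nrm_ge0 // exprn_ge0 // ltW.
move=> i; have h0 j : 0 <= nrm P`_j * rho ^+ j by rewrite mulr_ge0 ?nrm_ge0 // exprn_ge0 // ltW.
have [iP|iP] := ltnP i (size P); last first.
  by rewrite nth_default // nrm0 mul0r addr_ge0 ?sumr_ge0.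
rewrite (bigD1 (Ordinal iP)) //= addrCA lerDl addr_ge0 ?sumr_ge0 //.
Qed.

(** The truncated Cauchy product and the product of the truncations differ by a polynomial that
    starts in degree N and has Gauss norm at most B B', so its value at x is at most B B' (|x| /
    rho)^N. *)
Lemma sumsM rho B B' (a b : nat -> C) x l l' : 0 < rho -> gle rho B a -> gle rho B' b ->
  nrm x < rho -> sums a x l -> sums b x l' ->
  sums (fun k => \sum_(i < k.+1) a i * b (k - i)%N) x (l * l').
Proof.
move=> r0 ha hb xr hl hl'.
have B0 := gle_ge0 ha; have B0' := gle_ge0 hb.
pose T (c : nat -> C) N := \poly_(i < N) c i.
have TE c N : (T c N).[x] = \sum_(m < N) c m * x ^+ m by rewrite horner_poly.
have gT rh BB c N : 0 < rh -> gle rh BB c -> gle rh BB (fun i => (T c N)`_i).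
  move=> rh0 h i; rewrite coef_poly; case: ifP => // _; rewrite nrm0 mul0r; exact: gle_ge0 h.
set d := fun k => _.
suff h0 : cvg (fun N => \sum_(m < N) d m * x ^+ m - (\sum_(m < N) a m * x ^+ m) * (\sum_(m < N) b m * x ^+ m)) 0.
  have := cvgD h0 (cvgM hl hl'); rewrite add0r; apply: (@cvg_ext _ _ _ 0) => m _; by rewrite subrK.
apply: (@cvg0_le _ (fun N => B * B' * (nrm x / rho) ^+ N)).
  move=> N; rewrite -!TE -hornerM -hornerN -hornerD.
  apply: horner_le => //; last exact: ltW.
    have := gleB (gT _ _ d N r0 (gleM r0 ha hb)) (gleMp r0 (gT _ _ _ N r0 ha) (gT _ _ _ N r0 hb)).
    by move=> h i; rewrite coefB; exact: h.
  move=> i iN; rewrite coefB coef_poly iN coefM /d; apply/eqP; rewrite subr_eq0; apply/eqP.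
  apply: eq_bigr => j _; rewrite !coef_poly (leq_ltn_trans _ iN) ?leq_ord //.
  by rewrite (leq_ltn_trans (leq_subr _ _) iN).
apply: geo_small; first by rewrite divr_ge0 ?nrm_ge0 // ltW.
by rewrite ltr_pdivrMr // mul1r.
Qed.
Lemma sumsD c d x l l' : sums c x l -> sums d x l' -> sums (fun i => c i + d i) x (l + l').
Proof.
move=> h h'; apply: (@cvg_ext _ _ _ 0 _ (cvgD h h')) => m _.
by rewrite -big_split; apply: eq_bigr => i _; rewrite mulrDl.
Qed.

Lemma series_zero rho B c : 0 < rho -> gle rho B c ->
  (forall x, x != 0 -> nrm x < rho -> sums c x 0) -> forall i, c i = 0.
Proof.
move=> r0 hc h; apply: contrapT => /existsNP [i0 /eqP ci0].
have [k ck kmin] := @ex_minnP (fun i => c i != 0) (ex_intro _ i0 ci0).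
have B0 := gle_ge0 hc; have nc : 0 < nrm (c k) by rewrite nrm_gt0.
(* Below this size of x the tail B (|x| / rho)^(k+1) is smaller than the first non-zero term |c_k
   x^k|. *)
pose e := Num.min rho (nrm (c k) * rho ^+ k.+1 / (B + 1)).
have B1 : 0 < B + 1 by rewrite ltr_wpDl.
have e0 : 0 < e by rewrite /e lt_min r0 divr_gt0 // mulr_gt0 // exprn_gt0.
have [x x0 xe] := small_elt e0.
move: xe; rewrite /e lt_min => /andP[xr xe].
have := sums_tail k.+1 r0 hc xr (h _ x0 xr).
rewrite big_ord_recr /= big1 => [|j _]; last first.
  suff -> : c j = 0 by rewrite mul0r.
  by apply/eqP; apply: contraTT (ltn_ord j) => /kmin; rewrite -leqNgt.
rewrite add0r add0r nrmN nrmM nrmX expr_div_n mulrA ler_pdivlMr ?exprn_gt0 // leNgt => /negP; apply.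
have nx : 0 < nrm x by rewrite nrm_gt0.
rewrite exprS mulrA [ltRHS]mulrAC ltr_pM2r ?exprn_gt0 //.
move: xe; rewrite ltr_pdivlMr //; apply: le_lt_trans.
by rewrite mulrC ler_wpM2l ?nrm_ge0 // lerDl.
Qed.

Lemma nrm_subX x y m s : 0 <= s -> nrm x <= s -> nrm y <= s -> nrm (x ^+ m.+1 - y ^+ m.+1) <= nrm (x - y) * s ^+ m.
Proof.
move=> s0 hx hy; rewrite subrXX nrmM ler_wpM2l ?nrm_ge0 //.
apply: nrm_sum => [|i _]; first exact: exprn_ge0.
have im : (i <= m)%N by rewrite -ltnS.
rewrite nrmM !nrmX -[in leRHS](subnK im) exprD.
by apply: ler_pM; rewrite ?exprn_ge0 ?nrm_ge0 // lerXn2r // nnegrE ?nrm_ge0.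
Qed.
Lemma sums_lip rho B c x y l l' : 0 < rho -> gle rho B c -> nrm x < rho -> nrm y < rho ->
  sums c x l -> sums c y l' -> nrm (l - l') <= B / rho * nrm (x - y).
Proof.
move=> r0 hc xr yr hl hl'; have B0 := gle_ge0 hc.
apply: (@cvg_nrm_le _ _ _ 0 (cvgB hl hl')) => N _; rewrite -sumrB.
have bd : 0 <= B / rho * nrm (x - y) by rewrite mulr_ge0 ?nrm_ge0 // divr_ge0 // ltW.
apply: nrm_sum => // i _; rewrite -mulrBr nrmM.
case: (nat_of_ord i) => [|m]; first by rewrite !expr0 subrr nrm0 mulr0.
have := nrm_subX m (ltW r0) (ltW xr) (ltW yr) => h.
apply: le_trans (ler_wpM2l (nrm_ge0 _) h) _.
rewrite mulrCA mulrC ler_wpM2r ?nrm_ge0 // ler_pdivlMr //.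
by rewrite -mulrA -exprSr hc.
Qed.

(** Division by X - y: the quotient has coefficients g_i = sum_m c_(i+1+m) y^m, and the Gauss norm
    drops by the factor rho because that of X - y is rho when |y| < rho. *)
Lemma series_div rho B c y : 0 < rho -> gle rho B c -> nrm y < rho -> sums c y 0 ->
  exists g, [/\ gle rho (B / rho) g, c 0%N = - y * g 0%N, forall i, c i.+1 = g i - y * g i.+1 &
    forall x l, nrm x < rho -> x != y -> sums c x l -> sums g x (l / (x - y))].
Proof.
move=> r0 hc yr hy; have B0 := gle_ge0 hc.
have hsh i : gle rho (B / rho ^+ i) (fun m => c (i + m)%N).
  by move=> m; rewrite ler_pdivlMr ?exprn_gt0 // -mulrA -exprD addnC.
pose g i := limC nrm (fun N => \sum_(m < N) c (i.+1 + m)%N * y ^+ m).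
have gP i : sums (fun m => c (i.+1 + m)%N) y (g i).
  have [l hl] := gle_sums r0 (hsh i.+1) yr; by rewrite /g (limCE hl).
have rec c' l : sums c' y l -> forall l', sums (fun m => c' m.+1) y l' -> l = c' 0%N + y * l'.
  move=> h l' h'; apply: (cvg_uniq (cvg_shift 1 h)).
  apply: (@cvg_ext _ _ _ 0 _ (cvgD (cvg_cst (c' 0%N)) (cvgZ y h'))) => m _.
  rewrite addn1 big_ord_recl expr0 mulr1 mulr_sumr; congr (_ + _).
  by apply: eq_bigr => i _; rewrite /bump /= exprS mulrCA.
have g0 : c 0%N = - y * g 0%N.
  by have := rec _ _ hy _ (gP 0%N) => /esym/eqP; rewrite addr_eq0 mulNr => /eqP.
have gS i : c i.+1 = g i - y * g i.+1.
  rewrite (rec _ _ (gP i) (g i.+1)) ?addn0 ?addrK //.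
  by apply: (@cvg_ext _ _ _ 0 _ (gP i.+1)) => m _; apply: eq_bigr => j _; rewrite addSnnS.
have gg : gle rho (B / rho) g.
  move=> i; have := sums_le r0 (hsh i.+1) yr (gP i).
  by rewrite ler_pdivlMr ?exprn_gt0 // exprSr mulrA ler_pdivlMr.
exists g; split=> // x l xr xy hl.
have [l' hl'] := gle_sums r0 gg xr; suff -> : l / (x - y) = l' by [].
have xy0 : x - y != 0 by rewrite subr_eq0.
apply: (mulIf xy0); rewrite divfK //.
apply: (cvg_uniq (cvg_shift 1 hl)).
(* The truncation of (x - y) g differs from the truncation of c only by the boundary term g_N
   x^(N+1). *)
have hz : cvg (fun N => g N * x ^+ N * x) 0.
  apply: (@cvg0_le _ (fun N => B / rho * nrm x * (nrm x / rho) ^+ N)).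
    move=> N; rewrite nrmM mulrAC ler_wpM2r ?nrm_ge0 //.
    exact: gle_term.
  apply: geo_small; first by rewrite divr_ge0 ?nrm_ge0 // ltW.
  by rewrite ltr_pdivrMr // mul1r.
have := cvgB (cvgM (cvg_shift 1 hl') (cvg_cst (x - y))) hz; rewrite subr0.
apply: (@cvg_ext _ _ _ 0) => N _; rewrite addn1.
elim: N => [|N IH].
  by rewrite !big_ord_recl !big_ord0 !expr0 g0; ring.
rewrite big_ord_recr [RHS]big_ord_recr /= -IH gS exprS; ring.
Qed.

(** Dividing out a zero gains a factor rho on the large disc, and multiplying it back costs only r
    on the coefficients. Coefficients are bounded, rather than values, because the criterion ends by
    inspecting one coefficient. *)
Lemma schwarz rho r B c (ys : seq C) : 1 <= rho -> 1 <= r -> r < rho -> gle rho B c -> uniq ys ->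
  (forall y, y \in ys -> nrm y <= r /\ sums c y 0) ->
  forall i, nrm (c i) <= B * (r / rho) ^+ size ys.
Proof.
move=> rho1 r1 rr; have r0 : 0 < rho by apply: lt_le_trans ltr01 _.
elim: ys B c => [|y ys IH] B c hc /=.
  move=> _ _ i; rewrite expr0 mulr1; apply: le_trans (hc i).
  by rewrite ler_peMr ?nrm_ge0 // exprn_ege1.
move=> /andP[yys uys] h; have B0 := gle_ge0 hc.
have [yr hy] := h y (mem_head _ _).
have [g [gg g0 gS gd]] := series_div r0 hc (le_lt_trans yr rr) hy.
have gb : forall i, nrm (g i) <= B / rho * (r / rho) ^+ size ys.
  apply: IH => // y' hy'; have [y'r hy0] := h y' (mem_behead (s := y :: ys) hy'); split=> //.
  rewrite -(mul0r (y' - y)^-1); apply: gd => //; first exact: le_lt_trans rr.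
  by apply: contraNneq yys => <-.
have E : B * (r / rho) ^+ (size ys).+1 = r * (B / rho * (r / rho) ^+ size ys).
  by rewrite exprS; ring.
set S := B / rho * _ in gb E; have S0 : 0 <= S by apply: le_trans (gb 0%N); exact: nrm_ge0.
have yS i : nrm (y * g i) <= r * S by rewrite nrmM ler_pM ?nrm_ge0.
case=> [|i]; rewrite E; first by rewrite g0 mulNr nrmN.
by rewrite gS nrmB_le // (le_trans (gb i)) // ler_peMl.
Qed.

(** On the disc of radius c0 q^N all factors Q_k with k >= N have Gauss norm at most 1 and tend to
    1, so the product converges coefficientwise and pointwise. The relative error estimate is kept
    because it determines where the limit vanishes. Lattice exponentials and Omega are both products
    of this kind. *)
Lemma infprod (P Q : nat -> {poly C}) (c0 : R) : 0 < c0 ->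
  (forall N, P N.+1 = P N * Q N) -> (forall N, (Q N)`_0 = 1) ->
  (forall N i, nrm (Q N)`_i <= (c0 * q%:R ^+ N) ^- i) ->
  exists c, [/\ entire nrm c, forall m, cvg (fun N => (P N)`_m) (c m) &
    forall x, exists l, [/\ sums c x l, cvg (fun N => (P N).[x]) l &
      forall N, nrm x < c0 * q%:R ^+ N ->
        nrm (l - (P N).[x]) <= nrm (P N).[x] * (nrm x / (c0 * q%:R ^+ N))]].
Proof.
move=> c00 PS Q0 Qi; pose M N := c0 * q%:R ^+ N.
have M0 N : 0 < M N by rewrite mulr_gt0 ?qX_gt0.
have Mmono N k : (N <= k)%N -> M N <= M k.
  by move=> h; rewrite ler_pM2l // ler_weXn2l ?qR_ge1.
have Mlarge (x : R) : exists N, forall m, (N <= m)%N -> x < M m.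
  have [N hN] := expr_unbounded (x / c0) qR_gt1; exists N => m /hN.
  by rewrite ltr_pdivrMr // mulrC.
have gQ rho N : 0 < rho -> rho <= M N -> gle rho 1 (fun i => (Q N)`_i).
  move=> r0 h i; have := Qi N i; rewrite -/(M N) => hi.
  rewrite -ler_pdivlMr ?exprn_gt0 // mul1r (le_trans hi) //.
  by rewrite lef_pV2 ?posrE ?exprn_gt0 // lerXn2r // nnegrE ltW.
have gQ1 rho N : 0 < rho -> rho <= M N -> gle rho (rho / M N) (fun i => (Q N - 1)`_i).
  move=> r0 h i; rewrite coefB coef1; case: i => [|i].
    by rewrite Q0 subrr nrm0 mul0r divr_ge0 // ltW.
  rewrite subr0; have := Qi N i.+1; rewrite -/(M N) => hi.
  apply: le_trans (ler_wpM2r _ hi) _; first by rewrite exprn_ge0 // ltW.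
  have h0 : 0 <= rho / M N by rewrite divr_ge0 // ltW.
  have h1 : rho / M N <= 1 by rewrite ler_pdivrMr // mul1r.
  by rewrite mulrC -expr_div_n exprS -[leRHS]mulr1 ler_wpM2l // exprn_ile1.
have step rho : 0 < rho -> exists N0 B, forall N, (N0 <= N)%N ->
    [/\ 0 < B, rho <= M N, gle rho B (fun i => (P N)`_i) & gle rho (B * (rho / M N)) (fun i => (P N.+1 - P N)`_i)].
  move=> r0; have [N0 hN0] := Mlarge rho; have [B B0 hB] := gle_poly (P N0) r0.
  have hP k : gle rho B (fun i => (P (N0 + k)%N)`_i).
    elim: k => [|k IH]; first by rewrite addn0.
    rewrite addnS PS -[B]mulr1; apply: gleMp => //; apply: gQ => //.
    by rewrite ltW // hN0 // leq_addr.
  exists N0, B => N hN; have h1 : rho <= M N by rewrite ltW // hN0.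
  have h2 : gle rho B (fun i => (P N)`_i) by rewrite -(subnKC hN).
  split=> //; rewrite PS -{2}[P N]mulr1 -mulrBr; apply: gleMp => //; exact: gQ1.
have Msmall (B rho : R) e : 0 < rho -> 0 < e -> exists N, forall m, (N <= m)%N -> B * (rho / M m) < e.
  move=> r0 e0; have [N hN] := Mlarge (B * rho / e); exists N => m /hN.
  by rewrite ltr_pdivrMr // => h; rewrite mulrA ltr_pdivrMr // [ltRHS]mulrC.
have [c hc] : exists c, forall m, cvg (fun N => (P N)`_m) (c m).
  exists (fun m => limC nrm (fun N => (P N)`_m)) => m.
  suff [l hl] : exists l, cvg (fun N => (P N)`_m) l by rewrite (limCE hl).
  apply: cauchy_cvg => e e0; have [N0 [B hB]] := step 1 ltr01.
  have [N1 hN1] := Msmall B 1 e ltr01 e0; exists (maxn N0 N1) => N.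
  rewrite geq_max => /andP[/hB[_ _ _ h] /hN1]; apply: le_lt_trans.
  by have := h m; rewrite expr1n mulr1 coefB.
have gc rho : 0 < rho -> exists B, gle rho B c /\
    exists N0, forall N, (N0 <= N)%N -> gle rho (B * (rho / M N)) (fun i => c i - (P N)`_i).
  move=> r0; have [N0 [B hB]] := step rho r0; exists B; split.
    move=> i; rewrite -ler_pdivlMr ?exprn_gt0 //; apply: (cvg_nrm_le (hc i) (N := N0)) => N /hB [_ _ h _].
    by rewrite ler_pdivlMr ?exprn_gt0.
  exists N0 => N hN i; have [B0 _ _ _] := hB N hN.
  rewrite -ler_pdivlMr ?exprn_gt0 //.
  apply: (cvg_nrm_le (cvgB (hc i) (cvg_cst _)) (N := N)) => k hk.
  rewrite -(subnKC hk); elim: (k - N)%N => [|j IH].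
    by rewrite addn0 subrr nrm0 ltW // divr_gt0 ?mulr_gt0 ?exprn_gt0 ?invr_gt0.
  rewrite addnS -(subrK (P (N + j)%N)`_i (P _.+1)`_i) -addrA; apply: nrmD_le => //.
  have [|_ _ _ h] := hB (N + j)%N; first by apply: leq_trans hN _; exact: leq_addr.
  have := h i; rewrite coefB -ler_pdivlMr ?exprn_gt0 // => /le_trans; apply.
  rewrite ler_pM2r ?invr_gt0 ?exprn_gt0 // ler_pM2l // ler_pM2l // lef_pV2 ?posrE //.
  by apply: Mmono; exact: leq_addr.
exists c; split=> //.
  (* Doubling the radius turns a bound on the Gauss norm into geometric decay. *)
  move=> rad r0 e e0; have r20 : 0 < 2 * rad by rewrite mulr_gt0.
  have [B [hB _]] := gc _ r20.
  have [||N hN] := @geo_small B (2^-1) _ _ e e0; first by rewrite invr_ge0.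
    by rewrite invf_lt1 // ltr1n.
  exists N => m /hN; apply: le_lt_trans.
  rewrite exprVn ler_pdivlMr ?exprn_gt0 // -mulrA -exprMn mulrC; have := hB m.
  by rewrite [rad * 2]mulrC mulrC.
move=> x; have r0 : 0 < nrm x + 1 by rewrite ltr_wpDl ?nrm_ge0.
have xr : nrm x < nrm x + 1 by rewrite ltrDl.
have [B [hB [N0 hN0]]] := gc _ r0; have [l hl] := gle_sums r0 hB xr.
have cl : cvg (fun N => (P N).[x]) l.
  suff h0 : cvg (fun N => l - (P N).[x]) 0.
    have := cvgB (cvg_cst l) h0; rewrite subr0; apply: (@cvg_ext _ _ _ 0) => m _.
    by rewrite subKr.
  move=> e e0; have [N1 hN1] := Msmall B (nrm x + 1) e r0 e0.
  exists (maxn N0 N1) => N; rewrite geq_max => /andP[/hN0 h /hN1]; apply: le_lt_trans.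
  rewrite subr0.
  apply: (@cvg_nrm_le (fun K => \sum_(m < K) (c m - (P N)`_m) * x ^+ m) _ _ 0) => [|K _]; last first.
    apply: nrm_sum => [|i _]; first exact: gle_ge0 h.
    rewrite nrmM nrmX; apply: le_trans (h i); rewrite ler_wpM2l ?nrm_ge0 //.
    by rewrite lerXn2r ?nnegrE ?nrm_ge0 // ltW.
  apply: (@cvg_ext _ _ _ (size (P N)) _ (cvgB hl (cvg_cst (P N).[x]))) => K hK.
  rewrite (horner_coef_wide x hK) -sumrB; apply: eq_bigr => i _; by rewrite mulrBl.
exists l; split=> // N xM.
have stepx k : nrm ((P (N + k).+1).[x] - (P (N + k)%N).[x]) <= nrm (P (N + k)%N).[x] * (nrm x / M N).
  rewrite PS hornerM -{2}[(P _).[x]]mulr1 -mulrBr nrmM ler_wpM2l ?nrm_ge0 //.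
  have -> : (Q (N + k)%N).[x] - 1 = (Q (N + k)%N - 1).[x] by rewrite !hornerE.
  have hQ := gQ1 (M N) (N + k)%N (M0 N) (Mmono _ _ (leq_addr _ _)).
  apply: le_trans (horner_le (N := 1) (M0 N) hQ _ (ltW xM)) _.
    by case=> // _; rewrite coefB coef1 Q0 subrr.
  have h0 : 0 <= nrm x / M N by rewrite divr_ge0 ?nrm_ge0 // ltW.
  rewrite expr1 ler_piMl //.
  rewrite ler_pdivrMr // mul1r; apply: Mmono; exact: leq_addr.
have xM1 : nrm x / M N < 1 by rewrite ltr_pdivrMr // mul1r.
have xM0 : 0 <= nrm x / M N by rewrite divr_ge0 ?nrm_ge0 // ltW.
have nP k : nrm (P (N + k)%N).[x] = nrm (P N).[x].
  elim: k => [|k <-]; first by rewrite addn0.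
  have [z|z] := eqVneq (P (N + k)%N).[x] 0; first by rewrite addnS PS hornerM z mul0r.
  rewrite addnS -(subrK (P (N + k)%N).[x] (P _.+1).[x]) addrC nrm_dom //.
  apply: le_lt_trans (stepx k) _; by rewrite gtr_pMr ?nrm_gt0.
apply: (cvg_nrm_le (cvgB cl (cvg_cst _)) (N := N)) => K hK; rewrite -(subnKC hK).
elim: (K - N)%N => [|k IH]; first by rewrite addn0 subrr nrm0 mulr_ge0 ?nrm_ge0.
rewrite addnS -(subrK (P (N + k)%N).[x] (P _.+1).[x]) -addrA; apply: nrmD_le => //.
by apply: le_trans (stepx k) _; rewrite nP.
Qed.

(** * Polynomials of bounded height and Siegel's lemma *)
Lemma Fqp0 : FqP' (0 : {poly C}). Proof. by move=> k; rewrite coef0; exact: Fq0. Qed.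
Lemma FqpC c : Fq c -> FqP' c%:P.
Proof. by move=> h k; rewrite coefC; case: ifP => // _; exact: Fq0. Qed.
Lemma FqpX k : FqP' ('X^k : {poly C}).
Proof. by move=> i; rewrite coefXn; case: eqP => _; [exact: Fq1 | exact: Fq0]. Qed.
Lemma FqpD (P Q : {poly C}) : FqP' P -> FqP' Q -> FqP' (P + Q).
Proof. by move=> hP hQ k; rewrite coefD; apply: FqD. Qed.
Lemma FqpN (P : {poly C}) : FqP' P -> FqP' (- P).
Proof. by move=> hP k; rewrite coefN; apply: FqN. Qed.
Lemma FqpM (P Q : {poly C}) : FqP' P -> FqP' Q -> FqP' (P * Q).
Proof. by move=> hP hQ k; rewrite coefM; apply: Fq_sum => i _; apply: FqM. Qed.
Lemma Fqp_sum (I : Type) (s : seq I) (D : pred I) (F : I -> {poly C}) :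
  (forall i, D i -> FqP' (F i)) -> FqP' (\sum_(i <- s | D i) F i).
Proof. by move=> h; elim/big_ind: _ => //; [exact: Fqp0 | exact: FqpD]. Qed.

(** The leading term dominates, as |theta| > 1 and the coefficients have norm 0 or 1. *)
Lemma Fqp_nrm (P : {poly C}) : FqP' P -> P != 0 -> nrm P.[theta] = q%:R ^+ (size P).-1.
Proof.
move=> hP P0; have s0 : (0 < size P)%N by rewrite size_poly_gt0.
have lP : lead_coef P != 0 by rewrite lead_coef_eq0.
have hl : nrm (lead_coef P * theta ^+ (size P).-1) = q%:R ^+ (size P).-1.
  by rewrite nrmM (Fq_nrm (hP _) lP) mul1r nrm_thetaX.
rewrite horner_coef -(prednK s0) big_ord_recr /= addrC nrm_dom -/(lead_coef P) ?hl //.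
apply: nrm_sum_lt => [|i _]; first exact: qX_gt0.
rewrite nrmM nrm_thetaX; apply: (@le_lt_trans _ _ (q%:R ^+ i)).
  by rewrite ler_piMl ?Fq_nrm_le // ltW ?qX_gt0.
by rewrite ltr_eXn2l ?qR_gt1.
Qed.

(** Heights are degrees in theta, counted as sizes, so that exactly q^H elements have height H. *)
Definition Aht (H : nat) (x : C) := exists P : {poly C}, [/\ FqP' P, (size P <= H)%N & x = P.[theta]].
Lemma Aht0 H : Aht H 0.
Proof. by exists 0; rewrite size_poly0 horner0; split=> //; exact: Fqp0. Qed.
Lemma Aht_w H H' x : (H <= H')%N -> Aht H x -> Aht H' x.
Proof. by move=> h [P [hP sP ->]]; exists P; split=> //; apply: leq_trans h. Qed.
Lemma AhtD H x y : Aht H x -> Aht H y -> Aht H (x + y).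
Proof.
move=> [P [hP sP ->]] [Q [hQ sQ ->]]; exists (P + Q); rewrite hornerD; split=> //.
  exact: FqpD.
by apply: leq_trans (size_polyD _ _) _; rewrite geq_max sP.
Qed.
Lemma Aht_sum H (I : Type) (s : seq I) (D : pred I) (F : I -> C) :
  (forall i, D i -> Aht H (F i)) -> Aht H (\sum_(i <- s | D i) F i).
Proof. by move=> h; elim/big_ind: _ => //; [exact: Aht0 | exact: AhtD]. Qed.
Lemma AhtM H H' x y : Aht H x -> Aht H' y -> Aht (H + H') (x * y).
Proof.
move=> [P [hP sP ->]] [Q [hQ sQ ->]]; exists (P * Q); rewrite hornerM; split=> //.
  exact: FqpM.
apply: leq_trans (size_polyMleq _ _) _; apply: leq_trans (leq_pred _) _; exact: leq_add.
Qed.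
Lemma AhtX H x k : (0 < k)%N -> Aht H x -> Aht (H * k) (x ^+ k).
Proof.
case: k => // k _ h; elim: k => [|k IH]; first by rewrite muln1 expr1.
by rewrite mulnS exprS; apply: AhtM.
Qed.
Lemma Aht_frX H x k : Aht H x -> Aht (H * q ^ k) (x ^+ (q ^ k)).
Proof. by apply: AhtX; exact: qk_gt0. Qed.
Lemma Aht_Fq H c : (0 < H)%N -> Fq c -> Aht H c.
Proof.
move=> H0 h; exists c%:P; rewrite hornerC; split=> //; first exact: FqpC.
exact: leq_trans (size_polyC_leq1 _) H0.
Qed.
Lemma Aht1 H : (0 < H)%N -> Aht H 1. Proof. by move=> h; apply: Aht_Fq => //; exact: Fq1. Qed.
Lemma Aht_theta k H : (k < H)%N -> Aht H (theta ^+ k).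
Proof. by move=> kH; exists 'X^k; rewrite hornerXn size_polyXn; split=> //; exact: FqpX. Qed.
Lemma Aht_le H x : Aht H x -> nrm x <= q%:R ^+ H.
Proof.
move=> [P [hP sP ->]]; have [->|P0] := eqVneq P 0; first by rewrite horner0 nrm0 ltW ?qX_gt0.
rewrite Fqp_nrm // ler_weXn2l ?qR_ge1 //; apply: leq_trans (leq_pred _) sP.
Qed.
Lemma Aht_ge H x : Aht H x -> x != 0 -> 1 <= nrm x.
Proof.
move=> [P [hP sP ->]]; have [->|P0] := eqVneq P 0; first by rewrite horner0 eqxx.
by rewrite Fqp_nrm // qX_ge1.
Qed.
Lemma inAP x : inA q theta x <-> exists H, Aht H x.
Proof.
split; first by move=> [P [hP ->]]; exists (size P), P.
by move=> [H [P [hP _ ->]]]; exists P.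
Qed.
Lemma inA0 : inA' 0. Proof. by apply/inAP; exists 0%N; exact: Aht0. Qed.
Lemma inA1 : inA' 1. Proof. by apply/inAP; exists 1%N; exact: Aht1. Qed.
Lemma inA_theta : inA' theta. Proof. by apply/inAP; exists 2%N; exact: (@Aht_theta 1 2). Qed.
Lemma inA_Fq c : Fq c -> inA' c. Proof. by move=> h; apply/inAP; exists 1%N; exact: Aht_Fq. Qed.
Lemma inAD x y : inA' x -> inA' y -> inA' (x + y).
Proof.
move=> [P [hP ->]] [Q [hQ ->]]; exists (P + Q); rewrite hornerD; split=> //; exact: FqpD.
Qed.
Lemma inAN x : inA' x -> inA' (- x).
Proof. by move=> [P [hP ->]]; exists (- P); rewrite hornerN; split=> //; exact: FqpN. Qed.
Lemma inAM x y : inA' x -> inA' y -> inA' (x * y).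
Proof.
move=> [P [hP ->]] [Q [hQ ->]]; exists (P * Q); rewrite hornerM; split=> //; exact: FqpM.
Qed.
Lemma inAX x k : inA' x -> inA' (x ^+ k).
Proof. by move=> h; elim: k => [|k IH]; rewrite ?expr0 ?exprS; [exact: inA1 | exact: inAM]. Qed.

(** * Subfields of C and the perfect closure of K *)

Definition subfld (F : C -> Prop) := [/\ F 0, F 1, forall x y, F x -> F y -> F (x + y),
  forall x, F x -> F (- x) & (forall x y, F x -> F y -> F (x * y)) /\ forall x, F x -> F x^-1].
Section Subfield.
Variables (F : C -> Prop).
Hypothesis hF : subfld F.
Lemma sf0 : F 0. Proof. by case: hF. Qed.
Lemma sf1 : F 1. Proof. by case: hF. Qed.
Lemma sfD x y : F x -> F y -> F (x + y). Proof. by case: hF => _ _ h *; apply: h. Qed.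
Lemma sfN x : F x -> F (- x). Proof. by case: hF => _ _ _ h *; apply: h. Qed.
Lemma sfM x y : F x -> F y -> F (x * y). Proof. by case: hF => _ _ _ _ [h *]; apply: h. Qed.
Lemma sfV x : F x -> F x^-1. Proof. by case: hF => _ _ _ _ [_ h *]; apply: h. Qed.
Lemma sfB x y : F x -> F y -> F (x - y). Proof. by move=> *; apply: sfD => //; apply: sfN. Qed.
Lemma sfX x k : F x -> F (x ^+ k).
Proof. by move=> h; elim: k => [|k IH]; rewrite ?expr0 ?exprS; [exact: sf1 | exact: sfM]. Qed.
Lemma sf_sum (I : Type) (s : seq I) (D : pred I) (G : I -> C) :
  (forall i, D i -> F (G i)) -> F (\sum_(i <- s | D i) G i).
Proof. by move=> h; elim/big_ind: _ => //; [exact: sf0 | exact: sfD]. Qed.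

Lemma sub_basis (I : finType) (u : I -> C) : exists J : {set I},
  (forall c, (forall i, F (c i)) -> \sum_(i in J) c i * u i = 0 -> forall i, i \in J -> c i = 0) /\
  forall i, exists c, (forall j, F (c j)) /\ u i = \sum_(j in J) c j * u j.
Proof.
pose indep (J : {set I}) := forall c, (forall i, F (c i)) -> \sum_(i in J) c i * u i = 0 ->
  forall i, i \in J -> c i = 0.
have i0 : `[<indep finset.set0>] by apply/asboolP => c _ _ i; rewrite inE.
case: (@arg_maxnP _ _ (fun J => `[<indep J>]) (fun J : {set I} => #|J|) i0) => J /asboolP iJ mJ.
exists J; split=> // i; have [iJ'|iJ'] := boolP (i \in J).
  exists (fun j => (j == i)%:R); split=> [j|]; first by case: eqP => _; [exact: sf1 | exact: sf0].
  by rewrite (bigD1 i) //= eqxx mul1r big1 ?addr0 // => j /andP[_ /negPf ->]; rewrite mul0r.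
have : ~ indep (i |: J)%SET.
  move=> h; have := mJ (i |: J)%SET (introT (asboolP _) h).
  by rewrite /geq /= cardsU1 iJ' add1n ltnn.
rewrite /indep => /existsNP [c /not_implyP [hc /not_implyP [c0 /existsNP [k /not_implyP [kJ ck]]]]].
rewrite big_setU1 //= in c0.
have ci : c i != 0.
  apply/eqP => z; apply: ck; rewrite z mul0r add0r in c0.
  by move: kJ; rewrite in_setU1 => /orP[/eqP -> //|kJ]; apply: iJ.
exists (fun j => - (c j / c i)); split=> [j|].
  by apply: sfN; apply: sfM => //; apply: sfV.
move/eqP: c0; rewrite addr_eq0 => /eqP c0; apply: (mulfI ci); rewrite c0 mulr_sumr -sumrN.
by apply: eq_bigr => j _; field.
Qed.
End Subfield.

Lemma inK_sf : subfld inK'.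
Proof.
have e0 : (1 : C) != 0 by exact: oner_neq0.
split.
- by exists 0, 1; rewrite mul0r; split; [exact: inA0|split; [exact: inA1|]].
- by exists 1, 1; rewrite divr1; split; [exact: inA1|split; [exact: inA1|]].
- move=> x y [a [b [ha [hb [b0 ->]]]]] [c [d [hc [hd [d0 ->]]]]].
  exists (a * d + c * b), (b * d); split; first by apply: inAD; apply: inAM.
  split; first exact: inAM. split; first by rewrite mulf_neq0. by field; rewrite b0 d0.
- move=> x [a [b [ha [hb [b0 ->]]]]]; exists (- a), b; rewrite mulNr; split; first exact: inAN.
  by [].
split.
  move=> x y [a [b [ha [hb [b0 ->]]]]] [c [d [hc [hd [d0 ->]]]]].
  exists (a * c), (b * d); split; first exact: inAM.
  split; first exact: inAM. split; first by rewrite mulf_neq0. by field; rewrite b0 d0.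
move=> x [a [b [ha [hb [b0 ->]]]]]; have [->|a0] := eqVneq a 0.
  by exists 0, 1; rewrite mul0r invr0 mul0r; split; [exact: inA0|split; [exact: inA1|]].
by exists b, a; rewrite invf_div.
Qed.
Lemma inA_K x : inA' x -> inK' x.
Proof. by move=> h; exists x, 1; rewrite divr1 oner_neq0; split=> //; split=> //; exact: inA1. Qed.

(** The perfect closure of K in C. It contains the coefficients of the auxiliary function, which are
    q^m-th roots of elements of A. *)
Definition inKp (x : C) := exists m, inK' (x ^+ (q ^ m)).
Lemma inK_Kp x : inK' x -> inKp x. Proof. by exists 0%N; rewrite expn0 expr1. Qed.
Lemma inKp_up x m k : inK' (x ^+ (q ^ m)) -> (m <= k)%N -> inK' (x ^+ (q ^ k)).
Proof. by move=> h mk; rewrite -(subnKC mk) -frA; apply: (sfX inK_sf). Qed.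
Lemma inKp_sf : subfld inKp.
Proof.
split; [exact: (inK_Kp (sf0 inK_sf)) | exact: (inK_Kp (sf1 inK_sf)) | | |split].
- move=> x y [m hm] [k hk]; exists (maxn m k); rewrite frD; apply: (sfD inK_sf).
    exact: inKp_up hm (leq_maxl _ _). exact: inKp_up hk (leq_maxr _ _).
- by move=> x [m hm]; exists m; rewrite frN; apply: (sfN inK_sf).
- move=> x y [m hm] [k hk]; exists (maxn m k); rewrite exprMn; apply: (sfM inK_sf).
    exact: inKp_up hm (leq_maxl _ _). exact: inKp_up hk (leq_maxr _ _).
- by move=> x [m hm]; exists m; rewrite exprVn; apply: (sfV inK_sf).
Qed.

Lemma common_denom (I : finType) (u : I -> C) : (forall i, inK' (u i)) ->
  exists a, [/\ inA' a, a != 0 & forall i, inA' (a * u i)].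
Proof.
move=> h; suff [a [ha a0 hs]] : exists a, [/\ inA' a, a != 0 & forall i, i \in enum I -> inA' (a * u i)].
  by exists a; split=> // i; apply: hs; rewrite mem_enum.
elim: (enum I) => [|i s [a [ha a0 hs]]].
  by exists 1; rewrite oner_neq0; split=> //; exact: inA1.
have [c [d [hc [hd [d0 e]]]]] := h i; exists (a * d); split; first exact: inAM.
  by rewrite mulf_neq0.
move=> j; rewrite inE => /orP[/eqP ->|js]; last by rewrite mulrAC; apply: inAM => //; apply: hs.
by rewrite e (_ : _ * _ = a * c); [apply: inAM | field].
Qed.

(** Pigeonhole: there are q^(#J H) vectors of height H and at most q^(#I (H + B)) images, so two
    vectors share their image, and their difference is the solution. *)
Lemma siegel (I J : finType) (M : I -> J -> C) (H B : nat) :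
  (forall i j, Aht B (M i j)) -> (#|I| * (H + B) < #|J| * H)%N ->
  exists X : J -> C, [/\ forall j, Aht H (X j), exists j, X j != 0 & forall i, \sum_j M i j * X j = 0].
Proof.
move=> hM hc.
pose PM i j : {poly C} := xget 0 [set P | [/\ FqP' P, (size P <= B)%N & M i j = P.[theta]]]%classic.
have PMP i j : [/\ FqP' (PM i j), (size (PM i j) <= B)%N & M i j = (PM i j).[theta]].
  by rewrite /PM; case: xgetP => // h; have [P hP] := hM i j; have := h P.
pose el (i : 'I_q) : C := Fqs`_i.
have elF i : Fq (el i) by apply/FqP; rewrite mem_nth // size_Fqs.
have el_inj : injective el.
  by move=> i j /eqP; rewrite nth_uniq ?size_Fqs ?Fqs_uniq // => /eqP /val_inj.
(* The reduction modulo q only makes the code total; on F_q the index is already below q. *)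
have codeP c : (index c Fqs %% q < q)%N by rewrite ltn_mod q_gt0.
pose code c : 'I_q := Ordinal (codeP c).
have codeK c : Fq c -> el (code c) = c.
  move=> /FqP h; rewrite /el /= modn_small; first exact: nth_index.
  by move: h; rewrite -index_mem size_Fqs.
pose X (t : {ffun J * 'I_H -> 'I_q}) j : {poly C} := \poly_(k < H) (if insub k is Some k' then el (t (j, k')) else 0).
have XE t j (k : 'I_H) : (X t j)`_k = el (t (j, k)).
  by rewrite coef_poly ltn_ord insubT //= => h; congr (el (t (j, _))); apply: val_inj.
have XF t j : FqP' (X t j).
  move=> k; rewrite coef_poly; case: ifP => _; last exact: Fq0.
  by case: insub => [k'|]; [exact: elF | exact: Fq0].
have Xs t j : (size (X t j) <= H)%N by apply: size_poly.
pose G t i : {poly C} := \sum_j PM i j * X t j.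
have GF t i : FqP' (G t i).
  by apply: Fqp_sum => j _; apply: FqpM => //; case: (PMP i j).
have Gs t i : (size (G t i) <= H + B)%N.
  apply: (big_ind (fun P : {poly C} => (size P <= H + B)%N)); first by rewrite size_poly0.
    by move=> P Q hP hQ; apply: leq_trans (size_polyD _ _) _; rewrite geq_max hP.
  move=> j _; apply: leq_trans (size_polyMleq _ _) _; apply: leq_trans (leq_pred _) _.
  by rewrite addnC leq_add //; case: (PMP i j).
pose f (t : {ffun J * 'I_H -> 'I_q}) : {ffun I * 'I_(H + B) -> 'I_q} := [ffun ik : I * 'I_(H + B) => code (G t ik.1)`_(ik.2)].
have ninj : ~ injective f.
  move=> /leq_card; rewrite !card_ffun !card_prod !card_ord leq_exp2l ?q_gt1 //.
  by rewrite leqNgt hc.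
have [t [t' [ff tt]]] : exists t t', f t = f t' /\ t <> t'.
  apply: contrapT => hn; apply: ninj => t t' ff; apply: contrapT => tt; apply: hn.
  by exists t, t'.
exists (fun j => (X t j - X t' j).[theta]); split.
- move=> j; exists (X t j - X t' j); split=> //; first by apply: FqpD => //; apply: FqpN.
  by apply: leq_trans (size_polyD _ _) _; rewrite size_polyN geq_max !Xs.
- apply: contrapT => hn; apply: tt; apply/ffunP => -[j k]; apply: el_inj; rewrite -!XE.
  have : ~~ (((X t j - X t' j).[theta]) != 0) by apply/negP => h; apply: hn; exists j.
  rewrite negbK; have [/eqP d0 _|d0 /eqP] := eqVneq (X t j - X t' j) 0.
    by move: d0; rewrite subr_eq0 => /eqP ->.
  move=> z; have := Fqp_nrm (FqpD (XF t j) (FqpN (XF t' j))) d0.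
  by rewrite z nrm0 => /esym/eqP; rewrite expf_eq0 gt_eqF ?qR_gt0 // andbF.
move=> i; have -> : \sum_j M i j * (X t j - X t' j).[theta] = (G t i - G t' i).[theta].
  rewrite /G -sumrB horner_sum; apply: eq_bigr => j _; rewrite -mulrBr hornerM.
  by case: (PMP i j) => _ _ <-.
suff -> : G t i = G t' i by rewrite subrr horner0.
apply/polyP => k; have [kHB|kHB] := ltnP k (H + B); last first.
  by rewrite !nth_default // (leq_trans (Gs _ _)).
have := congr1 (fun g : {ffun I * 'I_(H + B) -> 'I_q} => el (g (i, Ordinal kHB))) ff.
by rewrite !ffunE !codeK //=; apply: GF.
Qed.

(** * Finite K-algebras inside C *)

Definition spanK (I : finType) (b : I -> C) (x : C) :=
  exists c : I -> C, (forall i, inK' (c i)) /\ x = \sum_i c i * b i.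
Section SpanK.
Variables (I : finType) (b : I -> C).
Lemma spanK0 : spanK b 0.
Proof. by exists (fun=> 0); split=> [_|]; [exact: (sf0 inK_sf) | rewrite big1 // => i _; rewrite mul0r]. Qed.
Lemma spanKD x y : spanK b x -> spanK b y -> spanK b (x + y).
Proof.
move=> [c [hc ->]] [d [hd ->]]; exists (fun i => c i + d i); split=> [i|]; first exact: (sfD inK_sf).
by rewrite -big_split; apply: eq_bigr => i _; rewrite mulrDl.
Qed.
Lemma spanKZ a x : inK' a -> spanK b x -> spanK b (a * x).
Proof.
move=> ha [c [hc ->]]; exists (fun i => a * c i); split=> [i|]; first exact: (sfM inK_sf).
by rewrite mulr_sumr; apply: eq_bigr => i _; rewrite mulrA.
Qed.
Lemma spanK_sum (T : Type) (s : seq T) (D : pred T) (F : T -> C) :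
  (forall i, D i -> spanK b (F i)) -> spanK b (\sum_(i <- s | D i) F i).
Proof. by move=> h; elim/big_ind: _ => //; [exact: spanK0 | exact: spanKD]. Qed.
Lemma spanKN x : spanK b x -> spanK b (- x).
Proof. by move=> h; rewrite -mulN1r; apply: spanKZ => //; apply: (sfN inK_sf); exact: (sf1 inK_sf). Qed.
Lemma spanK_gen i : spanK b (b i).
Proof.
exists (fun j => (j == i)%:R); split=> [j|].
  by case: eqP => _; [exact: (sf1 inK_sf) | exact: (sf0 inK_sf)].
by rewrite (bigD1 i) //= eqxx mul1r big1 ?addr0 // => j /negPf ->; rewrite mul0r.
Qed.
End SpanK.

(** The family spans a K-subalgebra of C. It may be linearly dependent, which avoids any discussion
    of bases and degrees. *)
Record fgalg (I : finType) (b : I -> C) : Prop := FgAlg {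
  fg1 : spanK b 1; fgM : forall i j, spanK b (b i * b j) }.
Lemma fg_mul (I : finType) (b : I -> C) x y : fgalg b -> spanK b x -> spanK b y -> spanK b (x * y).
Proof.
move=> [_ hM] [c [hc ->]] [d [hd ->]]; rewrite mulr_suml; apply: spanK_sum => i _.
rewrite mulr_sumr; apply: spanK_sum => j _; rewrite mulrACA.
by apply: spanKZ => //; apply: (sfM inK_sf).
Qed.
Lemma fgX (I : finType) (b : I -> C) x k : fgalg b -> spanK b x -> spanK b (x ^+ k).
Proof.
move=> hb hx; elim: k => [|k IH]; first by rewrite expr0; case: hb.
by rewrite exprS; apply: fg_mul.
Qed.
Lemma fgK (I : finType) (b : I -> C) a : fgalg b -> inK' a -> spanK b a.
Proof. by move=> [h1 _] ha; rewrite -(mulr1 a); apply: spanKZ. Qed.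

(** The products b_i x^k with k below the degree of P span a ring, because monicity rewrites x^d
    through lower powers with coefficients in the algebra. *)
Lemma fg_adjoin (I : finType) (b : I -> C) x (P : {poly C}) : fgalg b -> P \is monic ->
  (forall k, spanK b P`_k) -> root P x ->
  exists (I' : finType) (b' : I' -> C), [/\ fgalg b', forall y, spanK b y -> spanK b' y & spanK b' x].
Proof.
move=> hb mP cP rx; pose d := (size P).-1.
have sP : size P = d.+1 by rewrite /d prednK // size_poly_gt0 monic_neq0.
have xd : x ^+ d = - \sum_(k < d) P`_k * x ^+ k.
  move: rx; rewrite /root horner_coef sP big_ord_recr /= => /eqP /esym/eqP.
  by rewrite -[P`_d]/(lead_coef P) (monicP mP) mul1r eq_sym addrC addr_eq0 => /eqP.
pose b' (ik : I * 'I_d) := b ik.1 * x ^+ ik.2.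
have small y k : spanK b y -> (k < d)%N -> spanK b' (y * x ^+ k).
  move=> [c [hc ->]] kd; rewrite mulr_suml; apply: spanK_sum => i _; rewrite -mulrA.
  by apply: spanKZ => //; apply: (spanK_gen b' (i, Ordinal kd)).
have all k : forall y, spanK b y -> spanK b' (y * x ^+ k).
  have [m] := ubnP k; elim: m k => // m IH k km y hy.
  have [kd|dk] := ltnP k d; first exact: small.
  rewrite -(subnK dk) exprD mulrCA mulrC xd mulrN mulNr mulr_sumr mulr_suml.
  apply: spanKN; apply: spanK_sum => j _.
  rewrite (_ : _ * _ = (y * P`_j) * x ^+ (k - d + j)); last by rewrite exprD; ring.
  apply: IH; last exact: fg_mul.
  rewrite -(ltn_add2r d) addnAC subnK // -addnS; move: (ltn_ord j) km; lia.
have sub y : spanK b y -> spanK b' y by move=> hy; have := all 0%N y hy; rewrite expr0 mulr1.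
exists _, b'; split=> //; last first.
  by have := all 1%N 1 (fg1 hb); rewrite mul1r.
split; first exact: (sub _ (fg1 hb)).
move=> [i k] [j l]; rewrite /b' /= mulrACA -exprD; apply: all; exact: fgM.
Qed.

Lemma Kbar_monic x : inKbar' x -> exists P : {poly C}, [/\ P \is monic, forall k, inK' P`_k & root P x].
Proof.
move=> [P [P0 [hP rx]]]; have lP : lead_coef P != 0 by rewrite lead_coef_eq0.
exists ((lead_coef P)^-1 *: P); split.
- by rewrite monicE lead_coefZ mulVf.
- by move=> k; rewrite coefZ; apply: (sfM inK_sf); [apply: (sfV inK_sf)|]; exact: hP.
by rewrite rootZ // invr_eq0.
Qed.
Lemma inK_Kbar x : inK' x -> inKbar' x.
Proof.
move=> hx; exists ('X - x%:P); rewrite polyXsubC_eq0 root_XsubC eqxx; split=> //; split=> // k.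
rewrite coefB coefX coefC; apply: (sfB inK_sf).
  by case: eqP => _; [exact: (sf1 inK_sf) | exact: (sf0 inK_sf)].
by case: eqP => _ //; exact: (sf0 inK_sf).
Qed.
(** The reversed polynomial annihilates 1/x. This comes before Kbar is known to be a field, since
    [fg_exists_alg] divides by a leading coefficient. *)
Lemma KbarV x : inKbar' x -> inKbar' x^-1.
Proof.
move=> [P [P0 [hP rx]]]; have [->|x0] := eqVneq x 0.
  by rewrite invr0; apply: inK_Kbar; exact: (sf0 inK_sf).
have s0 : (0 < size P)%N by rewrite size_poly_gt0.
exists (\poly_(i < size P) P`_((size P).-1 - i)); split.
  apply: contraNneq P0 => /(congr1 (fun Q : {poly C} => Q`_0)).
  by rewrite coef_poly s0 subn0 coef0 -lead_coef_eq0 /lead_coef => ->.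
split=> [k|]; first by rewrite coef_poly; case: ifP => // _; exact: (sf0 inK_sf).
rewrite /root horner_poly; apply/eqP; apply: (mulfI (expf_neq0 (size P).-1 x0)).
rewrite mulr0 mulr_sumr (reindex_inj rev_ord_inj) /=.
transitivity P.[x]; last exact/eqP; rewrite horner_coef.
apply: eq_bigr => i _; have iP : (i <= (size P).-1)%N by rewrite -ltnS prednK.
rewrite (_ : (size P).-1 - (size P - i.+1) = i)%N; last by move: iP s0; lia.
rewrite mulrCA; congr (_ * _).
rewrite (_ : (size P).-1 = i + (size P - i.+1))%N; last by move: iP s0; lia.
by rewrite exprD -mulrA -exprMn divff // expr1n mulr1.
Qed.

Lemma fg_exists (s : seq C) : (forall x, x \in s -> inKbar' x) ->
  exists (I : finType) (b : I -> C), fgalg b /\ forall x, x \in s -> spanK b x.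
Proof.
elim: s => [|x s IH] h.
  exists unit, (fun=> 1); split=> //; split; last first.
    by move=> _ _; rewrite mul1r; exact: (spanK_gen (fun=> 1 : C) tt).
  exact: (spanK_gen (fun=> 1 : C) tt).
have [|I [b [hb hs]]] := IH; first by move=> y ys; apply: h; rewrite inE ys orbT.
have [P [mP cP rx]] := Kbar_monic (h x (mem_head _ _)).
have [I' [b' [hb' sub xb]]] := fg_adjoin hb mP (fun k => fgK hb (cP k)) rx.
by exists I', b'; split=> // y; rewrite inE => /orP[/eqP -> //|/hs /sub].
Qed.
(** The coefficients of the equation of e are adjoined first, together with the inverse of the
    leading one, so that the equation becomes monic over the algebra. *)
Lemma fg_exists_alg (s : seq C) e : (forall x, x \in s -> inKbar' x) -> algebraic_over inKbar' e ->
  exists (I : finType) (b : I -> C), [/\ fgalg b, forall x, x \in s -> spanK b x & spanK b e].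
Proof.
move=> hs [P [P0 [cP re]]]; have lP : lead_coef P != 0 by rewrite lead_coef_eq0.
have [x|I [b [hb h]]] := @fg_exists ((lead_coef P)^-1 :: (P ++ s)).
  rewrite inE mem_cat => /orP[/eqP -> |/orP[|/hs//]]; first exact: KbarV (cP _).
  by move=> /(nthP 0) [k _ <-].
have hPk k : spanK b P`_k.
  have [kP|kP] := ltnP k (size P); last by rewrite nth_default //; exact: spanK0.
  by apply: h; rewrite inE mem_cat mem_nth ?orbT.
have [|k||I' [b' [hb' sub eb]]] := @fg_adjoin _ b e ((lead_coef P)^-1 *: P) hb.
- by rewrite monicE lead_coefZ mulVf.
- by rewrite coefZ; apply: fg_mul => //; apply: h; rewrite mem_head.
- by rewrite rootZ // invr_eq0.
by exists I', b'; split=> // x xs; apply: sub; apply: h; rewrite inE mem_cat xs !orbT.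
Qed.

(** * Analytic functions on a disc *)
Definition anB (rho B : R) (f : C -> C) :=
  exists c, gle rho B c /\ forall x, nrm x < rho -> sums c x (f x).
Definition analytic rho f := exists B, anB rho B f.
Lemma anB_ext rho B f g : (forall x, nrm x < rho -> f x = g x) -> anB rho B f -> anB rho B g.
Proof. by move=> h [c [gc hc]]; exists c; split=> // x xr; rewrite -h //; apply: hc. Qed.
Lemma anB_w rho B B' f : B <= B' -> anB rho B f -> anB rho B' f.
Proof. by move=> h [c [gc hc]]; exists c; split=> //; apply: gle_w gc. Qed.
Lemma anB_poly rho B (P : {poly C}) : gle rho B (fun i => P`_i) -> anB rho B (fun x => P.[x]).
Proof.
move=> h; exists (fun i => P`_i); split=> // x _.
apply: (@cvg_ext (fun=> P.[x]) _ _ (size P)); last exact: cvg_cst.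
by move=> m hm; rewrite (horner_coef_wide x hm).
Qed.
Lemma anBD rho B f g : anB rho B f -> anB rho B g -> anB rho B (fun x => f x + g x).
Proof.
move=> [c [gc hc]] [d [gd hd]]; exists (fun i => c i + d i); split; first exact: gleD.
by move=> x xr; apply: sumsD; [apply: hc | apply: hd].
Qed.
Lemma anBM rho B B' f g : 0 < rho -> anB rho B f -> anB rho B' g -> anB rho (B * B') (fun x => f x * g x).
Proof.
move=> r0 [c [gc hc]] [d [gd hd]]; eexists; split; first exact: (gleM r0 gc gd).
by move=> x xr; apply: (sumsM r0 gc gd xr); [apply: hc | apply: hd].
Qed.
Lemma anB0 rho B : 0 <= B -> anB rho B (fun=> 0).
Proof.
move=> B0; exists (fun=> 0); split=> [i|x _]; first by rewrite nrm0 mul0r.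
by apply: (@cvg_ext (fun=> 0) _ _ 0 _ (cvg_cst 0)) => m _; rewrite big1 // => i _; rewrite mul0r.
Qed.
Lemma anB_sum rho B (I : Type) (s : seq I) (P : pred I) (F : I -> C -> C) : 0 <= B ->
  (forall i, P i -> anB rho B (F i)) -> anB rho B (fun x => \sum_(i <- s | P i) F i x).
Proof.
move=> B0 h; elim: s => [|i s IH].
  by apply: anB_ext (anB0 rho B0) => x _; rewrite big_nil.
have [Pi|Pi] := boolP (P i); last by apply: anB_ext IH => x _; rewrite big_cons (negPf Pi).
by apply: anB_ext (anBD (h i Pi) IH) => x _; rewrite big_cons Pi.
Qed.
Lemma an_ext rho f g : (forall x, nrm x < rho -> f x = g x) -> analytic rho f -> analytic rho g.
Proof. by move=> h [B hB]; exists B; apply: anB_ext hB. Qed.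
Lemma an_poly rho (P : {poly C}) : 0 < rho -> analytic rho (fun x => P.[x]).
Proof. by move=> r0; have [B _ hB] := gle_poly P r0; exists B; apply: anB_poly. Qed.
Lemma an_cst rho a : 0 < rho -> analytic rho (fun=> a).
Proof. by move=> r0; apply: an_ext (an_poly a%:P r0) => x _; rewrite hornerC. Qed.
Lemma anB_ge0 rho B f : anB rho B f -> 0 <= B. Proof. by move=> [c [/gle_ge0]]. Qed.
Lemma anD rho f g : analytic rho f -> analytic rho g -> analytic rho (fun x => f x + g x).
Proof.
move=> [B hB] [B' hB']; exists (B + B'); apply: anBD.
  by apply: anB_w hB; rewrite lerDl (anB_ge0 hB').
by apply: anB_w hB'; rewrite lerDr (anB_ge0 hB).
Qed.
Lemma anM rho f g : 0 < rho -> analytic rho f -> analytic rho g -> analytic rho (fun x => f x * g x).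
Proof. by move=> r0 [B hB] [B' hB']; exists (B * B'); apply: anBM. Qed.
Lemma an_sum rho (I : Type) (s : seq I) (P : pred I) (F : I -> C -> C) : 0 < rho ->
  (forall i, P i -> analytic rho (F i)) -> analytic rho (fun x => \sum_(i <- s | P i) F i x).
Proof.
move=> r0 h; elim: s => [|i s IH].
  by apply: an_ext (an_cst 0 r0) => x _; rewrite big_nil.
have [Pi|Pi] := boolP (P i); last by apply: an_ext IH => x _; rewrite big_cons (negPf Pi).
by apply: an_ext (anD (h i Pi) IH) => x _; rewrite big_cons Pi.
Qed.
Lemma an_prod rho (I : Type) (s : seq I) (P : pred I) (F : I -> C -> C) : 0 < rho ->
  (forall i, P i -> analytic rho (F i)) -> analytic rho (fun x => \prod_(i <- s | P i) F i x).
Proof.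
move=> r0 h; elim: s => [|i s IH].
  by apply: an_ext (an_cst 1 r0) => x _; rewrite big_nil.
have [Pi|Pi] := boolP (P i); last by apply: an_ext IH => x _; rewrite big_cons (negPf Pi).
by apply: an_ext (anM r0 (h i Pi) IH) => x _; rewrite big_cons Pi.
Qed.
(** Power series are Lipschitz on the disc. This recovers an identity at a point that was lost to a
    division. *)
Lemma an_cont rho f y : 0 < rho -> analytic rho f -> nrm y < rho ->
  (forall x, x != y -> nrm x < rho -> f x = 0) -> f y = 0.
Proof.
move=> r0 [B [c [gc hc]]] yr h; apply/eqP; apply: contraT; rewrite -nrm_gt0 => fy0.
have B0 := gle_ge0 gc; have B1 : 0 < B / rho + 1 by rewrite ltr_wpDl // divr_ge0 // ltW.
have e0 : 0 < Num.min rho (nrm (f y) / (B / rho + 1)) by rewrite lt_min r0 divr_gt0.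
have [z z0] := small_elt e0; rewrite lt_min => /andP[zr zf].
have xr : nrm (y + z) < rho by apply: nrmD_lt.
have xy : y + z != y by rewrite -subr_eq0 addrC addKr.
have := sums_lip r0 gc yr xr (hc _ yr) (hc _ xr); rewrite (h _ xy xr) subr0 opprD addrA subrr sub0r nrmN.
rewrite leNgt => /negP[]; move: zf; rewrite ltr_pdivlMr //; apply: le_lt_trans.
by rewrite mulrC ler_wpM2l ?nrm_ge0 // lerDl.
Qed.

(** * Frobenius twists of polynomials and their heights *)

Definition tw k (P : {poly C}) : {poly C} := map_poly (fun x => x ^+ (q ^ k)) P.
Lemma coef_tw k P i : (tw k P)`_i = P`_i ^+ (q ^ k).
Proof. by rewrite coef_map_id0 // fr0. Qed.
Lemma tw_horner k P x : (tw k P).[x ^+ (q ^ k)] = P.[x] ^+ (q ^ k).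
Proof.
rewrite (horner_coef_wide _ (size_poly _ _)) horner_coef fr_sum; apply: eq_bigr => i _.
by rewrite coef_tw exprMn exprAC.
Qed.
Lemma size_tw k P : (size (tw k P) <= size P)%N. Proof. exact: size_poly. Qed.
Lemma twM k P Q : tw k (P * Q) = tw k P * tw k Q.
Proof.
apply/polyP => i; rewrite coef_tw !coefM fr_sum; apply: eq_bigr => j _.
by rewrite !coef_tw exprMn.
Qed.
Lemma tw0 k : tw k 0 = 0.
Proof. by apply/polyP => i; rewrite coef_tw !coef0 fr0. Qed.
Lemma tw_id P : tw 0 P = P.
Proof. by apply/polyP => i; rewrite coef_tw expn0 expr1. Qed.
Lemma tw_inj k P : tw k P = 0 -> P = 0.
Proof.
move=> h; apply/polyP => i; apply: (@fr_inj k); by rewrite -coef_tw h !coef0 fr0.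
Qed.

Lemma nrm_root_lt rho (x : C) k : 1 < rho -> nrm (x ^+ (q ^ k.+1)) < rho -> nrm (x ^+ (q ^ k)) < rho.
Proof.
move=> r1 h; have [h1|h1] := ltP (nrm (x ^+ (q ^ k))) 1; first exact: lt_trans h1 r1.
by apply: le_lt_trans h; rewrite frS [leRHS]nrmX ler_eXnr // q_gt0.
Qed.
Lemma frt_lt rho y k : 1 < rho -> nrm y < rho -> nrm (frt k y) < rho.
Proof.
move=> r1; rewrite -{1}(frtK k y); elim: k (frt k y) => [|k IH] x; first by rewrite expn0 expr1.
by move=> h; apply: IH; exact: nrm_root_lt.
Qed.

Lemma fin_bound (I : finType) (P : I -> nat -> Prop) :
  (forall i b b', (b <= b')%N -> P i b -> P i b') -> (forall i, exists b, P i b) -> exists b, forall i, P i b.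
Proof.
move=> mono h; suff [b hb] : exists b, forall i, i \in enum I -> P i b.
  by exists b => i; apply: hb; rewrite mem_enum.
elim: (enum I) => [|i s [b hb]]; first by exists 0%N.
have [b' hb'] := h i; exists (maxn b b') => j; rewrite inE => /orP[/eqP ->|/hb].
  by apply: mono hb'; exact: leq_maxr.
by apply: mono; exact: leq_maxl.
Qed.
Lemma fin_boundR (I : finType) (f : I -> R) : exists b, 0 < b /\ forall i, f i <= b.
Proof.
suff [b [b0 hb]] : exists b, 0 < b /\ forall i, i \in enum I -> f i <= b.
  by exists b; split=> // i; apply: hb; rewrite mem_enum.
elim: (enum I) => [|i s [b [b0 hb]]]; first by exists 1.
exists (Num.max b (f i)); split; first by rewrite lt_max b0.
move=> j; rewrite inE le_max => /orP[/eqP ->|/hb -> //]; by rewrite lexx orbT.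
Qed.
Lemma exp_le_root (x a : R) Q : (0 < Q)%N -> 0 <= x -> 0 <= a -> x ^+ Q <= a ^+ Q -> x <= a.
Proof. by move=> Q0 x0 a0; rewrite ler_pXn2r. Qed.

(** One number bounds both the degree in the variable and the degrees in theta of the coefficients,
    so products and twists act on a single bound. *)
Definition PH B (P : {poly C}) := (size P <= B)%N /\ forall i, Aht B P`_i.
Lemma PH_w B B' P : (B <= B')%N -> PH B P -> PH B' P.
Proof. by move=> h [h1 h2]; split=> [|i]; [apply: leq_trans h | apply: Aht_w (h2 i)]. Qed.
Lemma PH0 B : PH B 0. Proof. by split=> [|i]; rewrite ?size_poly0 ?coef0 //; exact: Aht0. Qed.
Lemma PH1 B : (0 < B)%N -> PH B 1.
Proof.
by move=> h; split=> [|i]; rewrite ?size_poly1 // coef1; case: eqP => _; [exact: Aht1 | exact: Aht0].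
Qed.
Lemma PHD B P Q : PH B P -> PH B Q -> PH B (P + Q).
Proof.
move=> [h1 h2] [h3 h4]; split=> [|i]; last by rewrite coefD; apply: AhtD.
by apply: leq_trans (size_polyD _ _) _; rewrite geq_max h1.
Qed.
Lemma PH_sum B (I : Type) (s : seq I) (D : pred I) (F : I -> {poly C}) :
  (forall i, D i -> PH B (F i)) -> PH B (\sum_(i <- s | D i) F i).
Proof. by move=> h; elim/big_ind: _ => //; [exact: PH0 | exact: PHD]. Qed.
Lemma PHM B B' P Q : PH B P -> PH B' Q -> PH (B + B') (P * Q).
Proof.
move=> [h1 h2] [h3 h4]; split=> [|i].
  apply: leq_trans (size_polyMleq _ _) _; apply: leq_trans (leq_pred _) _; exact: leq_add.
by rewrite coefM; apply: Aht_sum => j _; apply: AhtM.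
Qed.
Lemma PH_tw B P : PH B P -> PH (B * q) (tw 1 P).
Proof.
move=> [h1 h2]; split=> [|i]; last by rewrite coef_tw expn1; apply: AhtX (q_gt0) (h2 i).
by apply: leq_trans (size_tw _ _) _; apply: leq_trans h1 _; rewrite leq_pmulr ?q_gt0.
Qed.
Lemma PH_val B P : PH B P -> Aht (B + B) P.[theta].
Proof.
move=> [h1 h2]; rewrite horner_coef; apply: Aht_sum => i _; apply: AhtM => //.
by apply: Aht_theta; apply: leq_trans h1; exact: ltn_ord.
Qed.
Lemma PH_ex (P : {poly C}) : (forall i, inA' P`_i) -> exists B, PH B P.
Proof.
move=> h; have [b hb] := @fin_bound 'I_(size P) (fun i b => Aht b P`_i)
  (fun i b b' => @Aht_w b b' _) (fun i => proj1 (inAP _) (h i)).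
exists (maxn (size P) b); split=> [|i]; first exact: leq_maxl.
have [iP|iP] := ltnP i (size P); last by rewrite nth_default //; exact: Aht0.
by apply: Aht_w (hb (Ordinal iP)); exact: leq_maxr.
Qed.

(** * A transcendence criterion for Frobenius systems *)
Section Abp.
Variables (rho : R) (I : finType) (chi : I -> C -> C) (T : I -> I -> {poly C}) (dl : {poly C}).
Hypothesis rho_gt : q%:R < rho.
Hypothesis chi_an : forall k, analytic rho (chi k).
Hypothesis TA : forall k l i, inA' (T k l)`_i.
Hypothesis chi_eq : forall k x, nrm (x ^+ q) < rho ->
  dl.[x ^+ q] * chi k x ^+ q = \sum_l (T k l).[x ^+ q] * chi l (x ^+ q).

Let rho1 : 1 < rho. Proof. exact: lt_trans qR_gt1 rho_gt. Qed.
Let rho0 : 0 < rho. Proof. exact: lt_trans ltr01 rho1. Qed.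

Fixpoint Tn nu k l : {poly C} :=
  if nu is nu'.+1 then \sum_m tw 1 (Tn nu' k m) * T m l else (k == l)%:R.
Fixpoint dn nu : {poly C} := if nu is nu'.+1 then tw 1 (dn nu') * dl else 1.

Lemma twist_iter nu k x : nrm (x ^+ (q ^ nu)) < rho ->
  (dn nu).[x ^+ (q ^ nu)] * chi k x ^+ (q ^ nu) = \sum_l (Tn nu k l).[x ^+ (q ^ nu)] * chi l (x ^+ (q ^ nu)).
Proof.
elim: nu x => [|nu IH] x xr.
  rewrite /= expn0 !expr1 hornerC mul1r (bigD1 k) //= eqxx hornerC mul1r big1 ?addr0 // => l.
  by rewrite eq_sym => /negPf ->; rewrite hornerC mul0r.
set y := x ^+ (q ^ nu); have yE : x ^+ (q ^ nu.+1) = y ^+ q by rewrite frS.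
rewrite !frS -/y /= hornerM -[y ^+ q]/(y ^+ (q ^ 1)) tw_horner.
rewrite mulrAC -exprMn IH; last exact: nrm_root_lt.
rewrite -/y fr_sum mulr_suml.
have step l : ((Tn nu k l).[y] * chi l y) ^+ (q ^ 1) * dl.[y ^+ (q ^ 1)] =
    \sum_m (tw 1 (Tn nu k l)).[y ^+ (q ^ 1)] * (T l m).[y ^+ (q ^ 1)] * chi m (y ^+ (q ^ 1)).
  rewrite tw_horner expn1 exprMn -mulrA [_ * dl.[_]]mulrC chi_eq -?yE // mulr_sumr.
  by apply: eq_bigr => m _; rewrite mulrA.
rewrite (eq_bigr _ (fun l _ => step l)).
rewrite exchange_big /=; apply: eq_bigr => m _; rewrite horner_sum mulr_suml; apply: eq_bigr => l _.
by rewrite hornerM.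
Qed.

Lemma T_bound : exists B, forall k l, PH B (T k l).
Proof.
have [b hb] := @fin_bound (I * I)%type (fun kl b => PH b (T kl.1 kl.2))
  (fun i b b' => @PH_w b b' _) (fun i => PH_ex (TA i.1 i.2)).
by exists b => k l; apply: (hb (k, l)).
Qed.
Lemma Tn_bound : exists beta, forall nu k l, PH (beta * q ^ nu) (Tn nu k l).
Proof.
have [B hB] := T_bound; exists B.+1 => nu k l.
(* Adding B makes the bound stable under the recursion: (b q + B) + B <= (b + B) q because q >=
   2. *)
suff [b [hb hP]] : exists b, (b + B <= B.+1 * q ^ nu)%N /\ forall k l, PH b (Tn nu k l).
  by apply: PH_w (hP k l); apply: leq_trans hb; exact: leq_addr.
elim: nu => [|nu [b [hb hP]]] /=.
  exists 1%N; rewrite expn0 muln1 add1n; split=> // k' l'.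
  by case: (k' == l'); [exact: PH1 | exact: PH0].
exists (b * q + B)%N; split; last first.
  move=> k' l'; apply: PH_sum => m _; apply: PHM => //; exact: PH_tw.
rewrite expnSr mulnA; apply: leq_trans (leq_mul hb (leqnn q)).
rewrite mulnDl -addnA leq_add2l; have := q_gt1; nia.
Qed.

Lemma dn_horner nu : (forall i, (tw i dl).[theta] != 0) -> (dn nu).[theta] != 0.
Proof.
move=> h; suff : forall i, (tw i (dn nu)).[theta] != 0 by move/(_ 0%N); rewrite tw_id.
elim: nu => [|nu IH] i /=.
  have -> : tw i 1 = 1 by apply/polyP => j; rewrite coef_tw coef1; case: eqP => _; rewrite ?expr1n ?fr0.
  by rewrite hornerC oner_neq0.
rewrite twM hornerM mulf_neq0 //.
have -> // : tw i (tw 1 (dn nu)) = tw i.+1 (dn nu).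
by apply/polyP => j; rewrite !coef_tw frA add1n.
Qed.
Lemma dn_0 nu : dl`_0 != 0 -> (dn nu)`_0 != 0.
Proof.
move=> h; elim: nu => [|nu IH] /=; first by rewrite coef1 oner_neq0.
by rewrite coef0M mulf_neq0 // coef_tw expf_neq0.
Qed.

Lemma Tn_bound' L : exists cT, (0 < cT)%N /\ forall j k l, (j <= L)%N -> PH cT (Tn j k l).
Proof.
have [beta h] := Tn_bound; exists (beta * q ^ L).+1; split=> // j k l jL.
by apply: PH_w (h j k l); apply: leqW; rewrite leq_mul // leq_pexp2l // q_gt0.
Qed.

Variables (J J' : {set I}) (S : I -> I -> C) (sg : C) (m0 : nat).
Hypothesis dl_th : forall i, (tw i dl).[theta] != 0.
Hypothesis dl_0 : dl`_0 != 0.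
Hypothesis SA : forall l j, inA' (S l j ^+ (q ^ m0)).
Hypothesis sg0 : sg != 0.
Hypothesis S_eq : forall l, sg * chi l theta = \sum_(j in J') S l j * chi j theta.
Hypothesis cardJ : (#|J'| < #|J|)%N.
Hypothesis indep : forall h : I -> {poly C}, (forall k i, inKp (h k)`_i) ->
  (forall x, nrm x < rho -> \sum_(k in J) (h k).[x] * chi k x = 0) -> forall k, k \in J -> h k = 0.

Let d := #|J'|.
(** There are N = [NN N1] zeros to impose and degree bound D = [DD N1]. The (d+1) D unknowns
    outnumber the d N equations by (d+1) N1, and the zeros outnumber the degree by N - D = N1.
    Raising to the power [QQ N1] brings the equations at all N points into A. *)
Let NN N1 := (2 * d.+1 * N1)%N.
Let DD N1 := (d.*2.+1 * N1)%N.
Let QQ N1 := (q ^ (2 * NN N1 + m0))%N.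

Lemma theta_lt : nrm theta < rho. Proof. by rewrite nrm_theta. Qed.

(* Auxiliary coefficients: the numbers [h^Q] lie in A, and the combination
   vanishes at the q^nu-th roots of theta for N <= nu < 2N. *)
Lemma aux_fun : exists kap, (0 < kap)%N /\ forall N1, (0 < N1)%N -> exists h : I -> {poly C},
  [/\ forall k, k \notin J -> h k = 0, exists k, h k != 0,
      forall k, (size (h k) <= DD N1)%N, forall k i, Aht (kap * QQ N1) ((h k)`_i ^+ QQ N1)
    & forall nu, (NN N1 <= nu < 2 * NN N1)%N -> \sum_(k in J) (h k).[frt nu theta] * chi k (frt nu theta) = 0].
Proof.
have [beta hbeta] := Tn_bound.
have [B1 hB1] : exists B1, forall lj : I * I, Aht B1 (S lj.1 lj.2 ^+ (q ^ m0)).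
  by apply: fin_bound => [i b b'|i]; [exact: Aht_w | apply/inAP; exact: SA].
(* Height of the matrix entries in units of Q: 1 for the power of theta, 2 beta for the value of
   [Tn], B1 for S. *)
pose kB := (1 + 2 * beta + B1)%N.
exists (2 * d * kB).+1; split=> // N1 N10.
set N := NN N1; set D := DD N1; set Q := QQ N1.
have Q0 : (0 < Q)%N by exact: qk_gt0.
have DN : (D <= N)%N by rewrite /D /N /DD /NN leq_mul2r; apply/orP; right; lia.
have NqN : (N < q ^ N)%N by rewrite ltn_expl // q_gt1.
pose a (nu : nat) := (2 * N + m0 - nu)%N.
have aQ nu : (N <= nu < 2 * N)%N -> (q ^ nu * q ^ a nu = Q)%N.
  by move=> /andP[h1 h2]; rewrite -expnD /a; congr (q ^ _)%N; lia.
pose E1 := ('I_N * {j : I | j \in J'})%type.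
pose U1 := ({k : I | k \in J} * 'I_D)%type.
pose W nu k j := \sum_l (Tn nu k l).[theta] * S l j.
(* The condition at the q^nu-th root of theta is raised to the power q^nu, which moves the functions
   to theta, where S reduces them to those in J'. A further power q^(a nu) turns the unknowns into
   the numbers h^Q and puts the entries in A. *)
pose M (e : E1) (u : U1) := let nu := (N + e.1)%N in
  theta ^+ (u.2 * q ^ a nu) * W nu (val u.1) (val e.2) ^+ (q ^ a nu).
have MA e u : Aht (kB * Q) (M e u).
  case: e u => [nu0 [j jJ]] [[k kJ] i]; rewrite /M /=; set nu := (N + nu0)%N.
  have hnu : (N <= nu < 2 * N)%N by rewrite leq_addr mul2n -addnn ltn_add2l ltn_ord.
  have hQ := aQ _ hnu.
  rewrite /kB -addnA mulnDl mul1n; apply: AhtM.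
    apply: Aht_theta; apply: (@leq_trans (q ^ N * q ^ a nu)%N); last first.
      by rewrite -hQ leq_mul2r leq_pexp2l ?q_gt0 ?orbT //; case/andP: hnu.
    rewrite ltn_pmul2r ?qk_gt0 //; apply: ltn_trans NqN; apply: leq_trans DN; exact: ltn_ord.
  rewrite /W fr_sum; apply: Aht_sum => l _; rewrite exprMn mulnDl; apply: AhtM.
    apply: (@Aht_w ((beta * q ^ nu + beta * q ^ nu) * q ^ a nu)).
      by rewrite addnn -mul2n -!mulnA hQ.
    by apply: Aht_frX; apply: PH_val; exact: hbeta.
  have am : (m0 <= a nu)%N by rewrite /a; case/andP: hnu => _; lia.
  rewrite -(subnKC am) -frA; apply: (@Aht_w (B1 * q ^ (a nu - m0))).
    rewrite leq_mul2l; apply/orP; right; rewrite leq_pexp2l ?q_gt0 // /a; lia.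
  by apply: Aht_frX; exact: (hB1 (l, j)).
(* With H = (2 d kB + 1) Q the counting condition reduces to 2 d kB Q < H. *)
have [|X [XA [u0 Xu0] X0]] := @siegel E1 U1 M ((2 * d * kB).+1 * Q) (kB * Q) MA.
  rewrite /E1 /U1 !card_prod !card_ord !card_sig.
  rewrite (_ : #|(fun x => _)| = d); last by apply: eq_card.
  rewrite (_ : #|(fun x => _)| = #|J|); last by apply: eq_card.
  apply: (@leq_trans (d.+1 * D * ((2 * d * kB).+1 * Q))); last first.
    have cJ : (d < #|J|)%N := cardJ; by rewrite !leq_mul2r cJ !orbT.
  rewrite -mulnDl !mulnA ltn_pmul2r // /N /D /NN /DD -muln2.
  rewrite (_ : 2 * d.+1 * N1 * d * _ = (d.+1 * N1) * (2 * d * ((2 * d * kB).+1 + kB)))%N; last by ring.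
  rewrite (_ : d.+1 * (d * 2).+1 * N1 * _ = (d.+1 * N1) * ((d * 2).+1 * (2 * d * kB).+1))%N; last by ring.
  rewrite ltn_pmul2l ?muln_gt0 //; nia.
pose h k : {poly C} := if insub k is Some k' then
  \poly_(i < D) (if insub i is Some i' then frt (2 * N + m0) (X (k', i')) else 0) else 0.
have hE (k : {k | k \in J}) (i : 'I_D) : (h (val k))`_i ^+ Q = X (k, i).
  rewrite /h valK coef_poly ltn_ord insubT //= => hi; rewrite /Q /QQ -/N frtK.
  by congr (X (_, _)); apply: val_inj.
have hs k : (size (h k) <= D)%N.
  by rewrite /h; case: insub => [k'|]; rewrite ?size_poly // size_poly0.
exists h; split=> //.
- by move=> k kJ; rewrite /h insubF //; apply: negPf.
- exists (val u0.1); apply: contraNneq Xu0 => z.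
  by case: u0 z => k i /= z; rewrite -hE z coef0 /Q /QQ fr0.
- move=> k i; have [kJ|kJ] := boolP (k \in J); last first.
    by rewrite /h insubF ?(negPf kJ) // coef0 /Q /QQ fr0; exact: Aht0.
  have [iD|iD] := ltnP i D; last first.
    by rewrite nth_default ?(leq_trans (hs k)) // /Q /QQ fr0; exact: Aht0.
  by rewrite (hE (exist _ k kJ) (Ordinal iD)); exact: XA.
move=> nu hnu; have nu0P : (nu - N < N)%N by case/andP: hnu => h1; lia.
have nuE : (N + (nu - N) = nu)%N by case/andP: hnu => h1 _; rewrite subnKC.
apply: (@fr_inj nu); rewrite fr0 fr_sum.
under eq_bigr => k _ do rewrite exprMn -tw_horner frtK.
apply: (mulfI (mulf_neq0 sg0 (dn_horner nu dl_th))); rewrite mulr0 mulr_sumr.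
transitivity (\sum_(j in J') (\sum_(k in J) (tw nu (h k)).[theta] * W nu k j) * chi j theta).
  under [RHS]eq_bigr => j _ do rewrite mulr_suml.
  rewrite [RHS]exchange_big /=; apply: eq_bigr => k kJ.
  have := @twist_iter nu k (frt nu theta); rewrite frtK => /(_ theta_lt) e.
  set c := (tw nu (h k)).[theta].
  rewrite (_ : _ * _ = c * (sg * ((dn nu).[theta] * chi k (frt nu theta) ^+ (q ^ nu)))); last by ring.
  rewrite e !mulr_sumr.
  transitivity (\sum_l \sum_(j in J') c * ((Tn nu k l).[theta] * (S l j * chi j theta))).
    by apply: eq_bigr => l _; rewrite -!mulr_sumr -S_eq; ring.
  rewrite exchange_big /=; apply: eq_bigr => j _.
  by rewrite /W mulr_sumr mulr_suml; apply: eq_bigr => l _; ring.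
(* The coefficient of each chi_j(theta) with j in J' is 0 by the choice of X, after a q^(a nu)-th
   root. *)
apply: big1 => j jJ; rewrite (_ : \sum_(k in J) _ = 0) ?mul0r //.
apply: (@fr_inj (a nu)); rewrite fr0 fr_sum.
have := X0 (Ordinal nu0P, exist _ j jJ); rewrite /M /= nuE => X0'.
transitivity (\sum_(k : {k | k \in J}) \sum_(i < D) theta ^+ (i * q ^ a nu) * W nu (val k) j ^+ (q ^ a nu) * X (k, i)); last first.
  by rewrite -[RHS]X0' pair_big /=; apply: eq_bigr => -[].
rewrite (big_sub J) /=.
apply: eq_bigr => k _; rewrite exprMn (horner_coef_wide _ (leq_trans (size_tw _ _) (hs (val k)))).
rewrite fr_sum mulr_suml; apply: eq_bigr => i _.
by rewrite exprMn coef_tw frA -exprM -hE expnD aQ //; ring.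
Qed.

Lemma chi_bound : exists B, 0 < B /\ forall k, anB rho B (chi k).
Proof.
suff [B [B0 h]] : exists B, 0 < B /\ forall k, k \in enum I -> anB rho B (chi k).
  by exists B; split=> // k; apply: h; rewrite mem_enum.
elim: (enum I) => [|k s [B [B0 h]]]; first by exists 1.
have [B' hB'] := chi_an k; exists (Num.max B B'); split; first by rewrite lt_max B0.
move=> j; rewrite inE => /orP[/eqP ->|/h hj]; [apply: anB_w hB'|apply: anB_w hj];
  by rewrite le_max lexx ?orbT.
Qed.

Lemma rt_theta_nrm N nu : (N <= nu)%N -> 1 <= nrm (frt nu theta) /\ nrm (frt nu theta) <= nrm (frt N theta).
Proof.
have h1 m : 1 <= nrm (frt m theta).
  apply: (@exp_le_root _ _ (q ^ m)) => //; rewrite ?qk_gt0 ?nrm_ge0 //.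
  by rewrite expr1n -nrmX frtK nrm_theta qR_ge1.
move=> Nn; split=> //; apply: (@exp_le_root _ _ (q ^ N)); rewrite ?qk_gt0 ?nrm_ge0 //.
rewrite -[leRHS]nrmX frtK -{2}(frtK nu theta) nrmX ler_weXn2l // leq_exp2l //; exact: q_gt1.
Qed.
(** The norm is q^(N / q^N): the zeros lie so close to the unit circle that N of them together cost
    only a bounded factor. *)
Lemma rt_theta_pow N : nrm (frt N theta) ^+ N <= q%:R.
Proof.
have [h1 _] := rt_theta_nrm (leqnn N).
apply: (@le_trans _ _ (nrm (frt N theta) ^+ (q ^ N))); last by rewrite -nrmX frtK nrm_theta.
by rewrite ler_weXn2l // ltnW // ltn_expl // q_gt1.
Qed.
Lemma rt_theta_inj nu mu : frt nu theta = frt mu theta -> nu = mu.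
Proof.
wlog : nu mu / (nu < mu)%N => [hw e|h e].
  by case: (ltngtP nu mu) => // h; [exact: hw | apply/esym; exact: hw].
have := frtK mu theta; rewrite -e -(subnKC (ltnW h)) -frA frtK => /(congr1 nrm) /eqP.
rewrite nrmX nrm_theta -[X in _ == X]expr1 => /eqP /(ieexprIn qR_gt0 _) e2.
have e1 : (q ^ (mu - nu) = 1)%N by apply: e2; rewrite gt_eqF // qR_gt1.
have := ltn_expl (mu - nu) q_gt1; rewrite e1; move: h; lia.
Qed.

(** The Schwarz bound is a constant times rho^D (|theta^(1/q^N)| / rho)^N, and N - D = N1 leaves
    rho^(-N1). Independence of the functions keeps the auxiliary function from being zero. *)
Lemma aux_small : exists kap C1, [/\ (0 < kap)%N, 0 < C1 & forall N1, (0 < N1)%N ->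
  exists (h : I -> {poly C}) (e : nat -> C) (B : R),
  [/\ (forall k, (size (h k) <= DD N1)%N) /\ (forall k i, Aht (kap * QQ N1) ((h k)`_i ^+ QQ N1)),
      gle rho B e, forall x, nrm x < rho -> sums e x (\sum_(k in J) (h k).[x] * chi k x),
      exists i, e i != 0 & forall i, nrm (e i) <= C1 / rho ^+ N1]].
Proof.
have [kap [kap0 hk]] := aux_fun; have [Bc [Bc0 hBc]] := chi_bound.
pose Ch : R := q%:R ^+ kap; have Ch0 : 0 < Ch by exact: qX_gt0.
exists kap, (Ch * Bc * q%:R); split=> //; first by rewrite !mulr_gt0 // qR_gt0.
move=> N1 N10; have [h [hJ [k0 hk0] hs hA h0]] := hk _ N10.
pose E x := \sum_(k in J) (h k).[x] * chi k x.
have Q0 : (0 < QQ N1)%N by exact: qk_gt0.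
have hn k i : nrm ((h k)`_i) <= Ch.
  apply: (@exp_le_root _ _ (QQ N1)) => //; [exact: nrm_ge0 | exact: ltW |].
  by rewrite -nrmX /Ch -exprM; exact: Aht_le.
have hg k : gle rho (Ch * rho ^+ DD N1) (fun i => (h k)`_i).
  move=> i; have [iD|iD] := ltnP i (DD N1); last first.
    by rewrite nth_default ?(leq_trans (hs k)) // nrm0 mul0r mulr_ge0 ?exprn_ge0 // ltW.
  apply: ler_pM; rewrite ?nrm_ge0 ?exprn_ge0 ?(ltW rho0) // ler_weXn2l ?(ltW rho1) //.
  exact: ltnW.
have BE0 : 0 <= Ch * rho ^+ DD N1 * Bc by rewrite !mulr_ge0 ?exprn_ge0 // ltW.
have [e [ge he]] : anB rho (Ch * rho ^+ DD N1 * Bc) E.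
  by apply: anB_sum => // k _; apply: anBM => //; exact: anB_poly.
exists h, e, (Ch * rho ^+ DD N1 * Bc); split=> //.
  apply: contrapT => hn0; have e0 i : e i = 0.
    by apply/eqP; apply: contrapT => h1; apply: hn0; exists i; apply/negP.
  have hz : forall k, k \in J -> h k = 0.
    apply: indep => [k i|x xr].
      exists (2 * NN N1 + m0)%N; apply: inA_K; apply/inAP; eexists; exact: hA.
    apply: cvg_uniq (he x xr) _; apply: (@cvg_ext (fun=> 0) _ _ 0 _ (cvg_cst 0)) => m _.
    by rewrite big1 // => i _; rewrite e0 mul0r.
  move/eqP: hk0; apply; have [kJ|kJ] := boolP (k0 \in J); [exact: hz | exact: hJ].
pose ys := [seq frt nu theta | nu <- iota (NN N1) (NN N1)].
have [r1 _] := rt_theta_nrm (leqnn (NN N1)).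
have rr : nrm (frt (NN N1) theta) < rho by apply: frt_lt => //; exact: theta_lt.
move=> i; apply: (le_trans (@schwarz _ _ _ e ys (ltW rho1) r1 rr ge _ _ i)).
- by rewrite map_inj_uniq ?iota_uniq // => nu mu; exact: rt_theta_inj.
- move=> y /mapP [nu]; rewrite mem_iota addnn -mul2n => hnu ->; split.
    by case: (rt_theta_nrm (proj1 (andP hnu))).
  rewrite -(h0 nu hnu); apply: he; apply: frt_lt => //; exact: theta_lt.
rewrite size_map size_iota expr_div_n.
have -> : rho ^+ NN N1 = rho ^+ DD N1 * rho ^+ N1.
  by rewrite -exprD; congr (_ ^+ _); rewrite /NN /DD -muln2; ring.
rewrite invfM (_ : _ * _ = Ch * Bc * (nrm (frt (NN N1) theta) ^+ NN N1) / rho ^+ N1); last first.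
  by field; rewrite !expf_neq0 // gt_eqF.
rewrite ler_wpM2r ?invr_ge0 ?exprn_ge0 ?(ltW rho0) // ler_wpM2l ?rt_theta_pow //.
by rewrite mulr_ge0 // ltW.
Qed.

Let L := #|I|.
Lemma I_gt0 : (0 < L)%N.
Proof. by apply: leq_trans (max_card (mem J)); apply: leq_ltn_trans cardJ. Qed.

(* The L + 1 twists of the auxiliary function live in the span of L functions,
   hence satisfy a linear relation of controlled height. *)
Lemma twist_rel kap : exists kap', forall N1 (h : I -> {poly C}), (0 < N1)%N ->
  (forall k, (size (h k) <= DD N1)%N) -> (forall k i, Aht (kap * QQ N1) ((h k)`_i ^+ QQ N1)) ->
  exists a : 'I_L.+1 -> {poly C}, [/\ exists j, a j != 0, forall j i, Aht (kap' * QQ N1) ((a j)`_i ^+ QQ N1)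
    & forall l, \sum_j a j * (\sum_(k in J) tw j (h k) * Tn j k l) = 0].
Proof.
have [cT [cT0 hT]] := Tn_bound' L; have L0 := I_gt0.
pose k2 := (kap * q ^ L + cT)%N.
exists (L.*2.+1 * k2).+1 => N1 h N10 hs hA; set Q := QQ N1.
have Q0 : (0 < Q)%N by exact: qk_gt0.
pose u (j : 'I_L.+1) l := \sum_(k in J) tw j (h k) * Tn j k l.
(* P = 2 L D' gives 2 L (L+1) D' unknown coefficients against L (2 L + 1) D' equations. *)
pose D' := (DD N1 + cT)%N; pose P := (2 * L * D')%N.
have us j l : (size (u j l) <= D')%N.
  apply: (big_ind (fun P : {poly C} => (size P <= D')%N)); first by rewrite size_poly0.
    by move=> A B hA' hB'; apply: leq_trans (size_polyD _ _) _; rewrite geq_max hA'.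
  move=> k _; apply: leq_trans (size_polyMleq _ _) _; apply: leq_trans (leq_pred _) _.
  apply: leq_add; first exact: leq_trans (size_tw _ _) (hs k).
  by case: (hT j k l) => //; rewrite -ltnS.
have uA j l i : Aht (k2 * Q) ((u j l)`_i ^+ Q).
  have jL : (j <= L)%N by rewrite -ltnS.
  rewrite coef_sum /Q /QQ fr_sum; apply: Aht_sum => k _; rewrite coefM fr_sum; apply: Aht_sum => i' _.
  rewrite exprMn /k2 mulnDl coef_tw; apply: AhtM.
    rewrite exprAC -/(QQ N1) -/Q mulnAC; apply: (@Aht_w (kap * Q * q ^ j)).
      by rewrite leq_mul // leq_pexp2l // q_gt0.
    by apply: Aht_frX; exact: hA.
  by apply: Aht_frX; case: (hT j k l jL).
pose E2 := (I * 'I_(P + D'))%type; pose U2 := ('I_L.+1 * 'I_P)%type.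
pose M (e : E2) (x : U2) := ('X^(x.2) * u x.1 e.1)`_(e.2) ^+ Q.
have [||Y [YA [y0 Yy0] Y0]] := @siegel E2 U2 M ((L.*2.+1 * k2).+1 * Q) (k2 * Q).
- move=> e x; rewrite /M coefXnM; case: ifP => _; last exact: uA.
  by rewrite /Q /QQ fr0; exact: Aht0.
- have D0 : (0 < D')%N by rewrite /D' addn_gt0 cT0 orbT.
  rewrite /E2 /U2 !card_prod !card_ord -/L -mulnDl !mulnA ltn_pmul2r //.
  rewrite /P -muln2.
  rewrite (_ : L * (2 * L * D' + D') * _ = (L * D') * ((2 * L).+1 * (((L * 2).+1 * k2).+1 + k2)))%N; last by ring.
  rewrite (_ : L.+1 * 2 * L * D' * _ = (L * D') * (2 * L.+1 * ((L * 2).+1 * k2).+1))%N; last by ring.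
  rewrite ltn_pmul2l ?muln_gt0 ?L0 //; nia.
pose y (x : U2) := frt (2 * NN N1 + m0) (Y x).
have yE x : y x ^+ Q = Y x by rewrite /y /Q /QQ frtK.
pose a j : {poly C} := \sum_(i < P) y (j, i) *: 'X^i.
have aE j (i : 'I_P) : (a j)`_i = y (j, i).
  rewrite coef_sum (bigD1 i) //= coefZ coefXn eqxx mulr1 big1 ?addr0 // => k ki.
  by rewrite coefZ coefXn eq_sym (inj_eq val_inj) (negPf ki) mulr0.
exists a; split.
- exists y0.1; apply: contraNneq Yy0 => z; case: y0 z => j i /= z.
  by rewrite -yE -aE z coef0 /Q /QQ fr0.
- move=> j i; have [iP|iP] := ltnP i P.
    by have := aE j (Ordinal iP) => /= ->; rewrite yE; exact: YA.
  rewrite coef_sum big1 ?/Q ?/QQ ?fr0; first exact: Aht0.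
  move=> k _; rewrite coefZ coefXn gtn_eqF ?mulr0 //; exact: leq_trans (ltn_ord k) iP.
move=> l; apply/polyP => m; rewrite coef0.
have -> : (\sum_j a j * u j l)`_m = \sum_(x : U2) y x * ('X^(x.2) * u x.1 l)`_m.
  transitivity (\sum_j \sum_(i < P) y (j, i) * ('X^i * u j l)`_m); last first.
    by rewrite pair_big; apply: eq_bigr => -[].
  rewrite coef_sum; apply: eq_bigr => j _; rewrite /a mulr_suml coef_sum; apply: eq_bigr => i _.
  by rewrite -scalerAl coefZ.
have [mP|mP] := ltnP m (P + D'); last first.
  apply: big1 => -[j i] _ /=; rewrite coefXnM; case: ifP => _; first by rewrite mulr0.
  rewrite [(u j l)`_(m - i)]nth_default ?mulr0 // (leq_trans (us j l)) //.
  by move: mP (ltn_ord i); lia.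
apply: (@fr_inj (2 * NN N1 + m0)); rewrite fr0 fr_sum -[RHS](Y0 (l, Ordinal mP)).
by apply: eq_bigr => x _; rewrite exprMn -/(QQ N1) -/Q yE mulrC.
Qed.

(** The twist y -> E(y^(1/q^k))^(q^k) has the coefficients of E raised to the power q^k, in the same
    degrees; hence all twists vanish to the same order at 0. *)
Lemma fr_sums k e B x l : gle rho B e -> sums e x l ->
  gle 1 (B ^+ (q ^ k)) (fun i => e i ^+ (q ^ k)) /\ sums (fun i => e i ^+ (q ^ k)) (x ^+ (q ^ k)) (l ^+ (q ^ k)).
Proof.
move=> ge he; split.
  move=> i; rewrite expr1n mulr1 nrmX lerXn2r ?nnegrE ?nrm_ge0 ?(gle_ge0 ge) //.
  apply: le_trans (ge i); by rewrite ler_peMr ?nrm_ge0 // exprn_ege1 // ltW.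
apply: (@cvg_ext _ _ _ 0 _ (cvgX (q ^ k) he)) => m _.
by rewrite fr_sum; apply: eq_bigr => i _; rewrite exprMn exprAC.
Qed.

(** The functions in J are independent over polynomials, while all values at theta are spanned by
    the fewer values in J'; such a drop of rank is impossible. The contradiction is read off from
    the lowest coefficient of the relation between the twists of the auxiliary function. *)
Theorem abp : False.
Proof.
have [kap [C1 [kap0 C10 hsm]]] := aux_small; have [kap' hrel] := twist_rel kap.
have L0 := I_gt0.
have [Cd [Cd0 hCd]] := @fin_boundR 'I_L.+1 (fun j => nrm (dn j)`_0).
have [Ci [Ci0 hCi]] := @fin_boundR 'I_L.+1 (fun j => (nrm (dn j)`_0)^-1).
pose C4 : R := q%:R ^+ kap'; have C40 : 0 < C4 by exact: qX_gt0.
(* C4, Cd and Ci do not depend on N1, so N1 can be chosen to push all coefficients of the auxiliary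
   function below this bound. *)
pose bd := Num.min 1 (1 / (C4 * Cd * Ci)).
have bd0 : 0 < bd by rewrite /bd lt_min ltr01 divr_gt0 // !mulr_gt0.
have [N1' hN1] := expr_small (divr_gt0 bd0 C10) rho1.
pose N1 := N1'.+1; have N10 : (0 < N1)%N by [].
have hlam : C1 / rho ^+ N1 < bd.
  by have := hN1 N1 (leqnSn _); rewrite ltr_pdivlMr // mulrC.
have [h [e [B [[hs hA] ge he [i1 ei1] hsmall]]]] := hsm N1 N10.
have [a [[j1 aj1] aA arel]] := hrel N1 h N10 hs hA.
have [kp ekp kmin] := @ex_minnP (fun i => e i != 0) (ex_intro _ i1 ei1).
have [i0 [j2 aj2] imin] : exists2 i0, exists j, (a j)`_i0 != 0 & forall i j, (a j)`_i != 0 -> (i0 <= i)%N.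
  have hex : exists i, [exists j, (a j)`_i != 0].
    by exists (size (a j1)).-1; apply/existsP; exists j1; rewrite -/(lead_coef _) lead_coef_eq0.
  have [i0 /existsP [j hj] hmin] := ex_minnP hex; exists i0; first by exists j.
  by move=> i j' hj'; apply: hmin; apply/existsP; exists j'.
pose E x := \sum_(k in J) (h k).[x] * chi k x.
pose A j := a j * dn j.
have relE y : nrm y < rho -> \sum_(j < L.+1) (A j).[y] * E (frt j y) ^+ (q ^ j) = 0.
  move=> yr; transitivity (\sum_l (\sum_j a j * (\sum_(k in J) tw j (h k) * Tn j k l)).[y] * chi l y); last first.
    by apply: big1 => l _; rewrite arel horner0 mul0r.
  under [RHS]eq_bigr => l _ do rewrite horner_sum mulr_suml.
  rewrite [RHS]exchange_big /=; apply: eq_bigr => j _.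
  rewrite /A /E hornerM fr_sum -mulrA mulr_sumr.
  under [RHS]eq_bigr => l _ do rewrite hornerM -mulrA horner_sum mulr_suml.
  rewrite -[RHS]mulr_sumr; congr (_ * _); rewrite exchange_big /=; apply: eq_bigr => k _.
  rewrite exprMn -tw_horner frtK mulrCA.
  have := @twist_iter j k (frt j y); rewrite frtK => /(_ yr) ->; rewrite mulr_sumr.
  by apply: eq_bigr => l _; rewrite hornerM mulrA.
pose c (j : 'I_L.+1) k := \sum_(i < k.+1) (A j)`_i * e (k - i)%N ^+ (q ^ j).
have glA j : exists B', gle 1 B' (c j).
  have [BA _ hBA] := gle_poly (A j) ltr01.
  have [x0 _ x0r] := small_elt rho0; have [ge1 _] := fr_sums j ge (he x0 x0r).
  by exists (BA * B ^+ (q ^ j)); exact: (gleM ltr01 hBA ge1).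
have [Bm [Bm0 hBm]] : exists B', 0 < B' /\ forall j, gle 1 B' (c j).
  have := glA => /(_ _)/cid hh; have [b [b0 hb]] := fin_boundR (fun j => sval (hh j)).
  by exists b; split=> // j; apply: gle_w (hb j) _; exact: (svalP (hh j)).
have cz k : \sum_j c j k = 0.
  move: k; apply: (@series_zero 1 Bm _ ltr01) => [i|x x0 xr].
    rewrite expr1n mulr1; apply: nrm_sum => [|j _]; first exact: ltW.
    by have := hBm j i; rewrite expr1n mulr1.
  have xr' : nrm x < rho by apply: lt_trans rho1.
  rewrite -[X in sums _ _ X](relE x xr'); apply: (@cvg_ext (fun N => \sum_(j < L.+1) \sum_(m < N) c j m * x ^+ m) _ _ 0).
    by move=> m _; rewrite exchange_big; apply: eq_bigr => i _; rewrite mulr_suml.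
  apply: cvg_sum => j _; have [BA BA0 hBA] := gle_poly (A j) ltr01.
  have [_] := fr_sums j ge (he (frt j x) (frt_lt j rho1 xr')).
  have [ge1 _] := fr_sums j ge (he (frt j x) (frt_lt j rho1 xr')).
  rewrite frtK => hE; apply: (sumsM ltr01 hBA ge1 xr _ hE).
  by apply: (@cvg_ext (fun=> (A j).[x]) _ _ (size (A j)) _ (cvg_cst _)) => m hm; rewrite (horner_coef_wide x hm).
have a_low j i : (i < i0)%N -> (a j)`_i = 0.
  by move=> ii; apply/eqP; apply: contraTT ii => /imin; rewrite -leqNgt.
have A_low j i : (i < i0)%N -> (A j)`_i = 0.
  move=> ii; rewrite coefM big1 // => k _; rewrite a_low ?mul0r //.
  by apply: leq_ltn_trans ii; rewrite -ltnS.
have A_eq j : (A j)`_i0 = (a j)`_i0 * (dn j)`_0.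
  rewrite coefM big_ord_recr /= subnn big1 ?add0r // => k _; by rewrite a_low ?mul0r.
pose lam := e kp.
(* The coefficient of y^(kp + i0) in the relation: only the lowest terms of both factors
   contribute. *)
have key : \sum_(j < L.+1) (a j)`_i0 * (dn j)`_0 * lam ^+ (q ^ j) = 0.
  rewrite -[RHS](cz (kp + i0)%N); apply: eq_bigr => j _.
  rewrite /c (bigD1 (inord i0)) //= inordK ?ltnS ?leq_addl // addnK A_eq big1 ?addr0 // => i ne.
  have [ii|ii] := ltnP i i0; first by rewrite A_low ?mul0r.
  have ii' : (i0 < i)%N.
    rewrite ltn_neqAle ii andbT eq_sym; apply: contraNneq ne => e'.
    by apply/eqP/val_inj; rewrite /= inordK ?ltnS ?leq_addl.
  suff -> : e (kp + i0 - i)%N = 0 by rewrite fr0 mulr0.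
  apply/eqP; rewrite -[_ == 0]negbK; apply/negP => /kmin; rewrite leqNgt => /negP; apply.
  by rewrite -(ltn_add2r i) subnK ?ltn_add2l // -ltnS ltn_ord.
(* The non-zero term with the smallest j carries the smallest power of lam. The other terms must
   balance it, yet each contains at least one more factor lam. *)
have [j0 aj0 jmin] := @arg_minnP _ j2 (fun j => (a j)`_i0 != 0) (fun j => nat_of_ord j) aj2.
have an j : nrm (a j)`_i0 <= C4.
  apply: (@exp_le_root _ _ (QQ N1)); rewrite ?nrm_ge0 ?(ltW C40) ?qk_gt0 //.
  by rewrite -nrmX /C4 -exprM; apply: Aht_le.
(* Its Q-th power is a non-zero element of A. *)
have an0 : 1 <= nrm (a j0)`_i0.
  apply: (@exp_le_root _ _ (QQ N1)); rewrite ?nrm_ge0 ?qk_gt0 //.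
  rewrite expr1n -nrmX; apply: Aht_ge (aA j0 i0) _; by rewrite expf_neq0.
have lam0 : 0 < nrm lam by rewrite nrm_gt0.
have lam_lt : nrm lam < bd by apply: le_lt_trans hlam; exact: hsmall.
have [lam1 lam2] : nrm lam < 1 /\ nrm lam < 1 / (C4 * Cd * Ci).
  by move: lam_lt; rewrite /bd lt_min => /andP[].
have dj0 : 0 < nrm (dn j0)`_0 by rewrite nrm_gt0 dn_0.
move/eqP: key; rewrite (bigD1 j0) //= addr_eq0 => /eqP /(congr1 nrm); rewrite nrmN => key.
have bnd : nrm ((a j0)`_i0 * (dn j0)`_0 * lam ^+ (q ^ j0)) <= C4 * Cd * nrm lam ^+ (q ^ j0).+1.
  rewrite key; apply: nrm_sum => [|j ne]; first by rewrite !mulr_ge0 ?exprn_ge0 ?nrm_ge0 // ltW.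
  have [->|aj] := eqVneq (a j)`_i0 0.
    by rewrite !mul0r nrm0 !mulr_ge0 ?exprn_ge0 ?nrm_ge0 // ltW.
  have jj : (j0 < j)%N by rewrite ltn_neqAle jmin // andbT eq_sym.
  rewrite !nrmM nrmX; apply: ler_pM; rewrite ?mulr_ge0 ?exprn_ge0 ?nrm_ge0 //.
    by apply: ler_pM; rewrite ?nrm_ge0.
  rewrite ler_wiXn2l ?ltW //.
  by apply: leq_trans (_ : q ^ j0.+1 <= _)%N; rewrite ?ltn_exp2l ?leq_exp2l ?q_gt1.
have : nrm (dn j0)`_0 <= C4 * Cd * nrm lam.
  have p0 : 0 < nrm lam ^+ (q ^ j0) by rewrite exprn_gt0.
  rewrite -(ler_pM2r p0) -[leRHS]mulrA -exprS; apply: le_trans bnd.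
  by rewrite !nrmM nrmX ler_pM2r // ler_peMl ?nrm_ge0.
have hh := hCi j0; move: lam2; rewrite ltr_pdivlMr ?mulr_gt0 // => lam2 hd.
have : (nrm (dn j0)`_0)^-1 * nrm (dn j0)`_0 = 1 by rewrite mulVf // gt_eqF.
apply/eqP; rewrite lt_eqF //.
apply: le_lt_trans lam2; rewrite (_ : _ * (C4 * Cd * Ci) = Ci * (C4 * Cd * nrm lam)); last by ring.
by apply: ler_pM; rewrite ?invr_ge0 ?nrm_ge0.
Qed.
End Abp.

(** * Purity and independence of values *)
Lemma fchoice (X Y : Type) (P : X -> Y -> Prop) :
  (forall x, exists y, P x y) -> exists f, forall x, P x (f x).
Proof. by move=> h; exists (fun x => sval (cid (h x))) => x; exact: (svalP (cid (h x))). Qed.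
Lemma size_bound (I : finType) (F : I -> {poly C}) : exists b, forall i, (size (F i) <= b)%N.
Proof.
apply: fin_bound => [i b b' h1 h2|i]; first exact: leq_trans h2 h1.
by exists (size (F i)).
Qed.
Lemma poly_zero rho (P : {poly C}) : 0 < rho -> (forall x, nrm x < rho -> P.[x] = 0) -> P = 0.
Proof.
move=> r0 h; have [B _ hB] := gle_poly P r0; apply/polyP => i; rewrite coef0.
move: i; apply: (series_zero r0 hB) => x _ xr; rewrite -[X in sums _ _ X](h x xr).
by apply: (@cvg_ext (fun=> P.[x]) _ _ (size P) _ (cvg_cst _)) => m hm; rewrite (horner_coef_wide x hm).
Qed.

Section Purity.
Variables (rho : R) (W : finType) (psi : W -> C -> C) (T : W -> W -> {poly C}).
Variables (r : nat) (wt : W -> nat).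
Hypothesis r_gt0 : (0 < r)%N.
Hypothesis rho_gt : q%:R < rho.
Let dl : {poly C} := ('X - (theta ^+ q)%:P) ^+ 2.
Hypothesis psi_eq : forall a x, nrm (x ^+ q) < rho ->
  dl.[x ^+ q] * psi a x ^+ q = \sum_b (T a b).[x ^+ q] * psi b (x ^+ q).
(** A weighted degree: if row a has weight wt a / r, one step of the system raises degree plus
    weight by at most 1. The zero polynomial is set apart because [(size 0).-1] is 0 rather than
    minus infinity. *)
Definition wdeg (P : {poly C}) (l m : nat) := P = 0 \/ ((size P).-1 * r + l <= m)%N.
Hypothesis T_wt : forall a b, wdeg (T a b) (wt b) (r + wt a).

Let rho0 : 0 < rho. Proof. by apply: lt_trans rho_gt; exact: qR_gt0. Qed.

Lemma wdegD P Q l m : wdeg P l m -> wdeg Q l m -> wdeg (P + Q) l m.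
Proof.
move=> [->|hP] [->|hQ]; rewrite ?addr0 ?add0r; [by left|by right|by right|right].
have := size_polyD P Q; have [h1|h1] := leqP (size P) (size Q) => h2.
  by apply: leq_trans hQ; rewrite leq_add2r leq_mul2r -!subn1 leq_sub2r ?orbT // (leq_trans h2).
by apply: leq_trans hP; rewrite leq_add2r leq_mul2r -!subn1 leq_sub2r ?orbT // (leq_trans h2).
Qed.
Lemma wdeg_sum (I : Type) (s : seq I) (D : pred I) F l m :
  (forall i, D i -> wdeg (F i) l m) -> wdeg (\sum_(i <- s | D i) F i) l m.
Proof.
by move=> h; elim/big_ind: _ => //; [left | move=> P Q; exact: wdegD].
Qed.
Lemma wdeg_tw k P l m : wdeg P l m -> wdeg (tw k P) l m.
Proof.
move=> [->|h]; first by left; rewrite tw0.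
right; apply: leq_trans h; rewrite leq_add2r leq_mul2r -!subn1 leq_sub2r ?orbT //; exact: size_tw.
Qed.
Lemma wdegM P Q l m l' m' : wdeg P l m -> wdeg Q l' m' -> wdeg (P * Q) (l + l') (m + m').
Proof.
move=> [->|hP]; first by rewrite mul0r; left.
move=> [->|hQ]; first by rewrite mulr0; left.
have [-> |P0] := eqVneq P 0; first by rewrite mul0r; left.
have [-> |Q0] := eqVneq Q 0; first by rewrite mulr0; left.
right; rewrite size_mul //; move: P0 Q0; rewrite -!size_poly_gt0 => P0 Q0.
apply: leq_trans (leq_add hP hQ).
rewrite (_ : (size P + size Q).-2 = (size P).-1 + (size Q).-1)%N; last by lia.
by rewrite mulnDl addnACA.
Qed.
Lemma wdegM' P Q l m l' : wdeg P l m -> wdeg Q l' (r + l) -> wdeg (P * Q) l' (r + m).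
Proof.
move=> hP hQ; have [->|h] := wdegM hP hQ; [by left|right; move: h; lia].
Qed.
Lemma Tn_wdeg n a b : wdeg (Tn T n a b) (wt b) (r * n + wt a).
Proof.
elim: n a b => [|n IH] a b /=.
  rewrite muln0 add0n; case: eqP => [->|_]; last by left.
  by right; rewrite size_poly1.
rewrite mulnS -addnA; apply: wdeg_sum => c _.
exact: (wdegM' (wdeg_tw 1 (IH a c)) (T_wt c b)).
Qed.
Lemma dn_size n : size (dn dl n) = (2 * n).+1 /\ lead_coef (dn dl n) = 1.
Proof.
elim: n => [|n [s1 l1]]; first by rewrite /= size_poly1 lead_coef1.
have lt : lead_coef (tw 1 (dn dl n)) = 1 /\ size (tw 1 (dn dl n)) = (2 * n).+1.
  have sz : size (tw 1 (dn dl n)) = (2 * n).+1.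
    apply/eqP; rewrite eqn_leq -{1}s1 size_tw /= ltnNge; apply/negP => /leq_sizeP /(_ _ (leqnn _)).
    move: l1; rewrite /lead_coef s1 /= coef_tw => ->; rewrite expr1n => /eqP; by rewrite oner_eq0.
  by split=> //; rewrite /lead_coef sz coef_tw; move: l1; rewrite /lead_coef s1 /= => ->; rewrite expr1n.
have sd : size dl = 3%N by rewrite /dl size_exp_XsubC.
have ld : lead_coef dl = 1 by rewrite /dl lead_coef_exp lead_coefXsubC expr1n.
case: lt => lt st; rewrite /= size_Mmonic ?monicE ?ld //; last by rewrite -lead_coef_eq0 lt oner_neq0.
by rewrite st sd lead_coefM lt ld mulr1; split=> //; lia.
Qed.

(** A subfamily independent over C[x] and of maximal size; the product of the individual
    denominators serves as the common p. *)
Lemma fun_basis : exists (J : {set W}) (p : {poly C}) (B : W -> W -> {poly C}), [/\ p != 0,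
  forall c : W -> {poly C}, (forall x, nrm x < rho -> \sum_(j in J) (c j).[x] * psi j x = 0) ->
    forall j, j \in J -> c j = 0
  & forall l x, nrm x < rho -> p.[x] * psi l x = \sum_(j in J) (B l j).[x] * psi j x].
Proof.
pose indep (J : {set W}) := forall c : W -> {poly C},
  (forall x, nrm x < rho -> \sum_(j in J) (c j).[x] * psi j x = 0) -> forall j, j \in J -> c j = 0.
have i0 : `[<indep finset.set0>] by apply/asboolP => c _ i; rewrite inE.
case: (@arg_maxnP _ _ (fun J => `[<indep J>]) (fun J : {set W} => #|J|) i0) => J /asboolP iJ mJ.
have [pB hpB] : exists pB : W -> {poly C} * (W -> {poly C}), forall l, (pB l).1 != 0 /\
    forall x, nrm x < rho -> (pB l).1.[x] * psi l x = \sum_(j in J) ((pB l).2 j).[x] * psi j x.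
  apply: (@fchoice _ _ (fun l (pB : {poly C} * (W -> {poly C})) => pB.1 != 0 /\
    forall x, nrm x < rho -> pB.1.[x] * psi l x = \sum_(j in J) (pB.2 j).[x] * psi j x)) => l.
  have [lJ|lJ] := boolP (l \in J).
    exists (1, fun j => (j == l)%:R); rewrite oner_neq0; split=> //= x _.
    rewrite (bigD1 l) //= eqxx big1 ?addr0 // => j /andP[_ /negPf ->].
    by rewrite mulr0n horner0 mul0r.
  have : ~ indep (l |: J)%SET.
    move=> h; have := mJ (l |: J)%SET (introT (asboolP _) h).
    by rewrite /geq /= cardsU1 lJ add1n ltnn.
  rewrite /indep => /existsNP [c /not_implyP [c0 /existsNP [k /not_implyP [kJ ck]]]].
  have c0' x : nrm x < rho -> (c l).[x] * psi l x + \sum_(j in J) (c j).[x] * psi j x = 0.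
    by move=> xr; have := c0 x xr; rewrite big_setU1.
  exists (c l, fun j => - c j); split=> /= [|x xr].
    apply/eqP => z; apply: ck; move: kJ; rewrite in_setU1 => /orP[/eqP -> //|kJ].
    by apply: iJ kJ => x xr; have := c0' x xr; rewrite z horner0 mul0r add0r.
  move/eqP: (c0' x xr); rewrite addr_eq0 => /eqP ->; rewrite -sumrN.
  by apply: eq_bigr => j _; rewrite hornerN mulNr.
exists J, (\prod_l (pB l).1), (fun l j => (\prod_(k | k != l) (pB k).1) * (pB l).2 j); split=> //.
  by apply/prodf_neq0 => l _; case: (hpB l).
move=> l x xr; rewrite (bigD1 l) //= hornerM mulrAC (proj2 (hpB l) x xr) mulrC mulr_sumr.
by apply: eq_bigr => j _; rewrite hornerM mulrA.
Qed.

(* The twists divide degrees: after n twists the left side of a relation has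
   gained 2n zeros while the entries of the n-fold product only grow like n. *)
Lemma purity (h0 : {poly C}) (h : W -> {poly C}) :
  (forall x, nrm x < rho -> h0.[x] = \sum_a (h a).[x] * psi a x) -> h0 = 0.
Proof.
move=> hrel; apply/eqP; apply: contraT => h00; exfalso.
have [J [p [B [p0 iJ hB]]]] := fun_basis.
pose hBj (h : W -> {poly C}) j := \sum_l h l * B l j.
have toJ (u : W -> {poly C}) x : nrm x < rho -> p.[x] * (\sum_l (u l).[x] * psi l x) = \sum_(j in J) (hBj u j).[x] * psi j x.
  move=> xr; under [RHS]eq_bigr => j _ do rewrite horner_sum mulr_suml.
  rewrite mulr_sumr exchange_big /=; apply: eq_bigr => l _; rewrite mulrCA hB // mulr_sumr.
  by apply: eq_bigr => j _; rewrite hornerM mulrA.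
have [j jJ hj] : exists2 j, j \in J & hBj h j != 0.
  apply: contrapT => hn; have hz j : j \in J -> hBj h j = 0.
    by move=> jJ; apply/eqP; apply: contrapT => /negP hj; apply: hn; exists j.
  have : p * h0 = 0.
    apply: (poly_zero rho0) => x xr; rewrite hornerM hrel // toJ //; apply: big1 => j jJ.
    by rewrite hz // horner0 mul0r.
  by move/eqP; rewrite mulf_eq0 (negPf p0) (negPf h00).
pose w n l := \sum_k tw n (h k) * Tn T n k l.
pose D n := dn dl n * tw n h0.
have rho1 : 1 < rho by apply: lt_trans rho_gt; exact: qR_gt1.
have twrel n x : nrm x < rho -> (D n).[x] = \sum_l (w n l).[x] * psi l x.
  move=> xr; under [RHS]eq_bigr => l _ do rewrite horner_sum mulr_suml.
  rewrite exchange_big /= /D hornerM -{2}(frtK n x) tw_horner hrel; last exact: frt_lt.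
  rewrite fr_sum mulr_sumr; apply: eq_bigr => k _; rewrite exprMn -tw_horner frtK mulrCA.
  have := @twist_iter rho W psi T dl rho_gt psi_eq n k (frt n x); rewrite frtK => /(_ xr) ->.
  by rewrite mulr_sumr; apply: eq_bigr => l _; rewrite hornerM mulrA.
(* Coordinates in the basis are unique, so the relation and its n-th twist have proportional
   coordinate vectors. *)
have key n : D n * hBj h j = h0 * hBj (w n) j.
  apply/eqP; rewrite -subr_eq0; apply/eqP.
  move: j jJ {hj}; apply: iJ => x xr.
  have e1 := toJ h x xr; have e2 := toJ (w n) x xr.
  transitivity ((D n).[x] * (p.[x] * \sum_l (h l).[x] * psi l x) - h0.[x] * (p.[x] * \sum_l (w n l).[x] * psi l x)).
    rewrite e1 e2 !mulr_sumr -sumrB; apply: eq_bigr => j _.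
    by rewrite hornerD hornerN !hornerM; ring.
  by rewrite -twrel // -hrel //; ring.
(* The weights limit the right side of [key] to degree n + c, while the left side contains [dn] of
   degree 2 n; already n = c + 1 is impossible. *)
have [c hc] : exists c, forall n, (size (h0 * hBj (w n) j)%R <= n + c)%N.
  have [c1 hc1] := @size_bound W (fun l => B l j).
  have [c2 hc2] := @size_bound W (fun l => h l).
  have [c3 hc3] := @fin_bound W (fun l b => (wt l <= b)%N) (fun i b b' h1 h2 => leq_trans h2 h1)
    (fun i => ex_intro _ (wt i) (leqnn _)).
  exists (size h0 + (c2 + (c3 + 1) + c1))%N => n.
  have sM (P Q : {poly C}) a b : (size P <= a)%N -> (size Q <= b)%N -> (size (P * Q)%R <= a + b)%N.
    move=> h1 h2; apply: leq_trans (size_polyMleq _ _) _; apply: leq_trans (leq_pred _) _; exact: leq_add.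
  have sS (I : finType) (F : I -> {poly C}) a : (forall i, size (F i) <= a)%N -> (size (\sum_i F i)%R <= a)%N.
    move=> hF; apply: (big_ind (fun P : {poly C} => (size P <= a)%N)); rewrite ?size_poly0 //.
    by move=> P Q h1 h2; apply: leq_trans (size_polyD _ _) _; rewrite geq_max h1.
  rewrite addnCA; apply: (sM _ _ _ _) => //; apply: (sS _ _ _) => l.
  rewrite addnA; apply: (sM _ _ _ _) => //; apply: (sS _ _ _) => k.
  rewrite addnCA; apply: (sM _ _ _ _); first exact: leq_trans (size_tw _ _) (hc2 k).
  have [->|] := Tn_wdeg n k l; first by rewrite size_poly0.
  have := hc3 k; move: (size _) => s; move: (wt k) (wt l) => a b h1 h2.
  rewrite addnA addn1; apply: (@leq_trans s.-1.+1); first by case: s {h2}.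
  rewrite ltnS -(leq_pmul2r r_gt0); apply: (@leq_trans (r * n + a)); first by apply: leq_trans h2; exact: leq_addr.
  rewrite mulnDl mulnC leq_add2l; apply: leq_trans h1 _; exact: leq_pmulr.
have th0 n : tw n h0 != 0 by apply: contra_neq h00; exact: tw_inj.
have := hc c.+1; rewrite -key size_mul //; last first.
  by rewrite mulf_neq0 // -lead_coef_eq0 (proj2 (dn_size _)) oner_neq0.
rewrite /D size_mul //; last by rewrite -lead_coef_eq0 (proj2 (dn_size _)) oner_neq0.
rewrite (proj1 (dn_size _)); move: (th0 c.+1) hj; rewrite -!size_poly_gt0.
move: (size (tw _ _)) (size (hBj h j)) => s1 s2; clear; case: s1 => // s1; case: s2 => // s2 _ _.
by rewrite !addnS /= mulnS; lia.
Qed.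
End Purity.

(** A relation evaluated at theta shows that theta is a root of every coefficient; dividing by X -
    theta lowers the degrees, and continuity restores the relation at theta itself. *)
Lemma indep_val rho (I : finType) (u : I -> C -> C) (J : {set I}) : q%:R < rho ->
  (forall i, analytic rho (u i)) ->
  (forall c, (forall i, inKp (c i)) -> \sum_(i in J) c i * u i theta = 0 -> forall i, i \in J -> c i = 0) ->
  forall h : I -> {poly C}, (forall i k, inKp (h i)`_k) ->
  (forall x, nrm x < rho -> \sum_(i in J) (h i).[x] * u i x = 0) -> forall i, i \in J -> h i = 0.
Proof.
move=> rho_gt ua hnum h; have r0 : 0 < rho by apply: lt_trans rho_gt; exact: qR_gt0.
have tr : nrm theta < rho by rewrite nrm_theta.
have [m hm] := @size_bound I (fun i => h i).
elim: m h hm => [|m IH] h hm hK hrel i iJ.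
  by apply/eqP; rewrite -size_poly_leq0.
have Kt : inKp theta by apply/inK_Kp/inA_K/inA_theta.
have hth : forall i, i \in J -> (h i).[theta] = 0.
  apply: hnum; last exact: hrel.
  move=> k; rewrite horner_coef; apply: (sf_sum inKp_sf) => l _.
  by apply: (sfM inKp_sf) => //; apply: (sfX inKp_sf).
pose h' i := if i \in J then h i %/ ('X - theta%:P) else 0.
have hE k : k \in J -> h k = h' k * ('X - theta%:P).
  by move=> kJ; rewrite /h' kJ divpK // dvdp_XsubCl; apply/rootP; exact: hth.
have s' k : (size (h' k) <= m)%N.
  rewrite /h'; case: ifP => kJ; last by rewrite size_poly0.
  by rewrite size_divp ?polyXsubC_eq0 // size_XsubC leq_subLR add1n; exact: hm.
rewrite hE // (IH h') ?mul0r // => [k l|x xr].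
  rewrite /h'; case: (boolP (k \in J)) => kJ; last by rewrite coef0; exact: (sf0 inKp_sf).
  have hE' := hE k kJ; rewrite /h' kJ in hE'; set g := _ %/ _ in hE' *.
  (* Horner's scheme, read from the top coefficient down, keeps the quotient over the perfect
     closure. *)
  have rec l' : g`_l' = (h k)`_l'.+1 + theta * g`_l'.+1.
    by rewrite hE' mulrBr coefB coefMX coefMC /=; ring.
  have [b] := ubnP (size g - l); elim: b l => // b IHb l lb.
  have [lg|lg] := leqP (size g) l; first by rewrite nth_default //; exact: (sf0 inKp_sf).
  rewrite rec; apply: (sfD inKp_sf) => //; apply: (sfM inKp_sf) => //; apply: IHb; lia.
apply: (@an_cont rho (fun x => \sum_(k in J) (h' k).[x] * u k x) x) => //.
  by apply: an_sum => // k _; apply: anM => //; exact: an_poly.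
suff vz y : y != theta -> nrm y < rho -> \sum_(k in J) (h' k).[y] * u k y = 0.
  move=> y _ yr; have [->|yt] := eqVneq y theta; last exact: vz.
  apply: (@an_cont rho (fun x => \sum_(k in J) (h' k).[x] * u k x)) => //.
  by apply: an_sum => // k _; apply: anM => //; exact: an_poly.
move=> yt yr; apply: (@mulfI _ (y - theta)); first by rewrite subr_eq0.
rewrite mulr0 mulr_sumr -[RHS](hrel y yr); apply: eq_bigr => k kJ.
by rewrite [in RHS]hE // hornerM hornerXsubC; ring.
Qed.

(** * Transcendence of algebraic combinations of the values *)

Section Transcend.
Variables (rho : R) (W : finType) (psi : W -> C -> C) (T : W -> W -> {poly C}).
Variables (r : nat) (wt : W -> nat) (Ib : finType) (b : Ib -> C).
Hypothesis r_gt0 : (0 < r)%N.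
Hypothesis rho_gt : q%:R < rho.
Hypothesis psi_an : forall a, analytic rho (psi a).
Let dl : {poly C} := ('X - (theta ^+ q)%:P) ^+ 2.
Hypothesis psi_eq : forall a x, nrm (x ^+ q) < rho ->
  dl.[x ^+ q] * psi a x ^+ q = \sum_b (T a b).[x ^+ q] * psi b (x ^+ q).
Hypothesis T_wt : forall a b, wdeg r (T a b) (wt b) (r + wt a).
Hypothesis hb : fgalg b.
Hypothesis T_span : forall a c k, spanK b (T a c)`_k.

Let rho0 : 0 < rho. Proof. by apply: lt_trans rho_gt; exact: qR_gt0. Qed.
Let tr : nrm theta < rho. Proof. by rewrite nrm_theta. Qed.

Definition psi' (a : option W) (x : C) : C := if a is Some a' then psi a' x else 1.
Definition T' (a c : option W) : {poly C} := match a, c with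
  | Some a', Some c' => T a' c' | None, None => dl | _, _ => 0 end.
(** Multiplying by the family b turns a system over the algebra spanned by b into a system over K;
    the index [None] carries the constant function 1. *)
Definition chi (k : Ib * option W) (x : C) : C := b k.1 * psi' k.2 x.

Lemma sum_option (F : option W -> C) : \sum_c F c = F None + \sum_c F (Some c).
Proof.
rewrite (bigD1 None) //=; congr (_ + _).
rewrite (reindex_omap Some id) /=; last by case.
by apply: eq_bigl => c; rewrite eqxx.
Qed.
Lemma psi'_eq a x : nrm (x ^+ q) < rho ->
  dl.[x ^+ q] * psi' a x ^+ q = \sum_c (T' a c).[x ^+ q] * psi' c (x ^+ q).
Proof.
move=> xr; rewrite sum_option; case: a => [a|] /=.
  by rewrite horner0 mul0r add0r psi_eq.
by rewrite expr1n big1 ?addr0 // => c _; rewrite horner0 mul0r.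
Qed.
Lemma theta_q_A k : inA q theta ((theta ^+ q) ^+ k).
Proof. by apply: inAX; apply: inAX; exact: inA_theta. Qed.
Lemma dl_A k : inA q theta dl`_k.
Proof.
rewrite /dl expr2 coefM; apply: (big_ind (inA q theta)); [exact: inA0 | exact: inAD |].
have h i : inA q theta ('X - (theta ^+ q)%:P)`_i.
  rewrite coefB coefX coefC; apply: inAD; first by case: eqP => _; [exact: inA1 | exact: inA0].
  by apply: inAN; case: eqP => _; [exact: (theta_q_A 1) | exact: inA0].
by move=> i _; apply: inAM.
Qed.
Lemma T'_span a c k : spanK b (T' a c)`_k.
Proof.
case: a => [a|]; case: c => [c|] /=; rewrite ?coef0; try exact: spanK0; first exact: T_span.
by apply: fgK => //; apply: inA_K; exact: dl_A.
Qed.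

(** The product of b_i^q with a coefficient of [T'] stays in the algebra, hence expands in the b_j
    over K; A0 clears the finitely many denominators. *)
Lemma chi_system : exists (A0 : C) (TK : Ib * option W -> Ib * option W -> {poly C}),
  [/\ inA q theta A0, A0 != 0, forall k l i, inA q theta (TK k l)`_i
  & forall k x, nrm (x ^+ q) < rho ->
      (A0 *: dl).[x ^+ q] * chi k x ^+ q = \sum_l (TK k l).[x ^+ q] * chi l (x ^+ q)].
Proof.
have hex k c i : exists m : Ib -> C, (forall j, inK q theta (m j)) /\
    b k.1 ^+ q * (T' k.2 c)`_i = \sum_j m j * b j.
  by apply: fg_mul => //; [apply: fgX => //; exact: spanK_gen | exact: T'_span].
have [m mP] := fchoice (fun k => fchoice (fun c => fchoice (hex k c))).
have [sz hsz] := @size_bound (option W * option W)%type (fun ac => T' ac.1 ac.2).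
have [A0 [hA0 A00 hA]] := @common_denom ((Ib * option W) * option W * 'I_sz * Ib)%type
  (fun x => m x.1.1.1 x.1.1.2 x.1.2 x.2) (fun x => proj1 (mP _ _ _) _).
exists A0, (fun k l => \poly_(i < sz) (A0 * m k l.2 i l.1)); split=> //.
  move=> k l i; rewrite coef_poly; case: ltnP => iz; last exact: inA0.
  exact: (hA (k, l.2, Ordinal iz, l.1)).
move=> k x xr; rewrite hornerZ /chi exprMn.
rewrite (_ : _ * _ = A0 * (b k.1 ^+ q * (dl.[x ^+ q] * psi' k.2 x ^+ q))); last by ring.
rewrite psi'_eq // !mulr_sumr.
transitivity (\sum_c \sum_j (\poly_(i < sz) (A0 * m k c i j)).[x ^+ q] * (b j * psi' c (x ^+ q))); last first.
  by rewrite exchange_big pair_big /=; apply: eq_bigr => -[].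
apply: eq_bigr => c _; rewrite (horner_coef_wide _ (hsz (k.2, c))) /=.
under [RHS]eq_bigr => j _ do rewrite horner_poly mulr_suml.
rewrite exchange_big /= mulr_suml !mulr_sumr; apply: eq_bigr => i _.
transitivity (A0 * psi' c (x ^+ q) * (x ^+ q) ^+ i * (b k.1 ^+ q * (T' k.2 c)`_i)); first by ring.
rewrite (proj2 (mP k c i)) mulr_sumr; apply: eq_bigr => j _; ring.
Qed.

(** J0 indexes a basis of the b_i and J1 a basis of the numbers b_i psi_a(theta), both over the
    perfect closure. The relation for e makes one value from J0 redundant, while purity keeps the
    corresponding functions independent; [abp] excludes this. *)
Theorem transcend (c : W -> C) e : (forall a, spanK b (c a)) -> spanK b e -> e != 0 ->
  e = \sum_a c a * psi a theta -> False.
Proof.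
move=> hc he e0 eE.
have [A0 [TK [A0A A00 TKA chi_eq]]] := chi_system.
have Kpsf := inKp_sf.
pose u0 (i : Ib) := b i; pose u1 (p : Ib * W) := b p.1 * psi p.2 theta.
have [J0 [iJ0 sJ0]] := sub_basis Kpsf u0; have [J1 [iJ1 sJ1]] := sub_basis Kpsf u1.
have span0 x : spanK b x -> exists al, (forall i, inKp (al i)) /\ x = \sum_(i in J0) al i * b i.
  move=> [d [hd ->]]; have [s sP] := fchoice sJ0.
  exists (fun j => \sum_i d i * s i j); split=> [j|].
    by apply: (sf_sum Kpsf) => i _; apply: (sfM Kpsf); [exact: inK_Kp | case: (sP i)].
  under [RHS]eq_bigr => j _ do rewrite mulr_suml.
  rewrite exchange_big /=; apply: eq_bigr => i _; rewrite [b i](proj2 (sP i)) mulr_sumr.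
  by apply: eq_bigr => j _; rewrite mulrA.
have span1 : exists be, (forall p, inKp (be p)) /\ e = \sum_(p in J1) be p * u1 p.
  have [d dP] := fchoice hc; have [s sP] := fchoice sJ1.
  exists (fun p' => \sum_a \sum_i d a i * s (i, a) p'); split=> [p'|].
    apply: (sf_sum Kpsf) => a _; apply: (sf_sum Kpsf) => i _; apply: (sfM Kpsf).
      by apply: inK_Kp; case: (dP a).
    by case: (sP (i, a)).
  rewrite eE; under [RHS]eq_bigr => p' _ do rewrite mulr_suml.
  rewrite exchange_big /=; apply: eq_bigr => a _; rewrite (proj2 (dP a)) mulr_suml.
  under [RHS]eq_bigr => p' _ do rewrite mulr_suml.
  rewrite exchange_big /=; apply: eq_bigr => i _; rewrite -mulrA -[b i * _]/(u1 (i, a)) (proj2 (sP (i, a))) mulr_sumr.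
  by apply: eq_bigr => p' _; rewrite mulrA.
have [al [hal eal]] := span0 e he; have [be [hbe ebe]] := span1.
have [k0 k0J alk0] : exists2 k0, k0 \in J0 & al k0 != 0.
  apply: contrapT => hn; move/eqP: e0; apply; rewrite eal big1 // => i iJ.
  apply/eqP; rewrite mulf_eq0; apply/orP; left; rewrite -[_ == 0]negbK; apply/negP => ai.
  by apply: hn; exists i.
pose J : {set Ib * option W} := [set k | match k.2 with None => k.1 \in J0 | Some a => (k.1, a) \in J1 end].
have sumJ (F : Ib * option W -> C) :
    \sum_(k in J) F k = \sum_(i in J0) F (i, None) + \sum_(p in J1) F (p.1, Some p.2).
  transitivity (\sum_(i : Ib) \sum_(a : option W) if (i, a) \in J then F (i, a) else 0).
    by rewrite pair_big big_mkcond /=; apply: eq_bigr => -[].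
  rewrite (eq_bigr (fun i => (if i \in J0 then F (i, None) else 0) + \sum_a if (i, a) \in J1 then F (i, Some a) else 0)).
    rewrite big_split /=; congr (_ + _); first by rewrite -big_mkcond.
    by rewrite pair_big [RHS]big_mkcond /=; apply: eq_bigr => -[].
  by move=> i _; rewrite sum_option inE /=; congr (_ + _); apply: eq_bigr => a _; rewrite inE.
pose J' := (J :\ (k0, None))%SET.
have k0J' : (k0, None) \in J by rewrite inE.
have inspan : forall l, exists S : Ib * option W -> C, (forall j, inKp (S j)) /\ chi l theta = \sum_(j in J') S j * chi j theta.
  have full l : exists S : Ib * option W -> C, (forall j, inKp (S j)) /\ chi l theta = \sum_(j in J) S j * chi j theta.
    case: l => i [a|].
      have [s [hs sE]] := sJ1 (i, a).
      exists (fun j => if j.2 is Some a' then s (j.1, a') else 0); split.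
        by case=> j [a'|] //=; exact: (sf0 Kpsf).
      rewrite sumJ [X in X + _]big1 ?add0r; last by move=> ? _; rewrite mul0r.
      by rewrite /chi /= -[b i * _]/(u1 (i, a)) sE; apply: eq_bigr => -[].
    have [s [hs sE]] := sJ0 i.
    exists (fun j => if j.2 is Some a' then 0 else s j.1); split.
      by case=> j [a'|] //=; exact: (sf0 Kpsf).
    rewrite sumJ [X in _ + X]big1 ?addr0; last by move=> ? _; rewrite mul0r.
    by rewrite /chi /= mulr1 -/(u0 i) sE; apply: eq_bigr => j _; rewrite mulr1.
  (* The two expansions of e are solved for the value with index k0. *)
  have [S0 [hS0 S0E]] : exists S : Ib * option W -> C, (forall j, inKp (S j)) /\ chi (k0, None) theta = \sum_(j in J') S j * chi j theta.
    exists (fun j => (al k0)^-1 * (if j.2 is Some a' then be (j.1, a') else - al j.1)); split.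
      case=> j [a'|] /=; apply: (sfM Kpsf); try exact: (sfV Kpsf); first exact: hbe.
      by apply: (sfN Kpsf).
    apply: (mulfI alk0); rewrite mulr_sumr.
    transitivity (\sum_(j in J') (if j.2 is Some a' then be (j.1, a') else - al j.1) * chi j theta); last first.
      by apply: eq_bigr => j _; rewrite -mulrA mulVKf.
    have := sumJ (fun j => (if j.2 is Some a' then be (j.1, a') else - al j.1) * chi j theta).
    rewrite (big_setD1 _ k0J') /= => /(canRL (addKr _)) ->.
    rewrite (_ : \sum_(p in J1) _ = e); last first.
      by rewrite ebe; apply: eq_bigr => -[i a] _ /=; rewrite /chi /=.
    rewrite (_ : \sum_(i in J0) _ = - e); last first.
      by rewrite eal -sumrN; apply: eq_bigr => i _; rewrite /chi /= mulr1 mulNr.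
    by rewrite addNr addr0 mulNr opprK.
  move=> l; have [S [hS SE]] := full l.
  exists (fun j => S j + S (k0, None) * S0 j); split.
    by move=> j; apply: (sfD Kpsf) => //; apply: (sfM Kpsf).
  rewrite SE (big_setD1 _ k0J') /= S0E mulr_sumr -big_split /=; apply: eq_bigr => j _; ring.
have [S1 S1P] := fchoice inspan.
have [m0 hm0] : exists m0, forall lj : (Ib * option W) * (Ib * option W), inK q theta (S1 lj.1 lj.2 ^+ (q ^ m0)).
  apply: fin_bound => [lj x y xy hx|[l j]]; first exact: inKp_up hx xy.
  by have [h _] := S1P l; exact: h.
have [sg [sgA sg0 hsg]] := common_denom hm0.
apply: (@abp rho _ chi TK (A0 *: dl) rho_gt _ TKA chi_eq J J' (fun l j => sg * S1 l j) sg m0).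
- move=> k; apply: anM => //; first exact: an_cst.
  by case: k => i [a|] /=; [exact: psi_an | exact: an_cst].
- move=> i; have -> : tw i (A0 *: dl) = A0 ^+ (q ^ i) *: ('X - (theta ^+ (q ^ i.+1))%:P) ^+ 2.
    have h : tw i ('X - (theta ^+ q)%:P) = 'X - (theta ^+ (q ^ i.+1))%:P.
      apply/polyP => j; rewrite coef_tw !coefB !coefX !coefC frB frSr.
      by case: j => [|[|j]] /=; rewrite ?expr1n ?fr0.
    rewrite -h /dl !expr2 -twM -!mul_polyC twM; congr (_ * _).
    by apply/polyP => j; rewrite coef_tw !coefC; case: eqP => _; rewrite ?fr0.
  rewrite hornerZ mulf_neq0 ?expf_neq0 // horner_exp hornerXsubC expf_neq0 // subr_eq0.
  apply/negP => /eqP /(congr1 nrm) /eqP; rewrite nrmX -{1}[nrm theta]expr1 nrm_theta => /eqP h.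
  have := ieexprIn qR_gt0 _ h; rewrite gt_eqF ?qR_gt1 // => /(_ isT) /esym.
  by have := ltn_expl i.+1 q_gt1 => h1 h2; rewrite h2 in h1.
- by rewrite -horner_coef0 hornerZ mulf_neq0 // horner_exp hornerXsubC sub0r expf_neq0 // oppr_eq0 expf_neq0 ?theta_neq0.
(* With Q = q^m0, (sg S)^Q = sg^(Q-1) (sg S^Q), and sg was chosen to clear the denominators of
   S^Q. *)
- move=> l j; rewrite exprMn -(prednK (qk_gt0 m0)) exprSr prednK ?qk_gt0 // -mulrA.
  apply: inAM; first exact: inAX.
  exact: (hsg (l, j)).
- exact: sg0.
- by move=> l; rewrite (proj2 (S1P l)) mulr_sumr; apply: eq_bigr => j _; rewrite mulrA.
- by rewrite [ltnRHS](cardsD1 (k0, None)) k0J'.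
move=> h hK hrel.
pose h0 : {poly C} := - \sum_(i in J0) b i *: h (i, None).
pose ha a : {poly C} := \sum_(i | (i, a) \in J1) b i *: h (i, Some a).
have rel x : nrm x < rho -> h0.[x] = \sum_a (ha a).[x] * psi a x.
  move=> xr; have := hrel x xr; rewrite sumJ => /eqP; rewrite addrC addr_eq0 => /eqP rl.
  rewrite /h0 hornerN horner_sum.
  transitivity (\sum_(p in J1) (h (p.1, Some p.2)).[x] * chi (p.1, Some p.2) x).
    rewrite rl; congr (- _); apply: eq_bigr => i _; by rewrite hornerZ /chi /= mulr1 mulrC.
  rewrite /ha; under [RHS]eq_bigr => a _ do rewrite horner_sum mulr_suml.
  rewrite big_mkcond /=; under [RHS]eq_bigr => a _ do rewrite big_mkcond /=.
  rewrite exchange_big pair_big /=; apply: eq_bigr => -[i a] _ /=; case: ifP => // _.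
  by rewrite hornerZ /chi /=; ring.
(* Purity removes the part indexed by [None]; what remains relates functions whose values at theta
   are independent, so [indep_val] applies. *)
have h00 := purity r_gt0 rho_gt psi_eq T_wt rel.
have hn i : i \in J0 -> h (i, None) = 0.
  move=> iJ; apply/polyP => k; rewrite coef0; move: i iJ.
  apply: iJ0 => [i|]; first exact: hK.
  have := congr1 (fun P : {poly C} => - P`_k) h00; rewrite coefN opprK coef0 oppr0 coef_sum => e'.
  by rewrite -[RHS]e'; apply: eq_bigr => i _; rewrite coefZ mulrC.
have hs p : p \in J1 -> h (p.1, Some p.2) = 0.
  move: p; apply: (@indep_val rho _ (fun p x => b p.1 * psi p.2 x)) => //.
    by move=> p; apply: anM => //; exact: an_cst.
  move=> x xr; have := hrel x xr; rewrite sumJ big1 ?add0r //.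
  by move=> i iJ; rewrite hn // horner0 mul0r.
case=> i [a|]; rewrite inE /= => hJ; [exact: (hs (i, a)) | exact: hn].
Qed.
End Transcend.

(** * The algebraic closure of K *)
Section Eigen.
Variable (F : C -> Prop).
Hypothesis hF : subfld F.
Lemma sfp_det m (M : 'M[{poly C}]_m) : (forall i j k, F (M i j)`_k) -> forall k, F (\det M)`_k.
Proof.
move=> hM; rewrite /determinant.
pose G (P : {poly C}) := forall k, F P`_k.
have G0 : G 0 by move=> k; rewrite coef0; exact: sf0.
have G1 : G 1 by move=> k; rewrite coef1; case: eqP => _; [exact: sf1 | exact: sf0].
have GD P Q : G P -> G Q -> G (P + Q) by move=> hP hQ k; rewrite coefD; apply: sfD.
have GN P : G P -> G (- P) by move=> hP k; rewrite coefN; apply: sfN.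
have GM P Q : G P -> G Q -> G (P * Q).
  by move=> hP hQ k; rewrite coefM; apply: sf_sum => // i _; apply: sfM.
apply: (big_ind G G0 GD) => s _; apply: (GM _ _); last by apply: (big_ind G G1 GM) => i _; exact: hM.
by case: (perm.odd_perm s); rewrite ?expr0 ?expr1 //; exact: GN.
Qed.
Lemma eigen_alg m (M : 'M[C]_m) x (v : 'rV[C]_m) : (forall i j, F (M i j)) -> v != 0 ->
  v *m M = x *: v -> algebraic_over F x.
Proof.
move=> hM v0 hv; exists (char_poly M); split; last split.
- exact: monic_neq0 (char_poly_monic M).
- apply: sfp_det => i j k; rewrite !mxE coefB coefMn coefX coefC; apply: sfB => //.
    by case: (i == j); rewrite ?mulr0n ?mulr1n; [case: eqP => _; [exact: sf1 | exact: sf0] | exact: sf0].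
  by case: eqP => _ //; exact: sf0.
- by rewrite -eigenvalue_root_char; apply/eigenvalueP; exists v.
Qed.
End Eigen.

(** x is an eigenvalue of the matrix of multiplication by x on the family; the eigenvector (b_i) is
    non-zero because its span contains 1. *)
Lemma fg_alg (I : finType) (b : I -> C) x : fgalg b -> spanK b x -> inKbar' x.
Proof.
move=> hb hx; have h i : exists c : I -> C, (forall j, inK' (c j)) /\ x * b i = \sum_j c j * b j.
  exact: (fg_mul hb hx (spanK_gen b i)).
have [M hM] := fchoice h.
pose w : 'rV[C]_#|I| := \row_i b (enum_val i).
have w0 : w != 0.
  apply/negP => /eqP e; have [c [_ h1]] := fg1 hb; have := oner_neq0 C; rewrite h1 big1 ?eqxx // => i _.
  by have := congr1 (fun u : 'rV[C]_#|I| => u 0 (enum_rank i)) e; rewrite !mxE enum_rankK => ->; rewrite mulr0.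
apply: (@eigen_alg _ inK_sf _ (\matrix_(j, i) M (enum_val i) (enum_val j)) x w) => //.
  by move=> i j; rewrite mxE; case: (hM (enum_val j)).
apply/rowP => i; rewrite !mxE; have [_ ->] := hM (enum_val i).
rewrite [RHS](reindex (@enum_val _ xpredT)) /=; last by exists enum_rank => j _; rewrite ?enum_valK ?enum_rankK.
by apply: eq_bigr => j _; rewrite !mxE mulrC.
Qed.
Lemma Kbar_alg x : algebraic_over inKbar' x -> inKbar' x.
Proof. by move=> /(@fg_exists_alg [::]) [] // I [b [hb _]]; exact: fg_alg. Qed.
Lemma Kbar_sf : subfld inKbar'.
Proof.
have two x y : inKbar' x -> inKbar' y -> exists (I : finType) (b : I -> C), [/\ fgalg b, spanK b x & spanK b y].
  move=> hx hy; have [|I [b [hb hs]]] := @fg_exists [:: x; y]; first by move=> t; rewrite !inE => /orP[]/eqP ->.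
  by exists I, b; split=> //; apply: hs; rewrite !inE eqxx ?orbT.
split; last split.
- exact: inK_Kbar (sf0 inK_sf).
- exact: inK_Kbar (sf1 inK_sf).
- by move=> x y hx hy; have [I [b [hb bx by']]] := two x y hx hy; apply: fg_alg hb (spanKD bx by').
- by move=> x hx; have [I [b [hb bx _]]] := two x x hx hx; apply: fg_alg hb (spanKN bx).
- by move=> x y hx hy; have [I [b [hb bx by']]] := two x y hx hy; apply: fg_alg hb (fg_mul hb bx by').
- exact: KbarV.
Qed.
Lemma Kbar_theta : inKbar' theta.
Proof. by apply: inK_Kbar; apply: inA_K; exact: inA_theta. Qed.
Lemma Kbar_Fq c : Fq c -> inKbar' c.
Proof. by move=> h; apply: inK_Kbar; apply: inA_K; exact: inA_Fq. Qed.

(** * Anderson generating functions and the Legendre relation *)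
Lemma geo_q (B : R) e : 0 < e -> exists N, forall m, (N <= m)%N -> B * q%:R ^- m < e.
Proof.
move=> e0; have [||N hN] := @geo_small B (q%:R^-1) _ _ e e0; first by rewrite invr_ge0 ltW ?qR_gt0.
  by rewrite invf_lt1 ?qR_gt0 ?qR_gt1.
by exists N => m /hN; rewrite exprVn.
Qed.

(* Sf y j is the (j+1)-st Frobenius twist of the Anderson generating function
   sum_k y_k x^k *)
Definition Sf (y : nat -> C) (j : nat) (x : C) := psum nrm (fun k => y k ^+ (q ^ j.+1)) x.

(** Any radius above |theta| = q and at most q^q would serve. The once twisted generating function
    converges up to q^q, while its untwisted form is only controlled for |x| < q; hence the twist j
    + 1 in [Sf]. *)
Definition rho : R := q%:R + 1.
Lemma rho_gt : q%:R < rho. Proof. by rewrite /rho ltrDl. Qed.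
Lemma rho_gt0 : 0 < rho. Proof. exact: lt_trans qR_gt0 rho_gt. Qed.
Lemma rho_le j : rho <= q%:R ^+ (q ^ j.+1).
Proof.
apply: (@le_trans _ _ (q%:R ^+ 2)); last first.
  rewrite ler_weXn2l ?qR_ge1 //; apply: leq_trans q_gt1 _; rewrite -{1}(expn1 q) leq_pexp2l ?q_gt0 //.
have h : 2%:R <= q%:R :> R by rewrite ler_nat q_gt1.
rewrite /rho expr2; nra.
Qed.

Section Seq.
Variables (g : {poly C}) (r : nat) (y : nat -> C) (B : R).
Hypothesis g0 : g`_0 = theta.
Hypothesis sg : size g = r.+1.
Hypothesis yS : forall k, skew_eval q g (y k.+1) = y k.
Hypothesis y0 : skew_eval q g (y 0%N) = 0.
Hypothesis yB : forall k, nrm (y k) <= B * q%:R ^- k.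

Lemma Sf_gle j : gle rho (B ^+ (q ^ j.+1)) (fun k => y k ^+ (q ^ j.+1)).
Proof.
move=> k; rewrite nrmX.
have h : nrm (y k) * q%:R ^+ k <= B by rewrite -ler_pdivlMr ?qX_gt0.
have B0 : 0 <= B by apply: le_trans h; rewrite mulr_ge0 ?nrm_ge0 // ltW ?qX_gt0.
apply: (@le_trans _ _ ((nrm (y k) * q%:R ^+ k) ^+ (q ^ j.+1))); last first.
  by rewrite lerXn2r ?nnegrE // mulr_ge0 ?nrm_ge0 // ltW ?qX_gt0.
rewrite exprMn ler_wpM2l ?exprn_ge0 ?nrm_ge0 // exprAC.
by rewrite lerXn2r ?nnegrE ?rho_le // ltW ?rho_gt0 // qX_gt0.
Qed.
Lemma Sf_sums j x : nrm x < rho -> sums (fun k => y k ^+ (q ^ j.+1)) x (Sf y j x).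
Proof.
by move=> xr; have [l hl] := gle_sums rho_gt0 (Sf_gle j) xr; rewrite /Sf (psumE hl).
Qed.
Lemma Sf_an j : analytic rho (Sf y j).
Proof. by exists (B ^+ (q ^ j.+1)), (fun k => y k ^+ (q ^ j.+1)); split; [exact: Sf_gle | exact: Sf_sums]. Qed.
Lemma Sf_tw j x : nrm (x ^+ q) < rho -> Sf y j x ^+ q = Sf y j.+1 (x ^+ q).
Proof.
move=> xr; have rho1 : 1 < rho by apply: lt_trans qR_gt1 rho_gt.
have xr' : nrm x < rho by have := @nrm_root_lt rho x 0 rho1; rewrite expn0 expr1 expn1; exact.
apply: cvg_uniq (Sf_sums j.+1 xr).
apply: (@cvg_ext _ _ _ 0 _ (cvgX q (Sf_sums j xr'))) => m _.
by rewrite frq_sum; apply: eq_bigr => k _; rewrite exprMn -frS exprAC.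
Qed.
(** This is phi_theta(y_(k+1)) = y_k raised to the power q and summed against x^(k+1), with
    phi_theta(y_0) = 0 as the initial term. *)
Lemma Sf_rel x : nrm x < rho -> \sum_(j < r.+1) g`_j ^+ q * Sf y j x = x * Sf y 0 x.
Proof.
move=> xr; have h1 := cvg_sum (index_enum 'I_r.+1) (P := xpredT) (fun (j : 'I_r.+1) _ => cvgZ (g`_j ^+ q) (Sf_sums j xr)).
have h2 := cvgZ x (Sf_sums 0 xr).
apply: (cvg_uniq (cvg_shift 1 h1)); apply: (@cvg_ext _ _ _ 0 _ h2) => m _; rewrite addn1.
have e k : \sum_(j < r.+1) g`_j ^+ q * y k ^+ (q ^ j.+1) = (skew_eval q g (y k)) ^+ q.
  rewrite /skew_eval frq_sum sg; apply: eq_bigr => j _; by rewrite exprMn frS.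
transitivity (\sum_(k < m.+1) (skew_eval q g (y k)) ^+ q * x ^+ k); last first.
  under [RHS]eq_bigr => j _ do rewrite mulr_sumr.
  rewrite exchange_big; apply: eq_bigr => k _; rewrite -e mulr_suml.
  by apply: eq_bigr => j _; rewrite mulrA.
rewrite big_ord_recl y0 expr0n gtn_eqF ?q_gt0 // mul0r add0r mulr_sumr; apply: eq_bigr => k _.
by rewrite /bump /= yS exprS expn1 mulrCA.
Qed.
(** The sum of (phi_theta(y_k) - theta y_k) theta^k over k <= m telescopes to - theta^(m+1) y_m. The
    limit is the residue at theta of the untwisted generating function. *)
Lemma Sf_theta z : cvg (fun m => theta ^+ m.+1 * y m) z -> \sum_(j < r) g`_j.+1 * Sf y j theta = - z.
Proof.
move=> hz; have tr : nrm theta < rho by rewrite nrm_theta rho_gt.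
have h1 := cvg_sum (index_enum 'I_r) (P := xpredT) (fun (j : 'I_r) _ => cvgZ (g`_j.+1) (Sf_sums j tr)).
apply: (cvg_uniq (cvg_shift 1 h1)); apply: (@cvg_ext _ _ _ 0 _ (cvgN hz)) => m _; rewrite addn1.
have e k : \sum_(j < r) g`_j.+1 * y k ^+ (q ^ j.+1) = skew_eval q g (y k) - theta * y k.
  by rewrite /skew_eval sg big_ord_recl g0 expn0 expr1 [RHS]addrAC subrr add0r.
transitivity (\sum_(k < m.+1) (skew_eval q g (y k) - theta * y k) * theta ^+ k); last first.
  under [RHS]eq_bigr => j _ do rewrite mulr_sumr.
  rewrite exchange_big; apply: eq_bigr => k _; rewrite -e mulr_suml.
  by apply: eq_bigr => j _; rewrite mulrA.
elim: m => [|m IH]; first by rewrite big_ord1 y0 sub0r expr0 expr1 mulr1.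
by rewrite big_ord_recr /= -IH yS !exprS; ring.
Qed.
Lemma Sf_0 j : Sf y j 0 = y 0%N ^+ (q ^ j.+1).
Proof.
apply: psumE; apply: (@cvg_ext (fun=> y 0%N ^+ (q ^ j.+1)) _ _ 1 _ (cvg_cst _)) => -[//|m] _.
by rewrite big_ord_recl expr0 mulr1 big1 ?addr0 // => i _; rewrite expr0n mulr0.
Qed.
End Seq.

Lemma det_fr k (m : nat) (M : 'M[C]_m) : (\det M) ^+ (q ^ k) = \det (map_mx (fun x => x ^+ (q ^ k)) M).
Proof.
rewrite /determinant fr_sum; apply: eq_bigr => s _; rewrite exprMn; congr (_ * _).
  by case: (perm.odd_perm s); rewrite ?expr1 ?expr0 ?expr1n // frN expr1n.
by rewrite -prodrXl; apply: eq_bigr => i _; rewrite mxE.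
Qed.

(** A kernel vector is an additive polynomial of degree at most q^(m-1) that vanishes on the
    F_q-span of the y_i, a set with q^m elements. *)
Lemma moore (m : nat) (y : 'I_m -> C) k :
  (forall c, (forall i, Fq (c i)) -> \sum_i c i * y i = 0 -> forall i, c i = 0) ->
  \det (\matrix_(i, j < m) y i ^+ (q ^ (k + j))) != 0.
Proof.
case: m y => [|m] y indep; first by rewrite det_mx00 oner_neq0.
have -> : \matrix_(i, j < m.+1) y i ^+ (q ^ (k + j)) = map_mx (fun x => x ^+ (q ^ k)) (\matrix_(i, j < m.+1) y i ^+ (q ^ j)).
  by apply/matrixP => i j; rewrite !mxE frA addnC.
rewrite -det_fr expf_neq0 // -det_tr; apply/negP => /det0P [v v0 hv].
pose P : {poly C} := \sum_(j < m.+1) v 0 j *: 'X^(q ^ j).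
have Pv j : P`_(q ^ nat_of_ord j) = v 0 j.
  rewrite coef_sum (bigD1 j) //= coefZ coefXn eqxx mulr1 big1 ?addr0 // => i ij.
  by rewrite coefZ coefXn eqn_exp2l ?q_gt1 // eq_sym (inj_eq val_inj) (negPf ij) mulr0.
have P0 : P != 0.
  apply: contraNneq v0 => z; apply/eqP/rowP => j; by rewrite -Pv z coef0 mxE.
have sP : (size P <= (q ^ m).+1)%N.
  apply: (big_ind (fun P : {poly C} => (size P <= (q ^ m).+1)%N)); first by rewrite size_poly0.
    by move=> A B hA hB; apply: leq_trans (size_polyD _ _) _; rewrite geq_max hA.
  move=> j _; apply: leq_trans (size_scale_leq _ _) _; rewrite size_polyXn ltnS leq_pexp2l ?q_gt0 //.
  by rewrite -ltnS.
have Py i : P.[y i] = 0.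
  have := congr1 (fun w : 'rV[C]_m.+1 => w 0 i) hv; rewrite !mxE => <-.
  rewrite horner_sum; apply: eq_bigr => j _; by rewrite hornerZ hornerXn !mxE.
have Padd a b : P.[a + b] = P.[a] + P.[b].
  rewrite !horner_sum -big_split; apply: eq_bigr => j _.
  by rewrite !hornerZ !hornerXn frD mulrDr.
have PZ c a : Fq c -> P.[c * a] = c * P.[a].
  move=> hc; rewrite !horner_sum mulr_sumr; apply: eq_bigr => j _.
  by rewrite !hornerZ !hornerXn exprMn (Fq_fr _ hc) mulrCA.
pose el (i : 'I_q) : C := Fqs`_i.
have elF i : Fq (el i) by apply/FqP; rewrite mem_nth // size_Fqs.
have el_inj : injective el.
  by move=> a b /eqP; rewrite (nth_uniq 0 _ _ Fqs_uniq) ?size_Fqs // => /eqP; exact: val_inj.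
pose f (c : {ffun 'I_m.+1 -> 'I_q}) := \sum_i el (c i) * y i.
have f_inj : injective f.
  move=> c c' ff; apply/ffunP => i; apply: el_inj; apply/eqP; rewrite -subr_eq0; apply/eqP.
  apply: (indep (fun i => el (c i) - el (c' i))) => [l|]; first exact: FqB.
  under eq_bigr => l _ do rewrite mulrBl.
  by rewrite sumrB -/(f c) -/(f c') ff subrr.
have := @max_poly_roots _ P [seq f c | c : {ffun 'I_m.+1 -> 'I_q}] P0.
rewrite map_inj_uniq ?enum_uniq // size_map -cardE card_ffun !card_ord => h.
have : (q ^ m.+1 < size P)%N.
  apply: h => //; apply/allP => x /mapP [c _ ->]; rewrite /root; apply/eqP.
  rewrite /f; elim/big_ind: _ => //; last by move=> i _; rewrite PZ // Py mulr0.
    by have := Padd 0 0; rewrite addr0 => /eqP; rewrite eq_sym -subr_eq0 addrK => /eqP.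
  by move=> a b ha hb'; rewrite Padd ha hb' addr0.
by move/leq_trans => /(_ _ sP); rewrite ltnS leq_exp2l ?q_gt1 // ltnn.
Qed.

(** * The function Omega and the Carlitz period *)

Section Omega.
Variable omega : C.
Hypothesis om : omega ^+ (q - 1) = - theta.
Lemma omega_neq0 : omega != 0.
Proof.
apply: contraTneq theta_neq0 => z; move/eqP: om; rewrite z expr0n subn_eq0 leqNgt q_gt1 /=.
by rewrite eq_sym oppr_eq0 negbK => ->.
Qed.
Lemma omq : omega ^+ q = - theta * omega.
Proof. by rewrite -om -exprSr subn1 prednK ?q_gt0. Qed.
(** Partial products of Omega. The factor omega^(-q), that is (-theta)^(-q/(q-1)), is the
    normalisation for which the functional equation in [Om_facts] has no extra constant. *)
Definition POm (N : nat) : {poly C} := (omega ^- q)%:P * \prod_(1 <= i < N.+1) (1 - (theta ^- (q ^ i)) *: 'X).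
Lemma POm_val N x : (POm N).[x] = omega ^- q * \prod_(1 <= i < N.+1) (1 - x / theta ^+ (q ^ i)).
Proof.
rewrite hornerM hornerC horner_prod; congr (_ * _); apply: eq_bigr => i _.
by rewrite !hornerE mulrC.
Qed.
Lemma Om_ex : exists Om, analytic rho Om /\ forall x, cvg (fun N => (POm N).[x]) (Om x).
Proof.
have [|N|N i|c [hc _ h]] := @infprod POm (fun N => 1 - (theta ^- (q ^ N.+1)) *: 'X) 1 ltr01.
- by move=> N; rewrite /POm big_nat_recr //= mulrA.
- by rewrite coefB coef1 coefZ coefX mulr0 subr0.
- rewrite coefB coef1 coefZ coefX mul1r; case: i => [|[|i]] /=.
  + by rewrite mulr0 subr0 nrm1 expr0 invr1.
  + rewrite sub0r mulr1 nrmN nrmV nrm_thetaX expr1 lef_pV2 ?posrE ?qX_gt0 //.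
    by rewrite ler_weXn2l ?qR_ge1 //; apply: leq_trans (ltnW (ltn_expl N.+1 q_gt1)); exact: leqnSn.
  + by rewrite mulr0 subr0 nrm0 invr_ge0 exprn_ge0 // ltW ?qX_gt0.
have [f hf] := fchoice h.
exists f; split; last by move=> x; case: (hf x).
have [N hN] := hc _ rho_gt0 1 ltr01.
pose c' : {poly C} := \poly_(i < N) c i; have [B B0 hB] := gle_poly c' rho_gt0.
exists (Num.max 1 B), c; split=> [i|x _]; last by case: (hf x).
have [Ni|iN] := leqP N i; first by rewrite le_max ltW // hN.
by rewrite le_max; apply/orP; right; have := hB i; rewrite coef_poly iN.
Qed.
Lemma Om_facts : exists Om, [/\ analytic rho Om, forall x, Om x ^+ q * (x ^+ q - theta ^+ q) = Om (x ^+ q),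
  Om 0 != 0, pitilde nrm q theta omega != 0 & (pitilde nrm q theta omega)^-1 = - Om theta].
Proof.
have [Om [hOm hl]] := Om_ex; exists Om.
have om0 := omega_neq0; have th0 := theta_neq0.
have Om0 : Om 0 = omega ^- q.
  apply: cvg_uniq (hl 0) _; apply: (@cvg_ext (fun=> omega ^- q) _ _ 0 _ (cvg_cst _)) => N _.
  by rewrite POm_val big1 ?mulr1 // => i _; rewrite mul0r subr0.
have tw x : Om x ^+ q * (x ^+ q - theta ^+ q) = Om (x ^+ q).
  have h1 := cvgM (cvgX q (hl x)) (cvg_cst (x ^+ q - theta ^+ q)).
  apply: (cvg_uniq h1); apply: (@cvg_ext _ _ _ 0 _ (cvg_shift 1 (hl (x ^+ q)))) => N _.
  rewrite addn1 !POm_val big_ltn // exprMn -prodrXl big_add1 /=.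
  under [in RHS]eq_bigr => i _ do rewrite -[X in (X - _) ^+ _](expr1n _ 1) frqB expr_div_n expr1n expr1n -frS.
  set P := \prod_(_ <= i < _) _; rewrite exprVn omq exprMn -[q in (- theta) ^+ q]expn1 frN expn1 omq.
  move: (- theta * omega) => w; rewrite invfM invrN (_ : 1 - _ = - (theta ^+ q)^-1 * (x ^+ q - theta ^+ q)); first by ring.
  by rewrite mulNr mulrBr mulVf ?expf_neq0 // opprB mulrC.
have trho : nrm theta < rho by rewrite nrm_theta rho_gt.
pose L N := \prod_(1 <= i < N.+1) (1 - theta / theta ^+ (q ^ i)).
have nL i : (0 < i)%N -> nrm (1 - theta / theta ^+ (q ^ i)) = 1.
  move=> i0; rewrite nrm_dom ?nrm1 // nrmN nrmf nrm_thetaX nrm_theta ltr_pdivrMr ?qX_gt0 // mul1r.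
  rewrite -{1}(expr1 q%:R) ltr_eXn2l ?qR_gt1 //; apply: leq_trans q_gt1 _.
  by rewrite -{1}(expn1 q) leq_pexp2l ?q_gt0.
(* All factors at theta have norm 1, so the limit cannot be 0. *)
have nLN N : nrm (L N) = 1.
  rewrite /L nrm_prod big_nat_cond big1 // => i /andP[/andP[i0 _] _]; exact: nL.
have cL : cvg L (omega ^+ q * Om theta).
  apply: (@cvg_ext _ _ _ 0 _ (cvgZ (omega ^+ q) (hl theta))) => N _.
  by rewrite POm_val mulVKf // expf_neq0.
have l0 : omega ^+ q * Om theta != 0.
  rewrite -nrm_gt0; apply: contraT; rewrite -leNgt => hle.
  have z : omega ^+ q * Om theta = 0 by apply/eqP; rewrite -nrm_eq0 eq_le hle nrm_ge0.
  have [N hN] := cL 1 ltr01; have := hN N (leqnn N); by rewrite z subr0 nLN ltxx.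
have piE : pitilde nrm q theta omega = theta * omega * (omega ^+ q * Om theta)^-1.
  rewrite /pitilde; congr (_ * _); apply: limCE.
  apply: (@cvg_ext _ _ _ 0 _ (cvgV cL l0)) => N _; by rewrite /L prodfV.
have Omt : Om theta != 0 by move: l0; rewrite mulf_eq0 negb_or => /andP[].
split=> //.
- by rewrite Om0 invr_eq0 expf_neq0.
- by rewrite piE !mulf_neq0 // invr_eq0.
rewrite piE omq !invfM !invrK !mulNr !mulrN; congr (- _).
by rewrite -invfM mulKf ?mulf_neq0.
Qed.
End Omega.

(** * The companion system of the generating functions *)

Section Sys.
Variables (g : {poly C}) (r' : nat) (B : R).
Notation r := r'.+1.
Variable (y : 'I_r -> nat -> C).
Hypothesis g0 : g`_0 = theta.
Hypothesis sg : size g = r.+1.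
Hypothesis gr : g`_r = 1.
Hypothesis gK : forall j, inKbar' g`_j.
Hypothesis yS : forall i k, skew_eval q g (y i k.+1) = y i k.
Hypothesis y0 : forall i, skew_eval q g (y i 0%N) = 0.
Hypothesis yB : forall i k, nrm (y i k) <= B * q%:R ^- k.
Hypothesis y_ind : forall c, (forall i, Fq (c i)) -> \sum_i c i * y i 0%N = 0 -> forall i, c i = 0.

(** Companion matrix: the last row solves [Sf_rel] for the r-th twist, which needs g_r = 1. Its
    first entry collects x Sf_0 - g_0^q Sf_0. *)
Definition Cm (j l : 'I_r) : {poly C} :=
  if (j.+1 < r)%N then (nat_of_ord l == j.+1)%:R
  else if nat_of_ord l == 0%N then 'X - (theta ^+ q)%:P else - (g`_l ^+ q)%:P.
Lemma Cm_eq i (j : 'I_r) x : nrm x < rho -> Sf (y i) j.+1 x = \sum_l (Cm j l).[x] * Sf (y i) l x.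
Proof.
move=> xr; rewrite /Cm; case: ltnP => jr.
  rewrite (bigD1 (Ordinal jr)) //= eqxx hornerC mul1r big1 ?addr0 // => l ne.
  rewrite (_ : (nat_of_ord l == j.+1) = false) ?hornerC ?mul0r //; apply/negP => /eqP e.
  by move/eqP: ne; apply; apply: val_inj.
have -> : j.+1 = r by apply/eqP; rewrite eqn_leq jr andbT; exact: (ltn_ord j).
have := Sf_rel sg (yS i) (y0 i) (yB i) xr.
rewrite big_ord_recr /= gr expr1n mul1r big_ord_recl g0 => e.
rewrite big_ord_recl /= !hornerE.
rewrite mulrBl (eq_bigr (fun l : 'I_r' => - (g`_(lift ord0 l) ^+ q * Sf (y i) (lift ord0 l) x))).
  by rewrite -e sumrN; ring.
by move=> l _; rewrite /= !hornerE mulNr.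
Qed.
Definition Smx (x : C) : 'M[C]_r := \matrix_(i, j) Sf (y i) j x.
Definition Cmx (x : C) : 'M[C]_r := \matrix_(j, l) (Cm j l).[x].
Lemma Smx_tw x : nrm (x ^+ q) < rho -> map_mx (fun a => a ^+ q) (Smx x) = Smx (x ^+ q) *m (Cmx (x ^+ q))^T.
Proof.
move=> xr; apply/matrixP => i j; rewrite !mxE (Sf_tw (yB i)) // (Cm_eq i j xr).
by apply: eq_bigr => l _; rewrite !mxE mulrC.
Qed.
Lemma det_Cmx x : \det (Cmx x) = (-1) ^+ r' * (x - theta ^+ q).
Proof.
rewrite (expand_det_col _ ord0) (bigD1 ord_max) //= big1 ?addr0; last first.
  move=> j ne; rewrite mxE /Cm ltnS ltn_neqAle leq_ord andbT ne /=.
  by rewrite hornerC mul0r.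
rewrite mxE /Cm /= ltnn /= !hornerE /cofactor.
rewrite (_ : row' _ _ = 1%:M) ?det1; first by rewrite /= mulr1 mulrC.
apply/matrixP => i j; rewrite !mxE /Cm.
have -> : nat_of_ord (lift ord_max i) = i by exact: lift_max.
rewrite !ltnS ltn_ord (_ : nat_of_ord (lift ord0 j) = j.+1) // eqSS.
by rewrite eq_sym (inj_eq val_inj); case: (i == j); rewrite hornerE.
Qed.
Lemma det_tw x : nrm (x ^+ q) < rho ->
  \det (Smx x) ^+ q = (-1) ^+ r' * (x ^+ q - theta ^+ q) * \det (Smx (x ^+ q)).
Proof.
move=> xr; rewrite -[q in _ ^+ q]expn1 det_fr expn1 Smx_tw // det_mulmx det_tr det_Cmx; ring.
Qed.
Lemma det_an : analytic rho (fun x => \det (Smx x)).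
Proof.
apply: an_sum rho_gt0 _ => s _; apply: anM rho_gt0 _ _; first exact: an_cst rho_gt0.
apply: an_prod rho_gt0 _ => i _.
have h j := Sf_an (yB i) j; apply: an_ext (h (perm.fun_of_perm s i)) => x _; by rewrite mxE.
Qed.
Lemma det_0 : \det (Smx 0) != 0.
Proof.
rewrite (_ : Smx 0 = \matrix_(i, j < r) y i 0%N ^+ (q ^ (1 + j))); first exact: moore.
by apply/matrixP => i j; rewrite !mxE Sf_0.
Qed.

(* Legendre relation: Omega * det is fixed by the twist up to sign, hence is a
   polynomial with coefficients algebraic over F_q. *)
Lemma legendre Om : analytic rho Om -> (forall x, Om x ^+ q * (x ^+ q - theta ^+ q) = Om (x ^+ q)) ->
  Om 0 != 0 -> inKbar' (Om theta * \det (Smx theta)) /\ Om theta * \det (Smx theta) != 0.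
Proof.
move=> hOm Omtw Om0; pose G x := Om x * \det (Smx x).
have Gtw x : nrm (x ^+ q) < rho -> G x ^+ q = (-1) ^+ r' * G (x ^+ q).
  by move=> xr; rewrite /G exprMn det_tw // -Omtw; ring.
have [BG [c [gc hc]]] : analytic rho G by apply: anM => //; [exact: rho_gt0 | exact: det_an].
have rho1 : 1 < rho by apply: lt_trans qR_gt1 rho_gt.
(* Both sides of [Gtw] are series in x^q whose coefficients are compared. *)
have cq i : c i ^+ q = (-1) ^+ r' * c i.
  apply/eqP; rewrite -subr_eq0; apply/eqP; move: i.
  have BG0 := gle_ge0 gc.
  have g1 : gle 1 (Num.max (BG ^+ q) BG) (fun i => c i ^+ q - (-1) ^+ r' * c i).
    have cb i : nrm (c i) <= BG by apply: le_trans (gc i); rewrite ler_peMr ?nrm_ge0 // exprn_ege1 // ltW.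
    apply: gleB => i; rewrite expr1n mulr1.
      by rewrite nrmX le_max lerXn2r ?nnegrE ?nrm_ge0 // cb.
    by rewrite nrmM nrmX nrmN nrm1 expr1n mul1r le_max cb orbT.
  apply: (series_zero ltr01 g1) => x _ x1.
  have xr : nrm x < rho by apply: lt_trans rho1.
  have x'r := frt_lt 1 rho1 xr; have xE : frt 1 x ^+ q = x by have := frtK 1 x; rewrite expn1.
  have h1 := cvgX q (hc _ x'r); have h2 := cvgZ ((-1) ^+ r') (hc _ xr).
  have := Gtw (frt 1 x); rewrite xE => /(_ xr) e.
  have := cvgB h1 h2; rewrite e subrr; apply: (@cvg_ext _ _ _ 0) => m _.
  rewrite frq_sum mulr_sumr -sumrB; apply: eq_bigr => i _.
  by rewrite exprMn exprAC xE mulrBl mulrA.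
have cn i : c i != 0 -> nrm (c i) = 1.
  move=> ci; have := congr1 nrm (cq i); rewrite nrmX nrmM nrmX nrmN nrm1 expr1n mul1r -{1}(prednK q_gt0) exprS.
  rewrite -[RHS]mulr1 => /(mulfI _); rewrite nrm_eq0 => /(_ ci) /eqP.
  by rewrite pexpr_eq1 ?nrm_ge0 -?subn1 ?subn_gt0 ?q_gt1 // => /eqP.
(* Non-zero coefficients have norm 1, but the Gauss norm is finite on a disc of radius above 1, so
   all but finitely many vanish. *)
have [N hN] := expr_unbounded BG rho1.
have cz i : (N <= i)%N -> c i = 0.
  move=> Ni; apply/eqP; apply: contraT => ci; have := gc i; rewrite (cn i ci) mul1r.
  by rewrite leNgt hN.
have c0 : c 0%N != 0.
  have := hc 0 (_ : nrm 0 < rho); rewrite nrm0 => /(_ rho_gt0) h.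
  have -> : c 0%N = G 0.
    apply: cvg_uniq _ h; apply: (@cvg_ext (fun=> c 0%N) _ _ 1 _ (cvg_cst _)) => -[//|m] _.
    by rewrite big_ord_recl expr0 mulr1 big1 ?addr0 // => i _; rewrite expr0n mulr0.
  by rewrite /G mulf_neq0 // det_0.
have trho : nrm theta < rho by rewrite nrm_theta rho_gt.
have GE : G theta = \sum_(i < N) c i * theta ^+ i.
  apply: cvg_uniq (hc _ trho) _; apply: (@cvg_ext (fun=> \sum_(i < N) c i * theta ^+ i) _ _ N _ (cvg_cst _)) => m hm.
  rewrite -!(big_mkord xpredT (fun i => c i * theta ^+ i)) (big_cat_nat _ hm) //= -[LHS]addr0; congr (_ + _).
  by rewrite big_nat_cond big1 // => i /andP[/andP[Ni _] _]; rewrite cz ?mul0r.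
have cK i : inKbar' (c i).
  exists ('X^q - (-1) ^+ r' *: 'X); split; last split.
  - apply/negP => /eqP /(congr1 (fun P : {poly C} => P`_q)).
    rewrite coefB coefXn eqxx coefZ coefX gtn_eqF ?q_gt1 // mulr0 subr0 coef0 => /eqP.
    by rewrite oner_eq0.
  - move=> k; rewrite coefB coefXn coefZ coefX; apply: (sfB inK_sf).
      by case: eqP => _; [exact: (sf1 inK_sf) | exact: (sf0 inK_sf)].
    apply: (sfM inK_sf); first by apply: (sfX inK_sf); apply: (sfN inK_sf); exact: (sf1 inK_sf).
    by case: eqP => _; [exact: (sf1 inK_sf) | exact: (sf0 inK_sf)].
  - by rewrite /root !hornerE cq subrr.
split; last first.
  rewrite -/(G theta) GE.
  pose Q : {poly C} := \poly_(i < N) c i.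
  have Q0 : Q != 0.
    apply: contraNneq c0 => z; have := congr1 (fun P : {poly C} => P`_0) z; rewrite coef_poly coef0.
    by case: (posnP N) => [N0|N0 -> //]; rewrite (cz 0%N) ?N0.
  have QE : \sum_(i < N) c i * theta ^+ i = Q.[theta] by rewrite horner_poly.
  have Qn i : nrm Q`_i <= 1.
    rewrite coef_poly; case: ifP => _; last by rewrite nrm0.
    by have [->|/cn ->] := eqVneq (c i) 0; rewrite ?nrm0.
  have lQ : nrm (lead_coef Q) = 1.
    have : lead_coef Q != 0 by rewrite lead_coef_eq0.
    rewrite /lead_coef coef_poly; case: ifP => _; [exact: cn | by rewrite eqxx].
  have s0 : (0 < size Q)%N by rewrite size_poly_gt0.
  have hl : nrm (lead_coef Q * theta ^+ (size Q).-1) = q%:R ^+ (size Q).-1.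
    by rewrite nrmM lQ mul1r nrm_thetaX.
  rewrite QE -nrm_gt0 horner_coef -(prednK s0) big_ord_recr /= addrC nrm_dom -/(lead_coef Q) ?hl ?qX_gt0 //.
  apply: nrm_sum_lt => [|i _]; first exact: qX_gt0.
  rewrite nrmM nrm_thetaX; apply: (@le_lt_trans _ _ (q%:R ^+ i)).
    by rewrite ler_piMl // ltW ?qX_gt0.
  by rewrite ltr_eXn2l ?qR_gt1.
rewrite -/(G theta) GE.
have [I [b [hb hs]]] := @fg_exists [seq c i | i <- iota 0 N] (fun x => ltac:(by move=> /mapP [i _ ->])).
have hG : spanK b (\sum_(i < N) c i * theta ^+ i).
  apply: spanK_sum => i _; rewrite mulrC; apply: spanKZ.
    by apply: (sfX inK_sf); apply: inA_K; exact: inA_theta.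
  by apply: hs; apply/mapP; exists (nat_of_ord i); rewrite // mem_iota /= add0n ltn_ord.
exact: fg_alg hb hG.
Qed.
End Sys.

(** * Valuation rings *)
Definition subrng (B : C -> Prop) := [/\ B 1, forall x y, B x -> B y -> B (x + y),
  forall x, B x -> B (- x) & forall x y, B x -> B y -> B (x * y)].
Section Subring.
Variable B : C -> Prop.
Hypothesis hB : subrng B.
Lemma sr1 : B 1. Proof. by case: hB. Qed.
Lemma srD x y : B x -> B y -> B (x + y). Proof. by case: hB => _ h _ _; apply: h. Qed.
Lemma srN x : B x -> B (- x). Proof. by case: hB => _ _ h _; apply: h. Qed.
Lemma srM x y : B x -> B y -> B (x * y). Proof. by case: hB => _ _ _; apply. Qed.
Lemma srB x y : B x -> B y -> B (x - y). Proof. by move=> hx hy; apply: srD => //; apply: srN. Qed.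
Lemma sr0 : B 0. Proof. by rewrite -(subrr 1); apply: srB; exact: sr1. Qed.
Lemma srX x k : B x -> B (x ^+ k).
Proof. by move=> hx; elim: k => [|k IH]; rewrite ?expr0 ?exprS; [exact: sr1 | exact: srM]. Qed.
Lemma sr_sum (T : Type) (s : seq T) (D : pred T) (G : T -> C) :
  (forall i, D i -> B (G i)) -> B (\sum_(i <- s | D i) G i).
Proof. by move=> h; elim/big_ind: _ => //; [exact: sr0 | exact: srD]. Qed.
Lemma sr_nat k : B k%:R.
Proof. by elim: k => [|k IH]; [exact: sr0 | rewrite -addn1 natrD; apply: srD => //; exact: sr1]. Qed.

Definition adj u y := exists P : {poly C}, (forall k, B P`_k) /\ y = P.[u].
Lemma adj_B u y : B y -> adj u y.
Proof.
move=> hy; exists y%:P; split=> [k|]; last by rewrite hornerC.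
by rewrite coefC; case: eqP => _ //; exact: sr0.
Qed.
Lemma adj_gen u : adj u u.
Proof.
exists 'X; split=> [k|]; last by rewrite hornerX.
by rewrite coefX; exact: sr_nat.
Qed.
Lemma adj_rng u : subrng (adj u).
Proof.
split.
- exact: adj_B sr1.
- move=> _ _ [P [hP ->]] [Q [hQ ->]]; exists (P + Q); split=> [k|]; last by rewrite hornerD.
  by rewrite coefD; apply: srD.
- move=> _ [P [hP ->]]; exists (- P); split=> [k|]; last by rewrite hornerN.
  by rewrite coefN; apply: srN.
- move=> _ _ [P [hP ->]] [Q [hQ ->]]; exists (P * Q); split=> [k|]; last by rewrite hornerM.
  by rewrite coefM; apply: sr_sum => i _; apply: srM.
Qed.
End Subring.

Lemma subfld_rng (F : C -> Prop) : subfld F -> subrng F.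
Proof. by move=> hF; split; [exact: sf1 | exact: sfD | exact: sfN | exact: sfM]. Qed.

(** A maximal ring of this kind will be a valuation ring; having 1/x but not x in it places 1/x in
    the maximal ideal. *)
Definition xring (F : C -> Prop) x (S : C -> Prop) :=
  [/\ subrng S, forall y, F y -> S y, S x^-1 & ~ S x].

(** An equation x = P(1/x) over F would make x algebraic over F. *)
Lemma xring_start F x : subfld F -> (forall y, algebraic_over F y -> F y) -> ~ F x -> xring F x (adj F x^-1).
Proof.
move=> hF algF hx; have hR := subfld_rng hF.
split; [exact: adj_rng | by move=> y; exact: adj_B | exact: adj_gen|].
have x0 : x != 0 by apply: contra_notN hx => /eqP ->; exact: sf0.
move=> [P [hP xP]]; apply: hx; apply: algF.
pose d := size P; exists ('X^(d.+1) - \poly_(j < d.+1) P`_(d - j)); split; last split.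
- apply: monic_neq0; rewrite monicE lead_coefDl ?lead_coefXn //.
  by rewrite size_polyN size_polyXn ltnS size_poly.
- move=> k; rewrite coefB coefXn coef_poly; apply: sfB => //.
    by case: eqP => _; [exact: sf1 | exact: sf0].
  by case: ifP => _ //; exact: sf0.
- rewrite /root hornerD hornerN hornerXn horner_poly subr_eq0 exprSr {2}xP.
  rewrite (@horner_coef_wide _ d.+1) ?leqnSn // mulr_sumr (reindex_inj rev_ord_inj) /=; apply/eqP.
  apply: eq_bigr => i _; rewrite subSS mulrCA; congr (_ * _).
  have id : (i <= d)%N by rewrite -ltnS.
  by rewrite exprVn -{1}(subnK id) addnC exprD mulfK // expf_neq0.
Qed.

Lemma xring_max F x : subfld F -> (forall y, algebraic_over F y -> F y) -> ~ F x ->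
  exists B, xring F x B /\ forall S, (forall y, B y -> S y) -> xring F x S -> forall y, S y -> B y.
Proof.
move=> hF algF hx; have h0 := xring_start hF algF hx.
(* The union of the empty chain is empty; the guard admits the empty set so that Zorn's lemma
   applies. *)
pose P (S : set C) := (exists y, S y) -> xring F x S.
have [|B [PB hB]] := @Zorn_bigcup C P.
  move=> G GP tot [y [S0 GS0 S0y]].
  have good S y' : G S -> S y' -> xring F x S by move=> GS Sy; apply: GP => //; exists y'.
  have h1 := good _ _ GS0 S0y.
  have two a b : (\bigcup_(S in G) S)%classic a -> (\bigcup_(S in G) S)%classic b -> exists S, [/\ G S, S a & S b].
    move=> [S GS Sa] [S' GS' Sb]; have [h|h] := tot _ _ GS GS'.
      by exists S'; split=> //; apply: h.
    by exists S; split=> //; apply: h.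
  split.
  - split.
    + by exists S0 => //; case: h1 => /sr1.
    + move=> a b ha hb; have [S [GS Sa Sb]] := two a b ha hb; exists S => //.
      by case: (good _ _ GS Sa) => hS _ _ _; apply: srD.
    + move=> a [S GS Sa]; exists S => //; by case: (good _ _ GS Sa) => hS _ _ _; apply: srN.
    + move=> a b ha hb; have [S [GS Sa Sb]] := two a b ha hb; exists S => //.
      by case: (good _ _ GS Sa) => hS _ _ _; apply: srM.
  - by move=> a Fa; exists S0 => //; case: h1 => _ h _ _; apply: h.
  - by exists S0 => //; case: h1.
  - by move=> [S GS Sx]; case: (good _ _ GS Sx).
have Bne : exists y, B y.
  apply: contrapT => Bn; apply: (hB (adj F x^-1)); last by move=> _.
  split; first by move=> y By; case: Bn; exists y.
  by move=> h; case: Bn; exists 1; apply: h; case: h0 => /sr1.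
exists B; split; first exact: PB.
move=> S BS hS y Sy; apply: contrapT => nBy; apply: (hB S); last by move=> _.
by split=> // h; apply: nBy; exact: h.
Qed.

(** Chevalley's argument. By maximality, u outside B gives x in B[u], hence 1 = P(u) with
    coefficients in x^(-1) B. If 1/u is also outside B, the two relations lower each other's degree
    until one becomes constant, which would put x in B. *)
Lemma val_ring F x : subfld F -> (forall y, algebraic_over F y -> F y) -> ~ F x ->
  exists B, [/\ subrng B, forall y, F y -> B y, ~ B x & forall u, B u \/ B u^-1].
Proof.
move=> hF algF hx; have [B [[rB FB Bt nBx] hmax]] := xring_max hF algF hx.
exists B; split=> // u.
have x0 : x != 0 by apply: contra_notN hx => /eqP ->; exact: sf0.
(* Otherwise x = P(1/w) with w = 1 - a/x. Every x w^n equals x plus an element of B, so multiplying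
   by a high power of w puts x in B. *)
have jac a : B a -> B (1 - x^-1 * a)^-1.
  move=> Ba; set w := 1 - _; apply: contrapT => nw.
  have Bw : B w by apply: srB => //; [exact: sr1 | exact: srM].
  have [P [hP xP]] : adj B w^-1 x.
    apply: contrapT => nx; apply: nw; apply: (hmax (adj B w^-1)); last exact: adj_gen.
      by move=> y; exact: adj_B.
    split=> //; [exact: adj_rng | by move=> y Fy; apply: adj_B => //; exact: FB | exact: adj_B].
  have w0 : w != 0 by apply: contra_notN nw => /eqP ->; rewrite invr0; exact: sr0.
  have xw k : exists2 b, B b & x * w ^+ k = x + b.
    elim: k => [|k [b Bb e]]; first by exists 0; [exact: sr0 | rewrite expr0 mulr1 addr0].
    exists (b * w - a); last by rewrite exprSr mulrA e mulrDl /w mulrBr mulr1 mulVKf //; ring.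
    by apply: srB => //; apply: srM.
  have [b Bb e] := xw (size P); apply: nBx.
  have -> : x = (\sum_(i < size P) P`_i * w ^+ (size P - i)) - b.
    rewrite -[LHS](addrK b) -e {1}xP horner_coef mulr_suml; congr (_ - _); apply: eq_bigr => i _.
    rewrite -mulrA; congr (_ * _); have iP := ltnW (ltn_ord i).
    have -> : w ^+ size P = w ^+ i * w ^+ (size P - i) by rewrite -exprD subnKC.
    by rewrite exprVn mulKf // expf_neq0.
  by apply: srB => //; apply: sr_sum => // i _; apply: srM => //; exact: srX.
pose I n u := exists P : {poly C}, [/\ (size P <= n.+1)%N, forall k, B (x * P`_k) & P.[u] = 1].
have I0 v : ~ I 0%N v.
  move=> [P [sP hP]]; rewrite (size1_polyC sP) hornerC => P1; apply: nBx.
  by have := hP 0%N; rewrite P1 mulr1.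
(* The relation in 1/v, of degree at most that of the relation in v, rewrites the top power of v;
   its constant term is absorbed in the unit 1 - Q_0. *)
have red n m v : v != 0 -> (m < n.+1)%N -> I n.+1 v -> I m.+1 v^-1 -> I n v.
  move=> v0 mn [P [sP hP P1]] [Q [sQ hQ Q1]].
  have Bc k : B (P`_k) by rewrite -[P`_k](mulKf x0); apply: srM.
  pose w := (1 - Q`_0)^-1.
  have Bw : B w by rewrite /w -[Q`_0](mulKf x0); exact: jac.
  have u1 : 1 - Q`_0 != 0.
    rewrite subr_eq0; apply/negP => /eqP e; apply: nBx; by have := hQ 0%N; rewrite -e mulr1.
  have Qv : 1 = w * \sum_(i < m.+1) Q`_i.+1 * v ^- i.+1.
    rewrite /w; apply: (mulfI u1); rewrite mulr1 mulVKf // -{1}Q1 (horner_coef_wide _ sQ) big_ord_recl.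
    by rewrite expr0 mulr1 addrC addKr; apply: eq_bigr => i _; rewrite exprVn.
  exists (\poly_(k < n.+1) (P`_k + P`_n.+1 * w * (if (n - k < m.+1)%N then Q`_(n - k).+1 else 0))); split.
  - exact: size_poly.
  - move=> k; rewrite coef_poly; case: ifP => _; last by rewrite mulr0; exact: sr0.
    rewrite mulrDr; apply: srD => //; rewrite mulrCA; apply: srM => //; first exact: srM.
    by case: ifP => _ //; rewrite mulr0; exact: sr0.
  - rewrite horner_poly -[RHS]P1 (horner_coef_wide _ sP) [RHS]big_ord_recr /=.
    under eq_bigr => k _ do rewrite mulrDl.
    rewrite big_split /=; congr (_ + _).
    transitivity (P`_n.+1 * w * (\sum_(i < m.+1) Q`_i.+1 / v ^+ i.+1) * v ^+ n.+1); last first.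
      by rewrite -[P`_n.+1 * w * _]mulrA -Qv mulr1.
    rewrite mulr_sumr mulr_suml (reindex_inj rev_ord_inj) /=.
    under eq_bigr => i _ do rewrite subSS.
    rewrite -(big_mkord xpredT (fun k => P`_n.+1 * w * (if (n - (n - k) < m.+1)%N then Q`_(n - (n - k)).+1 else 0) * v ^+ (n - k))).
    rewrite (big_cat_nat (n := m.+1)) //= [X in _ + X]big_nat_cond [X in _ + X]big1 ?addr0; last first.
      move=> k /andP[/andP[mk kn] _]; rewrite subKn // ltnNge mk /= mulr0 mul0r //.
    rewrite big_mkord; apply: eq_bigr => k _; have kn : (k <= n)%N by move: (ltn_ord k) mn; lia.
    rewrite subKn // ltn_ord -!mulrA; congr (_ * (_ * (_ * _))).
    by rewrite -[n.+1](@subnK k.+1 n.+1) // subSS exprD mulrC mulfK // expf_neq0.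
have key N : forall n m v, v != 0 -> (n + m <= N)%N -> I n v -> I m v^-1 -> False.
  elim: N => [|N IH] n m v v0; first by rewrite leqn0 addn_eq0 => /andP[/eqP -> _] /I0.
  case: n => [_ /I0//|n]; case: m => [_ _ /I0//|m]; move=> le h1 h2.
  have [mn|nm] := ltnP m n.+1.
    by apply: (IH n m.+1 v v0 le) => //; exact: red _ _ _ v0 mn h1 h2.
  apply: (IH n.+1 m v v0 _ h1); first by move: le; rewrite addnS.
  by apply: (red m n v^-1) => //; [rewrite invr_eq0 | exact: ltnW | rewrite invrK].
apply: contrapT => /not_orP [n1 n2].
have u0 : u != 0 by apply: contra_notN n1 => /eqP ->; exact: sr0.
have gen v : ~ B v -> exists n, I n v.
  move=> nv; have [P [hP xP]] : adj B v x.
    apply: contrapT => nx; apply: nv; apply: (hmax (adj B v)); last exact: adj_gen.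
      by move=> y; exact: adj_B.
    split=> //; [exact: adj_rng | by move=> y Fy; apply: adj_B => //; exact: FB | exact: adj_B].
  exists (size P), (x^-1 *: P); split.
  - by apply: leq_trans (size_scale_leq _ _) _.
  - by move=> k; rewrite coefZ mulVKf.
  - by rewrite hornerZ -xP mulVf.
have [n hn] := gen u n1; have [m hm] := gen u^-1 n2.
exact: key u0 (leqnn _) hn hm.
Qed.

Section Val.
Variable B : C -> Prop.
Hypothesis hB : subrng B.
Hypothesis hv : forall u, B u \/ B u^-1.
(** The maximal ideal of B. Elements outside B are excluded as well, since their inverses lie in
    B. *)
Definition mm u := ~ (u != 0 /\ B u^-1).
Lemma mm_B u : mm u -> B u.
Proof.
move=> h; have [->|u0] := eqVneq u 0; first exact: sr0.
by have [//|h'] := hv u; case: h.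
Qed.
Lemma mm0 : mm 0. Proof. by move=> []; rewrite eqxx. Qed.
Lemma mm1 : ~ mm 1. Proof. by apply; rewrite oner_neq0 invr1; split=> //; exact: sr1. Qed.
Lemma mm_n u : ~ mm u -> u != 0 /\ B u^-1. Proof. exact: contrapT. Qed.
Lemma mm_V u : ~ B u -> mm u^-1.
Proof. by move=> h []; rewrite invrK. Qed.
Lemma mmM u b : mm u -> B b -> mm (u * b).
Proof.
move=> hu hb []; rewrite mulf_eq0 negb_or => /andP[u0 b0] h; apply: hu; split=> //.
by have := srM hB hb h; rewrite invfM mulrCA mulfV // mulr1.
Qed.
Lemma mmMl u b : mm u -> B b -> mm (b * u). Proof. by rewrite mulrC; exact: mmM. Qed.
Lemma mmD u v : mm u -> mm v -> mm (u + v).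
Proof.
move=> hu hw; have [->|v0] := eqVneq v 0; first by rewrite addr0.
have [->|u0] := eqVneq u 0; first by rewrite add0r.
have [h|h] := hv (u / v).
  rewrite (_ : u + v = v * (u / v + 1)); last by rewrite mulrDr mulr1 mulrC divfK.
  by apply: mmM => //; apply: srD => //; exact: sr1.
rewrite (_ : u + v = u * (1 + (u / v)^-1)); last by rewrite mulrDr mulr1 invf_div mulrC divfK.
by apply: mmM => //; apply: srD => //; exact: sr1.
Qed.
Lemma mmN u : mm u -> mm (- u).
Proof. by move=> h; rewrite -mulrN1; apply: mmM => //; apply: srN => //; exact: sr1. Qed.
Lemma mmB u v : mm u -> mm v -> mm (u - v). Proof. by move=> hu hw; apply: mmD => //; apply: mmN. Qed.
Lemma mm_sum (T : Type) (s : seq T) (D : pred T) (G : T -> C) :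
  (forall i, D i -> mm (G i)) -> mm (\sum_(i <- s | D i) G i).
Proof. by move=> h; elim/big_ind: _ => //; [exact: mm0 | exact: mmD]. Qed.
Lemma mm_prime u v : mm (u * v) -> mm u \/ mm v.
Proof.
move=> h; apply: contrapT => /not_orP[/mm_n[u0 hu] /mm_n[v0 hw]]; apply: h; rewrite mulf_neq0 //.
by split=> //; rewrite invfM; apply: srM.
Qed.
Lemma mmX u k : mm (u ^+ k) -> mm u.
Proof. by elim: k => [|k IH]; [rewrite expr0 => /mm1 | rewrite exprS => /mm_prime []]. Qed.
Lemma mmX' u k : (0 < k)%N -> mm u -> mm (u ^+ k).
Proof. by case: k => // k _ h; rewrite exprS; apply: mmM => //; apply: srX => //; exact: mm_B. Qed.
Lemma mm_prod_ex (T : eqType) (s : seq T) (G : T -> C) : mm (\prod_(i <- s) G i) -> exists2 i, i \in s & mm (G i).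
Proof.
elim: s => [|a s IH]; first by rewrite big_nil => /mm1.
rewrite big_cons => /mm_prime [h|/IH [i is_ h]]; first by exists a; rewrite ?mem_head.
by exists i => //; rewrite inE is_ orbT.
Qed.
(** k is the last index of largest value, so later entries are strictly smaller. For a list of
    coefficients it is the degree of the reduction after scaling. *)
Lemma vmax (f : nat -> C) N : (exists2 i, (i < N)%N & f i != 0) ->
  exists2 k, (k < N)%N & [/\ f k != 0, forall i, (i < N)%N -> B (f i / f k) &
    forall i, (k < i < N)%N -> mm (f i / f k)].
Proof.
elim: N => [[] //|N IH] [i iN fi].
have new : f N != 0 -> (forall i, (i < N)%N -> B (f i / f N)) -> exists2 k, (k < N.+1)%N &
  [/\ f k != 0, forall i, (i < N.+1)%N -> B (f i / f k) & forall i, (k < i < N.+1)%N -> mm (f i / f k)].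
  move=> fN h; exists N => //; split=> // j; last by case/andP => a b; move: a b; lia.
  by rewrite ltnS leq_eqVlt => /orP[/eqP ->|/h//]; rewrite divff //; exact: sr1.
have [[j jN fj]|no] := pselect (exists2 i, (i < N)%N & f i != 0); last first.
  have z j : (j < N)%N -> f j = 0.
    by move=> jN; apply/eqP; apply: contraT => fj; case: no; exists j.
  apply: new => [|j /z ->]; last by rewrite mul0r; exact: sr0.
  move: iN; rewrite ltnS leq_eqVlt => /orP[/eqP <- //|/z e]; by rewrite e eqxx in fi.
have [|k kN [fk h1 h2]] := IH; first by exists j.
have [hm|/mm_n [h0 hi]] := pselect (mm (f N / f k)).
  exists k; first exact: ltnW.
  split=> // l; first by rewrite ltnS leq_eqVlt => /orP[/eqP ->|/h1//]; exact: mm_B.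
  by rewrite ltnS => /andP[kl]; rewrite leq_eqVlt => /orP[/eqP ->//|lN]; apply: h2; rewrite kl.
have fN : f N != 0 by apply: contraNneq h0 => ->; rewrite mul0r.
apply: new => // l /h1 hl; rewrite (_ : f l / f N = (f l / f k) * (f k / f N)); last by rewrite mulrA divfK.
apply: srM => //.
by move: hi; rewrite invf_div.
Qed.
End Val.

(** * Skew polynomials *)
Lemma ev_wide N (u : {poly C}) x : (size u <= N)%N -> ev u x = \sum_(i < N) u`_i * x ^+ (q ^ i).
Proof.
move=> h; rewrite /skew_eval (big_ord_widen _ (fun i => u`_i * x ^+ (q ^ i)) h) big_mkcond /=.
by apply: eq_bigr => i _; case: ltnP => // /leq_sizeP -> //; rewrite mul0r.
Qed.
Lemma evD (u v : {poly C}) x : ev (u + v) x = ev u x + ev v x.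
Proof.
have hu := leq_maxl (size u) (size v); have hw := leq_maxr (size u) (size v).
rewrite (ev_wide x hu) (ev_wide x hw) (ev_wide x (size_polyD u v)) -big_split.
by apply: eq_bigr => i _; rewrite coefD mulrDl.
Qed.
Lemma evZ c (u : {poly C}) x : ev (c *: u) x = c * ev u x.
Proof.
rewrite (ev_wide x (size_scale_leq c u)) /skew_eval mulr_sumr.
by apply: eq_bigr => i _; rewrite coefZ mulrA.
Qed.
Lemma ev0l x : ev 0 x = 0. Proof. by rewrite /skew_eval size_poly0 big_ord0. Qed.
Lemma evN (u : {poly C}) x : ev (- u) x = - ev u x. Proof. by rewrite -scaleN1r evZ mulN1r. Qed.
Lemma evB (u v : {poly C}) x : ev (u - v) x = ev u x - ev v x. Proof. by rewrite evD evN. Qed.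
Lemma ev_sum (I : Type) (s : seq I) (P : pred I) (F : I -> {poly C}) x :
  ev (\sum_(i <- s | P i) F i) x = \sum_(i <- s | P i) ev (F i) x.
Proof. by elim/big_rec2: _ => [|i a b _ <-]; rewrite ?ev0l ?evD. Qed.
Lemma evDr (u : {poly C}) x y : ev u (x + y) = ev u x + ev u y.
Proof. by rewrite /skew_eval -big_split; apply: eq_bigr => i _; rewrite frD mulrDr. Qed.
Lemma ev0 (u : {poly C}) : ev u 0 = 0.
Proof. by rewrite /skew_eval big1 // => i _; rewrite fr0 mulr0. Qed.
Lemma evNr (u : {poly C}) x : ev u (- x) = - ev u x.
Proof. by apply/eqP; rewrite -addr_eq0 -evDr addNr ev0. Qed.
Lemma evBr (u : {poly C}) x y : ev u (x - y) = ev u x - ev u y.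
Proof. by rewrite evDr evNr. Qed.
Lemma evZr c (u : {poly C}) x : Fq c -> ev u (c * x) = c * ev u x.
Proof.
by move=> hc; rewrite /skew_eval mulr_sumr; apply: eq_bigr => i _; rewrite exprMn (Fq_fr _ hc) mulrCA.
Qed.
Lemma ev_mulXn (u : {poly C}) i x : ev (u * 'X^i) x = ev u (x ^+ (q ^ i)).
Proof.
rewrite (@ev_wide (i + size u)) ?big_split_ord /=; last first.
  by apply: leq_trans (size_polyMleq _ _) _; rewrite size_polyXn addnS /= addnC.
rewrite big1 ?add0r => [|j _]; last by rewrite coefMXn ltn_ord mul0r.
by apply: eq_bigr => j _; rewrite coefMXn ltnNge leq_addr /= addKn frA.
Qed.
Lemma ev_tw i (u : {poly C}) x : ev (tw i u) (x ^+ (q ^ i)) = ev u x ^+ (q ^ i).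
Proof.
rewrite (ev_wide _ (size_tw i u)) /skew_eval fr_sum; apply: eq_bigr => j _.
by rewrite coef_tw exprMn !frA addnC.
Qed.

Definition linp (u : {poly C}) : {poly C} := \sum_(i < size u) u`_i *: 'X^(q ^ i).
Lemma linp_horner (u : {poly C}) x : (linp u).[x] = ev u x.
Proof. by rewrite horner_sum; apply: eq_bigr => i _; rewrite hornerZ hornerXn. Qed.
Lemma coef_linp (u : {poly C}) i : (linp u)`_(q ^ i) = u`_i.
Proof.
rewrite coef_sum; have [h|h] := ltnP i (size u).
  rewrite (bigD1 (Ordinal h)) //= coefZ coefXn eqxx mulr1 big1 ?addr0 // => j ij.
  rewrite coefZ coefXn eqn_exp2l ?q_gt1 // (_ : (i == j) = false) ?mulr0 //.
  by apply/negP => /eqP e; move/eqP: ij; apply; apply: val_inj.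
rewrite nth_default // big1 // => j _; rewrite coefZ coefXn eqn_exp2l ?q_gt1 //.
by rewrite gtn_eqF ?mulr0 //; apply: leq_trans (ltn_ord j) h.
Qed.
(** A skew polynomial is determined by its additive map on C, so the ring laws of C[tau] follow from
    those of composition. *)
Lemma ev_inj (u v : {poly C}) : (forall x, ev u x = ev v x) -> u = v.
Proof.
move=> h; apply/eqP; rewrite -subr_eq0; apply/eqP.
have z : linp (u - v) = 0.
  by apply: (@poly_zero 1 _ ltr01) => x _; rewrite linp_horner evB h subrr.
by apply/polyP => i; rewrite -coef_linp z !coef0.
Qed.

Lemma coef_sm (u v : {poly C}) k : (sm u v)`_k = \sum_(i < k.+1) u`_i * v`_(k - i) ^+ (q ^ i).
Proof.
rewrite coef_poly; case: ltnP => // h; rewrite big1 // => i _.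
have [iu|iu] := ltnP i (size u); last by rewrite nth_default ?mul0r.
rewrite [v`__]nth_default ?fr0 ?mulr0 // -(addKn (size u) (size v)).
by apply: leq_sub => //; exact: ltnW.
Qed.
Lemma smE (u v : {poly C}) : sm u v = \sum_(i < size u) u`_i *: (tw i v * 'X^i).
Proof.
apply/polyP => k; rewrite coef_sm coef_sum.
transitivity (\sum_(i < (k.+1 + size u)) (if (i < k.+1)%N then u`_i * v`_(k - i) ^+ (q ^ i) else 0)).
  rewrite big_split_ord /= [X in _ + X]big1 ?addr0; first by apply: eq_bigr => i _; rewrite ltn_ord.
  by move=> i _; rewrite ltnNge leq_addr.
rewrite addnC big_split_ord /= [X in _ + X]big1 ?addr0.
  by apply: eq_bigr => i _; rewrite coefZ coefMXn coef_tw ltnS leqNgt; case: ltnP; rewrite ?mulr0.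
by move=> i _; rewrite [u`__]nth_default ?leq_addr // mul0r; case: ifP.
Qed.
Lemma ev_sm (u v : {poly C}) x : ev (sm u v) x = ev u (ev v x).
Proof.
rewrite smE ev_sum [RHS]/skew_eval; apply: eq_bigr => i _.
by rewrite evZ ev_mulXn ev_tw.
Qed.
Lemma smA (u v w : {poly C}) : sm u (sm v w) = sm (sm u v) w.
Proof. by apply: ev_inj => x; rewrite !ev_sm. Qed.
Lemma smDl (u v w : {poly C}) : sm (u + v) w = sm u w + sm v w.
Proof. by apply: ev_inj => x; rewrite evD !ev_sm evD. Qed.
Lemma smDr (u v w : {poly C}) : sm u (v + w) = sm u v + sm u w.
Proof. by apply: ev_inj => x; rewrite evD !ev_sm evD evDr. Qed.
Lemma sm0 (u : {poly C}) : sm u 0 = 0.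
Proof. by apply: ev_inj => x; rewrite !ev_sm !ev0l ev0. Qed.
Lemma sm0l (u : {poly C}) : sm 0 u = 0.
Proof. by apply: ev_inj => x; rewrite !ev_sm !ev0l. Qed.
Lemma smNl (u v : {poly C}) : sm (- u) v = - sm u v.
Proof. by apply: ev_inj => x; rewrite evN !ev_sm evN. Qed.
Lemma smNr (u v : {poly C}) : sm u (- v) = - sm u v.
Proof. by apply: ev_inj => x; rewrite evN !ev_sm evN evNr. Qed.
Lemma evC c x : ev c%:P x = c * x.
Proof. by rewrite (ev_wide _ (size_polyC_leq1 c)) big_ord1 coefC eqxx expn0 expr1. Qed.
Lemma ev1 x : ev 1 x = x. Proof. by rewrite -[1]/(1%:P) evC mul1r. Qed.
Lemma sm1 (u : {poly C}) : sm u 1 = u. Proof. by apply: ev_inj => x; rewrite ev_sm ev1. Qed.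
Lemma sm1l (u : {poly C}) : sm 1 u = u. Proof. by apply: ev_inj => x; rewrite ev_sm ev1. Qed.
Lemma smC c (u : {poly C}) : sm c%:P u = c *: u.
Proof. by apply: ev_inj => x; rewrite ev_sm evC evZ. Qed.

(* a v a^-1 in C[tau] *)
Definition cj (a : C) (v : {poly C}) : {poly C} := \poly_(j < size v) (v`_j * (a / a ^+ (q ^ j))).
Lemma coef_cj a v j : (cj a v)`_j = v`_j * (a / a ^+ (q ^ j)).
Proof. by rewrite coef_poly; case: ltnP => // h; rewrite nth_default // mul0r. Qed.
Section Conj.
Variable a : C.
Hypothesis a0 : a != 0.
Lemma ev_cj v x : ev (cj a v) x = a * ev v (x / a).
Proof.
rewrite (ev_wide _ (size_poly _ _)) /skew_eval mulr_sumr; apply: eq_bigr => i _.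
rewrite coef_cj expr_div_n; ring.
Qed.
Lemma cj_sm u v : cj a (sm u v) = sm (cj a u) (cj a v).
Proof. by apply: ev_inj => x; rewrite !(ev_sm, ev_cj) [a * ev v _]mulrC mulfK. Qed.
Lemma cjD u v : cj a (u + v) = cj a u + cj a v.
Proof. by apply/polyP => i; rewrite coefD !coef_cj coefD mulrDl. Qed.
Lemma cj0 : cj a 0 = 0. Proof. by apply/polyP => i; rewrite coef_cj !coef0 mul0r. Qed.
Lemma cj_sum (I : Type) (s : seq I) (P : pred I) (F : I -> {poly C}) :
  cj a (\sum_(i <- s | P i) F i) = \sum_(i <- s | P i) cj a (F i).
Proof. by elim/big_rec2: _ => [|i u b _ <-]; rewrite ?cj0 ?cjD. Qed.
Lemma cjC c : cj a c%:P = c%:P.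
Proof.
apply/polyP => i; rewrite coef_cj coefC; case: eqP => [->|_]; last by rewrite mul0r.
by rewrite expn0 expr1 divff // mulr1.
Qed.
Lemma cj_pow g k : cj a (skew_pow q g k) = skew_pow q (cj a g) k.
Proof. by elim: k => [|k IH] /=; rewrite ?cj_sm ?IH // -[1]/(1%:P) cjC. Qed.
Lemma cj_phi g P : cj a (phi_of q g P) = phi_of q (cj a g) P.
Proof. by rewrite cj_sum; apply: eq_bigr => i _; rewrite cj_sm cjC cj_pow. Qed.
End Conj.
Lemma cjK a v : a != 0 -> cj a (cj a^-1 v) = v.
Proof.
move=> a0; apply: ev_inj => x; rewrite !ev_cj ?invr_eq0 // invrK mulrA divff // mul1r.
by rewrite divfK.
Qed.
Lemma cj_CM a r g : a != 0 -> is_CM q r g -> is_CM q r (cj a g).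
Proof.
move=> a0 [v [hv [hgen hfree]]]; have b0 : a^-1 != 0 by rewrite invr_eq0.
have aK u : cj a^-1 (cj a u) = u by have := @cjK a^-1 u b0; rewrite invrK.
exists (fun i => cj a (v i)); split; last split.
- by move=> i; rewrite /is_endo -!cj_sm // hv.
- move=> w hw; have [|P [hP e]] := hgen (cj a^-1 w).
    by rewrite /is_endo -[g]aK -!cj_sm // hw.
  exists P; split=> //; rewrite -[LHS](cjK _ a0) e cj_sum; apply: eq_bigr => i _.
  by rewrite cj_sm // cj_phi.
- move=> P hP e; apply: hfree => //; rewrite -[LHS]aK cj_sum (eq_bigr _ (fun i _ => cj_sm a0 _ _)).
  by rewrite (eq_bigr (fun i => sm (phi_of q (cj a g) (P i)) (cj a (v i)))) ?e ?cj0 // => i _; rewrite cj_phi.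
Qed.

(** * CM modules are defined over the algebraic closure of K *)
Section Endo.
Variable g : {poly C}.
Hypothesis g0 : g`_0 = theta.
Notation endo := (is_endo q g).
Lemma endoD u v : endo u -> endo v -> endo (u + v).
Proof. by rewrite /is_endo smDl smDr => -> ->. Qed.
Lemma endoN u : endo u -> endo (- u).
Proof. by rewrite /is_endo smNl smNr => ->. Qed.
Lemma endoB u v : endo u -> endo v -> endo (u - v).
Proof. by move=> hu hw; apply: endoD => //; apply: endoN. Qed.
Lemma endo0 : endo 0. Proof. by rewrite /is_endo sm0 sm0l. Qed.
Lemma endo1 : endo 1. Proof. by rewrite /is_endo sm1 sm1l. Qed.
Lemma endo_sm u v : endo u -> endo v -> endo (sm u v).
Proof. by rewrite /is_endo => hu hw; rewrite -smA hw smA hu smA. Qed.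
Lemma endo_sum (I : Type) (s : seq I) (P : pred I) (F : I -> {poly C}) :
  (forall i, P i -> endo (F i)) -> endo (\sum_(i <- s | P i) F i).
Proof. by move=> h; elim/big_ind: _ => //; [exact: endo0 | exact: endoD]. Qed.
Lemma endoC c : Fq c -> endo c%:P.
Proof. by move=> hc; apply: ev_inj => x; rewrite !ev_sm !evC evZr. Qed.
Lemma endo_pow k : endo (skew_pow q g k).
Proof. by elim: k => [|k IH]; [exact: endo1 | exact: endo_sm]. Qed.
Lemma endo_phi P : FqP' P -> endo (phi_of q g P).
Proof. by move=> hP; apply: endo_sum => i _; apply: endo_sm; [exact: endoC | exact: endo_pow]. Qed.
Lemma phi_wide N (P : {poly C}) : (size P <= N)%N -> phi_of q g P = \sum_(k < N) P`_k *: skew_pow q g k.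
Proof.
move=> h; rewrite /phi_of; under eq_bigr => k _ do rewrite smC.
rewrite (big_ord_widen _ (fun k => P`_k *: skew_pow q g k) h) big_mkcond /=.
by apply: eq_bigr => k _; case: ltnP => // /leq_sizeP -> //; rewrite scale0r.
Qed.
Lemma phiB P Q : phi_of q g (P - Q) = phi_of q g P - phi_of q g Q.
Proof.
have hP := leq_maxl (size P) (size Q); have hQ := leq_maxr (size P) (size Q).
have hPQ : (size (P - Q)%R <= maxn (size P) (size Q))%N by rewrite -[size Q]size_polyN size_polyD.
rewrite (phi_wide hP) (phi_wide hQ) (phi_wide hPQ) -sumrB; apply: eq_bigr => k _.
by rewrite coefB scalerBl.
Qed.
Lemma sm_0 (u v : {poly C}) : (sm u v)`_0 = u`_0 * v`_0.
Proof. by rewrite coef_sm big_ord1 expn0 expr1. Qed.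
Lemma phi_0 P : (phi_of q g P)`_0 = P.[theta].
Proof.
rewrite (phi_wide (leqnn _)) coef_sum horner_coef; apply: eq_bigr => k _; rewrite coefZ; congr (_ * _).
elim: (nat_of_ord k) => [|j IH] /=; first by rewrite coef1 expr0.
by rewrite sm_0 IH g0 exprS.
Qed.
(** If tau^l is the lowest term of v, commutation with phi_theta forces theta^(q^l) = theta, which
    norms exclude for l > 0. Hence an endomorphism is determined by its constant coefficient. *)
Lemma endo_v0 v : endo v -> v`_0 = 0 -> v = 0.
Proof.
move=> hv v0; apply/eqP; apply: contraT => vn.
have ex : exists l, v`_l != 0 by exists (size v).-1; rewrite -[_`__]/(lead_coef v) lead_coef_eq0.
case: (ex_minnP ex) => l vl lmin.
have lt i : (i < l)%N -> v`_i = 0.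
  by move=> il; apply/eqP; apply: contraLR il => h; rewrite -leqNgt lmin.
have l0 : (0 < l)%N by rewrite lt0n; apply: contraNneq vl => ->; rewrite v0.
have h1 : (sm v g)`_l = v`_l * theta ^+ (q ^ l).
  rewrite coef_sm big_ord_recr /= subnn g0 big1 ?add0r // => i _; by rewrite lt ?mul0r.
have h2 : (sm g v)`_l = theta * v`_l.
  rewrite coef_sm big_ord_recl /= subn0 expn0 expr1 g0 big1 ?addr0 // => i _.
  by rewrite lt ?fr0 ?mulr0 // /bump /= add1n; move: l0; lia.
move: hv; rewrite /is_endo => /(congr1 (fun p : {poly C} => p`_l)); rewrite h1 h2 mulrC => /(mulIf vl).
move/(congr1 nrm); rewrite nrm_thetaX nrm_theta -{2}(expr1 q%:R) => /ieexprIn.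
rewrite qR_gt0 (gt_eqF qR_gt1) => /(_ isT isT) /eqP.
by rewrite -(expn0 q) eqn_exp2l ?q_gt1 // gtn_eqF.
Qed.
Lemma endo_comm u v : endo u -> endo v -> sm u v = sm v u.
Proof.
move=> hu hw; apply/eqP; rewrite -subr_eq0; apply/eqP; apply: endo_v0.
  by apply: endoB; apply: endo_sm.
by rewrite coefB !sm_0 mulrC subrr.
Qed.
Variable r : nat.
Hypothesis r0 : (0 < r)%N.
Hypothesis hCM : is_CM q r g.
(** v_0 is an eigenvalue of the matrix over A by which v acts on the basis of End(phi). *)
Lemma endo_K v : endo v -> inKbar' v`_0.
Proof.
move=> hv; have [w [hw [hgen hfree]]] := hCM.
have h j : exists P : 'I_r -> {poly C}, (forall i, FqP' (P i)) /\ sm v (w j) = \sum_i sm (phi_of q g (P i)) (w i).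
  by apply: hgen; apply: endo_sm.
have [P hP] := fchoice h.
apply: (@eigen_alg _ inK_sf r (\matrix_(i, j) (P j i).[theta]) _ (\row_j (w j)`_0)).
- move=> i j; rewrite mxE; apply: inA_K; exists (P j i); split=> //; case: (hP j) => h1 _; exact: h1.
- have jP : w (Ordinal r0) != 0.
    apply/eqP => w0; have := hfree (fun i => if i == Ordinal r0 then 1 else 0) _ _ (Ordinal r0).
    rewrite eqxx => h1; have : (1 : {poly C}) = 0.
      apply: h1 => [i|]; first by case: eqP => _; [exact: (FqpX 0) | exact: Fqp0].
      rewrite big1 // => i _; case: eqP => [->|_]; first by rewrite w0 sm0.
      by rewrite /phi_of size_poly0 big_ord0 sm0l.
    by move/eqP; rewrite oner_eq0.
  apply: contraNneq jP => /(congr1 (fun u : 'rV[C]_r => u 0 (Ordinal r0))); rewrite !mxE => e.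
  by apply/eqP; apply: endo_v0.
- apply/rowP => j; rewrite !mxE; have [_ e] := hP j.
  have := congr1 (fun p : {poly C} => p`_0) e; rewrite sm_0 coef_sum => ->.
  by apply: eq_bigr => i _; rewrite sm_0 phi_0 !mxE mulrC.
Qed.
End Endo.

(* A CM module cannot have stable reduction of smaller rank: the reduced
   endomorphisms commute, so those of bounded degree are too few. *)
Section Good.
Variable B : C -> Prop.
Hypothesis hB : subrng B.
Hypothesis hv : forall u, B u \/ B u^-1.
Hypothesis hK : forall y, inKbar' y -> B y.
Variables (g : {poly C}) (r s : nat).
Hypothesis gB : forall j, B g`_j.
Hypothesis g0 : g`_0 = theta.
Hypothesis gs : g`_s = 1.
Hypothesis s0 : (0 < s)%N.
Hypothesis sr : (s < r)%N.
Hypothesis gm : forall j, (s < j)%N -> mm B g`_j.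
Hypothesis hCM : is_CM q r g.
Notation endo := (is_endo q g).
Notation m' := (mm B).
Let m1 := mm1 hB.
Let mM := mmM hB.
Let mMl := mmMl hB.
Let mN := mmN hB.
Let mB := mmB hB hv.

Lemma mm_Kbar y : inKbar' y -> m' y -> y = 0.
Proof.
move=> hy h; apply/eqP; apply: contraT => y0; case: h; split=> //.
by apply: hK; apply: KbarV.
Qed.

(** Suppose the largest coefficient M of v is not integral. Then g v has a coefficient of value at
    least that of M^(q^s), while the coefficients of v g are bounded by M. *)
Lemma endo_B v : endo v -> forall i, B v`_i.
Proof.
move=> hw i; apply: contrapT => nB.
have vi : v`_i != 0 by apply: contra_notN nB => /eqP ->; exact: sr0.
have lt_of (u : {poly C}) j : u`_j != 0 -> (j < size u)%N.
  by rewrite ltnNge; apply: contra => /leq_sizeP ->.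
have [|b bs [M0 h1 h2]] := vmax hB hv (f := fun i => v`_i) (N := size v).
  by exists i => //; exact: lt_of.
set M := v`_b in M0 h1 h2.
have h1' j : B (v`_j / M).
  by have [/h1//|h] := ltnP j (size v); rewrite nth_default // mul0r; exact: sr0.
have h2' j : (b < j)%N -> m' (v`_j / M).
  move=> bj; have [h|h] := ltnP j (size v); first by apply: h2; rewrite bj.
  by rewrite nth_default // mul0r; exact: mm0.
have nM : ~ B M by move=> BM; apply: nB; rewrite -(divfK M0 v`_i); apply: srM.
have mM1 : m' M^-1 by exact: mm_V.
pose f2 i := g`_i * M ^+ (q ^ i).
have gs0 : g`_s != 0 by rewrite gs oner_neq0.
have [|i0 i0s [T0 k1 k2]] := vmax hB hv (f := f2) (N := size g).
  by exists s; [exact: lt_of | rewrite /f2 mulf_neq0 // expf_neq0].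
set T := f2 i0 in T0 k1 k2.
have k1' j : B (f2 j / T).
  have [/k1//|h] := ltnP j (size g); rewrite /f2 nth_default // !mul0r; exact: sr0.
have k2' j : (i0 < j)%N -> m' (f2 j / T).
  move=> bj; have [h|h] := ltnP j (size g); first by apply: k2; rewrite bj.
  by rewrite /f2 nth_default // !mul0r; exact: mm0.
have e1 : m' ((sm g v)`_(b + i0) / T - 1).
  have i0k : (i0 < (b + i0).+1)%N by rewrite ltnS leq_addl.
  rewrite coef_sm (bigD1 (Ordinal i0k)) //= addnK -/M -/(f2 i0) -/T mulrDl divff // addrAC subrr add0r mulr_suml.
  apply: mm_sum => // j ne.
  rewrite (_ : _ / T = f2 j / T * (v`_(b + i0 - j) / M) ^+ (q ^ j)); last first.
    by rewrite /f2 expr_div_n mulrACA; field; rewrite T0 expf_neq0.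
  have [ij|ji] := ltnP i0 j; first by apply: mM; [exact: k2' | exact: srX].
  apply: mMl => //; apply: mmX' => //; first exact: qk_gt0.
  apply: h2'; have : nat_of_ord j != i0.
    by apply: contraNneq ne => e; apply/eqP; apply: val_inj.
  by move: ji; lia.
have e2 : m' ((sm v g)`_(b + i0) / T).
  have mMT : m' (M / T).
    rewrite (_ : M / T = (M^-1) ^+ (q ^ s - 1) * (f2 s / T)).
      apply: mM => //; apply: mmX' => //; rewrite subn_gt0 -(expn0 q) ltn_exp2l ?q_gt1 //.
    rewrite /f2 gs mul1r mulrA; congr (_ / _).
    rewrite -{2}(subnK (qk_gt0 s)) addn1 exprSr mulrA -exprMn mulVf // expr1n mul1r //.
  rewrite coef_sm mulr_suml; apply: mm_sum => // j _.
  rewrite (_ : _ / T = (v`_j / M * g`_(b + i0 - j) ^+ (q ^ j)) * (M / T)); last by field; rewrite T0 M0.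
  by apply: mMl => //; apply: srM => //; exact: srX.
apply: m1; have := mB e2 e1; rewrite hw.
by rewrite opprB addrCA subrr addr0.
Qed.

(** Degrees of reductions modulo the maximal ideal, expressed without forming the residue field:
    [rlt] bounds the degree in tau, [rd] gives its exact value. *)
Definition rlt (v : {poly C}) D := forall i, (D <= i)%N -> m' v`_i.
Definition rd (v : {poly C}) d := ~ m' v`_d /\ rlt v d.+1.
Lemma rlt_w v D D' : (D <= D')%N -> rlt v D -> rlt v D'.
Proof. by move=> le h i hi; apply: h; apply: leq_trans hi. Qed.
Lemma rltB u v D : rlt u D -> rlt v D -> rlt (u - v) D.
Proof. by move=> hu hw i hi; rewrite coefB; apply: mB; [exact: hu | exact: hw]. Qed.
Lemma rlt_sum (I : Type) (t : seq I) (P : pred I) (F : I -> {poly C}) D :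
  (forall i, P i -> rlt (F i) D) -> rlt (\sum_(i <- t | P i) F i) D.
Proof. by move=> h i hi; rewrite coef_sum; apply: mm_sum => // j hj; exact: h. Qed.
Lemma rlt_step v D : rlt v D.+1 -> m' v`_D -> rlt v D.
Proof. by move=> h hD i; rewrite leq_eqVlt => /orP[/eqP <- //|/h]. Qed.
(** An endomorphism with zero reduction is zero: its constant coefficient is algebraic over K, and B
    contains Kbar. *)
Lemma rd_ex v D : endo v -> rlt v D -> v = 0 \/ exists2 d, (d < D)%N & rd v d.
Proof.
move=> hw; elim: D => [|D IH] h.
  by left; apply: (endo_v0 g0 hw); apply: (mm_Kbar _ (h 0%N isT)); exact: (endo_K g0 (ltn_trans s0 sr) hCM hw).
have [hD|hD] := pselect (m' v`_D).
  by have [->|[d dD hd]] := IH (rlt_step h hD); [left | right; exists d => //; exact: ltnW].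
by right; exists D.
Qed.
Lemma sm_top (u v : {poly C}) D E : (forall i, B u`_i) -> (forall i, B v`_i) -> rlt u D.+1 -> rlt v E.+1 ->
  rlt (sm u v) (D + E).+1 /\ m' ((sm u v)`_(D + E) - u`_D * v`_E ^+ (q ^ D)).
Proof.
move=> Bu Bv hu hw.
have t1 i k : (D < i)%N -> m' (u`_i * v`_k ^+ (q ^ i)) by move=> h; apply: mM; [exact: hu | exact: srX].
have t2 i k : (E < k)%N -> m' (u`_i * v`_k ^+ (q ^ i)).
  by move=> h; apply: mMl => //; apply: mmX' => //; [exact: qk_gt0 | exact: hw].
split=> [k hk|].
  rewrite coef_sm; apply: mm_sum => // i _.
  by have [/t1//|iD] := ltnP D i; apply: t2; move: hk iD; lia.
have Dk : (D < (D + E).+1)%N by rewrite ltnS leq_addr.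
rewrite coef_sm (bigD1 (Ordinal Dk)) //= addKn addrAC subrr add0r; apply: mm_sum => // i ne.
have [/t1//|iD] := ltnP D i; apply: t2.
have : nat_of_ord i != D by apply: contraNneq ne => e; apply/eqP; apply: val_inj.
by move: iD; lia.
Qed.
Lemma rd_sm u v D E : endo u -> endo v -> rd u D -> rd v E -> rd (sm u v) (D + E).
Proof.
move=> eu ew [nu hu] [nw hw]; have [h1 h2] := sm_top (endo_B eu) (endo_B ew) hu hw.
split=> // h; have := mB h h2; rewrite opprB addrCA subrr addr0 => /(mm_prime hB) [//|/(mmX hB)//].
Qed.
Definition SS d := exists v, endo v /\ rd v d.
Lemma SS0 : SS 0.
Proof.
exists 1; split; first exact: endo1.
split; first by rewrite coef1; exact: m1.
by move=> i i0; rewrite coef1 gtn_eqF //; exact: mm0.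
Qed.
Lemma SSs : SS s.
Proof. by exists g; split=> //; split; [rewrite gs; exact: m1 | move=> i; exact: gm]. Qed.
Lemma SSD d e : SS d -> SS e -> SS (d + e).
Proof.
by move=> [u [eu hu]] [v [ew hw]]; exists (sm u v); split; [exact: endo_sm | exact: rd_sm].
Qed.
Lemma SSM k d : SS d -> SS (k * d).
Proof. by move=> h; elim: k => [|k IH]; [exact: SS0 | rewrite mulSn; apply: SSD]. Qed.
(** The top coefficients in v w = w v and v' w = w v' are compared, with w of reduced degree e; the
    top coefficient of w cancels in the quotient. *)
Lemma ratio_fix v v' d e : endo v -> endo v' -> rd v d -> rd v' d -> SS e ->
  m' ((v'`_d / v`_d) ^+ (q ^ e) - v'`_d / v`_d).
Proof.
move=> ev1 ev2 h1 h2 [w [ew hw]].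
have cm u : endo u -> rd u d -> m' (u`_d * w`_e ^+ (q ^ d) - w`_e * u`_d ^+ (q ^ e)).
  move=> eu [nu hu]; have [nw hw'] := hw.
  have [_ a1] := sm_top (endo_B eu) (endo_B ew) hu hw'.
  have [_ a2] := sm_top (endo_B ew) (endo_B eu) hw' hu.
  have := mB a2 a1; rewrite (endo_comm g0 eu ew) [(e + d)%N]addnC.
  have E X b c : X - c - (X - b) = b - c :> C by ring.
  by rewrite E.
have c1 := cm _ ev1 h1; have c2 := cm _ ev2 h2.
have [/mm_n [v0 Bv] _] := h1; have [/mm_n [w0 Bw] _] := hw.
set x := v`_d in c1 v0 Bv *; set x' := v'`_d in c2 *; set y := w`_e in c1 c2 w0 Bw *.
have Bx : B x by exact: endo_B.
have Bx' : B x' by exact: endo_B.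
have := mB (mM c1 Bx') (mM c2 Bx).
rewrite (_ : _ - _ = y * (x * x' ^+ (q ^ e) - x' * x ^+ (q ^ e))); last by ring.
move=> h; have := mMl (mMl h Bw) (srM hB Bv (srX hB (q ^ e) Bv)).
rewrite mulKf // expr_div_n; congr m'; rewrite exprVn; field.
by rewrite v0 expf_neq0.
Qed.
(** e is the least positive difference of two degrees. For a degree k, the degrees (k / e)(d + e)
    and (k / e) d + k differ by k mod e, so this remainder is 0. *)
Lemma min_diff : exists e, [/\ (0 < e)%N, exists d, SS d /\ SS (d + e) & forall d, SS d -> (e %| d)%N].
Proof.
have ex : exists e, `[< (0 < e)%N /\ exists d, SS d /\ SS (d + e) >].
  by exists s; apply/asboolP; split=> //; exists 0%N; split; [exact: SS0 | exact: SSs].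
case: (ex_minnP ex) => e /asboolP [e0 [d [h1 h2]]] emin; exists e; split=> //; first by exists d.
move=> k hk; rewrite /dvdn; apply: contraT => t0.
have : (e <= k %% e)%N.
  apply: emin; apply/asboolP; rewrite lt0n; split=> //.
  exists ((k %/ e) * (d + e))%N; split; first exact: SSM.
  rewrite mulnDr -addnA -divn_eq addnC; apply: SSD => //; exact: SSM.
by rewrite leqNgt ltn_mod e0.
Qed.
Lemma fr_roots e : (0 < e)%N -> exists Z : seq C, size Z = (q ^ e)%N /\ forall x, x ^+ (q ^ e) - x = \prod_(y <- Z) (x - y).
Proof.
move=> e0; have e1 : (1 < q ^ e)%N by rewrite -(expn0 q) ltn_exp2l ?q_gt1.
have sX : (size (- 'X : {poly C})%R < size ('X^(q ^ e) : {poly C}))%N by rewrite size_polyN size_polyX size_polyXn.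
have [Z hZ] := poly_split ('X^(q ^ e) - 'X); move: (hZ).
rewrite lead_coefDl // lead_coefXn scale1r => hZ'; exists Z; split.
  by have := congr1 (fun p : {poly C} => size p) hZ'; rewrite size_polyDl // size_polyXn size_prod_XsubC => -[].
move=> x; have := congr1 (fun p : {poly C} => p.[x]) hZ'; rewrite !hornerE horner_prod => ->.
by apply: eq_bigr => y _; rewrite !hornerE.
Qed.
(** Top coefficients divided by a fixed one reduce to roots of X^(q^e) = X, because d and d + e are
    both degrees. Subtraction within a class lowers the reduced degree, by divisibility past the
    previous multiple of e; each such step costs a factor q^e. *)
Lemma endo_count e : (0 < e)%N -> (exists d, SS d /\ SS (d + e)) -> (forall d, SS d -> (e %| d)%N) ->
  forall m (T : finType) (f : T -> {poly C}), (forall t, endo (f t)) -> injective f ->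
  (forall t, rlt (f t) (e * m)) -> (#|T| <= q ^ (e * m))%N.
Proof.
move=> e0 [d0 [hd0 hd0e]] hdiv; have [Z [sZ hZ]] := fr_roots e0.
elim=> [|m IH] T f ef finj hf.
  rewrite muln0 expn0; apply/fintype_le1P => t t'; apply: finj.
  have z u : f u = 0 by have := rd_ex (ef u) (hf u); rewrite muln0 => -[//|[]].
  by rewrite !z.
have hf' t : rlt (f t) (e * m).+1.
  have [->|[d dD hd]] := rd_ex (ef t) (hf t); first by move=> i _; rewrite coef0; exact: mm0.
  apply: rlt_w (proj2 hd); have /dvdnP [k dk] : (e %| d)%N by apply: hdiv; exists (f t).
  move: dD; rewrite dk mulnC ltn_pmul2l // ltnS => km; by rewrite ltnS leq_mul2l km orbT.
have [[t0 ht0]|no] := pselect (exists t, ~ m' (f t)`_(e * m)); last first.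
  apply: (@leq_trans (q ^ (e * m))); last by rewrite leq_exp2l ?q_gt1 // leq_mul2l leqnSn orbT.
  apply: (IH T f) => // t; apply: rlt_step => //; apply: contrapT => h; by case: no; exists t.
have [x0 Bx] := mm_n ht0; set x := (f t0)`_(e * m) in x0 Bx.
have cl t : exists i : 'I_(q ^ e), m' ((f t)`_(e * m) / x - Z`_i).
  have [] : exists2 y, y \in Z & m' ((f t)`_(e * m) / x - y).
    apply: mm_prod_ex => //; rewrite -hZ; have [h|h] := pselect (m' (f t)`_(e * m)).
      have h' := mM h Bx; apply: mB => //; apply: mmX' => //; exact: qk_gt0.
    have rt : rd (f t) (e * m) by [].
    have r0 : rd (f t0) (e * m) by [].
    have a1 := ratio_fix (ef t0) (ef t) r0 rt hd0; have a2 := ratio_fix (ef t0) (ef t) r0 rt hd0e.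
    rewrite -/x in a1 a2; apply: (@mmX B hB _ (q ^ d0)); rewrite frB frA addnC.
    by have := mB a2 a1; rewrite opprB addrA subrK.
  move=> y yZ h; have iZ : (index y Z < q ^ e)%N by rewrite -sZ index_mem.
  by exists (Ordinal iZ); rewrite nth_index.
have [c hc] := fchoice cl.
rewrite mulnS expnD -sum1_card (partition_big c xpredT) //=.
apply: (@leq_trans (\sum_(i < q ^ e) q ^ (e * m))%N); last by rewrite sum_nat_const card_ord.
apply: leq_sum => i _; rewrite sum1_card.
have [[t1 /eqP ht1]|no] := pselect (exists t, c t == i); last first.
  rewrite eq_card0 // => t; apply/negP => h; apply: no; by exists t.
rewrite -(card_sig (fun t => c t == i)).
apply: (IH _ (fun t : {t | c t == i} => f (val t) - f t1)).
- by move=> t; apply: endoB.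
- by move=> t t' /addIr /finj h; exact: val_inj.
move=> [t /= /eqP ht]; apply: rlt_step; first exact: rltB.
have := mM (mB (hc t) (hc t1)) (endo_B (ef t0) (e * m)); rewrite ht ht1.
congr m'; rewrite coefB -/x; field; exact: x0.
Qed.
Lemma rlt_pow k : rlt (skew_pow q g k) (s * k).+1.
Proof.
elim: k => [|k IH] /=; first by move=> i i0; move: i0; rewrite muln0 coef1 => /gtn_eqF ->; exact: mm0.
have gsm : rlt g s.+1 by move=> i; exact: gm.
rewrite mulnS; by have [] := sm_top gB (endo_B (endo_pow g k)) gsm IH.
Qed.
Lemma rltZ c v D : B c -> rlt v D -> rlt (c *: v) D.
Proof. by move=> hc h i hi; rewrite coefZ; apply: mMl => //; exact: h. Qed.
(** Coefficients in A of degree below N give q^(r N) endomorphisms of reduced degree at most s N +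
    c, but [endo_count] allows only q^(s N + c + 1 + e). With s < r, N = c + e + 2 is large enough
    for a contradiction. *)
Lemma no_CM : False.
Proof.
have [e [e0 ed ediv]] := min_diff.
have [v [ve [_ hfree]]] := hCM.
have [c hc] := size_bound v.
pose N := (c + e).+2.
pose el (i : 'I_q) : C := Fqs`_i.
have elF i : Fq (el i) by apply/FqP; rewrite mem_nth // size_Fqs.
have el_inj : injective el.
  by move=> a b /eqP; rewrite (nth_uniq 0 _ _ Fqs_uniq) ?size_Fqs // => /eqP; exact: val_inj.
pose el' (a : {ffun 'I_N -> 'I_q}) (k : nat) : C := if insub k is Some i then el (a i) else 0.
have el'E a (i : 'I_N) : el' a i = el (a i) by rewrite /el' valK.
pose P (a : {ffun 'I_N -> 'I_q}) : {poly C} := \poly_(k < N) el' a k.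
have PF a : FqP' (P a).
  move=> k; rewrite coef_poly; case: ifP => [kN|_]; last exact: Fq0.
  by rewrite (el'E a (Ordinal kN)).
pose f (t : {ffun 'I_r -> {ffun 'I_N -> 'I_q}}) := \sum_i sm (phi_of q g (P (t i))) (v i).
have fe t : endo (f t) by apply: endo_sum => i _; apply: endo_sm => //; apply: endo_phi.
have f_inj : injective f.
  move=> t t' ff; apply/ffunP => i; apply/ffunP => k; apply: el_inj.
  have z : forall j, P (t j) - P (t' j) = 0.
    apply: hfree => [j|]; first by apply: FqpD => //; apply: FqpN.
    rewrite (eq_bigr (fun j => sm (phi_of q g (P (t j))) (v j) - sm (phi_of q g (P (t' j))) (v j))).
      by rewrite sumrB -/(f t) -/(f t') ff subrr.
    by move=> j _; rewrite phiB smDl smNl.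
  have := congr1 (fun p : {poly C} => p`_k) (z i); rewrite coefB !coef_poly ltn_ord coef0 !el'E => /eqP.
  by rewrite subr_eq0 => /eqP.
have rphi a : rlt (phi_of q g (P a)) (s * N).+1.
  rewrite (phi_wide _ (size_poly _ _)); apply: rlt_sum => k _; apply: rltZ.
    by apply: hK; apply: Kbar_Fq; exact: PF.
  by apply: (rlt_w _ (@rlt_pow k)); rewrite ltnS leq_mul2l (ltnW (ltn_ord k)) orbT.
have rv i : rlt (v i) c.+1.
  by move=> k ck; rewrite nth_default; [exact: mm0 | apply: leq_trans (hc i) (ltnW ck)].
have rf t : rlt (f t) (s * N + c).+1.
  by apply: rlt_sum => i _; have [] := sm_top (endo_B (endo_phi g (PF (t i)))) (endo_B (ve i)) (rphi (t i)) (rv i).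
pose M := (s * N + c).+1.
have := endo_count e0 ed ediv (m := (M %/ e).+1) fe f_inj.
rewrite !card_ffun !card_ord -expnM leq_exp2l ?q_gt1 // => h.
have : (N * r <= e * (M %/ e).+1)%N.
  by apply: h => t; apply: rlt_w (rf t); rewrite -/M mulnC ltnW // ltn_ceil.
apply/negP; rewrite -ltnNge mulnS mulnC.
apply: (@leq_ltn_trans (e + M)); first by rewrite leq_add2l leq_trunc_div.
apply: (@leq_trans (N * s.+1)); last by rewrite leq_mul2l sr orbT.
rewrite mulnS [(N * s)%N]mulnC /M; move: (s * N)%N => X; rewrite /N; clear; lia.
Qed.
End Good.

(* Scaling by an element of largest absolute value (for the valuation attached
   to a non-algebraic coefficient) gives stable reduction of smaller rank. *)
Lemma CM_algebraic (g : {poly C}) (r : nat) : g`_0 = theta -> size g = r.+1 -> g`_r = 1 ->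
  is_CM q r g -> forall j, inKbar' g`_j.
Proof.
move=> g0 sg gr hCM j; apply: contrapT => nK.
have [B [hB hK nB hv]] := val_ring Kbar_sf Kbar_alg nK.
have jr : (j < r.+1)%N.
  rewrite ltnNge -sg; apply/negP => h; apply: nK; rewrite nth_default //; exact: (sf0 Kbar_sf).
have j0 : (0 < j)%N by rewrite lt0n; apply/negP => /eqP j0; apply: nK; rewrite j0 g0; exact: Kbar_theta.
have jr' : (j < r)%N.
  move: jr; rewrite ltnS leq_eqVlt => /orP[/eqP e|//]; case: nK; rewrite e gr; exact: (sf1 Kbar_sf).
have qi i : (0 < i)%N -> (0 < q ^ i - 1)%N by move=> i0; rewrite subn_gt0 -(expn0 q) ltn_exp2l ?q_gt1.
have rt i : exists a, (0 < i)%N -> a ^+ (q ^ i - 1) = g`_i.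
  by case: (posnP i) => [->|i0]; [exists 0 | have [a ha] := root_ex g`_i (qi i i0); exists a].
have [a ha] := fchoice rt.
(* f_i is the scaling that would turn g_i into 1. Setting f_0 = 0 keeps g_0 = theta, which scaling
   does not change, out of the comparison. *)
pose f i := if i == 0%N then 0 else a i.
have fE i : (0 < i)%N -> f i ^+ (q ^ i - 1) = g`_i by move=> i0; rewrite /f gtn_eqF // ha.
have nBf : ~ B (f j) by move=> h; apply: nB; rewrite -fE //; exact: srX.
have fj0 : f j != 0 by apply: contra_notN nBf => /eqP ->; exact: sr0.
have [|s sr [fs0 h1 h2]] := vmax hB hv (f := f) (N := r.+1); first by exists j.
have s0 : (0 < s)%N by rewrite lt0n; apply: contraNneq fs0 => ->.
have nBs : ~ B (f s) by move=> h; apply: nBf; rewrite -(divfK fs0 (f j)); apply: srM => //; exact: h1.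
(* If s were r, then f_r^(q^r - 1) = g_r = 1, although 1/f_r lies in the maximal ideal. *)
have srr : (s < r)%N.
  move: (sr); rewrite ltnS leq_eqVlt => /orP[/eqP e|//]; case: (mm1 hB); rewrite -gr -fE; last exact: leq_trans jr'.
  have m := mm_V nBs; rewrite e in m; have r1 : (0 < r)%N by apply: leq_trans jr'.
  have hu : (f r)^-1 ^+ (q ^ r - 1) = 1 by rewrite exprVn fE // gr invr1.
  have h : mm B 1 by rewrite -hu; apply: mmX' => //; exact: qi.
  by rewrite fE // gr.
have gE i : (0 < i)%N -> (cj (f s) g)`_i = (f i / f s) ^+ (q ^ i - 1).
  move=> i0; rewrite coef_cj expr_div_n fE //; congr (_ * _).
  have -> : f s ^+ (q ^ i) = f s ^+ (q ^ i - 1) * f s by rewrite -exprSr subn1 prednK ?qk_gt0.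
  by rewrite invfM mulrCA mulfV // mulr1.
apply: (@no_CM B hB hv hK (cj (f s) g) r s) => //.
- move=> i; have [->|i0] := posnP i.
    by rewrite coef_cj expn0 expr1 divff // mulr1 g0; apply: hK; exact: Kbar_theta.
  have [ir|ri] := ltnP i r.+1; first by rewrite gE //; apply: srX => //; exact: h1.
  by rewrite coef_cj nth_default ?sg // mul0r; exact: sr0.
- by rewrite coef_cj expn0 expr1 divff // mulr1.
- by rewrite gE // divff // expr1n.
- move=> i si; have i0 : (0 < i)%N by apply: leq_ltn_trans si.
  have [ir|ri] := ltnP i r.+1; first by rewrite gE //; apply: mmX' => //; [exact: qi | apply: h2; rewrite si].
  by rewrite coef_cj nth_default ?sg // mul0r; exact: mm0.
- exact: cj_CM.
Qed.

(** * Skew polynomials with prescribed kernel *)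
Fixpoint spn (l : seq C) (x : C) : Prop :=
  if l is y :: l' then exists2 a, Fq a & spn l' (x - a * y) else x = 0.
Fixpoint nd (l : seq C) : Prop := if l is y :: l' then ~ spn l' y /\ nd l' else True.
(* the monic-at-0 skew polynomial whose kernel is the F_q-span of l; the junk
   value 0 / 0 = 0 makes a vector that already lies in the span harmless *)
Fixpoint sk (l : seq C) : {poly C} :=
  if l is y :: l' then sm (1 - (ev (sk l') y / ev (sk l') y ^+ q) *: 'X) (sk l') else 1.

Lemma ev_X u : ev 'X u = u ^+ q.
Proof. by rewrite -['X]mul1r -['X]expr1 ev_mulXn ev1 expn1. Qed.
Lemma ev_skS y l x : ev (sk (y :: l)) x =
  ev (sk l) x - ev (sk l) y / ev (sk l) y ^+ q * ev (sk l) x ^+ q.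
Proof. by rewrite /= ev_sm evB ev1 evZ ev_X. Qed.

Lemma spn0 l : spn l 0.
Proof. by elim: l => //= y l IH; exists 0; [exact: Fq0 | rewrite mul0r subr0]. Qed.
Lemma spnD l x x' : spn l x -> spn l x' -> spn l (x + x').
Proof.
elim: l x x' => [|y l IH] x x' /=; first by move=> -> ->; rewrite addr0.
move=> [a ha h] [a' ha' h']; exists (a + a'); first exact: FqD.
by rewrite mulrDl opprD addrACA; apply: IH.
Qed.
Lemma spnZ l c x : Fq c -> spn l x -> spn l (c * x).
Proof.
move=> hc; elim: l x => [|y l IH] x /=; first by move=> ->; rewrite mulr0.
by move=> [a ha h]; exists (c * a); [exact: FqM | rewrite -mulrA -mulrBr; apply: IH].
Qed.
Lemma spn_cat l1 l2 x : spn (l1 ++ l2) x <-> exists u v, [/\ spn l1 u, spn l2 v & x = u + v].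
Proof.
elim: l1 x => [|y l IH] x /=.
  by split=> [h|[u [v [-> h ->]]]]; [exists 0, x; rewrite add0r | rewrite add0r].
split=> [[a ha /IH [u [v [hu hw e]]]]|[u [v [[a ha hu] hw ->]]]].
  exists (u + a * y), v; split=> //; first by exists a => //; rewrite addrK.
  by rewrite addrAC -e subrK.
by exists a => //; apply/IH; exists (u - a * y), v; split=> //; rewrite addrAC.
Qed.
Lemma spn_map (f : C -> C) l x : (forall u v, f (u - v) = f u - f v) -> (forall a u, Fq a -> f (a * u) = a * f u) ->
  spn [seq f y | y <- l] x <-> exists2 u, spn l u & x = f u.
Proof.
move=> fB fZ; have f0 : f 0 = 0 by have := fB 0 0; rewrite !subrr.
have fN u : f (- u) = - f u by rewrite -sub0r fB f0 sub0r.
elim: l x => [|y l IH] x /=; first by split=> [->|[u -> ->]//]; exists 0.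
split=> [[a ha /IH [u hu e]]|[u [a ha hu] ->]].
  exists (u + a * y); first by exists a => //; rewrite addrK.
  by rewrite -(opprK (a * y)) fB fN fZ // opprK -e subrK.
by exists a => //; apply/IH; exists (u - a * y) => //; rewrite fB fZ.
Qed.
Lemma spn_seq (I : eqType) (z : I -> C) (s : seq I) x : uniq s ->
  spn [seq z i | i <- s] x <-> exists c : I -> C, (forall i, Fq (c i)) /\ x = \sum_(i <- s) c i * z i.
Proof.
elim: s x => [|i s IH] x /=.
  by split=> [->|[c [_ ->]]]; [exists (fun=> 0); split=> [j|]; [exact: Fq0 | rewrite big_nil] | rewrite big_nil].
move=> /andP[ins us]; split=> [[a ha /(IH _ us) [c [hc e]]]|[c [hc ->]]].
  exists (fun j => if j == i then a else c j); split=> [j|]; first by case: eqP.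
  rewrite big_cons eqxx big_seq (eq_bigr (fun j => c j * z j)) => [|j js].
    by rewrite -big_seq -e addrC subrK.
  by case: eqP => // ji; rewrite -ji js in ins.
by exists (c i) => //; apply/(IH _ us); exists c; split=> //; rewrite big_cons addrAC subrr add0r.
Qed.

(** With w the value at y of the previous polynomial, u - u^q / w^(q-1) vanishes exactly when u / w
    lies in F_q. *)
Lemma sk_ker l x : ev (sk l) x = 0 <-> spn l x.
Proof.
elim: l x => [|y l IH] x; first by rewrite /= ev1.
rewrite ev_skS /=; set w := ev (sk l) y; set u := ev (sk l) x.
have uB a : Fq a -> ev (sk l) (x - a * y) = u - a * w by move=> ha; rewrite evBr evZr.
split=> [h|[a ha /IH]].
  have [w0|w0] := eqVneq w 0.
    by exists 0; [exact: Fq0 | apply/IH; rewrite uB ?mul0r ?subr0; [move: h; rewrite w0 !mul0r subr0 | exact: Fq0]].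
  have ha : Fq (u / w).
    have e : w / w ^+ q * u ^+ q = u by move/eqP: h; rewrite subr_eq0 => /eqP.
    rewrite /inFq expr_div_n; apply: (mulfI w0); rewrite [RHS]mulrC divfK //.
    by rewrite -[RHS]e mulrA mulrAC.
  by exists (u / w) => //; apply/IH; rewrite uB // divfK // subrr.
rewrite uB // => /eqP; rewrite subr_eq0 => /eqP ->.
have [->|w0] := eqVneq w 0; first by rewrite mulr0 !mul0r subr0.
by rewrite exprMn ha mulrA mulrAC divfK ?expf_neq0 // mulrC subrr.
Qed.
(** First the span of l1 is divided out, then the image of l2 in the quotient. *)
Lemma sk_cat l2 l1 x : ev (sk (l2 ++ l1)) x = ev (sk [seq ev (sk l1) y | y <- l2]) (ev (sk l1) x).
Proof.
elim: l2 x => [|y l IH] x; first by rewrite /= ev1.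
by rewrite cat_cons map_cons !ev_skS -!IH.
Qed.
Lemma sk_scale a l x : a != 0 -> ev (sk [seq a * y | y <- l]) x = a * ev (sk l) (x / a).
Proof.
move=> a0; elim: l x => [|y l IH] x; first by rewrite /= !ev1 mulrC divfK.
rewrite map_cons !ev_skS !IH mulrC [a * y]mulrC mulfK //.
set w := ev (sk l) y; set u := ev (sk l) (x / a); rewrite [in RHS]mulrBr mulrC; congr (_ - _).
have [->|w0] := eqVneq w 0; first by rewrite mulr0 !mul0r mulr0.
by rewrite !exprMn; field; rewrite ?a0 ?w0 ?expf_neq0.
Qed.
Lemma coef_skS c (P : {poly C}) k : (sm (1 - c *: 'X) P)`_k.+1 = P`_k.+1 - c * P`_k ^+ q.
Proof.
rewrite coef_sm 2!big_ord_recl big1 ?addr0 => [|i _].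
  by rewrite !coefB !coef1 !coefZ !coefX /= !mulr0 subr0 mul1r subn0 expn0 expr1 sub0r mulr1 subSS subn0 expn1 mulNr.
by rewrite coefB coef1 coefZ coefX /= mulr0 subr0 mul0r.
Qed.
Lemma sk_0 l : (sk l)`_0 = 1.
Proof.
elim: l => [|y l IH] /=; first by rewrite coef1.
by rewrite sm_0 IH coefB coef1 coefZ coefX mulr0 subr0 mulr1.
Qed.
Lemma size_sk l : (size (sk l) <= (size l).+1)%N.
Proof.
elim: l => [|y l IH]; first by rewrite size_poly1.
apply/leq_sizeP => -[|k] // hk; rewrite [sk _]/= coef_skS.
have h1 : (size (sk l) <= k)%N by apply: leq_trans IH hk.
by rewrite [_`_k]nth_default // nth_default ?leqW // expr0n gtn_eqF ?q_gt0 // mulr0 subr0.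
Qed.
Lemma size_sk_nd l : nd l -> size (sk l) = (size l).+1.
Proof.
move=> h; apply/eqP; rewrite eqn_leq size_sk ltnNge; apply/negP => /leq_sizeP /(_ _ (leqnn _)) /eqP.
apply/negP; elim: l h => [|y l IH] /=; first by rewrite coef1 oner_neq0.
move=> [ns /IH h]; rewrite coef_skS nth_default ?size_sk // sub0r oppr_eq0 mulf_neq0 ?expf_neq0 //.
by rewrite mulf_neq0 ?invr_eq0 ?expf_neq0 //; apply/eqP => /sk_ker.
Qed.

Lemma linp_eq (P : {poly C}) u : (forall x, P.[x] = ev u x) -> P = linp u.
Proof.
move=> h; apply/eqP; rewrite -subr_eq0; apply/eqP; apply: (@poly_zero 1 _ ltr01) => x _.
by rewrite hornerD hornerN linp_horner h subrr.
Qed.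
Lemma roots_bound (P : {poly C}) (rho : R) : 0 < rho -> P`_0 = 1 -> (forall x, root P x -> rho <= nrm x) ->
  forall i, nrm P`_i <= rho ^- i.
Proof.
move=> r0 P0 hr; have [rs hP] := poly_split P.
have lP : lead_coef P != 0.
  by rewrite lead_coef_eq0; apply: contraTneq (oner_neq0 C) => e; rewrite -P0 e coef0 eqxx.
have rsr x : x \in rs -> rho <= nrm x.
  by move=> xr; apply: hr; rewrite hP rootZ // root_prod_XsubC.
have rs0 x : x \in rs -> x != 0 by move=> /rsr h; rewrite -nrm_gt0 (lt_le_trans r0).
have hP' : P = \prod_(x <- rs) (1 - x^-1 *: 'X).
  have e : \prod_(x <- rs) ('X - x%:P) = (\prod_(x <- rs) - x) *: \prod_(x <- rs) (1 - x^-1 *: 'X).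
    elim: rs rs0 {hP rsr} => [|x rs IH] rs0; first by rewrite !big_nil scale1r.
    have x0 := rs0 x (mem_head _ _); rewrite !big_cons IH; last by move=> y yr; apply: rs0; rewrite inE yr orbT.
    rewrite -scalerAr [in RHS]mulrC -scalerA [in RHS]scalerAl; congr (_ *: (_ * _)).
    by rewrite scalerBr scalerA mulNr mulfV // scaleN1r opprK addrC scaleNr alg_polyC.
  move: hP; rewrite e scalerA; set k := _ * _; set Q := \prod_(x <- rs) _ => hP.
  have Q0 : Q`_0 = 1.
    rewrite -horner_coef0 horner_prod big1 // => x _; by rewrite hornerD hornerN hornerZ hornerX hornerC mulr0 subr0.
  have : k = 1 by rewrite -P0 hP coefZ Q0 mulr1.
  by move=> k1; rewrite hP k1 scale1r.
have h : gle rho 1 (fun i => P`_i).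
  rewrite hP'; elim: rs rsr rs0 {hP hP'} => [|x rs IH] rsr rs0.
    by rewrite big_nil => i; rewrite coef1; case: i => [|i]; rewrite ?expr0 ?nrm1 ?mul1r // nrm0 mul0r.
  rewrite big_cons -[1]mulr1; apply: gleMp => //; last first.
    by apply: IH => y yr; [apply: rsr | apply: rs0]; rewrite inE yr orbT.
  move=> [|[|i]]; rewrite coefB coef1 coefZ coefX /= ?mulr0 ?subr0.
  - by rewrite nrm1 expr0 mulr1.
  - rewrite sub0r mulr1 nrmN nrmV expr1 mulrC ler_pdivrMr ?mul1r; first by apply: rsr; rewrite mem_head.
    by rewrite nrm_gt0 rs0 ?mem_head.
  - by rewrite nrm0 mul0r.
by move=> i; have := h i; rewrite -ler_pdivlMr ?exprn_gt0 // mul1r.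
Qed.
(** Q is H(e) / e, where e is the additive polynomial of l1 and H that of the image of l2. Its roots
    are the points of the large span outside the small one, and [roots_bound] applies. *)
Lemma tower l2 l1 (rho : R) : 0 < rho -> (forall x, spn (l2 ++ l1) x -> ~ spn l1 x -> rho <= nrm x) ->
  exists Q : {poly C}, [/\ linp (sk (l2 ++ l1)) = linp (sk l1) * Q, Q`_0 = 1 & forall i, nrm Q`_i <= rho ^- i].
Proof.
move=> r0 hl; set H := sk [seq ev (sk l1) y | y <- l2].
pose K : {poly C} := \sum_(i < size H) H`_i *: 'X^(q ^ i - 1).
have HK x : ev H x = x * K.[x].
  rewrite /skew_eval horner_sum mulr_sumr; apply: eq_bigr => i _.
  by rewrite hornerZ hornerXn mulrCA -exprS -addn1 subnK ?qk_gt0.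
have K0 : K.[0] = 1.
  rewrite horner_sum /H -[in RHS](sk_0 [seq ev (sk l1) y | y <- l2]) -/H.
  have s0 : (0 < size H)%N.
    rewrite lt0n size_poly_eq0; apply: contraTneq (oner_neq0 C) => e.
    by rewrite -(sk_0 [seq ev (sk l1) y | y <- l2]) -/H e coef0 eqxx.
  rewrite (bigD1 (Ordinal s0)) //= subnn expr0 hornerZ hornerC mulr1 big1 ?addr0 // => i ni.
  rewrite hornerZ hornerXn expr0n subn_eq0 leqNgt -(expn0 q) ltn_exp2l ?q_gt1 // lt0n.
  by rewrite (_ : nat_of_ord i != 0%N) ?mulr0 //; apply: contraNneq ni => e; apply/eqP/val_inj.
pose Q := K \Po linp (sk l1).
have e : linp (sk (l2 ++ l1)) = linp (sk l1) * Q.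
  by apply/esym/linp_eq => x; rewrite hornerM horner_comp !linp_horner sk_cat -/H HK.
have Q0 : Q`_0 = 1 by rewrite -horner_coef0 horner_comp linp_horner ev0.
exists Q; split=> //; apply: roots_bound => // x /rootP hx; apply: hl.
  by apply/sk_ker; rewrite -linp_horner e hornerM hx mulr0.
move=> /sk_ker h; move: hx; rewrite horner_comp linp_horner h K0 => /eqP.
by rewrite oner_eq0.
Qed.
Lemma one_bound (Q : {poly C}) (rho : R) x : 0 < rho -> Q`_0 = 1 -> (forall i, nrm Q`_i <= rho ^- i) ->
  nrm x <= rho -> nrm (Q.[x] - 1) <= nrm x / rho.
Proof.
move=> r0 Q0 hQ xr; rewrite (_ : Q.[x] - 1 = (Q - 1).[x]); last by rewrite !hornerE.
have g1 : gle rho 1 (fun i => (Q - 1)`_i).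
  move=> i; rewrite coefB coef1; case: i => [|i]; first by rewrite Q0 subrr nrm0 mul0r.
  by rewrite subr0 -ler_pdivlMr ?exprn_gt0 // mul1r.
have := horner_le (N := 1) r0 g1 _ xr; rewrite expr1 mul1r; apply; case=> // _.
by rewrite coefB coef1 Q0 subrr.
Qed.

Lemma sk_cvg (f : nat -> C -> C) (f' : C -> C) (l : seq C) u u' :
  (forall y, y \in l -> cvg (fun N => f N y) (f' y)) -> nd [seq f' y | y <- l] -> cvg u u' ->
  cvg (fun N => ev (sk [seq f N y | y <- l]) (u N)) (ev (sk [seq f' y | y <- l]) u').
Proof.
elim: l u u' => [|y l IH] u u' hf hn hu.
  by rewrite /= ev1; apply: (@cvg_ext u _ _ 0 _ hu) => m _; rewrite ev1.
have hf' x : x \in l -> cvg (fun N => f N x) (f' x) by move=> xl; apply: hf; rewrite inE xl orbT.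
have [ns hn'] := hn; have c1 := IH _ _ hf' hn' hu; have c2 := IH _ _ hf' hn' (hf y (mem_head _ _)).
rewrite map_cons ev_skS; set w := ev (sk _) (f' y) in c2 *.
have w0 : w != 0 by apply/eqP => /sk_ker.
have := cvgB c1 (cvgM (cvgM c2 (cvgV (cvgX q c2) (expf_neq0 _ w0))) (cvgX q c1)).
by apply: (@cvg_ext _ _ _ 0) => m _; rewrite map_cons ev_skS.
Qed.

Lemma prod_Fqs u w : \prod_(a <- Fqs) (u - a * w) = u ^+ q - u * w ^+ (q - 1).
Proof.
have q1 : (0 < q - 1)%N by rewrite subn_gt0 q_gt1.
have [->|w0] := eqVneq w 0.
  rewrite expr0n gtn_eqF // mulr0 subr0; under eq_bigr => a _ do rewrite mulr0 subr0.
  by rewrite big_const_seq count_predT size_Fqs; elim: q => //= k ->; rewrite exprS.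
have sX : size ('X^q - 'X : {poly C}) = q.+1.
  by rewrite size_polyDl size_polyXn // size_polyN size_polyX ltnS q_gt1.
have e : 'X^q - 'X = \prod_(a <- Fqs) ('X - a%:P).
  rewrite (@all_roots_prod_XsubC _ ('X^q - 'X) Fqs) ?uniq_rootsE ?Fqs_uniq //; last 2 first.
  - by rewrite sX size_Fqs.
  - by apply/allP => x /FqP hx; rewrite /root !hornerE hx subrr.
  rewrite (_ : lead_coef _ = 1) ?scale1r // lead_coefDl ?lead_coefXn //.
  by rewrite size_polyN size_polyX size_polyXn ltnS q_gt1.
have := congr1 (fun p : {poly C} => w ^+ q * p.[u / w]) e; rewrite horner_prod !hornerE mulrBr expr_div_n.
rewrite mulrCA mulfV ?expf_neq0 // mulr1 mulrCA -{2}(subnK q_gt0) addn1 exprSr -!mulrA mulfV // mulr1 => ->.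
rewrite -[in X in X * _]size_Fqs -(count_predT Fqs); elim: Fqs => [|a s IH]; first by rewrite !big_nil mulr1.
by rewrite !big_cons IH /= add1n exprS hornerXsubC [in RHS]mulrACA; congr (_ * _); field.
Qed.

(** * Stability of additive polynomials when their kernels move *)

Section Near.
Variables (Rel : C -> C -> Prop) (eta : R).
Hypothesis eta0 : 0 <= eta.
Hypothesis eta1 : eta < 1.
Definition near x x' := nrm (x' - x) <= eta * nrm x.
Lemma near_le x x' : near x x' -> nrm x' <= nrm x.
Proof.
move=> h; rewrite -(subrK x x'); apply: nrmD_le => //; apply: le_trans h _.
by rewrite ler_piMl ?nrm_ge0 // ltW.
Qed.
Lemma near_eq x x' : near x x' -> nrm x' = nrm x.
Proof.
move=> h; have [x0|x0] := eqVneq x 0.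
  by apply/le_anti; rewrite near_le //= x0 nrm0 nrm_ge0.
apply: nrm_domB; rewrite nrmC; apply: le_lt_trans h _.
by rewrite gtr_pMl ?nrm_gt0.
Qed.
Lemma near_mul x x' y y' : near x x' -> near y y' -> near (x * y) (x' * y').
Proof.
move=> hx hy; rewrite /near (_ : _ - _ = x' * (y' - y) + (x' - x) * y); last by ring.
rewrite nrmM; apply: nrmD_le; rewrite nrmM.
  rewrite mulrCA; apply: ler_pM; rewrite ?nrm_ge0 //; exact: near_le.
by rewrite mulrA ler_wpM2r ?nrm_ge0.
Qed.
Lemma near_inv x x' : near x x' -> near x^-1 x'^-1.
Proof.
move=> h; have e := near_eq h; have [x0|x0] := eqVneq x 0.
  by move: e; rewrite /near x0 nrm0 => /eqP; rewrite nrm_eq0 => /eqP ->; rewrite invr0 subrr nrm0 mulr0.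
have x'0 : x' != 0 by rewrite -nrm_eq0 e nrm_eq0.
rewrite /near (_ : _ - _ = - (x' - x) * x'^-1 * x^-1); last by field; rewrite x0 x'0.
rewrite !nrmM nrmN !nrmV e ler_wpM2r ?invr_ge0 ?nrm_ge0 // ler_pdivrMr ?nrm_gt0 //.
Qed.
Lemma near_refl x : near x x.
Proof. by rewrite /near subrr nrm0 mulr_ge0 ?nrm_ge0. Qed.
Lemma nearN x x' : near x x' -> near (- x) (- x').
Proof. by rewrite /near -opprD !nrmN. Qed.
Lemma nearX x x' k : near x x' -> near (x ^+ k) (x' ^+ k).
Proof. by move=> h; elim: k => [|k IH]; rewrite ?expr0 ?exprS; [exact: near_refl | exact: near_mul]. Qed.

Hypothesis RelB : forall x x' y y' a, Fq a -> Rel x x' -> Rel y y' -> Rel (x - a * y) (x' - a * y').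
Hypothesis Rel_near : forall x x', Rel x x' -> near x x'.
(** Relative closeness survives products but not sums. So u - u^q / w^(q-1) is written as minus the
    product of all u - a w, a in F_q, over w^(q-1); each factor is a value of the same additive
    polynomial at a related pair of points. *)
Lemma sk_near (L : seq (C * C)) : (forall p, p \in L -> Rel p.1 p.2) -> forall x x', Rel x x' ->
  near (ev (sk [seq p.1 | p <- L]) x) (ev (sk [seq p.2 | p <- L]) x').
Proof.
elim: L => [|[y y'] L IH] hL x x' hx; first by rewrite /= !ev1; exact: Rel_near.
have {}IH := IH (fun p hp => hL p (mem_behead (s := _ :: L) hp)).
have hy : Rel y y' by exact: (hL _ (mem_head _ _)).
rewrite !map_cons !ev_skS /=.
set w := ev _ y; set w' := ev _ y'; set u := ev _ x; set u' := ev _ x'.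
have nw : near w w' by apply: IH.
have nu : near u u' by apply: IH.
have [w0|w0] := eqVneq w 0.
  have : w' = 0 by apply/eqP; rewrite -nrm_eq0 (near_eq nw) w0 nrm0.
  by rewrite w0 => ->; rewrite !mul0r !subr0.
have w'0 : w' != 0 by rewrite -nrm_eq0 (near_eq nw) nrm_eq0.
have E (t v : C) : v != 0 -> t - v / v ^+ q * t ^+ q = - (\prod_(a <- Fqs) (t - a * v) * (v ^+ (q - 1))^-1).
  move=> v0; rewrite prod_Fqs -{1}(subnK q_gt0) addn1 exprSr.
  by field; rewrite ?v0 ?expf_neq0.
rewrite !E //; apply: nearN; apply: near_mul; last by apply: near_inv; apply: nearX.
rewrite big_seq [X in near _ X]big_seq.
elim/big_rec2: _ => [|a b c /FqP ha hbc]; first exact: near_refl.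
apply: near_mul => //; have := IH (x - a * y) (x' - a * y') (RelB ha hx hy).
by rewrite !evBr !evZr.
Qed.
End Near.

(** * The exponential function of a lattice *)
Lemma Aht_lt H x : Aht H x -> nrm x < q%:R ^+ H.
Proof.
move=> [P [hP sP ->]]; have [->|P0] := eqVneq P 0; first by rewrite horner0 nrm0 qX_gt0.
rewrite Fqp_nrm // ltr_eXn2l ?qR_gt1 //; apply: leq_trans sP.
by rewrite prednK // size_poly_gt0.
Qed.
Lemma Aht_top H x : Aht H.+1 x -> ~ Aht H x -> nrm x = q%:R ^+ H.
Proof.
move=> [P [hP sP ->]] n; have [sP'|sP'] := leqP (size P) H; first by case: n; exists P.
have e : size P = H.+1 by apply/eqP; rewrite eqn_leq sP.
by rewrite Fqp_nrm ?e // -size_poly_gt0 e.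
Qed.
Lemma Aht_topP H x : Aht H.+1 x -> exists2 c, Fq c & Aht H (x - c * theta ^+ H).
Proof.
move=> [P [hP sP ->]]; exists P`_H; first exact: hP.
exists (\poly_(i < H) P`_i); split=> [i||]; [|exact: size_poly|].
  by rewrite coef_poly; case: ifP => _; [exact: hP | exact: Fq0].
by rewrite horner_poly (horner_coef_wide _ sP) big_ord_recr /= addrK.
Qed.
Lemma Aht_botP H x : Aht H.+1 x -> exists c y, [/\ Fq c, Aht H y & x = c + theta * y].
Proof.
move=> [P [hP sP ->]]; exists P`_0, (\poly_(i < H) P`_i.+1).[theta]; split; first exact: hP.
  exists (\poly_(i < H) P`_i.+1); split=> [i||//]; last exact: size_poly.
  by rewrite coef_poly; case: ifP => _; [exact: hP | exact: Fq0].
rewrite (horner_coef_wide _ sP) big_ord_recl expr0 mulr1 horner_poly mulr_sumr; congr (_ + _).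
by apply: eq_bigr => i _; rewrite /bump /= exprS mulrCA.
Qed.
Lemma Aht_FqX N d : Fq d -> Aht N.+1 (d * theta ^+ N).
Proof.
move=> hd; exists (d *: 'X^N); split=> [i||]; last by rewrite hornerZ hornerXn.
  by rewrite coefZ; apply: FqM => //; exact: FqpX.
by apply: leq_trans (size_scale_leq _ _) _; rewrite size_polyXn.
Qed.
Lemma spn_mem l x : x \in l -> spn l x.
Proof.
elim: l => //= y l IH; rewrite inE => /orP[/eqP ->|/IH h].
  by exists 1; [exact: Fq1 | rewrite mul1r subrr; exact: spn0].
by exists 0; [exact: Fq0 | rewrite mul0r subr0].
Qed.
Lemma nd_moore l : nd l -> forall c : nat -> C, (forall i, Fq (c i)) ->
  \sum_(i < size l) c i * l`_i = 0 -> forall i, (i < size l)%N -> c i = 0.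
Proof.
elim: l => [//|y l IH] /= [ny hl] c hc; rewrite big_ord_recl /=.
have hs : spn l (\sum_(i < size l) c i.+1 * l`_i).
  elim/big_ind: _ => [||i _]; [exact: spn0 | exact: spnD | apply: spnZ => //].
  by apply: spn_mem; exact: mem_nth.
move=> e; have c0 : c 0%N = 0.
  apply/eqP; apply: contraT => c0; case: ny.
  rewrite (_ : y = - (c 0%N)^-1 * \sum_(i < size l) c i.+1 * l`_i).
    by apply: spnZ => //; apply: FqN; exact: FqV.
  by rewrite -(addKr (c 0%N * y) (\sum_(i < _) _)) e addr0 mulrN mulNr opprK mulKf.
case=> [//|i] hi; apply: (IH hl (fun i => c i.+1)) => //.
by move: e; rewrite c0 mul0r add0r.
Qed.
(** The difference has no constant coefficient, so the others form a vector in the kernel of an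
    invertible Moore matrix. *)
Lemma sk_uniq (G : {poly C}) l : nd l -> (size G <= (size l).+1)%N -> (forall y, y \in l -> ev G y = 0) ->
  G = G`_0 *: sk l.
Proof.
move=> hl sG hG; apply/eqP; rewrite -subr_eq0; apply/eqP; set D := _ - _.
have sD : (size D <= (size l).+1)%N.
  apply: leq_trans (size_polyD _ _) _; rewrite size_polyN geq_max sG.
  exact: leq_trans (size_scale_leq _ _) (size_sk l).
have D0 : D`_0 = 0 by rewrite coefB coefZ sk_0 mulr1 subrr.
have De y : y \in l -> ev D y = 0.
  by move=> yl; rewrite evB evZ hG // (proj2 (sk_ker l y)) ?mulr0 ?subrr //; exact: spn_mem.
have M := @moore (size l) (fun i => l`_i) 1 _.
have {}M : \det (\matrix_(i, j < size l) l`_i ^+ (q ^ (1 + j))) != 0.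
  apply: M => c hc e i; pose c' k := if insub k is Some i then c i else 0.
  have c'E (j : 'I_(size l)) : c' j = c j by rewrite /c' valK.
  rewrite -c'E; apply: (nd_moore hl) => //.
    by move=> k; rewrite /c'; case: insubP => [u _ _|_]; [exact: hc | exact: Fq0].
  by rewrite -[RHS]e; apply: eq_bigr => j _; rewrite c'E.
have hv : (\row_(j < size l) D`_j.+1) *m (\matrix_(i, j < size l) l`_i ^+ (q ^ (1 + j)))^T = 0.
  apply/rowP => i; rewrite !mxE -[RHS](De l`_i) ?mem_nth // (ev_wide _ sD) big_ord_recl D0 mul0r add0r.
  by apply: eq_bigr => j _; rewrite !mxE.
apply/polyP => -[|j]; rewrite coef0 //; have [jl|jl] := ltnP j (size l); last first.
  by rewrite nth_default //; apply: leq_trans sD _.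
apply/eqP; apply: contraT => Dj; case/negP: M; rewrite -det_tr; apply/det0P.
exists (\row_(j < size l) D`_j.+1) => //; apply: contraNneq Dj => /rowP /(_ (Ordinal jl)).
by rewrite !mxE /= => ->.
Qed.
Lemma nd_map (f : C -> C) l : (forall u v, f (u - v) = f u - f v) -> (forall a u, Fq a -> f (a * u) = a * f u) ->
  nd l -> (forall x, spn l x -> f x = 0 -> x = 0) -> nd [seq f y | y <- l].
Proof.
move=> fB fZ; elim: l => //= y l IH [ny hl] h; split; last first.
  apply: IH => // x hx; apply: h; exists 0; [exact: Fq0 | by rewrite mul0r subr0].
move=> /(spn_map _ _ fB fZ) [u hu e]; apply: ny.
have /eqP : y - u = 0.
  apply: h; last by rewrite fB e subrr.
  exists 1; first exact: Fq1.
  by rewrite mul1r addrAC subrr sub0r -mulN1r; apply: spnZ => //; apply: FqN; exact: Fq1.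
by rewrite subr_eq0 => /eqP ->.
Qed.

Section Lattice.
Variables (r : nat) (z : 'I_r -> C) (c : R).
(** Quantitative discreteness: coordinates over K are bounded by the norm. Points of Omega^r have it
    by [omega_lat]. *)
Definition lat := 0 < c /\ forall b : 'I_r -> C, (forall i, inK' (b i)) ->
  forall i, c * nrm (b i) <= nrm (\sum_i b i * z i).
Definition LamN N x := exists a : 'I_r -> C, (forall i, Aht N (a i)) /\ x = \sum_i a i * z i.
(** Two lists for the lattice elements with coefficients of degree below N. [mN] grows by a new
    power of theta and gives e_(N+1) as a multiple of e_N; [lN] grows by a multiplication by theta
    and gives the functional equation. *)
Fixpoint mN N : seq C := if N is N'.+1 then [seq theta ^+ N' * z i | i <- enum 'I_r] ++ mN N' else [::].
Fixpoint lN N : seq C := if N is N'.+1 then [seq z i | i <- enum 'I_r] ++ [seq theta * y | y <- lN N'] else [::].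
Definition eN N x := ev (sk (mN N)) x.
Definition ez x := limC nrm (fun N => eN N x).
(** The future phi_theta: its kernel, the theta-torsion, is spanned by the numbers e(z_i /
    theta). *)
Definition gz : {poly C} := theta *: sk [seq ez (z i / theta) | i <- enum 'I_r].

Lemma size_mN N : size (mN N) = (r * N)%N.
Proof. by elim: N => [|N IH]; rewrite ?muln0 //= size_cat size_map size_enum_ord IH mulnS. Qed.
Lemma size_lN N : size (lN N) = (r * N)%N.
Proof. by elim: N => [|N IH]; rewrite ?muln0 //= size_cat size_map size_enum_ord [size [seq theta * y | y <- _]]size_map IH mulnS. Qed.
Lemma LamN_w N N' x : (N <= N')%N -> LamN N x -> LamN N' x.
Proof. by move=> le [a [ha ->]]; exists a; split=> // i; apply: Aht_w (ha i). Qed.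
Lemma spn_mN N x : spn (mN N) x <-> LamN N x.
Proof.
elim: N x => [|N IH] x /=.
  split=> [->|[a [ha ->]]]; first by exists (fun=> 0); split=> [i|]; [exact: Aht0 | rewrite big1 // => i _; rewrite mul0r].
  rewrite big1 // => i _; have := Aht_lt (ha i); rewrite expr0 => h.
  suff -> : a i = 0 by rewrite mul0r.
  by apply/eqP; apply: contraLR h => h; rewrite -leNgt; apply: Aht_ge h.
split.
  move=> /spn_cat [u [v [/(spn_seq _ _ (enum_uniq _)) [d [hd ->]] /IH [a [ha ->]] ->]]].
  exists (fun i => d i * theta ^+ N + a i); split=> [i|].
    by apply: AhtD; [exact: Aht_FqX | apply: Aht_w (ha i)].
  by rewrite big_enum /= -big_split; apply: eq_bigr => i _; rewrite mulrDl mulrA.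
move=> [a [ha ->]]; have h i : exists d, Fq d /\ Aht N (a i - d * theta ^+ N).
  by have [d hd h] := Aht_topP (ha i); exists d.
have [d hd] := fchoice h; apply/spn_cat.
exists (\sum_i d i * (theta ^+ N * z i)), (\sum_i (a i - d i * theta ^+ N) * z i); split.
- apply/(spn_seq _ _ (enum_uniq _)); exists d; split=> [i|]; first by case: (hd i).
  by rewrite big_enum.
- by apply/IH; exists (fun i => a i - d i * theta ^+ N); split=> // i; case: (hd i).
- by rewrite -big_split; apply: eq_bigr => i _ /=; rewrite mulrA -mulrDl addrC subrK.
Qed.
Lemma spn_lN N x : LamN N x -> spn (lN N) x.
Proof.
elim: N x => [|N IH] x; first by move/spn_mN.
move=> [a [ha ->]]; have h i : exists dy : C * C, [/\ Fq dy.1, Aht N dy.2 & a i = dy.1 + theta * dy.2].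
  by have [d [y [hd hy e]]] := Aht_botP (ha i); exists (d, y).
have [d hd] := fchoice h; apply/spn_cat.
exists (\sum_i (d i).1 * z i), (theta * \sum_i (d i).2 * z i); split.
- apply/(spn_seq _ _ (enum_uniq _)); exists (fun i => (d i).1); split=> [i|]; first by case: (hd i).
  by rewrite big_enum.
- apply/spn_map => [u v|b u _|]; [exact: mulrBr | exact: mulrCA |].
  exists (\sum_i (d i).2 * z i) => //; apply: IH; exists (fun i => (d i).2); split=> // i; by case: (hd i).
- rewrite mulr_sumr -big_split; apply: eq_bigr => i _ /=.
  by have [_ _ ->] := hd i; rewrite mulrDl mulrA.
Qed.
Lemma latticeP x : inLattice q theta z x <-> exists N, LamN N x.
Proof.
split=> [[a [ha ->]]|[N [a [ha ->]]]]; last first.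
  by exists a; split=> // i; apply/inAP; exists N.
have [N hN] := @fin_bound _ (fun i N => Aht N (a i)) (fun i N N' le => Aht_w le) (fun i => proj1 (inAP _) (ha i)).
by exists N, a.
Qed.
Lemma big_uniq_ind (s : seq 'I_r) (F : 'I_r -> C) : uniq s ->
  \sum_(j <- s) F j = \sum_j (if j \in s then F j else 0).
Proof. by move=> us; rewrite (big_uniq _ us) big_mkcond. Qed.

Hypothesis LC : lat.
Let c0 : 0 < c. Proof. by case: LC. Qed.
Lemma lat_A (a : 'I_r -> C) : (forall i, inA' (a i)) -> forall i, c * nrm (a i) <= nrm (\sum_i a i * z i).
Proof. by move=> ha; case: LC => _; apply=> i; apply: inA_K. Qed.
Lemma lat_free (b : 'I_r -> C) : (forall i, inK' (b i)) -> \sum_i b i * z i = 0 -> forall i, b i = 0.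
Proof.
move=> hb e i; have [_ h] := LC; have := h b hb i; rewrite e nrm0 pmulr_rle0 // => h'.
by apply/eqP; rewrite -nrm_eq0 eq_le h' nrm_ge0.
Qed.
Lemma Aht_K N x : Aht N x -> inK' x.
Proof. by move=> h; apply: inA_K; apply/inAP; exists N. Qed.
Lemma lam_gap N x : LamN N.+1 x -> ~ LamN N x -> c * q%:R ^+ N <= nrm x.
Proof.
move=> [a [ha e]] n; have [i hi] : exists i, ~ Aht N (a i).
  by apply: contrapT => h; apply: n; exists a; split=> // i; apply: contrapT => h'; apply: h; exists i.
rewrite -(Aht_top (ha i) hi) e; apply: lat_A => j; apply/inAP; by exists N.+1.
Qed.
Lemma nd_mN N : nd (mN N).
Proof.
elim: N => //= N IH; have := enum_uniq 'I_r; elim: (enum 'I_r) => //= i s IHs /andP[ins us].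
split; last exact: IHs.
move=> /spn_cat [u [v [/(spn_seq _ _ us) [d [hd ->]] /spn_mN [a [ha ->]] e]]].
pose b j := (if j == i then theta ^+ N else 0) - (if j \in s then d j * theta ^+ N else 0) - a j.
have bi : b i = 0.
  apply: lat_free => [j|].
    apply: (sfB inK_sf); last exact: Aht_K (ha j).
    apply: (sfB inK_sf); case: ifP => _; try exact: (sf0 inK_sf).
      by apply: inA_K; apply: inAX; exact: inA_theta.
    apply: (sfM inK_sf); apply: inA_K; first exact: inA_Fq.
    by apply: inAX; exact: inA_theta.
  under eq_bigr => j _ do rewrite !mulrBl.
  rewrite !sumrB (bigD1 i) //= eqxx big1 ?addr0 => [|j /negPf ->]; last by rewrite mul0r.
  apply/eqP; rewrite subr_eq0 subr_eq addrC; apply/eqP; rewrite e big_uniq_ind //; congr (_ + _).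
  by apply: eq_bigr => j _; case: ifP => _; rewrite ?mul0r // mulrA.
move: bi; rewrite /b eqxx (negPf ins) subr0 => /eqP; rewrite subr_eq0 => /eqP e'.
by have := Aht_lt (ha i); rewrite -e' nrm_thetaX ltxx.
Qed.
Lemma eN_lN N x : eN N x = ev (sk (lN N)) x.
Proof.
rewrite /eN; have := @sk_uniq (sk (lN N)) (mN N) (nd_mN N); rewrite sk_0 scale1r => -> //.
  by rewrite size_mN -(size_lN N) size_sk.
by move=> y /spn_mem /spn_mN /spn_lN /sk_ker.
Qed.
(** The list [lN] shows theta times level N inside level N + 1; [sk_cat] factors through it, and
    scaling by theta brings both factors back to level N. *)
Lemma eN_rec N x : eN N.+1 (theta * x) =
  ev (theta *: sk [seq eN N (z i / theta) | i <- enum 'I_r]) (eN N x).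
Proof.
rewrite eN_lN /= sk_cat evZ.
have E y : ev (sk [seq theta * y | y <- lN N]) y = theta * eN N (y / theta).
  by rewrite sk_scale ?theta_neq0 // eN_lN.
rewrite E [theta * x]mulrC mulfK ?theta_neq0 //.
rewrite (_ : [seq _ | y <- _] = [seq theta * y | y <- [seq eN N (z i / theta) | i <- enum 'I_r]]).
  by rewrite sk_scale ?theta_neq0 // [theta * eN N x]mulrC mulfK ?theta_neq0.
by rewrite -!map_comp; apply: eq_map => i /=; rewrite E.
Qed.
Lemma coef_linp0 (u : {poly C}) m : (forall i, m != q ^ i)%N -> (linp u)`_m = 0.
Proof.
move=> h; rewrite coef_sum big1 // => i _; rewrite coefZ coefXn (negPf (h i)) mulr0 //.
Qed.
Lemma ez_ex : exists cf, [/\ entire nrm cf, cf 0%N = 0, cf 1%N = 1, (forall m, (1 < m < q)%N -> cf m = 0) &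
  forall x, [/\ sums cf x (ez x), cvg (fun N => eN N x) (ez x) & forall N, nrm x < c * q%:R ^+ N ->
     nrm (ez x - eN N x) <= nrm (eN N x) * (nrm x / (c * q%:R ^+ N))]].
Proof.
have tw N : exists Q : {poly C}, [/\ linp (sk (mN N.+1)) = linp (sk (mN N)) * Q, Q`_0 = 1 &
    forall i, nrm Q`_i <= (c * q%:R ^+ N) ^- i].
  apply: tower; first by rewrite mulr_gt0 ?qX_gt0.
  move=> x h1 h2; apply: lam_gap; first by apply/(spn_mN N.+1).
  by move=> h; apply: h2; apply/spn_mN.
have [Q hQ] := fchoice tw.
have [|||cf [he hc h]] := @infprod (fun N => linp (sk (mN N))) Q c c0.
- by move=> N; case: (hQ N).
- by move=> N; case: (hQ N).
- by move=> N; case: (hQ N).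
have cfE m b : (forall N, (linp (sk (mN N)))`_m = b) -> cf m = b.
  move=> e; apply: cvg_uniq (hc m) _; apply: (@cvg_ext (fun=> b) _ _ 0 _ (cvg_cst _)) => N _; by rewrite e.
exists cf; split=> //.
- apply: cfE => N; apply: coef_linp0 => i; by rewrite eq_sym -lt0n qk_gt0.
- by apply: cfE => N; rewrite -(expn0 q) coef_linp sk_0.
- move=> m /andP[m1 mq]; apply: cfE => N; apply: coef_linp0 => -[|i]; first by rewrite expn0 gtn_eqF.
  by rewrite ltn_eqF // (leq_trans mq) // expnS leq_pmulr // qk_gt0.
move=> x; have [l [h1 h2 h3]] := h x.
have h2' : cvg (fun N => eN N x) l by apply: (@cvg_ext _ _ _ 0 _ h2) => N _; rewrite linp_horner.
by rewrite /ez (limCE h2'); split=> // N hx; rewrite /eN -!linp_horner; apply: h3.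
Qed.
Lemma ez_cvg x : cvg (fun N => eN N x) (ez x).
Proof. by have [cf [_ _ _ _ h]] := ez_ex; case: (h x). Qed.
Lemma ez_near N x : nrm x < c * q%:R ^+ N -> nrm (ez x - eN N x) <= nrm (eN N x) * (nrm x / (c * q%:R ^+ N)).
Proof. by have [cf [_ _ _ _ h]] := ez_ex; case: (h x) => _ _; exact. Qed.
Lemma ez_small x : nrm x < c -> nrm (ez x - x) <= nrm x * (nrm x / c).
Proof. by have := @ez_near 0%N x; rewrite /eN /= ev1 expr0 mulr1. Qed.
Lemma ez_nrm x : nrm x < c -> nrm (ez x) = nrm x.
Proof.
move=> xc; have [->|x0] := eqVneq x 0.
  have := @ez_small 0; rewrite nrm0 => /(_ c0); rewrite mul0r subr0 => h; by apply/le_anti; rewrite h nrm_ge0.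
apply: nrm_domB; rewrite nrmC; apply: le_lt_trans (ez_small xc) _.
by rewrite gtr_pMr ?nrm_gt0 // ltr_pdivrMr // mul1r.
Qed.
Lemma ezB x y : ez (x - y) = ez x - ez y.
Proof.
apply: cvg_uniq (ez_cvg _) _; apply: (@cvg_ext _ _ _ 0 _ (cvgB (ez_cvg x) (ez_cvg y))) => N _.
by rewrite /eN evBr.
Qed.
Lemma ezZ a x : Fq a -> ez (a * x) = a * ez x.
Proof.
move=> ha; apply: cvg_uniq (ez_cvg _) _; apply: (@cvg_ext _ _ _ 0 _ (cvgZ a (ez_cvg x))) => N _.
by rewrite /eN evZr.
Qed.
(** If e(x) = 0 but e_N(x) is not, the relative error in [ez_near] is 1, which is excluded once c
    q^N exceeds |x|. *)
Lemma ez_ker x : ez x = 0 <-> inLattice q theta z x.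
Proof.
rewrite latticeP; split=> [e|[N hN]]; last first.
  apply: cvg_uniq (ez_cvg _) _; apply: (@cvg_ext (fun=> 0) _ _ N _ (cvg_cst _)) => k hk.
  by apply/esym/sk_ker/spn_mN; apply: LamN_w hN.
have [N hN] := expr_unbounded (nrm x / c) qR_gt1.
have hx : nrm x < c * q%:R ^+ N by rewrite mulrC -ltr_pdivrMr // hN.
exists N; apply/spn_mN/sk_ker; apply/eqP; apply: contraT => n0; have := ez_near hx.
rewrite e sub0r nrmN -[X in X <= _]mulr1 ler_pM2l ?nrm_gt0 // leNgt.
by rewrite ltr_pdivrMr ?mul1r ?hx // mulr_gt0 ?qX_gt0.
Qed.
Lemma nd_theta : nd [seq ez (z i / theta) | i <- enum 'I_r].
Proof.
have e : [seq ez (z i / theta) | i <- enum 'I_r] = [seq ez (y / theta) | y <- [seq z i | i <- enum 'I_r]].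
  by rewrite -(map_comp (fun y => ez (y / theta)) z).
have hz : nd [seq z i | i <- enum 'I_r].
  have := nd_mN 1; rewrite /= cats0; congr nd; apply: eq_map => i; by rewrite expr0 mul1r.
rewrite e; apply: nd_map => // [u v|a u ha|x]; first by rewrite mulrBl ezB.
  by rewrite -mulrA ezZ.
move=> /(spn_seq _ _ (enum_uniq _)) [d [hd]]; rewrite big_enum /= => -> /ez_ker [a [ha e']].
have hb i : d i - theta * a i = 0.
  apply: (lat_free (b := fun i => d i - theta * a i)) => [j|].
    apply: inA_K; rewrite -mulN1r; apply: inAD; first exact: inA_Fq.
    by rewrite mulN1r; apply: inAN; apply: inAM => //; exact: inA_theta.
  under eq_bigr => j _ do rewrite mulrBl -mulrA.
  by rewrite sumrB -mulr_sumr -e' mulrCA mulfV ?theta_neq0 // mulr1 subrr.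
rewrite big1 // => i _; have /eqP := hb i; rewrite subr_eq0 => /eqP e2; rewrite e2.
have /inAP [H h] := ha i.
suff -> : a i = 0 by rewrite mulr0 mul0r.
apply/eqP; apply: contraT => a0; have := Aht_ge h a0; have := Fq_nrm_le (hd i).
rewrite e2 nrmM nrm_theta => h1 h2; have := qR_gt1; rewrite ltNge; case/negP; apply: le_trans h1.
by rewrite ler_peMr // ltW // qR_gt0.
Qed.
Lemma ez_theta x : ez (theta * x) = ev gz (ez x).
Proof.
have h1 := cvg_shift 1 (ez_cvg (theta * x)); apply: (cvg_uniq h1); rewrite /gz evZ.
have := @sk_cvg (fun N i => eN N i) ez [seq z i / theta | i <- enum 'I_r] _ _ _ _ (ez_cvg x).
rewrite -(map_comp ez (fun i => z i / theta)) => h; have {}h := cvgZ theta (h (fun y _ => ez_cvg y) nd_theta).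
by apply: (@cvg_ext _ _ _ 0 _ h) => N _; rewrite addn1 eN_rec evZ -(map_comp (fun y => eN N y) (fun i => z i / theta)).
Qed.
Lemma gz_0 : gz`_0 = theta. Proof. by rewrite coefZ sk_0 mulr1. Qed.
Lemma size_gz : size gz = r.+1.
Proof. by rewrite /gz size_scale ?theta_neq0 // (size_sk_nd nd_theta) size_map size_enum_ord. Qed.
Lemma gz_drinfeld : drinfeld_of_lattice nrm q theta z gz.
Proof.
split; [exact: gz_0 | split; [exact: size_gz|]].
have [cf [h1 h2 h3 h4 h5]] := ez_ex; exists cf.
have pE x : psum nrm cf x = ez x by apply: psumE; case: (h5 x).
split; last by move=> x; rewrite pE ez_ker.
by split=> //; split=> //; split=> //; split=> // x; rewrite !pE ez_theta.
Qed.
End Lattice.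

(** * Uniqueness of the Drinfeld module of a lattice *)
Lemma size_sm (u v : {poly C}) a b : (size u <= a.+1)%N -> (size v <= b.+1)%N -> (size (sm u v) <= (a + b).+1)%N.
Proof.
move=> hu hw; apply/leq_sizeP => k hk; rewrite coef_sm big1 // => i _.
have [ia|ia] := ltnP a i; first by rewrite [u`__]nth_default ?mul0r //; apply: leq_trans hu _.
rewrite [v`__]nth_default ?fr0 ?mulr0 //; apply: leq_trans hw _; move: hk ia; lia.
Qed.
Lemma size_pow (g : {poly C}) r k : (size g <= r.+1)%N -> (size (skew_pow q g k) <= (r * k).+1)%N.
Proof.
move=> hg; elim: k => [|k IH] /=; first by rewrite size_poly1.
by rewrite mulnS; apply: size_sm.
Qed.
Lemma pow_0 (g : {poly C}) k : g`_0 = theta -> (skew_pow q g k)`_0 = theta ^+ k.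
Proof. by move=> g0; elim: k => [|k IH] /=; [rewrite coef1 | rewrite sm_0 g0 IH exprS]. Qed.
Lemma tele (a : nat -> C) (eta : R) N : 0 <= eta -> eta < 1 -> (forall j, nrm (a j.+1 - a j) <= eta * nrm (a j)) ->
  forall k, (N <= k)%N -> nrm (a k - a N) <= eta * nrm (a N).
Proof.
move=> e0 e1 h k /subnKC <-; elim: (k - N)%N => [|j IH].
  by rewrite addn0 subrr nrm0 mulr_ge0 ?nrm_ge0.
rewrite addnS -(subrK (a (N + j)%N) (a _.+1)) -addrA; apply: nrmD_le => //.
apply: le_trans (h _) _; rewrite ler_wpM2l //.
rewrite -(subrK (a N) (a (N + j)%N)); apply: nrmD_le => //; apply: le_trans IH _.
by rewrite ler_piMl ?nrm_ge0 // ltW.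
Qed.

Section Uni.
Variables (r : nat) (z : 'I_r -> C) (c : R).
Hypothesis LC : lat z c.
Variables (g : {poly C}) (cf : nat -> C).
Hypothesis g0 : g`_0 = theta.
Hypothesis sg : size g = r.+1.
Hypothesis hent : entire nrm cf.
Hypothesis cf0 : cf 0%N = 0.
Hypothesis cf1 : cf 1%N = 1.
Let e x := psum nrm cf x.
Hypothesis hfun : forall x, e (theta * x) = ev g (e x).
Hypothesis hker : forall x, e x = 0 <-> inLattice q theta z x.
Let c0 : 0 < c. Proof. by case: LC. Qed.

Lemma e_gle rho : 0 < rho -> exists2 B, 0 < B & gle rho B cf.
Proof.
move=> r0; have [N hN] := hent r0 ltr01.
have [B B0 hB] := gle_poly (\poly_(i < N) cf i) r0.
exists (B + 1); first by rewrite addr_gt0.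
move=> i; have [iN|Ni] := ltnP i N.
  by have := hB i; rewrite coef_poly iN => h; apply: le_trans h _; rewrite lerDl.
by apply: le_trans (ltW (hN i Ni)) _; rewrite lerDr ltW.
Qed.
Lemma e_sums x : sums cf x (e x).
Proof.
have x1 : 0 < nrm x + 1 by rewrite ltr_wpDl ?nrm_ge0.
have [B _ hB] := e_gle x1; have [|l hl] := gle_sums (x := x) x1 hB; first by rewrite ltrDl.
by rewrite /e (psumE hl).
Qed.
Lemma e_quad : exists2 B, 0 < B & forall x, nrm x < 1 -> nrm (e x - x) <= B * nrm x ^+ 2.
Proof.
have [B B0 hB] := e_gle ltr01; exists B => // x x1.
have := sums_tail 2 ltr01 hB x1 (e_sums x); rewrite divr1.
by rewrite !big_ord_recl big_ord0 cf0 cf1 mul0r add0r mul1r addr0 expr1.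
Qed.
Lemma e_loc : exists eps, [/\ 0 < eps, eps <= 1 & forall x y, nrm x < eps -> nrm y < eps ->
  nrm (e x - e y - (x - y)) <= nrm (x - y) / 2].
Proof.
have [B B0 hB] := e_gle ltr01; pose eps := Num.min 1 (2 * B)^-1.
have eps0 : 0 < eps by rewrite lt_min ltr01 invr_gt0 mulr_gt0.
have eps1 : eps <= 1 by rewrite ge_min lexx.
have epsB : B * eps <= 2^-1.
  have h : eps <= (2 * B)^-1 by rewrite ge_min lexx orbT.
  by apply: (le_trans (ler_wpM2l (ltW B0) h)); rewrite invfM mulrC mulfVK // gt_eqF.
exists eps; split=> // x y hx hy.
pose s m := if (m < 2)%N then 0 else cf m.
have hs : gle eps (B * eps ^+ 2) s.
  case=> [|[|m]]; rewrite /s /= ?nrm0 ?mul0r ?mulr_ge0 ?exprn_ge0 ?(ltW B0) ?(ltW eps0) //.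
  rewrite -addn2 exprD mulrA ler_wpM2r ?exprn_ge0 ?(ltW eps0) //.
  apply: (@le_trans _ _ (nrm (cf (m + 2)%N))).
    by rewrite ler_piMr ?nrm_ge0 // exprn_ile1 // ltW.
  by have := hB (m + 2)%N; rewrite expr1n mulr1.
have ss t : sums s t (e t - t).
  apply: (@cvg_ext _ _ _ 2 _ (cvgB (e_sums t) (cvg_cst t))) => m hm.
  rewrite -(subnKC hm) !big_split_ord /= !big_ord_recl !big_ord0 /s /= cf0 cf1 !mul0r !add0r mul1r !addr0 expr1.
  by rewrite -addrA addrC subrK.
have := sums_lip eps0 hs hx hy (ss x) (ss y).
rewrite expr2 mulrA mulfK ?gt_eqF // (_ : _ - _ - _ = e x - e y - (x - y)); last by ring.
move=> h; apply: le_trans h _; rewrite mulrC ler_wpM2l ?nrm_ge0 //.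
Qed.
Lemma e_0 : e 0 = 0.
Proof. by apply/hker/latticeP; exists 0%N; apply/spn_mN. Qed.
Lemma e_nrm eps : 0 < eps -> (forall x y, nrm x < eps -> nrm y < eps -> nrm (e x - e y - (x - y)) <= nrm (x - y) / 2) ->
  forall x, nrm x < eps -> nrm (e x) = nrm x.
Proof.
move=> eps0 h x hx; have := h x 0 hx; rewrite nrm0 => /(_ eps0); rewrite e_0 !subr0 => h'.
have [->|x0] := eqVneq x 0; first by rewrite e_0.
apply: nrm_domB; rewrite nrmC; apply: le_lt_trans h' _.
by rewrite ltr_pdivrMr // ltr_pMr ?nrm_gt0 // ltr1n.
Qed.
(** Iteration of y -> y - (e(y) - w), a contraction because e minus the identity has Lipschitz
    constant 1/2. *)
Lemma e_surj eps : 0 < eps -> (forall x y, nrm x < eps -> nrm y < eps -> nrm (e x - e y - (x - y)) <= nrm (x - y) / 2) ->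
  forall w, nrm w < eps -> exists2 y, nrm y <= nrm w & e y = w.
Proof.
move=> eps0 h w hw; pose y k := iter k (fun y => y - (e y - w)) 0.
have h2 k : 0 <= 2^-1 ^+ k :> R by rewrite exprn_ge0 // invr_ge0.
have h21 k : 2^-1 ^+ k <= 1 :> R by rewrite exprn_ile1 // ?invr_ge0 // invf_le1 // ler1n.
have key k : nrm (y k) <= nrm w /\ nrm (e (y k) - w) <= nrm w * 2^-1 ^+ k.
  elim: k => [|k [IH1 IH2]]; first by rewrite /y /= e_0 sub0r nrmN nrm0 expr0 mulr1 nrm_ge0.
  have h1 : nrm (y k.+1) <= nrm w.
    rewrite /y iterS -/(y k); apply: nrmB_le => //; apply: le_trans IH2 _.
    by rewrite ler_piMr ?nrm_ge0.
  split=> //; have := h _ _ (le_lt_trans h1 hw) (le_lt_trans IH1 hw).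
  have -> : y k.+1 - y k = - (e (y k) - w) by rewrite /y iterS -/(y k) addrAC subrr add0r.
  rewrite (_ : _ - _ - _ = e (y k.+1) - w); last by ring.
  rewrite nrmN => h3; apply: le_trans h3 _; rewrite exprSr mulrA ler_wpM2r // invr_ge0 //.
have sm0 d : 0 < d -> exists N, forall m, (N <= m)%N -> nrm w * 2^-1 ^+ m < d.
  by move=> d0; apply: geo_small => //; rewrite ?invr_ge0 // invf_lt1 // ltr1n.
have [l hl] : exists l, cvg y l.
  apply: cauchy_cvg => d d0; have [N hN] := sm0 d d0; exists N => m /hN; apply: le_lt_trans.
  rewrite (_ : y m.+1 - y m = - (e (y m) - w)); last by rewrite /y iterS -/(y m) addrAC subrr add0r.
  by rewrite nrmN; case: (key m).
have lw : nrm l <= nrm w by apply: (cvg_nrm_le hl (N := 0)) => m _; case: (key m).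
exists l => //; apply: (@cvg_uniq (fun=> e l)); first exact: cvg_cst.
move=> d d0; have [N hN] := sm0 d d0; have [N' hN'] := hl d d0.
exists (maxn N N') => m _; have [h3 h4] := key (maxn N N').
rewrite -(subrK (e (y (maxn N N'))) (e l)) -addrA; apply: nrmD_lt; last first.
  by apply: le_lt_trans h4 _; apply: hN; exact: leq_maxl.
have := h l (y (maxn N N')) (le_lt_trans lw hw) (le_lt_trans h3 hw) => h5.
rewrite -(subrK (l - y (maxn N N')) (e l - _)); apply: nrmD_lt; last by rewrite nrmC; apply: hN'; exact: leq_maxr.
apply: le_lt_trans h5 _; apply: (@le_lt_trans _ _ (nrm (l - y (maxn N N')))).
  by rewrite ler_pdivrMr // ler_peMr ?nrm_ge0 // ler1n.
by rewrite nrmC; apply: hN'; exact: leq_maxr.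
Qed.

(** A second-order defect at x / theta^k returns to x by k applications of phi_theta, each
    multiplying small norms by at most q; the total is O(q^(-k)). Applied to additivity defects,
    this makes e an F_q-linear map. *)
Lemma fun_zero (D : nat -> C) B K : (forall k, D k = ev g (D k.+1)) ->
  (forall k, (K <= k)%N -> nrm (D k) <= B * q%:R ^- k ^+ 2) -> D 0%N = 0.
Proof.
move=> hD hB; have [G [G0 hG]] := fin_boundR (fun i : 'I_r.+1 => nrm g`_i).
(* Up to this size of u no term of phi_theta(u) exceeds |theta u|. *)
pose del := Num.min 1 (q%:R / G).
have del0 : 0 < del by rewrite lt_min ltr01 divr_gt0 ?qR_gt0.
have small u : nrm u <= del -> nrm (ev g u) <= q%:R * nrm u.
  move=> hu; have u1 : nrm u <= 1 by apply: le_trans hu _; rewrite ge_min lexx.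
  have uG : G * nrm u <= q%:R by rewrite mulrC -ler_pdivlMr //; apply: le_trans hu _; rewrite ge_min lexx orbT.
  rewrite /skew_eval sg; apply: nrm_sum => [|i _]; first by rewrite mulr_ge0 ?nrm_ge0 // ltW ?qR_gt0.
  rewrite nrmM nrmX; case: i => -[|i] hi /=; first by rewrite g0 nrm_theta expn0 expr1.
  apply: (@le_trans _ _ (G * nrm u ^+ 2)); last by rewrite expr2 mulrA ler_wpM2r ?nrm_ge0.
  apply: ler_pM; rewrite ?nrm_ge0 ?exprn_ge0 ?nrm_ge0 //; first exact: (hG (Ordinal hi)).
  rewrite ler_wiXn2l ?nrm_ge0 //; apply: leq_trans q_gt1 _; by rewrite -{1}(expn1 q) leq_pexp2l ?q_gt0.
have B0 : 0 <= B.
  have := hB K (leqnn K) => h; have : 0 <= B * q%:R ^- K ^+ 2 by apply: le_trans h; exact: nrm_ge0.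
  by rewrite pmulr_lge0 // exprn_gt0 // invr_gt0 qX_gt0.
have [K1 hK1] := geo_q B del0.
have bd k : (maxn K K1 <= k)%N -> nrm (D 0%N) <= B * q%:R ^- k.
  rewrite geq_max => /andP[kK kK1].
  have key j : (j <= k)%N -> nrm (D (k - j)%N) <= B * q%:R ^- k ^+ 2 * q%:R ^+ j.
    elim: j => [|j IH] jk; first by rewrite subn0 expr0 mulr1 hB.
    have {}IH := IH (ltnW jk); rewrite hD (_ : (k - j.+1).+1 = k - j)%N; last by move: jk; lia.
    have s1 : nrm (D (k - j)%N) <= del.
      apply: le_trans IH _; apply: le_trans (ltW (hK1 k kK1)); rewrite -mulrA ler_wpM2l // expr2 -mulrA.
      have q0 : 0 <= (q%:R ^+ k)^-1 :> R by rewrite invr_ge0 ltW ?qX_gt0.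
      rewrite ler_piMr // mulrC ler_pdivrMr ?qX_gt0 // mul1r.
      by rewrite ler_weXn2l ?qR_ge1 // ltnW.
    have q0 : 0 <= q%:R :> R by rewrite ltW ?qR_gt0.
    by apply: le_trans (small _ s1) _; rewrite [q%:R ^+ j.+1]exprS mulrCA ler_wpM2l.
  by have := key k (leqnn k); rewrite subnn expr2 mulrA mulfVK ?gt_eqF ?qX_gt0.
apply/eqP; apply: contraT; rewrite -nrm_gt0 => n0; have [K2 hK2] := geo_q B n0.
by have := bd (maxn (maxn K K1) K2) (leq_maxl _ _); rewrite leNgt hK2 // leq_maxr.
Qed.
Lemma divX (x : C) : exists K, forall k, (K <= k)%N -> nrm (x / theta ^+ k) < 1.
Proof.
have [K hK] := geo_q (nrm x) ltr01; exists K => k /hK; by rewrite nrmf nrm_thetaX.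
Qed.
Lemma e_step x k : e (x / theta ^+ k) = ev g (e (x / theta ^+ k.+1)).
Proof.
have -> : x / theta ^+ k = theta * (x / theta ^+ k.+1) by rewrite exprS invfM mulrCA mulVKf ?theta_neq0.
exact: hfun.
Qed.
Lemma eB x y : e (x - y) = e x - e y.
Proof.
have [B B0 hB] := e_quad; have [K1 h1] := divX x; have [K2 h2] := divX y.
pose D k := e ((x - y) / theta ^+ k) - (e (x / theta ^+ k) - e (y / theta ^+ k)).
have := @fun_zero D (B * Num.max (nrm x) (nrm y) ^+ 2) (maxn K1 K2) _ _.
rewrite /D expr0 !divr1 => h; apply/eqP; rewrite -subr_eq0; apply/eqP; apply: h => [k|k].
  by rewrite !evBr -!e_step.
rewrite geq_max => /andP[/h1 a1 /h2 a2].
have b t : nrm (t / theta ^+ k) < 1 -> nrm t <= Num.max (nrm x) (nrm y) ->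
    nrm (e (t / theta ^+ k) - t / theta ^+ k) <= B * Num.max (nrm x) (nrm y) ^+ 2 * q%:R ^- k ^+ 2.
  move=> /hB ht tm; apply: le_trans ht _; rewrite -mulrA ler_wpM2l ?(ltW B0) // -exprMn.
  have q0 : 0 <= (q%:R ^+ k)^-1 :> R by rewrite invr_ge0 ltW ?qX_gt0.
  rewrite lerXn2r ?nnegrE ?nrm_ge0 //; first by rewrite mulr_ge0 // le_max nrm_ge0.
  by rewrite nrmf nrm_thetaX ler_wpM2r.
have -> : e ((x - y) / theta ^+ k) - (e (x / theta ^+ k) - e (y / theta ^+ k)) =
  (e ((x - y) / theta ^+ k) - (x - y) / theta ^+ k) -
  ((e (x / theta ^+ k) - x / theta ^+ k) - (e (y / theta ^+ k) - y / theta ^+ k)) by ring.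
apply: nrmB_le; last by apply: nrmB_le; apply: b => //; rewrite le_max lexx ?orbT.
by apply: b; [rewrite mulrBl; exact: nrmB_lt | exact: nrmB].
Qed.
Lemma eZ a x : Fq a -> e (a * x) = a * e x.
Proof.
move=> ha; have [B B0 hB] := e_quad; have [K1 h1] := divX x.
pose D k := e (a * x / theta ^+ k) - a * e (x / theta ^+ k).
have := @fun_zero D (B * nrm x ^+ 2) K1 _ _.
rewrite /D expr0 !divr1 => h; apply/eqP; rewrite -subr_eq0; apply/eqP; apply: h => [k|k].
  by rewrite evBr evZr // -!e_step.
move=> /h1 a1; have na := Fq_nrm_le ha.
have b t : nrm t <= nrm x -> nrm (t / theta ^+ k) < 1 ->
    nrm (e (t / theta ^+ k) - t / theta ^+ k) <= B * nrm x ^+ 2 * q%:R ^- k ^+ 2.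
  move=> tm /hB ht; apply: le_trans ht _; rewrite -mulrA ler_wpM2l ?(ltW B0) // -exprMn.
  have q0 : 0 <= (q%:R ^+ k)^-1 :> R by rewrite invr_ge0 ltW ?qX_gt0.
  rewrite lerXn2r ?nnegrE ?nrm_ge0 //; first by rewrite mulr_ge0 // nrm_ge0.
  by rewrite nrmf nrm_thetaX ler_wpM2r.
have ax : nrm (a * x) <= nrm x by rewrite nrmM ler_piMl ?nrm_ge0.
rewrite (_ : _ - _ = (e (a * x / theta ^+ k) - a * x / theta ^+ k) -
  a * (e (x / theta ^+ k) - x / theta ^+ k)); last by ring.
apply: nrmB_le.
  by apply: b => //; apply: le_lt_trans a1; rewrite !nrmf ler_wpM2r ?invr_ge0 ?nrm_ge0.
rewrite nrmM; apply: le_trans (b x (lexx _) a1); by rewrite ler_piMl ?nrm_ge0.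
Qed.

Let f k y := e (y / theta ^+ k).
Let fB k u v : f k (u - v) = f k u - f k v. Proof. by rewrite /f mulrBl eB. Qed.
Let fZ k a u : Fq a -> f k (a * u) = a * f k u. Proof. by move=> ha; rewrite /f -mulrA eZ. Qed.
Lemma e_pow k x : e (theta ^+ k * x) = ev (skew_pow q g k) (e x).
Proof. by elim: k => [|k IH] /=; rewrite ?expr0 ?mul1r ?ev1 // ev_sm -IH -hfun exprS mulrA. Qed.
Lemma A_theta_frac (a b : C) N k : (N <= k)%N -> Aht N a -> inA' b -> nrm a / q%:R ^+ k <= nrm (a / theta ^+ k - b).
Proof.
move=> Nk ha hb; have E : nrm (a / theta ^+ k) = nrm a / q%:R ^+ k by rewrite nrmf nrm_thetaX.
have lt1 : nrm (a / theta ^+ k) < 1.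
  rewrite E ltr_pdivrMr ?qX_gt0 // mul1r; apply: lt_le_trans (Aht_lt ha) _.
  by rewrite ler_weXn2l ?qR_ge1.
have [->|b0] := eqVneq b 0; first by rewrite subr0 E.
have /inAP [H hH] := hb; have b1 := Aht_ge hH b0.
by rewrite -E nrmC nrm_dom ?nrmN; [apply: le_trans b1; exact: ltW | apply: lt_le_trans b1].
Qed.
Lemma e_tors_ker k x : LamN z k x -> f k x = 0 -> x = 0.
Proof.
move=> [a [ha ->]] /hker [b [hb e']].
rewrite big1 // => i _; suff -> : a i = 0 by rewrite mul0r.
have := A_theta_frac (leqnn k) (ha i) (hb i).
have -> : a i / theta ^+ k - b i = 0.
  apply: (lat_free LC (b := fun i => a i / theta ^+ k - b i)) => [j|].
    apply: (sfB inK_sf); last exact: inA_K.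
    apply: (sfM inK_sf); first exact: Aht_K (ha j).
    by apply: (sfV inK_sf); apply: inA_K; apply: inAX; exact: inA_theta.
  under eq_bigr => j _ do rewrite mulrBl mulrAC.
  by rewrite sumrB -mulr_suml e' subrr.
rewrite nrm0 => h; apply/eqP; rewrite -nrm_eq0 eq_le nrm_ge0 andbT.
by rewrite -(pmulr_lle0 _ (_ : 0 < (q%:R ^+ k)^-1)) ?invr_gt0 ?qX_gt0.
Qed.
(** The theta^k-torsion is spanned by the r k numbers e(y / theta^k), y in the list of level k, and
    r k is the degree of phi_(theta^k) in tau. *)
Lemma e_tors k : skew_pow q g k = theta ^+ k *: sk [seq f k y | y <- mN z k].
Proof.
have hn : nd [seq f k y | y <- mN z k].
  apply: (nd_map (fB k) (@fZ k) (nd_mN LC k)) => x /spn_mN h; exact: e_tors_ker h.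
rewrite -(pow_0 k g0); apply: sk_uniq => //.
  by rewrite size_map size_mN; apply: size_pow; rewrite sg.
move=> w /mapP [y /spn_mem /spn_mN [a [ha ->]] ->].
rewrite -e_pow mulrC divfK ?expf_neq0 ?theta_neq0 //; apply/hker.
by exists a; split=> // i; apply/inAP; exists k.
Qed.
(** A small e(x / theta^k) equals e(y) for some y of at most the same norm, and y is congruent to x
    / theta^k modulo the lattice; the lattice bound then applies to y. *)
Lemma e_gap : exists c1, 0 < c1 /\ forall N k x, (N < k)%N -> LamN z N.+1 x -> ~ LamN z N x ->
  c1 * q%:R ^+ N / q%:R ^+ k <= nrm (f k x).
Proof.
have [eps [eps0 eps1 hloc]] := e_loc; exists (Num.min c eps); split; first by rewrite lt_min c0.
move=> N k x Nk hx nx; set c1 := Num.min c eps.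
have c10 : 0 < c1 by rewrite lt_min c0.
have t1 : q%:R ^+ N / q%:R ^+ k <= 1 :> R.
  by rewrite ler_pdivrMr ?qX_gt0 // mul1r ler_weXn2l ?qR_ge1 // ltnW.
have t0 : 0 <= q%:R ^+ N / q%:R ^+ k :> R by rewrite divr_ge0 // ltW ?qX_gt0.
have [hl|hl] := ltP (nrm (f k x)) eps; last first.
  apply: le_trans hl; rewrite -mulrA; apply: (@le_trans _ _ c1); last by rewrite ge_min lexx orbT.
  by rewrite ler_piMr // ltW.
have [y yle ye] := e_surj eps0 hloc hl.
apply: le_trans yle; have [a [ha xe]] := hx.
have [b [hb e']] : inLattice q theta z (x / theta ^+ k - y) by apply/hker; rewrite eB ye subrr.
have ye' : y = \sum_i (a i / theta ^+ k - b i) * z i.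
  under eq_bigr => j _ do rewrite mulrBl mulrAC.
  by rewrite sumrB -mulr_suml -xe -e' subKr.
have [i hi] : exists i, ~ Aht N (a i).
  by apply: contrapT => h; apply: nx; exists a; split=> // i; apply: contrapT => h'; apply: h; exists i.
have h1 := A_theta_frac Nk (ha i) (hb i); rewrite (Aht_top (ha i) hi) in h1.
have h2 : c * nrm (a i / theta ^+ k - b i) <= nrm y.
  rewrite ye'; case: LC => _ h; apply: (h (fun i => a i / theta ^+ k - b i)) => j.
  apply: (sfB inK_sf); last exact: inA_K.
  apply: (sfM inK_sf); first exact: Aht_K (ha j).
  by apply: (sfV inK_sf); apply: inA_K; apply: inAX; exact: inA_theta.
apply: le_trans h2; rewrite -mulrA; apply: ler_pM => //; first exact: ltW.
by rewrite ge_min lexx.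
Qed.
Lemma e_scaled x : cvg (fun k => theta ^+ k * e (x / theta ^+ k)) x.
Proof.
have [B B0 hB] := e_quad; have [K hK] := divX x => d d0.
have [K' hK'] := geo_q (B * nrm x ^+ 2) d0; exists (maxn K K') => k.
rewrite geq_max => /andP[/hK /hB h /hK']; apply: le_lt_trans.
rewrite -{2}(mulfVK (expf_neq0 k theta_neq0) x) [_ * theta ^+ k]mulrC -mulrBr nrmM nrm_thetaX.
apply: le_trans (ler_wpM2l (ltW (qX_gt0 k)) h) _.
by rewrite nrmf nrm_thetaX expr_div_n le_eqVlt; apply/orP; left; apply/eqP; field; rewrite gt_eqF ?qX_gt0.
Qed.
(** e(x) is phi_(theta^k) applied to e(x / theta^k), an expression built from the torsion. Truncated
    at level N it tends to e_N(x) as k grows, and the relative truncation error is at most |x| / (c1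
    q^N), uniformly in k. *)
Lemma e_ez x : e x = ez z x.
Proof.
have [c1 [c10 hgap]] := e_gap; have [eps [eps0 eps1 hloc]] := e_loc.
pose u k := e (x / theta ^+ k).
pose A k N := ev (sk [seq f k y | y <- mN z N]) (u k).
have eA k : e x = theta ^+ k * A k k.
  rewrite -{1}(divfK (expf_neq0 k theta_neq0) x) [_ * theta ^+ k]mulrC e_pow e_tors evZ //.
have [K0 hK0] : exists K, forall k, (K <= k)%N -> nrm (u k) = nrm x / q%:R ^+ k.
  have [K hK] := geo_q (nrm x) eps0; exists K => k /hK h.
  by rewrite (e_nrm eps0 hloc) nrmf nrm_thetaX.
have stepA N k : (K0 <= k)%N -> (N < k)%N -> nrm x <= c1 * q%:R ^+ N ->
    nrm (A k N.+1 - A k N) <= nrm x / (c1 * q%:R ^+ N) * nrm (A k N).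
  move=> Kk Nk xN; have rho0 : 0 < c1 * q%:R ^+ N / q%:R ^+ k by rewrite divr_gt0 ?mulr_gt0 ?qX_gt0.
  have [Q [e1 Q0 Qi]] : exists Q : {poly C}, [/\ linp (sk [seq f k y | y <- mN z N.+1]) = linp (sk [seq f k y | y <- mN z N]) * Q,
      Q`_0 = 1 & forall i, nrm Q`_i <= (c1 * q%:R ^+ N / q%:R ^+ k) ^- i].
    rewrite [mN z N.+1]/= map_cat; apply: tower => // w; rewrite -map_cat.
    move=> /(spn_map _ _ (fB k) (@fZ k)) [y /(spn_mN z N.+1) hy ->] h; apply: hgap => // h'.
    by apply: h; apply/(spn_map _ _ (fB k) (@fZ k)); exists y => //; apply/spn_mN.
  rewrite /A -!linp_horner e1 hornerM -[X in _ - X]mulr1 -mulrBr nrmM mulrC ler_wpM2r ?nrm_ge0 //.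
  apply: le_trans (one_bound rho0 Q0 Qi _) _.
    by rewrite hK0 // ler_pM2r // invr_gt0 qX_gt0.
  rewrite hK0 // le_eqVlt; apply/orP; left; apply/eqP; field.
  by rewrite !gt_eqF ?qX_gt0.
have cA N : cvg (fun k => theta ^+ k * A k N) (eN z N x).
  have := @sk_cvg (fun k y => theta ^+ k * f k y) id (mN z N) (fun k => theta ^+ k * u k) x _ _ (e_scaled x).
  rewrite map_id => h; have {}h := h (fun y _ => e_scaled y) (nd_mN LC N).
  apply: (@cvg_ext _ _ _ 0 _ h) => k _; have tk := expf_neq0 k theta_neq0.
  rewrite (map_comp (fun y => theta ^+ k * y) (f k)) sk_scale // [theta ^+ k * u k]mulrC mulfK //.
have hz := ez_cvg LC x; have [M [M0 [N1 hM]]] := cvg_bound hz.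
apply: (cvg_uniq _ hz) => d d0; have [N2 hN2] := geo_q (nrm x / c1 * M) d0.
have [N3 hN3] := expr_unbounded (nrm x / c1) qR_gt1.
exists (maxn N1 (maxn N2 N3)) => N; rewrite !geq_max => /and3P[/hM h1 /hN2 h2 /hN3 h3].
have xN : nrm x < c1 * q%:R ^+ N by rewrite mulrC -ltr_pdivrMr.
set eta := nrm x / (c1 * q%:R ^+ N).
have eta0 : 0 <= eta by rewrite divr_ge0 ?nrm_ge0 // ltW // mulr_gt0 ?qX_gt0.
have eta1 : eta < 1 by rewrite ltr_pdivrMr ?mul1r // mulr_gt0 ?qX_gt0.
apply: le_lt_trans h2; have -> : nrm x / c1 * M * q%:R ^- N = eta * M.
  by rewrite /eta invfM; ring.
rewrite nrmC; have [K1 hK1] := cA N M M0.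
apply: (cvg_nrm_le (cvgB (cvg_cst (e x)) (cA N)) (N := maxn (maxn K0 K1) N)) => k.
rewrite !geq_max => /andP[/andP[k0 k1] Nk].
have h4 : nrm (theta ^+ k * A k N) <= M.
  by rewrite -(subrK (eN z N x) (_ * _)); apply: nrmD_le => //; apply: ltW; exact: hK1.
apply: (@le_trans _ _ (eta * nrm (theta ^+ k * A k N))); last by rewrite ler_wpM2l.
rewrite (eA k) -mulrBr !nrmM mulrCA ler_wpM2l ?nrm_ge0 //.
pose a j := if (j <= k)%N then A k j else A k k.
have := @tele (fun j => a (N + j)%N) eta 0 eta0 eta1 _ (k - N)%N (leq0n _).
rewrite addn0 subnKC // /a leqnn Nk; apply=> j.
rewrite addnS; have [jk|jk] := ltnP (N + j) k; last first.
  have -> : (if (N + j <= k)%N then A k (N + j)%N else A k k) = A k k.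
    by case: leqP => // h; congr A; apply/eqP; rewrite eqn_leq h jk.
  by rewrite subrr nrm0 mulr_ge0 ?nrm_ge0.
rewrite (ltnW jk); apply: le_trans (stepA _ _ k0 jk _) _.
  by apply: le_trans (ltW xN) _; rewrite ler_pM2l // ler_weXn2l ?qR_ge1 // leq_addr.
rewrite ler_wpM2r ?nrm_ge0 // ler_wpM2l ?nrm_ge0 // lef_pV2 ?posrE ?mulr_gt0 ?qX_gt0 //.
by rewrite ler_pM2l // ler_weXn2l ?qR_ge1 // leq_addr.
Qed.
Lemma g_gz : g = gz z.
Proof.
apply/eqP; rewrite -subr_eq0; apply/eqP.
have := @sk_uniq (g - gz z) [seq ez z (z i / theta) | i <- enum 'I_r] (nd_theta LC).
rewrite coefB g0 gz_0 subrr scale0r size_map size_enum_ord; apply.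
  by apply: leq_trans (size_polyD _ _) _; rewrite size_polyN sg (size_gz LC) maxnn.
move=> w /mapP [i _ ->]; rewrite evB -(ez_theta LC) -!e_ez -hfun subrr //.
Qed.
End Uni.
Lemma drinfeld_uniq r (z : 'I_r -> C) c g : lat z c -> drinfeld_of_lattice nrm q theta z g -> g = gz z.
Proof.
move=> LC [g0 [sg [cf [[h1 [h2 [h3 [_ h5]]]] h6]]]].
exact: (g_gz LC g0 sg h1 h2 h3 h5 h6).
Qed.
Lemma phi_zE r (z : 'I_r -> C) c : lat z c -> phi_z nrm q theta z = gz z.
Proof.
move=> LC; apply: (drinfeld_uniq LC); apply: (epsilon_spec (inhabits 0)).
by exists (gz z); exact: gz_drinfeld LC.
Qed.

(** * The derivative of the discriminant *)
Lemma derivC_eq (f : C -> C) x d :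
  (forall e : R, 0 < e -> exists del : R, 0 < del /\
    forall h, h != 0 -> nrm h < del -> nrm ((f (x + h) - f x) / h - d) < e) -> Defs.derivC nrm f x = d.
Proof.
move=> hd; set P := fun d => forall e : R, 0 < e -> exists del : R, 0 < del /\
    forall h, h != 0 -> nrm h < del -> nrm ((f (x + h) - f x) / h - d) < e.
have hd' : P (Defs.derivC nrm f x) by apply: (epsilon_spec (inhabits 0) P); exists d.
apply/eqP; rewrite -subr_eq0 -nrm_eq0 eq_le nrm_ge0 andbT leNgt; apply/negP => n0.
have [d1 [d10 h1]] := hd _ n0; have [d2 [d20 h2]] := hd' _ n0.
have d0 : 0 < Num.min d1 d2 by rewrite lt_min d10.
have [h h0] := small_elt d0; rewrite lt_min => /andP[/(h1 _ h0) a1 /(h2 _ h0) a2].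
have := nrmB_lt a1 a2; rewrite (_ : _ - _ - _ = Defs.derivC nrm f x - d) ?ltxx //; last by ring.
Qed.
Lemma max_entry r (f : 'I_r.+1 -> R) : exists j, forall i, f i <= f j.
Proof.
by exists [arg max_(i > ord0) f i]%O; case: arg_maxP => // j _ h i; exact: h.
Qed.

(** Induction on the number of coordinates allowed. If K-combinations of earlier z_i came
    arbitrarily close to the next one, the bound already known would make their coefficients
    converge, and the limits would give a relation over K_infty. *)
Lemma omega_lat r (z : 'I_r -> C) : in_Omega nrm q theta z -> exists c, lat z c.
Proof.
move=> [hz _].
suff [c [c0 hc]] : exists c, 0 < c /\ forall b : 'I_r -> C, (forall i, inK' (b i)) ->
    (forall i : 'I_r, (r <= i)%N -> b i = 0) -> forall i, c * nrm (b i) <= nrm (\sum_i b i * z i).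
  exists c; split=> // b hb; apply: hc => // i; by rewrite leqNgt ltn_ord.
suff H : forall j, (j <= r)%N -> exists c, 0 < c /\ forall b : 'I_r -> C, (forall i, inK' (b i)) ->
    (forall i : 'I_r, (j <= i)%N -> b i = 0) -> forall i, c * nrm (b i) <= nrm (\sum_i b i * z i).
  exact: (H r (leqnn r)).
elim=> [|j IH] jr.
  exists 1; split=> // b hb b0 i; by rewrite b0 // nrm0 mulr0 nrm_ge0.
have [c [c0 hc]] := IH (ltnW jr); pose J := Ordinal jr.
have [d [d0 hd]] : exists d, 0 < d /\ forall b : 'I_r -> C, (forall i, inK' (b i)) ->
    (forall i : 'I_r, (j <= i)%N -> b i = 0) -> d <= nrm (z J - \sum_i b i * z i).
  apply: contrapT => no.
  have h m : exists b : 'I_r -> C, [/\ forall i, inK' (b i), forall i : 'I_r, (j <= i)%N -> b i = 0 &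
      nrm (z J - \sum_i b i * z i) < q%:R ^- m].
    apply: contrapT => nb; apply: no; exists (q%:R ^- m); split; first by rewrite invr_gt0 qX_gt0.
    move=> b hb b0; rewrite leNgt; apply/negP => lt; by apply: nb; exists b.
  have [b hb] := fchoice h.
  have cau i : exists l, cvg (fun m => b m i) l.
    apply: cauchy_cvg => e e0; have ec : 0 < c * e by rewrite mulr_gt0.
    have [N hN] := geo_q 1 ec; exists N => m hm.
    have [k1 z1 s1] := hb m; have [k2 z2 s2] := hb m.+1.
    have s2' : nrm (z J - \sum_i b m.+1 i * z i) < q%:R ^- m.
      apply: lt_le_trans s2 _; rewrite lef_pV2 ?posrE ?qX_gt0 // ler_weXn2l ?qR_ge1 //.
    have := hc (fun i => b m.+1 i - b m i) (fun i => sfB inK_sf (k2 i) (k1 i)) _ i.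
    under eq_bigr => l _ do rewrite mulrBl.
    rewrite sumrB -(ltr_pM2l c0) => hle; apply: le_lt_trans (hle _) _.
      by move=> l hl; rewrite z1 // z2 // subrr.
    have := hN m hm; rewrite mul1r; apply: lt_trans.
    have := nrmB_lt s1 s2'; congr (nrm _ < _); ring.
  have [l hl] := fchoice cau.
  pose a i := l i - (i == J)%:R.
  have := hz a _ _ J; rewrite /a eqxx; have -> : l J = 0.
    apply: cvg_uniq (hl J) _; apply: (@cvg_ext (fun=> 0) _ _ 0 _ (cvg_cst _)) => m _.
    by have [_ -> ] := hb m.
  rewrite sub0r => h1; have /eqP : (-1 : C) = 0; last by rewrite oppr_eq0 oner_eq0.
  apply: h1 => [i e e0|].
    have [N hN] := hl i e e0; exists (b N i - (i == J)%:R); split.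
      apply: (sfB inK_sf); first by case: (hb N).
      by case: eqP => _; [exact: (sf1 inK_sf) | exact: (sf0 inK_sf)].
    rewrite (_ : _ - _ - _ = - (b N i - l i)); last by ring.
    by rewrite nrmN hN.
  under eq_bigr => i _ do rewrite mulrBl.
  rewrite sumrB [X in _ - X](bigD1 J) //= eqxx mul1r [X in _ - (_ + X)]big1 ?addr0 => [|i /negPf ->]; last by rewrite mul0r.
  apply/eqP; rewrite subr_eq0; apply/eqP.
  have h2 := cvg_sum (index_enum 'I_r) (P := xpredT) (fun i _ => cvgM (hl i) (cvg_cst (z i))).
  apply: (cvg_uniq h2) => e e0; have [N hN] := geo_q 1 e0; exists N => m hm.
  have [_ _ s] := hb m; rewrite nrmC; apply: lt_trans s _; have := hN m hm; by rewrite mul1r.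
(* As |b_J| <= |S| / d, this M satisfies |S - b_J z_J| <= M |S|. *)
pose M := Num.max 1 (nrm (z J) / d).
have M1 : 1 <= M by rewrite le_max lexx.
have M0 : 0 < M by apply: lt_le_trans M1.
exists (Num.min d (c / M)); split; first by rewrite lt_min d0 divr_gt0.
move=> b hb b0; set S := \sum_i _.
pose v i := if i == J then 0 else b i.
have Sv : S = b J * z J + \sum_i v i * z i.
  rewrite /S (bigD1 J) //= [in RHS](bigD1 J) //= /v eqxx mul0r add0r; congr (_ + _).
  by apply: eq_bigr => i /negPf ->.
have hv : forall i, inK' (v i) by move=> i; rewrite /v; case: eqP => _ //; exact: (sf0 inK_sf).
have v0 : forall i : 'I_r, (j <= i)%N -> v i = 0.
  move=> i ji; rewrite /v; case: eqP => // ne; apply: b0.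
  by rewrite ltn_neqAle ji andbT; apply: contra_notN ne => /eqP e; apply: val_inj.
have bJ : d * nrm (b J) <= nrm S.
  have [->|bn] := eqVneq (b J) 0; first by rewrite nrm0 mulr0 nrm_ge0.
  have := hd (fun i => - v i / b J) _ _.
  have -> : \sum_i - v i / b J * z i = - (\sum_i v i * z i) / b J.
    by rewrite mulNr mulr_suml -sumrN; apply: eq_bigr => i _; rewrite !mulNr mulrAC.
  move=> h; have {}h : d <= nrm (z J - - (\sum_i v i * z i) / b J).
    apply: h => i; last by move=> /v0 ->; rewrite oppr0 mul0r.
    by apply: (sfM inK_sf); [apply: (sfN inK_sf) | apply: (sfV inK_sf)].
  have -> : S = (z J - - (\sum_i v i * z i) / b J) * b J.
    by rewrite Sv mulrBl divfK // opprK mulrC.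
  by rewrite nrmM ler_wpM2r ?nrm_ge0.
move=> i; have [->|iJ] := eqVneq i J.
  by apply: le_trans bJ; rewrite ler_wpM2r ?nrm_ge0 // ge_min lexx.
have := hc v hv v0 i; rewrite /v (negPf iJ) -/v => h.
have hV : nrm (\sum_i v i * z i) <= M * nrm S.
  rewrite (_ : \sum_i _ = S - b J * z J); last by rewrite Sv addrC addKr.
  apply: nrmB_le; first by rewrite ler_peMl ?nrm_ge0.
  apply: (@le_trans _ _ (nrm (z J) / d * nrm S)); last by rewrite ler_wpM2r ?nrm_ge0 // le_max lexx orbT.
  by rewrite nrmM mulrC -mulrA ler_wpM2l ?nrm_ge0 // mulrC ler_pdivlMr // mulrC.
apply: (@le_trans _ _ (c / M * nrm (b i))); first by rewrite ler_wpM2r ?nrm_ge0 // ge_min lexx orbT.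
by rewrite mulrAC ler_pdivrMr // mulrC [X in _ <= X]mulrC [X in X <= _]mulrC; apply: le_trans h hV.
Qed.

(** * Variation of the lattice in its first generator *)

Section Shift.
Variables (r' : nat) (z : 'I_r'.+1 -> C) (c : R).
Notation r := r'.+1.
Hypothesis LC : lat z c.
Let c0 : 0 < c. Proof. by case: LC. Qed.

Lemma sum_shift (b : 'I_r -> C) h : \sum_i b i * shift1 z h i = \sum_i b i * z i + b ord0 * h.
Proof.
rewrite !big_ord_recl /= /shift1 /= mulrDr addrAC; congr (_ + _ + _).
Qed.
Lemma lat_shift h : nrm h < c -> lat (shift1 z h) c.
Proof.
move=> hc; split=> // b hb i; rewrite sum_shift; case: (LC) => _ hL.
have [b0|b0] := eqVneq (b ord0) 0; first by rewrite b0 mul0r addr0; exact: hL.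
rewrite nrm_dom; first exact: hL.
apply: lt_le_trans (hL b hb ord0); by rewrite nrmM mulrC ltr_pM2r ?nrm_gt0.
Qed.

(** The coefficients of the Anderson generating function of z_i. *)
Definition yz (z : 'I_r -> C) (i : 'I_r) (k : nat) := ez z (z i / theta ^+ k.+1).
Lemma yz_S i k : ev (gz z) (yz z i k.+1) = yz z i k.
Proof.
rewrite /yz -(ez_theta LC) [theta ^+ k.+2]exprS invfM mulrCA mulVKf ?theta_neq0 //.
Qed.
Lemma yz_0 i : ev (gz z) (yz z i 0%N) = 0.
Proof.
rewrite /yz -(ez_theta LC) expr1 mulrC divfK ?theta_neq0 //; apply/(ez_ker LC).
exists (fun j => (j == i)%:R); split=> [j|]; first by case: eqP => _; [exact: inA1 | exact: inA0].
by rewrite (bigD1 i) //= eqxx mul1r big1 ?addr0 // => j /negPf ->; rewrite mul0r.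
Qed.
Lemma yz_ind (d : 'I_r -> C) : (forall i, Fq (d i)) -> \sum_i d i * yz z i 0%N = 0 -> forall i, d i = 0.
Proof.
move=> hd e i; pose d' k := if insub k is Some j then d j else 0.
have dE (j : 'I_r) : d' j = d j by rewrite /d' valK.
rewrite -dE; apply: (nd_moore (nd_theta LC)).
- by move=> k; rewrite /d'; case: insubP => [u _ _|_]; [exact: hd | exact: Fq0].
- rewrite -[RHS]e size_map size_enum_ord; apply: eq_bigr => j _; rewrite dE; congr (_ * _).
  by rewrite (nth_map j) ?size_enum_ord // nth_ord_enum /yz expr1.
- by rewrite size_map size_enum_ord.
Qed.
Lemma yz_cvg i : cvg (fun m => theta ^+ m.+1 * yz z i m) (z i).
Proof.
move=> d d0; have [K hK] := geo_q (nrm (z i)) c0; have [K' hK'] := geo_q (nrm (z i) * nrm (z i) / c) d0.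
exists (maxn K K') => m; rewrite geq_max => /andP[mK mK'].
have tm : nrm (z i / theta ^+ m.+1) < c by rewrite nrmf nrm_thetaX; apply: hK; exact: leqW.
have := ez_small LC tm; rewrite -/(yz z i m) => h.
have -> : theta ^+ m.+1 * yz z i m - z i = theta ^+ m.+1 * (yz z i m - z i / theta ^+ m.+1).
  by rewrite mulrBr [_ * (z i / _)]mulrC divfK // expf_neq0 // theta_neq0.
rewrite nrmM nrm_thetaX; apply: le_lt_trans (ler_wpM2l (ltW (qX_gt0 _)) h) _.
apply: le_lt_trans (hK' m.+1 (leqW mK')).
rewrite nrmf nrm_thetaX le_eqVlt; apply/orP; left; apply/eqP; field.
by rewrite !gt_eqF ?qX_gt0.
Qed.
Lemma yz_bound : exists2 B, 0 < B & forall i k, nrm (yz z i k) <= B * q%:R ^- k.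
Proof.
have hK i : exists K, forall k, (K <= k)%N -> nrm (z i) * q%:R ^- k < c by exact: geo_q.
have [K1 hK1] := fin_bound (fun i K K' le (h : forall k, (K <= k)%N -> nrm (z i) * q%:R ^- k < c) k hk => h k (leq_trans le hk)) hK.
have [b1 [b10 hb1]] := fin_boundR (fun i : 'I_r => nrm (z i)).
have [b2 [b20 hb2]] := fin_boundR (fun ik : 'I_r * 'I_K1 => nrm (yz z ik.1 ik.2) * q%:R ^+ ik.2).
exists (b1 + b2); first by rewrite addr_gt0.
move=> i k; have [kK|Kk] := ltnP k K1.
  by rewrite ler_pdivlMr ?qX_gt0 //; apply: le_trans (hb2 (i, Ordinal kK)) _; rewrite lerDr ltW.
have tm : nrm (z i / theta ^+ k.+1) < c by rewrite nrmf nrm_thetaX; apply: hK1; exact: leqW.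
rewrite /yz (ez_nrm LC tm) nrmf nrm_thetaX; apply: ler_pM; rewrite ?nrm_ge0 //.
- by rewrite invr_ge0 ltW ?qX_gt0.
- by apply: le_trans (hb1 i) _; rewrite lerDl ltW.
by rewrite lef_pV2 ?posrE ?qX_gt0 // ler_weXn2l ?qR_ge1.
Qed.

Section Perturb.
Variable h : C.
Hypothesis hc : nrm h < c.
Let z' := shift1 z h.
Let eta := nrm h / c.
Let eta0 : 0 <= eta. Proof. by rewrite divr_ge0 ?nrm_ge0 // ltW. Qed.
Let eta1 : eta < 1. Proof. by rewrite ltr_pdivrMr // mul1r. Qed.
(** Points with the same coordinates over K in both lattices. They differ by the first coordinate
    times h, hence by the relative amount |h| / c at most. *)
Definition Rel x x' := exists b : 'I_r -> C, [/\ forall i, inK' (b i), x = \sum_i b i * z i & x' = \sum_i b i * z' i].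
Lemma Rel_gen i a : inK' a -> Rel (a * z i) (a * z' i).
Proof.
move=> ha; exists (fun j => if j == i then a else 0); split=> [j||].
- by case: eqP => _ //; exact: (sf0 inK_sf).
- by rewrite (bigD1 i) //= eqxx big1 ?addr0 // => j /negPf ->; rewrite mul0r.
- by rewrite (bigD1 i) //= eqxx big1 ?addr0 // => j /negPf ->; rewrite mul0r.
Qed.
Lemma Rel_B x x' y y' a : Fq a -> Rel x x' -> Rel y y' -> Rel (x - a * y) (x' - a * y').
Proof.
move=> ha [b [hb -> ->]] [d [hd -> ->]]; exists (fun i => b i - a * d i); split=> [i||].
- apply: (sfB inK_sf) => //; apply: (sfM inK_sf) => //; apply: inA_K; exact: inA_Fq.
- by rewrite mulr_sumr -sumrB; apply: eq_bigr => i _; rewrite mulrBl mulrA.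
- by rewrite mulr_sumr -sumrB; apply: eq_bigr => i _; rewrite mulrBl mulrA.
Qed.
Lemma Rel_near x x' : Rel x x' -> near eta x x'.
Proof.
move=> [b [hb -> ->]]; rewrite /near sum_shift addrAC subrr add0r nrmM mulrC.
rewrite /eta mulrAC -mulrA ler_wpM2l ?nrm_ge0 // ler_pdivlMr // mulrC.
by case: LC => _ hL; apply: hL.
Qed.
Fixpoint Lp N : seq (C * C) :=
  if N is N'.+1 then [seq (theta ^+ N' * z i, theta ^+ N' * z' i) | i <- enum 'I_r] ++ Lp N' else [::].
Lemma Lp1 N : [seq p.1 | p <- Lp N] = mN z N.
Proof. by elim: N => //= N IH; rewrite map_cat IH -(map_comp fst). Qed.
Lemma Lp2 N : [seq p.2 | p <- Lp N] = mN z' N.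
Proof. by elim: N => //= N IH; rewrite map_cat IH -(map_comp snd). Qed.
Lemma Lp_Rel N p : p \in Lp N -> Rel p.1 p.2.
Proof.
elim: N => //= N IH; rewrite mem_cat => /orP[/mapP [i _ ->]|/IH//].
by apply: Rel_gen; apply: inA_K; apply: inAX; exact: inA_theta.
Qed.
Lemma ez_Rel x x' : Rel x x' -> near eta (ez z x) (ez z' x').
Proof.
move=> hx; have hN N : near eta (eN z N x) (eN z' N x').
  by rewrite /eN -Lp1 -Lp2; apply: (sk_near eta0 eta1 Rel_B Rel_near (@Lp_Rel N)).
have h1 := ez_cvg LC x; have h2 := ez_cvg (lat_shift hc) x'.
have h3 := cvgB h2 h1.
have [e0|e0] := eqVneq (ez z x) 0; last first.
  have [N hN'] := cvg_nrm_eq h1 e0.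
  by apply: (cvg_nrm_le h3 (N := N)) => m /hN' <-; exact: hN.
have h4 : cvg (fun N => eN z' N x' - eN z N x) 0.
  move=> d d0; have [N hN'] := h1 d d0; exists N => m /hN'; rewrite e0 !subr0 => lt.
  apply: le_lt_trans (hN m) _; apply: le_lt_trans lt; by rewrite ler_piMl ?nrm_ge0 // ltW.
by rewrite /near (cvg_uniq h3 h4) nrm0 mulr_ge0 ?nrm_ge0.
Qed.
Lemma yz_near i k : near eta (yz z i k) (yz z' i k).
Proof.
apply: ez_Rel; rewrite ![_ / theta ^+ _]mulrC; apply: Rel_gen; apply: (sfV inK_sf).
by apply: inA_K; apply: inAX; exact: inA_theta.
Qed.
(** Frobenius is additive, so the change of the twisted series is the twisted series of the changes
    of the y_k, each of which is O(h). *)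
Lemma Sf_shift B i j : (forall k, nrm (yz z i k) <= B * q%:R ^- k) ->
  nrm (Sf (yz z' i) j theta - Sf (yz z i) j theta) <= (eta * B) ^+ (q ^ j.+1).
Proof.
move=> hB; have tr : nrm theta < rho by rewrite nrm_theta rho_gt.
have hB' k : nrm (yz z' i k) <= B * q%:R ^- k by apply: le_trans (near_le eta1 (yz_near i k)) (hB k).
have hD k : nrm (yz z' i k - yz z i k) <= eta * B * q%:R ^- k.
  by apply: le_trans (yz_near i k) _; rewrite -mulrA ler_wpM2l.
apply: (sums_le rho_gt0 (Sf_gle hD j) tr).
apply: (@cvg_ext _ _ _ 0 _ (cvgB (Sf_sums hB' j tr) (Sf_sums hB j tr))) => m _.
by rewrite -sumrB; apply: eq_bigr => k _; rewrite -mulrBl frB.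
Qed.
End Perturb.

Definition Fz (z : 'I_r -> C) : 'M[C]_r := \matrix_(i, j) Sf (yz z i) j theta.
Definition gcol (z : 'I_r -> C) : 'cV[C]_r := \col_j (gz z)`_j.+1.
End Shift.

Lemma Fz_rel r' (z : 'I_r'.+1 -> C) c : lat z c -> Fz z *m gcol z = - \col_i z i.
Proof.
move=> LC; have [B _ hB] := yz_bound LC; apply/colP => i; rewrite !mxE.
rewrite -(Sf_theta (gz_0 z) (size_gz LC) (yz_S LC i) (yz_0 LC i) (hB i) (yz_cvg LC i)).
by apply: eq_bigr => j _; rewrite !mxE mulrC.
Qed.

(** Subtracting F g = - z before and after the shift gives F (g' - g) = - h e_1 - (F' - F) g', where
    e_1 is the first unit vector. The last term is O(h^2) once g' is known to be bounded. *)
Lemma deriv_Delta r' (z : 'I_r'.+1 -> C) c : lat z c -> Fz z \in unitmx ->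
  Defs.derivC nrm (fun h => Delta nrm q theta (shift1 z h)) 0 = - invmx (Fz z) ord_max ord0.
Proof.
move=> LC uF; have c0 : 0 < c by case: LC.
have sh0 : shift1 z 0 = z by apply: funext => i; rewrite /shift1 addr0; case: ifP.
have [B B0 hB] := yz_bound LC.
have [I0 [I00 hI0]] := fin_boundR (fun ij : 'I_r'.+1 * 'I_r'.+1 => nrm (invmx (Fz z) ij.1 ij.2)).
have [G [G0 hG]] := fin_boundR (fun j : 'I_r'.+1 => nrm (gcol z j 0)).
have [A [A0 AE]] : exists A, 0 < A /\ A = (B / c) ^+ 2.
  by exists ((B / c) ^+ 2); rewrite exprn_gt0 // divr_gt0.
have DE h : nrm h < c -> Delta nrm q theta (shift1 z h) = gcol (shift1 z h) ord_max 0.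
  by move=> hc; rewrite /Delta (phi_zE (lat_shift LC hc)) mxE.
(* The bounds on |h| in turn: the lattice constant; 1; |h| B / c <= 1, so that powers above the
   square only help; and an error term of at most half the size of g'. *)
pose d0 := Num.min (Num.min c 1) (Num.min (c / B) (2 * (I0 * A))^-1).
have cB0 : 0 < c / B by rewrite divr_gt0.
have IA0 : 0 < (2 * (I0 * A))^-1 by rewrite invr_gt0 !mulr_gt0.
have d00 : 0 < d0 by rewrite /d0 !lt_min c0 ltr01 cB0 IA0.
have key h : nrm h < d0 -> exists w : 'I_r'.+1 -> C, [/\ forall i, nrm (w i) <= A * nrm h ^+ 2 * (G + I0) &
    gcol (shift1 z h) ord_max 0 - gcol z ord_max 0 =
    - h * invmx (Fz z) ord_max ord0 - \sum_i invmx (Fz z) ord_max i * w i].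
  rewrite !lt_min => /andP[/andP[hc h1] /andP[hB1 hA]].
  set g := gcol z; set g' := gcol (shift1 z h); set F := Fz z; set F' := Fz (shift1 z h).
  have e1 : F *m g = - \col_i z i := Fz_rel LC.
  have e2 : F' *m g' = - \col_i shift1 z h i := Fz_rel (lat_shift LC hc).
  pose w i := \sum_j (F' i j - F i j) * g' j 0.
  have e3 : F *m (g' - g) = \col_i (- ((i == ord0)%:R * h) - w i).
    apply/colP => i; have := congr1 (fun M : 'cV[C]_r'.+1 => M i 0) e1; have := congr1 (fun M : 'cV[C]_r'.+1 => M i 0) e2.
    rewrite mulmxBr !mxE => a2 a1; rewrite a1 opprK /w.
    have -> : \sum_j (F' i j - F i j) * g' j 0 = - shift1 z h i - \sum_j F i j * g' j 0.
      by rewrite -a2 -sumrB; apply: eq_bigr => j _; rewrite mulrBl.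
    rewrite /shift1 (_ : (nat_of_ord i == 0%N) = (i == ord0)) //.
    case: eqP => _; rewrite ?mul1r ?mul0r; ring.
  have e4 l : g' l 0 - g l 0 = - h * invmx F l ord0 - \sum_i invmx F l i * w i.
    have : invmx F *m (F *m (g' - g)) = g' - g by rewrite mulKmx.
    rewrite e3 => /(congr1 (fun M : 'cV[C]_r'.+1 => M l 0)); rewrite !mxE => <-.
    under eq_bigr => i _ do rewrite mxE mulrBr.
    rewrite sumrB; congr (_ - _); rewrite (bigD1 ord0) // eqxx mul1r big1.
      by rewrite /= addr0 mulrC.
    by move=> i /negPf ->; rewrite mul0r oppr0 mulr0.
  have hD i j : nrm (F' i j - F i j) <= A * nrm h ^+ 2.
    rewrite !mxE; apply: le_trans (Sf_shift LC hc _ (hB i)) _.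
    have e0 : 0 <= nrm h / c * B by rewrite !mulr_ge0 ?nrm_ge0 ?invr_ge0 // ltW.
    have e1' : nrm h / c * B <= 1.
      by rewrite mulrAC ler_pdivrMr // mul1r; move: (ltW hB1); rewrite ler_pdivlMr.
    apply: (@le_trans _ _ ((nrm h / c * B) ^+ 2)).
      rewrite ler_wiXn2l //; apply: leq_trans q_gt1 _; by rewrite -{1}(expn1 q) leq_pexp2l ?q_gt0.
    rewrite AE -exprMn le_eqVlt; apply/orP; left; apply/eqP; congr (_ ^+ 2); ring.
  have [j0 hj0] := max_entry (fun j => nrm (g' j 0)).
  have h20 : 0 <= A * nrm h ^+ 2 by rewrite mulr_ge0 ?exprn_ge0 ?nrm_ge0 // ltW.
  have hw i : nrm (w i) <= A * nrm h ^+ 2 * nrm (g' j0 0).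
    by apply: nrm_sum => [|j _]; [rewrite mulr_ge0 ?nrm_ge0 | rewrite nrmM ler_pM ?nrm_ge0].
  have hIA : I0 * (A * nrm h ^+ 2) <= 2^-1.
    have t1 : nrm h ^+ 2 <= nrm h by rewrite expr2 ler_piMr ?nrm_ge0 // ltW.
    have t2 : nrm h * (2 * (I0 * A)) <= 1 by rewrite -ler_pdivlMr ?mulr_gt0 // div1r ltW.
    have t3 : I0 * A * nrm h ^+ 2 <= I0 * A * nrm h by rewrite ler_wpM2l // mulr_ge0 // ltW.
    rewrite mulrA; apply: (le_trans t3); rewrite -[leRHS]div1r ler_pdivlMr // mulrC mulrCA.
    by move: t2; congr (_ <= 1); ring.
  (* The bound is self-improving: at the largest entry of g' the error term is at most half that
     entry, so the other terms must account for it. *)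
  have hM : nrm (g' j0 0) <= G + I0.
    rewrite leNgt; apply/negP => lt; have n0 : 0 < nrm (g' j0 0) by apply: lt_trans lt; rewrite addr_gt0.
    have : nrm (g' j0 0) < nrm (g' j0 0); last by rewrite ltxx.
    rewrite -{1}(subrK (g j0 0) (g' j0 0)) e4; apply: nrmD_lt; last first.
      by apply: le_lt_trans (hG j0) _; apply: lt_trans lt; rewrite ltrDl.
    apply: nrmB_lt.
      rewrite nrmM nrmN; apply: lt_trans lt; apply: (@le_lt_trans _ _ I0); last by rewrite ltrDr.
      by rewrite -[leRHS]mul1r; apply: ler_pM; rewrite ?nrm_ge0 ?(ltW h1) //; exact: (hI0 (_, _)).
    apply: nrm_sum_lt => // i _; rewrite nrmM.
    apply: (@le_lt_trans _ _ (I0 * (A * nrm h ^+ 2 * nrm (g' j0 0)))).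
      by apply: ler_pM; rewrite ?nrm_ge0 //; exact: (hI0 (_, _)).
    rewrite mulrA gtr_pMl //; apply: le_lt_trans hIA _; lra.
  exists w; split; last exact: e4.
  by move=> i; apply: le_trans (hw i) _; rewrite ler_wpM2l.
apply: derivC_eq => e e0; pose K := I0 * (A * (G + I0)).
have K0 : 0 < K by rewrite !mulr_gt0 // addr_gt0.
exists (Num.min d0 (e / K)); split; first by rewrite lt_min d00 divr_gt0.
move=> h h0; rewrite lt_min => /andP[hd he]; have [w [hw ew]] := key h hd.
have hc : nrm h < c by move: hd; rewrite !lt_min => /andP[/andP[]].
rewrite add0r sh0 /Delta (phi_zE LC) -/(Delta nrm q theta (shift1 z h)) DE //.
have -> : (gz z)`_r'.+1 = gcol z ord_max 0 by rewrite mxE.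
rewrite ew opprK mulrBl mulNr mulNr mulrAC mulfV // mul1r addrAC addNr sub0r nrmN nrmf ltr_pdivrMr ?nrm_gt0 //.
apply: (@le_lt_trans _ _ (K * nrm h ^+ 2)); last first.
  by rewrite expr2 mulrA ltr_pM2r ?nrm_gt0 // mulrC -ltr_pdivlMr.
apply: nrm_sum => [|i _]; first by rewrite mulr_ge0 ?exprn_ge0 ?nrm_ge0 // ltW.
rewrite nrmM; apply: le_trans (ler_pM (nrm_ge0 _) (nrm_ge0 _) (hI0 (_, i)) (hw i)) _.
by rewrite /K le_eqVlt; apply/orP; left; apply/eqP; ring.
Qed.

(** * Values of E_r at CM points *)
Section Psi.
Variables (g : {poly C}) (r' : nat) (B : R).
Notation r := r'.+1.
Variable (y : 'I_r -> nat -> C).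
Hypothesis g0 : g`_0 = theta.
Hypothesis sg : size g = r.+1.
Hypothesis gr : g`_r = 1.
Hypothesis gK : forall j, inKbar' g`_j.
Hypothesis yS : forall i k, skew_eval q g (y i k.+1) = y i k.
Hypothesis y0 : forall i, skew_eval q g (y i 0%N) = 0.
Hypothesis yB : forall i k, nrm (y i k) <= B * q%:R ^- k.
Variables (Om : C -> C) (idx : 'I_r -> 'I_r).
Hypothesis Om_an : analytic rho Om.
Hypothesis Om_tw : forall x, Om x ^+ q * (x ^+ q - theta ^+ q) = Om (x ^+ q).

Definition psi (a : {ffun 'I_r -> 'I_r}) (x : C) : C := Om x ^+ 2 * \prod_k Sf (y (idx k)) (a k) x.
Definition TT (a b : {ffun 'I_r -> 'I_r}) : {poly C} := \prod_k Cm g (a k) (b k).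
Definition wt (a : {ffun 'I_r -> 'I_r}) : nat := \sum_k a k.

Lemma psi_an a : analytic rho (psi a).
Proof.
apply: anM rho_gt0 _ _; first by rewrite /= ; apply: anM rho_gt0 Om_an Om_an.
by apply: an_prod rho_gt0 _ => k _; exact: (Sf_an (yB _)).
Qed.
Lemma psi_eq a x : nrm (x ^+ q) < rho ->
  (('X - (theta ^+ q)%:P) ^+ 2).[x ^+ q] * psi a x ^+ q = \sum_b (TT a b).[x ^+ q] * psi b (x ^+ q).
Proof.
move=> xr; rewrite /psi exprMn -prodrXl.
under eq_bigr => k _ do rewrite (Sf_tw (yB _)) // (Cm_eq g0 sg gr yS y0 yB _ _ xr).
rewrite bigA_distr_bigA /= !mulr_sumr; apply: eq_bigr => b _.
rewrite /TT horner_prod big_split /= horner_exp hornerXsubC -Om_tw exprAC; ring.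
Qed.
(** A twist raises the index by 1, and wrapping from the last index to 0 costs one degree, that is r
    units of weight. So each factor has slope 1/r, and a product of r factors has slope 1. *)
Lemma Cm_wt (j l : 'I_r) : wdeg r (Cm g j l) l (1 + j).
Proof.
rewrite /wdeg /Cm; case: ltnP => jr.
  case: eqP => [->|_]; last by left.
  by right; rewrite size_poly1 mul0n add0n add1n.
right; case: eqP => [->|_]; first by rewrite size_XsubC mul1n addn0 add1n.
have s0 : ((size (- (g`_l ^+ q)%:P : {poly C})%R).-1 = 0)%N.
  by rewrite size_polyN size_polyC; case: (_ != 0).
by rewrite s0 mul0n add0n add1n; apply: leq_trans jr; exact: ltnW.
Qed.
Lemma TT_wt a b : wdeg r (TT a b) (wt b) (r + wt a).
Proof.
have -> : (r + wt a = \sum_(k < r) (1 + a k))%N by rewrite big_split /= sum1_card card_ord.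
rewrite /TT /wt; elim/big_rec3: _ => [|k m l P _ IH]; last first.
  exact: (wdegM (ltn0Sn r') rho_gt (Cm_wt _ _) IH).
by right; rewrite size_poly1.
Qed.

Lemma psi_transcend (c : {ffun 'I_r -> 'I_r} -> C) e : (forall a, inKbar' (c a)) -> inKbar' e -> e != 0 ->
  e = \sum_a c a * psi a theta -> False.
Proof.
move=> hc he e0 eE.
have [|I [b [hb hs]]] := @fg_exists (e :: [seq c a | a <- enum {ffun 'I_r -> 'I_r}] ++ [seq g`_j | j <- iota 0 r]).
  move=> x; rewrite inE mem_cat => /orP[/eqP -> //|/orP[/mapP [a _ ->]|/mapP [j _ ->]]]; [exact: hc | exact: gK].
have sc a : spanK b (c a) by apply: hs; rewrite inE mem_cat map_f ?orbT // mem_enum.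
have sgj (j : 'I_r) : spanK b g`_j.
  by apply: hs; rewrite inE mem_cat; apply/orP; right; apply/orP; right; apply/mapP; exists (nat_of_ord j); rewrite // mem_iota add0n ltn_ord.
have sC (j l : 'I_r) k : spanK b (Cm g j l)`_k.
  have s01 (t : bool) : spanK b t%:R by case: t; [exact: fg1 | exact: spanK0].
  rewrite /Cm; case: ifP => _.
    by rewrite -polyC_natr coefC; case: eqP => _; [exact: s01 | exact: spanK0].
  case: ifP => _.
    rewrite coefB coefX coefC; apply: spanKD; first exact: s01.
    apply: spanKN; case: eqP => _; last exact: spanK0.
    by apply: fgK => //; apply: inA_K; apply: inAX; exact: inA_theta.
  by rewrite coefN coefC; apply: spanKN; case: eqP => _; [exact: fgX | exact: spanK0].
apply: (@transcend rho _ psi TT r wt I b isT rho_gt psi_an psi_eq TT_wt hb _ c e) => //; last first.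
  by apply: hs; rewrite mem_head.
move=> a d; rewrite /TT; elim/big_ind: _ => [k|P Q hP hQ k|i _ k]; last exact: sC.
  by rewrite coef1; case: eqP => _; [exact: fg1 | exact: spanK0].
by rewrite coefM; apply: spanK_sum => i _; apply: fg_mul.
Qed.
End Psi.

(** Scaling by o with o^(q^r - 1) = Delta gives E_r = Omega(theta) o (S^-1)_(r,1). Both o and the
    cofactor are polynomials in the entries of S, and multiplying by the algebraic number G =
    Omega(theta) det S clears the determinant. *)
Lemma E_r_transcendental (omega : C) (r : nat) (z : 'I_r -> C) :
  omega ^+ (q - 1) = - theta -> (2 <= r)%N -> CM_point nrm q theta z ->
  E_r nrm q theta omega z != 0 -> transcendental_over inKbar' (E_r nrm q theta omega z).
Proof.
move=> om; case: r z => [//|r'] z r2 [hO hCM] E0 /Kbar_alg EK.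
have [c LC] := omega_lat hO; have [B B0 hB] := yz_bound LC.
have zl : z ord_max = 1 by case: hO => _; apply.
rewrite (phi_zE LC) in hCM; set g := gz z in hCM.
have sg : size g = r'.+2 := size_gz LC.
have D0 : g`_r'.+1 != 0.
  by have := sg; rewrite -[g`__]/(nth 0 g r'.+2.-1) => <-; rewrite -/(lead_coef g) lead_coef_eq0 -size_poly_eq0 sg.
have q1 : (0 < q ^ r'.+1 - 1)%N by rewrite subn_gt0 -(expn0 q) ltn_exp2l ?q_gt1.
have [o ho] := root_ex g`_r'.+1 q1.
have o0 : o != 0 by apply: contraNneq D0 => e; rewrite -ho e expr0n gtn_eqF.
have oq : o ^+ (q ^ r'.+1) = g`_r'.+1 * o by rewrite -ho -exprSr subn1 prednK ?qk_gt0.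
pose g' := cj o g.
have g'0 : g'`_0 = theta by rewrite coef_cj expn0 expr1 divff // mulr1 gz_0.
have g'r : g'`_r'.+1 = 1 by rewrite coef_cj oq invfM [o * _]mulrC divfK // mulfV.
have sg' : size g' = r'.+2.
  apply/eqP; rewrite eqn_leq; apply/andP; split; first by rewrite -sg size_poly.
  by rewrite ltnNge; apply/negP => /leq_sizeP /(_ _ (leqnn _)) /eqP; rewrite g'r oner_eq0.
have g'K := CM_algebraic g'0 sg' g'r (cj_CM o0 hCM).
pose y i k := o * yz z i k.
have yS i k : skew_eval q g' (y i k.+1) = y i k.
  by rewrite ev_cj // /y [o * yz z i k.+1]mulrC mulfK // (yz_S LC).
have y0 i : skew_eval q g' (y i 0%N) = 0.
  by rewrite ev_cj // /y [o * yz z i _]mulrC mulfK // (yz_0 LC) mulr0.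
have yB i k : nrm (y i k) <= nrm o * B * q%:R ^- k by rewrite nrmM -mulrA ler_wpM2l ?nrm_ge0.
have y_ind (d : 'I_r'.+1 -> C) : (forall i, Fq (d i)) -> \sum_i d i * y i 0%N = 0 -> forall i, d i = 0.
  move=> hd e; apply: (yz_ind LC) => //; apply: (mulfI o0); rewrite mulr0 -[RHS]e mulr_sumr.
  by apply: eq_bigr => i _; rewrite mulrCA.
have tr : nrm theta < rho by rewrite nrm_theta rho_gt.
have [Om [Om_an Om_tw Om0 pi0 piE]] := Om_facts om.
pose S := Smx y theta.
have [GK G0] := legendre g'0 sg' g'r yS y0 yB y_ind Om_an Om_tw Om0.
set G := Om theta * \det (Smx y theta) in GK G0.
have dS0 : \det S != 0 by apply: contraNneq G0 => e; rewrite /G -/S e mulr0.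
pose dd : 'rV[C]_r'.+1 := \row_j o ^+ (q ^ j.+1).
have SF : S = Fz z *m diag_mx dd.
  apply/matrixP => i j; rewrite mul_mx_diag !mxE mulrC.
  apply: (cvg_uniq (Sf_sums (yB i) j tr)).
  apply: (@cvg_ext _ _ _ 0 _ (cvgZ _ (Sf_sums (hB i) j tr))) => m _.
  by rewrite mulr_sumr; apply: eq_bigr => k _; rewrite /y exprMn mulrA.
have uS : S \in unitmx by rewrite unitmxE unitfE.
have uF : Fz z \in unitmx by move: uS; rewrite SF unitmx_mul => /andP[].
have iF : invmx (Fz z) = diag_mx dd *m invmx S.
  have : Fz z *m (diag_mx dd *m invmx S) = 1%:M by rewrite mulmxA -SF mulmxV.
  by move/(congr1 (mulmx (invmx (Fz z)))); rewrite mulKmx // mulmx1 => ->.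
have EE : E_r nrm q theta omega z = Om theta * o * invmx S ord_max ord0.
  rewrite /E_r (deriv_Delta LC uF) /Delta (phi_zE LC) -/g piE iF mul_diag_mx !mxE /= oq.
  by field.
have iS : invmx S ord_max ord0 = (\det S)^-1 * cofactor S ord0 ord_max.
  by rewrite /invmx uS !mxE.
(* The normalisation z_r = 1 enters here: o is the last generator of the scaled lattice. *)
have oE : o = - \sum_(j < r'.+1) g'`_j.+1 * S ord_max j.
  have hz : cvg (fun m => theta ^+ m.+1 * y ord_max m) o.
    have := cvgZ o (yz_cvg LC ord_max); rewrite zl mulr1; apply: (@cvg_ext _ _ _ 0) => m _.
    by rewrite /y mulrCA.
  rewrite -[LHS]opprK -(Sf_theta g'0 sg' (yS _) (y0 _) (yB _) hz); congr (- _).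
  by apply: eq_bigr => j _; rewrite mxE.
pose e := E_r nrm q theta omega z * G.
have e0 : e != 0 by rewrite mulf_neq0.
have eK : inKbar' e by apply: (sfM Kbar_sf).
(* The cofactor omits the first row; its slot is filled by the last row, which the expansion of o
   supplies. *)
pose idx (k : 'I_r'.+1) := if k == ord0 then ord_max else k.
pose W := {ffun 'I_r'.+1 -> 'I_r'.+1}.
pose P := ('I_r'.+1 * perm_type 'I_r'.+1)%type.
pose okp (p : P) := p.2 ord0 == ord_max.
pose aof (p : P) : W := [ffun k => if k == ord0 then p.1 else p.2 k].
pose cf (p : P) : C := - g'`_p.1.+1 * (-1) ^+ (odd_perm p.2).
pose cc (a : W) : C := \sum_(p : P | okp p && (aof p == a)) cf p.
apply: (@psi_transcend g' r' (nrm o * B) y g'0 sg' g'r g'K yS y0 yB Om idx Om_an Om_tw cc e) => //.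
  move=> a; apply: (sf_sum Kbar_sf) => p _; apply: (sfM Kbar_sf); first by apply: (sfN Kbar_sf).
  by apply: (sfX Kbar_sf); apply: (sfN Kbar_sf); exact: (sf1 Kbar_sf).
have -> : e = Om theta ^+ 2 * o * cofactor S ord0 ord_max.
  by rewrite /e EE iS /G -/S; field.
transitivity (\sum_(p : P | okp p) cf p * psi y Om idx (aof p) theta); last first.
  rewrite (partition_big aof xpredT) //=; apply: eq_bigr => a _; rewrite /cc mulr_suml.
  by apply: eq_bigr => p /andP[_ /eqP ->].
have psiE p : psi y Om idx (aof p) theta = Om theta ^+ 2 * (S ord_max p.1 * \prod_(k | ord0 != k) S k (p.2 k)).
  rewrite /psi; congr (_ * _); rewrite (bigD1 ord0) //= /idx /aof ffunE eqxx mxE; congr (_ * _).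
  apply: eq_big => [k|k k0]; first by rewrite eq_sym.
  by rewrite ffunE mxE (negPf k0).
rewrite {1}oE mulrN mulNr -mulrA [(\sum_(j < _) _) * _]mulr_suml mulr_sumr -sumrN.
under eq_bigr => j _ do rewrite expand_cofactor !mulr_sumr -sumrN.
rewrite pair_big /=; apply: eq_big => [[j s]//|[j s] _] /=.
rewrite psiE /cf /=; move: ((-1) ^+ _) (\prod_(k | _) _) (S _ _) (Om _ ^+ 2) (g'`_ _) => s1 p1 S1 O1 g1.
by rewrite !mulNr; congr (- _); ring.
Qed.
End Cinfty.

Theorem theorem6p3 (p n : nat) (C : fieldType) (R : realType) (nrm : C -> R)
    (theta omega : C) (r : nat) (z : 'I_r -> C) :
  is_Cinfty p n nrm theta ->
  omega ^+ (p ^ n - 1) = - theta ->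
  (2 <= r)%N ->
  CM_point nrm (p ^ n) theta z ->
  E_r nrm (p ^ n) theta omega z != 0 ->
  transcendental_over (inKbar (p ^ n) theta) (E_r nrm (p ^ n) theta omega z).
Proof.
by move=> HC om r2 hz; apply: (E_r_transcendental HC erefl om r2 hz).
Qed.
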